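(* Let $p>1$, $\gamma\in\mathbb R$, and let $V=(V_e)_{e=1}^N$ be a real-valued symmetric potential (i.e. $V_1=\dots=V_N$) on the star graph $\Gamma$ satisfying Assumptions 1–3 (see context). Suppose $0<\omega_{0,\mathrm{eq}}<\omega$. Then the set of ground states $\mathcal G_{\omega,\mathrm{eq}}$ is not empty, and $\mathcal G_{\omega,\mathrm{eq}}=\mathcal M_{\omega,\mathrm{eq}}$. If $\varphi_\omega\in\mathcal G_{\omega,\mathrm{eq}}$, then there exist $\theta\in\mathbb R$ and a positive function $\phi\in H^1_{\mathrm{eq}}(\Gamma)$ such that $\varphi_\omega(x)=e^{i\theta}\phi(x)$.
   Context: $\Gamma$ is the star graph consisting of $N$ half-lines $(0,\infty)$ joined at the vertex $0$. A function on $\Gamma$ is $v=(v_e)_{e=1}^N$, $v_e:(0,\infty)\to\mathbb C$; $v_e(0)$ denotes the limit as $x\to0^+$. $L^q(\Gamma)=\bigoplus_{e=1}^N L^q(\mathbb R^+)$ with norm $\|\cdot\|_q$, and $\int_\Gamma f\,dx=\sum_e\int_0^\infty f_e\,dx$. $C(\Gamma)$ is the set of $v$ with each $v_e$ continuous and $v_1(0)=\dots=v_N(0)$. $H^1(\Gamma)=\{v\in C(\Gamma): v_e\in H^1(\mathbb R^+)\ \forall e\}$, and $H^1_{\mathrm{eq}}(\Gamma)=\{v\in H^1(\Gamma): v_1(x)=\dots=v_N(x),\ x>0\}$. Assumptions on $V$: (1) $V\in L^1(\Gamma)+L^\infty(\Gamma)$; (2) $\lim_{x\to\infty}V_e(x)=0$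 for each $e$; (3) $\int_{\mathbb R^+}V_e|\phi|^2dx<0$ for all $\phi\in H^1(\mathbb R^+)\setminus\{0\}$ and each $e$. $F_{\gamma,V}(v)=\|v'\|_2^2-\gamma|v_1(0)|^2+\int_\Gamma V|v|^2dx$, and $-\omega_{0,\mathrm{eq}}=\inf\{F_{\gamma,V}(v): v\in H^1_{\mathrm{eq}}(\Gamma),\ \|v\|_2=1\}$. For $v\in H^1_{\mathrm{eq}}(\Gamma)$: $S_\omega(v)=\frac12F_{\gamma,V}(v)+\frac\omega2\|v\|_2^2-\frac1{p+1}\|v\|_{p+1}^{p+1}$, $I_\omega(v)=F_{\gamma,V}(v)+\omega\|v\|_2^2-\|v\|_{p+1}^{p+1}$. Put $\mathcal B_{\omega,\mathrm{eq}}=\{v\in H^1_{\mathrm{eq}}(\Gamma)\setminus\{0\}:S'_\omega(v)=0\}$, $\mathcal G_{\omega,\mathrm{eq}}=\{\phi\in\mathcal B_{\omega,\mathrm{eq}}:S_\omega(\phi)\le S_\omega(v)\ \forall v\in\mathcal B_{\omega,\mathrm{eq}}\}$, $d_{\omega,\mathrm{eq}}=\inf\{S_\omega(v):v\in H^1_{\mathrm{eq}}(\Gamma)\setminus\{0\},I_\omega(v)=0\}$, $\mathcal M_{\omega,\mathrm{eq}}=\{\phi\in H^1_{\mathrm{eq}}(\Gamma)\setminus\{0\}:S_\omega(\phi)=d_{\omega,\mathrm{eq}},\ I_\omega(\phi)=0\}$. ''Positive'' means $\phi_e(x)>0$ for all $e$ and $x$. *)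

(* Defs.v *)
From HB Require Import structures.
From mathcomp Require Import all_boot all_order all_algebra.
From mathcomp Require Import complex.
From mathcomp Require Import all_classical all_reals all_analysis.
Set Implicit Arguments.
Unset Strict Implicit.
Unset Printing Implicit Defensive.
Import Order.TTheory GRing.Theory Num.Theory.
Import numFieldNormedType.Exports.
Local Open Scope classical_set_scope.
Local Open Scope complex_scope.
Local Open Scope ring_scope.

(* Functions on (0, oo) are represented by total functions on R, and no
   definition below depends on their values outside (0, oo). *)

Section HalfLine.
Context {R : realType}.
Implicit Types (f g : R -> R[i]) (phi : R -> R).

Definition halfline : set R := `]0, +oo[%classic.

(* The modulus with values in R; the MathComp norm `|z| lives in R[i]. *)
Definition modulus (z : R[i]) : R := ComplexField.Normc.normc z.

Definition integral_halfline (h : R -> R) : R :=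
  \int[lebesgue_measure]_(x in halfline) h x.

Definition cintegral_halfline f : R[i] :=
  integral_halfline (fun x => complex.Re (f x)) +i*
  integral_halfline (fun x => complex.Im (f x)).

Definition square_integrable f : Prop :=
  [/\ measurable_fun halfline (fun x => complex.Re (f x)),
      measurable_fun halfline (fun x => complex.Im (f x)) &
      lebesgue_measure.-integrable halfline
        (fun x => (modulus (f x) ^+ 2)%:E)].

(* C^1 functions with compact support in (0, oo), extended by 0 to R. *)
Definition test_function phi : Prop :=
  [/\ forall x, derivable phi x 1,
      continuous (derive1 phi) &
      exists a b : R, 0 < a /\ forall x, ~ (a <= x <= b) -> phi x = 0].

(* Real-valued test functions suffice: the complex-valued case follows by
   linearity. *)
Definition weak_derivative f g : Prop :=
  forall phi, test_function phi ->
    cintegral_halfline (fun x => f x * (derive1 phi x)%:C) =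
    - cintegral_halfline (fun x => g x * (phi x)%:C).

(* H^1(0, oo), as functions and not as classes modulo a.e. equality:
   continuity is not required here, it comes from C(Gamma) in H1_graph. *)
Definition H1_halfline f : Prop :=
  square_integrable f /\
  exists g, square_integrable g /\ weak_derivative f g.

(* v'; for f in H^1 it is unique up to a.e. equality. *)
Definition H1_derivative f : R -> R[i] :=
  xget (fun=> 0) [set g | square_integrable g /\ weak_derivative f g].

(* phi <> 0 in H^1(0, oo), i.e. as a class modulo a.e. equality. *)
Definition nonzero_ae f : Prop :=
  ~ {ae lebesgue_measure, forall x, halfline x -> f x = 0}.

End HalfLine.

Section StarGraph.
Context {R : realType} {n : nat}.

(* The star graph has N = n.+1 >= 1 half-lines, indexed by 'I_n.+1; the vertex
   value v_1(0) is taken on the edge ord0. *)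
Definition graph_function : Type := 'I_n.+1 -> R -> R[i].
Definition potential : Type := 'I_n.+1 -> R -> R.
Implicit Types (v u w h phi : graph_function) (V : potential).

Definition integral_graph (f : 'I_n.+1 -> R -> R) : R :=
  \sum_(e < n.+1) integral_halfline (f e).

Definition Lq_norm (q : R) v : R :=
  (integral_graph (fun e x => modulus (v e x) `^ q)) `^ q^-1.

Definition vertex_value v (e : 'I_n.+1) : R[i] :=
  lim ((v e x : R[i]^o) @[x --> (0 : R)^'+]).

Definition C_graph v : Prop :=
  [/\ forall e x, 0 < x -> {for x, continuous (v e : R -> R[i]^o)},
      forall e, cvg ((v e x : R[i]^o) @[x --> (0 : R)^'+]) &
      forall e e', vertex_value v e = vertex_value v e'].

Definition H1_graph v : Prop := C_graph v /\ forall e, H1_halfline (v e).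

Definition H1_eq v : Prop :=
  H1_graph v /\ forall e e' x, 0 < x -> v e x = v e' x.

Definition graph_derivative v : graph_function := fun e => H1_derivative (v e).

Definition H1_norm v : R :=
  Num.sqrt (Lq_norm 2 v ^+ 2 + Lq_norm 2 (graph_derivative v) ^+ 2).

(* v <> 0 as a function on the graph. *)
Definition nonzero v : Prop := exists e x, 0 < x /\ v e x <> 0.

Definition symmetric_potential V : Prop :=
  forall e e' x, 0 < x -> V e x = V e' x.

(* V is in L^1(Gamma) + L^oo(Gamma). *)
Definition potential_L1_Loo V : Prop :=
  exists V1 V2 : potential,
    [/\ forall e, lebesgue_measure.-integrable halfline (EFin \o V1 e),
        forall e, measurable_fun halfline (V2 e) /\
          exists M : R,
            {ae lebesgue_measure, forall x, halfline x -> `|V2 e x| <= M} &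
        forall e x, 0 < x -> V e x = V1 e x + V2 e x].

Definition potential_vanishing V : Prop :=
  forall e, V e x @[x --> +oo] --> (0 : R).

Definition potential_negative V : Prop :=
  forall e (f : R -> R[i]), H1_halfline f -> nonzero_ae f ->
    integral_halfline (fun x => V e x * modulus (f x) ^+ 2) < 0.

Definition F_functional (gamma : R) V v : R :=
  Lq_norm 2 (graph_derivative v) ^+ 2
  - gamma * modulus (vertex_value v ord0) ^+ 2
  + integral_graph (fun e x => V e x * modulus (v e x) ^+ 2).

(* The infima are taken in the extended reals, so no boundedness is assumed. *)
Definition omega0_eq (gamma : R) V : \bar R :=
  oppe (ereal_inf [set (F_functional gamma V v)%:E
                  | v in [set v | H1_eq v /\ Lq_norm 2 v = 1]]).

(* L is the Frechet derivative of T at v on H^1_eq(Gamma), the latter being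
   regarded as a real normed space (T is real-valued). *)
Definition frechet_derivative_H1_eq (T : graph_function -> R) v
    (L : graph_function -> R) : Prop :=
  [/\ forall (a : R) u w, H1_eq u -> H1_eq w ->
        L (fun e x => a%:C * u e x + w e x) = a * L u + L w,
      exists M : R, forall u, H1_eq u -> `|L u| <= M * H1_norm u &
      forall eps : R, 0 < eps -> exists delta : R, 0 < delta /\
        forall h, H1_eq h -> H1_norm h < delta ->
          `|T (fun e x => v e x + h e x) - T v - L h| <= eps * H1_norm h].

Section Action.
Variables (p gamma omega : R) (V : potential).

Definition S_action v : R :=
  2^-1 * F_functional gamma V v + omega / 2 * Lq_norm 2 v ^+ 2
  - (p + 1)^-1 * Lq_norm (p + 1) v `^ (p + 1).

Definition I_nehari v : R :=
  F_functional gamma V v + omega * Lq_norm 2 v ^+ 2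
  - Lq_norm (p + 1) v `^ (p + 1).

Definition bound_states_eq : set graph_function :=
  [set v | [/\ H1_eq v, nonzero v &
               frechet_derivative_H1_eq S_action v (fun=> 0)]].

Definition ground_states_eq : set graph_function :=
  [set phi | bound_states_eq phi /\
             forall v, bound_states_eq v -> S_action phi <= S_action v].

Definition d_eq : \bar R :=
  ereal_inf [set (S_action v)%:E
            | v in [set v | [/\ H1_eq v, nonzero v & I_nehari v = 0]]].

Definition minimizers_eq : set graph_function :=
  [set phi | [/\ H1_eq phi, nonzero phi,
                 (S_action phi)%:E = d_eq & I_nehari phi = 0]].

End Action.

(* The order of R[i] gives 0 < z iff z is real and positive. *)
Definition positive_function v : Prop := forall e x, 0 < x -> 0 < v e x.

End StarGraph.

Arguments graph_function : clear implicits.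
Arguments potential : clear implicits.

(* Main.v *)
(* By symmetry everything takes place on one half-line, on which a complex function is a
   pair (u, w) of real ones, the action is a quadratic form a minus a power B of degree
   r = p + 1, and the vertex carries the delta coupling gamma / N.

   Existence. On the ball a <= 1 one maximizes B. Loss of mass at infinity is excluded by
   comparing with the soliton on the line: if F(psi) < 0, then e^(sqrt omega x) psi on
   [0, s], continued by a soliton tail, does strictly better than the soliton, because
   V <= 0 in the sense of forms. Elsewhere cut-offs show that maximizing sequences are
   tight, and the parallelogram law makes them converge strongly. On the Nehari manifold
   this gives a minimizer, at which the action is differentiable with zero derivative by
   convexity of |z|^r; conversely critical points lie on the Nehari manifold, so ground
   states and minimizers coincide.

   Phase. If a component u of a minimizer vanishes at x0, reflecting u beyond x0 gives
   another minimizer; u and its reflection solve the same linear equation, so unique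
   continuation from either side of x0 gives u = 0. Rotating the pair so that one
   component vanishes at x = 1 makes this component zero, and then the other one never
   vanishes. *)

Require Import Defs.
From HB Require Import structures.
From mathcomp Require Import all_boot all_order all_algebra.
From mathcomp Require Import complex ring lra.
From mathcomp Require Import all_classical all_reals all_analysis.
From mathcomp Require Import measurable_realfun.
Import Order.TTheory GRing.Theory Num.Theory.
Import numFieldNormedType.Exports.
Local Open Scope classical_set_scope.
Local Open Scope complex_scope.
Local Open Scope ring_scope.

Set Implicit Arguments.
Unset Strict Implicit.
Unset Printing Implicit Defensive.

(** * Integrals and absolutely continuous functions *)

Section Integrals.
Context {R : realType}.
Notation mu := (@lebesgue_measure R).
Implicit Types (f g h k : R -> R) (D E : set R).

(** The embedding of [H^1] into [L^r] on the half-line is not compact, so attainment rests on a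
    strict inequality between the best constant [Lambda] and that of the line; the latter is
    computed exactly by a calibration argument. The sign of the potential is known only through
    integrals, so it can be used only on admissible test functions, also when a tail of the
    potential is estimated. The weight [expR (sqrt omega * x)] is the growing solution of
    [u'' = omega u]: multiplying by it turns the [omega] term into a boundary term, and negativity
    of the form without [omega] becomes a gain at the gluing point. Both parts of the action are
    homogeneous, so everything passes through the single inequality
    [m^(r/2 - 1) * bb u <= aa u^(r/2)], where [m] is the common value of the two parts at a
    minimizer. The equation of a minimizer holds only weakly, with an integrable coefficient: unique
    continuation is an energy estimate on intervals so short that the coefficient is absorbed. *)

Definition integ D h : Prop := mu.-integrable D (EFin \o h).

(* The library has two measurable structures on R, with convertible sigma-algebras. *)
Lemma measurableR_cast D : measurable D -> @measurable _ (measurableTypeR R) D.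
Proof. by []. Qed.

Lemma integ_meas D h : integ D h -> measurable_fun D h.
Proof. by move=> /(measurable_int mu)/measurable_EFinP. Qed.

Lemma integ_le D h k : measurable D -> measurable_fun D h ->
  (forall x, D x -> `|h x| <= k x) -> integ D k -> integ D h.
Proof.
move=> mD mh hk; apply: le_integrable => //; first exact/measurable_EFinP.
by move=> x Dx /=; rewrite lee_fin (le_trans (hk _ Dx))// ler_norm.
Qed.

Lemma integ_sub D E h : measurable D -> measurable E -> E `<=` D ->
  integ D h -> integ E h.
Proof. by move=> mD mE ED; exact: integrableS. Qed.

Lemma integ_eq D h k : measurable D -> (forall x, D x -> h x = k x) ->
  integ D h -> integ D k.
Proof.
move=> mD hk ih; refine (@eq_integrable _ _ _ mu D mD (EFin \o h) (EFin \o k) _ ih) => x /set_mem Dx /=.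
by rewrite hk.
Qed.

Lemma integD D h k : measurable D -> integ D h -> integ D k ->
  integ D (fun x => h x + k x).
Proof. by move=> /measurableR_cast mD ih ik; exact (integrableD mD ih ik). Qed.

Lemma integZ D a h : measurable D -> integ D h -> integ D (fun x => a * h x).
Proof. by move=> /measurableR_cast mD ih; exact (integrableZl mD a ih). Qed.

Lemma integ_lin D a b h k : measurable D -> integ D h -> integ D k ->
  integ D (fun x => a * h x + b * k x).
Proof. by move=> mD ih ik; apply: integD => //; exact: integZ. Qed.

Lemma integN D h : measurable D -> integ D h -> integ D (fun x => - h x).
Proof.
by move=> mD ih; apply: (integ_eq mD _ (integZ (-1) mD ih)) => x _; rewrite mulN1r.
Qed.

Lemma integB D h k : measurable D -> integ D h -> integ D k ->
  integ D (fun x => h x - k x).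
Proof. by move=> mD ih ik; apply: integD => //; exact: integN. Qed.

Lemma integ0 D : integ D (fun=> 0).
Proof. exact: integrable0. Qed.

Lemma integ_abs D h : integ D h -> integ D (fun x => `|h x|).
Proof. exact: integrable_norm. Qed.

Lemma int_lin D a b h k : measurable D -> integ D h -> integ D k ->
  \int[mu]_(x in D) (a * h x + b * k x) =
  a * \int[mu]_(x in D) h x + b * \int[mu]_(x in D) k x.
Proof.
move=> mD ih ik; rewrite RintegralD ?RintegralZl//.
- exact: integZ.
- exact: integZ.
Qed.

Lemma int_le D h k : measurable D -> integ D h -> integ D k ->
  (forall x, D x -> h x <= k x) ->
  \int[mu]_(x in D) h x <= \int[mu]_(x in D) k x.
Proof. by move=> /measurableR_cast mD ih ik hk; exact: le_Rintegral. Qed.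

Lemma int_abs_le D h k : measurable D -> measurable_fun D h -> integ D k ->
  (forall x, D x -> `|h x| <= k x) ->
  `|\int[mu]_(x in D) h x| <= \int[mu]_(x in D) k x.
Proof.
move=> mD mh ik hk; have ih := integ_le mD mh hk ik.
by apply: le_trans (le_normr_Rintegral (measurableR_cast mD) ih) _; apply: int_le => //; exact: integ_abs.
Qed.

Lemma int_sub_le D E h : measurable D -> measurable E -> E `<=` D ->
  integ D h -> (forall x, D x -> 0 <= h x) ->
  \int[mu]_(x in E) h x <= \int[mu]_(x in D) h x.
Proof.
move=> mD mE ED ih h0.
rewrite -(setDUK ED) Rintegral_setU//; last 3 first.
- exact: measurableD.
- by rewrite setDUK.
- by apply/disj_set2P; rewrite setDIK.
by rewrite lerDl; apply: Rintegral_ge0 => x [Dx _]; exact: h0.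
Qed.

Lemma int_setU D E h : measurable D -> measurable E -> [disjoint D & E] ->
  integ (D `|` E) h -> \int[mu]_(x in D `|` E) h x =
  \int[mu]_(x in D) h x + \int[mu]_(x in E) h x.
Proof. by move=> mD mE DE ih; rewrite Rintegral_setU. Qed.

Lemma itv_oc_cat (a b c : R) : a <= b -> b <= c ->
  `]a, c]%classic = `]a, b]%classic `|` `]b, c]%classic.
Proof.
move=> ab bc; apply/seteqP; split=> x /=; rewrite !in_itv/=.
  by move=> /andP[ax xc]; case: (leP x b) => xb; [left|right]; rewrite ?ax ?xb.
by move=> [/andP[-> xb]|/andP[bx ->]]; rewrite ?(le_trans xb)// ?(le_lt_trans ab).
Qed.

Lemma itv_oy_cat (a b : R) : a <= b ->
  `]a, +oo[%classic = `]a, b]%classic `|` `]b, +oo[%classic.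
Proof.
move=> ab; apply/seteqP; split=> x /=; rewrite !in_itv/= ?andbT.
  by move=> ax; case: (leP x b) => xb; [left|right]; rewrite ?ax ?xb.
by move=> [/andP[-> xb]|bx]; rewrite ?(le_lt_trans ab).
Qed.

Lemma int_oc_cat (a b c : R) h : a <= b -> b <= c -> integ `]a, c] h ->
  \int[mu]_(x in `]a, c]) h x =
  \int[mu]_(x in `]a, b]) h x + \int[mu]_(x in `]b, c]) h x.
Proof.
move=> ab bc; rewrite (itv_oc_cat ab bc) => ih; rewrite int_setU//.
apply/disj_set2P/seteqP; split=> x //= [].
by rewrite !in_itv/= => /andP[_ xb] /andP[/(le_lt_trans xb)]; rewrite ltxx.
Qed.

Lemma int_oy_cat (a b : R) h : a <= b -> integ `]a, +oo[ h ->
  \int[mu]_(x in `]a, +oo[) h x =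
  \int[mu]_(x in `]a, b]) h x + \int[mu]_(x in `]b, +oo[) h x.
Proof.
move=> ab; rewrite (itv_oy_cat ab) => ih; rewrite int_setU//.
apply/disj_set2P/seteqP; split=> x //= [].
by rewrite !in_itv/= andbT => /andP[_ xb] /(le_lt_trans xb); rewrite ltxx.
Qed.

Lemma measurable_halfline : measurable (@halfline R).
Proof. exact: measurable_itv. Qed.

Lemma integ_halfline_oc h (x y : R) : 0 <= x -> integ halfline h ->
  integ `]x, y] h.
Proof.
move=> x0; apply: (integ_sub measurable_halfline) => // z.
rewrite /halfline/= !in_itv/= andbT.
by move=> /andP[/(le_lt_trans x0)].
Qed.

Lemma int_cst_oc (a b c : R) : a <= b ->
  \int[mu]_(x in `]a, b]) c = c * (b - a).
Proof.
move=> ab; rewrite (@Rintegral_cst _ (measurableTypeR R) R mu); last first.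
  exact: measurable_itv.
transitivity (c * fine (@lebesgue_measure R `]a, b]%classic)); first by [].
rewrite lebesgue_measure_itv/= lte_fin.
case: ltP => [_|ba]; first by [].
by rewrite (@le_anti _ _ a b) ?ab//= subrr.
Qed.

Lemma integ_cst_oc (a b c : R) : integ `]a, b] (fun=> c).
Proof.
apply: measurable_bounded_integrable => //.
  change (@lebesgue_measure R `]a, b]%classic < +oo)%E.
  by rewrite lebesgue_measure_itv/=; case: ifP => _; rewrite ?ltry.
by exists `|c|; split => // M cM x _ /=; exact: ltW.
Qed.

Lemma integ_mulb D h k (M : R) : measurable D -> measurable_fun D h ->
  (forall x, D x -> `|h x| <= M) -> integ D k -> integ D (fun x => h x * k x).
Proof.
move=> mD mh hM ik; apply: (@integ_le _ _ (fun x => M * `|k x|)) => //.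
- by apply: measurable_funM => //; exact: integ_meas.
- by move=> x Dx; rewrite normrM ler_wpM2r// hM.
- exact/integZ/integ_abs.
Qed.

Lemma int_eq D h k : (forall x, D x -> h x = k x) ->
  \int[mu]_(x in D) h x = \int[mu]_(x in D) k x.
Proof. by move=> hk; apply: eq_Rintegral => x /set_mem; exact: hk. Qed.

Lemma int_zero D h : (forall x, D x -> h x = 0) -> \int[mu]_(x in D) h x = 0.
Proof. by move=> hk; rewrite (int_eq hk) /Rintegral integral0. Qed.

End Integrals.

(** * Continuity and differentiability in epsilon form *)

Section EpsilonDelta.
Context {R : realType}.
Implicit Types (f g h : R -> R).

Lemma cont_eps h x : {for x, continuous h} -> forall e : R, 0 < e ->
  exists2 d : R, 0 < d & forall y : R, `|y - x| < d -> `|h y - h x| < e.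
Proof.
move=> ch e e0; have /cvgrPdist_lt/(_ e e0) := ch.
move=> /nbhs_ballP[d d0 hd]; exists d => // y yd.
by rewrite distrC; apply: hd; rewrite -ball_normE/= distrC.
Qed.

Lemma eps_cont h x : (forall e : R, 0 < e ->
  exists2 d : R, 0 < d & forall y : R, `|y - x| < d -> `|h y - h x| <= e) ->
  {for x, continuous h}.
Proof.
move=> ch; apply/cvgrPdist_le => e e0; have [d d0 hd] := ch e e0.
apply/nbhs_ballP; exists d => // y yd.
have {}yd : `|x - y| < d := yd.
by rewrite distrC; apply: hd; rewrite distrC.
Qed.

Lemma deriv_eps h (x d : R) : is_derive x 1 h d -> forall e : R, 0 < e ->
  exists2 r : R, 0 < r &
    forall z : R, `|z - x| < r -> `|h z - h x - d * (z - x)| <= e * `|z - x|.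
Proof.
move=> [dh <-] e e0; have /cvgrPdist_le/(_ e e0) := dh.
rewrite near_withinE => /nbhs_ballP[r r0 hr]; exists r => // z zr.
have [->|zx] := eqVneq z x; first by rewrite !subrr mulr0 subrr normr0 mulr0.
have zx0 : z - x != 0 by rewrite subr_eq0.
have := hr (z - x); rewrite -ball_normE/= sub0r normrN => /(_ zr zx0).
rewrite scaler1 subrK -/('D_1 h x) => H.
rewrite -ler_pdivrMr ?normr_gt0//; apply: le_trans H.
rewrite -normfV -normrM distrC mulrBl.
by rewrite -mulrA (mulrC (z - x)) mulrA mulfVK// mulrC.
Qed.

Lemma cont_bounded h (a b : R) : continuous h ->
  exists M : R, forall x, a <= x <= b -> `|h x| <= M.
Proof.
move=> ch; have [ab|ba] := leP a b; last first.
  by exists 0 => x /andP[ax xb]; have := le_trans ax xb; rewrite leNgt ba.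
have /(EVT_max ab)[c _ hc] : {within `[a, b], continuous (fun x => `|h x|)}.
  by apply: continuous_subspaceT => x; apply: cvg_norm; exact: ch.
by exists `|h c| => x xab; apply: hc; rewrite in_itv.
Qed.

(** A connectedness argument: the supremum of the points [x] of [[a, b]] with [B a <= B x] has the
    same property and cannot lie below [b]. The hypothesis compares [B y] only with the value at the
    center [x], which is all that differentiability at a point can give. *)
Lemma local_mono (B : R -> R) (a b : R) : a <= b ->
  (forall x, a <= x <= b -> exists2 d : R, 0 < d &
     forall y, a <= y <= b -> `|y - x| < d ->
       (x <= y -> B x <= B y) /\ (y <= x -> B y <= B x)) -> B a <= B b.
Proof.
move=> ab loc; pose E := [set x | a <= x <= b /\ B a <= B x].
have Ea : E a by split; rewrite ?lexx ?ab.
have hE : has_sup E by split; [exists a | exists b => x [/andP[]]].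
have as_ : a <= sup E by apply: ub_le_sup => //; exact: hE.2.
have sb : sup E <= b by apply: ge_sup; [exists a|move=> x [/andP[]]].
have sab : a <= sup E <= b by rewrite as_ sb.
have [d d0 hd] := loc _ sab.
have [x Ex xs] := sup_adherent d0 hE.
have xs' : x <= sup E by apply: ub_le_sup => //; exact: hE.2.
have Bs : B a <= B (sup E).
  apply: le_trans Ex.2 _; apply: (hd x Ex.1 _).2 => //.
  by rewrite ler0_norm ?subr_le0// opprB ltrBlDr -ltrBlDl.
have [sbe|nsb] := eqVneq (sup E) b; first by rewrite -sbe.
have ltsb : sup E < b by rewrite lt_neqAle nsb.
pose y := Num.min b (sup E + d / 2).
have sy : sup E < y by rewrite lt_min ltsb ltrDl divr_gt0.
have yab : a <= y <= b by rewrite (le_trans as_ (ltW sy)) ge_min lexx.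
suff Ey : E y by have := ub_le_sup hE.2 Ey; rewrite leNgt sy.
split=> //; apply: le_trans Bs _; apply: (hd y yab _).1; last exact: ltW.
rewrite gtr0_norm ?subr_gt0// ltrBlDl.
have : y <= sup E + d / 2 by rewrite ge_min lexx orbT.
by move=> h; apply: le_lt_trans h _; rewrite ltrD2l ltr_pdivrMr// ltr_pMr// ltr1n.
Qed.

End EpsilonDelta.

(** * Absolutely continuous functions: chain rule and product rule *)

Section AbsoluteContinuity.
Context {R : realType}.
Notation mu := (@lebesgue_measure R).
Implicit Types (f g h k : R -> R).

(* [f] is the primitive of [g] on [0, oo), extended by [f 0] to the left. *)
Definition AC f g : Prop :=
  (forall T, integ `]0, T] g) /\
  forall x, f x = f 0 + \int[mu]_(t in `]0, x]) g t.

Lemma AC_neg f g (x : R) : AC f g -> x <= 0 -> f x = f 0.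
Proof.
move=> [_ ->] x0; rewrite set_itv_ge ?Rintegral_set0 ?addr0//.
by rewrite bnd_simp -leNgt.
Qed.

Lemma AC_integ f g (x y : R) : AC f g -> 0 <= x -> integ `]x, y] g.
Proof.
move=> [ig _] x0; apply: integ_sub (ig y) => // z /=.
by rewrite !in_itv/= => /andP[/(le_lt_trans x0) -> ->].
Qed.

Lemma AC_diff f g (x y : R) : AC f g -> 0 <= x -> x <= y ->
  f y - f x = \int[mu]_(t in `]x, y]) g t.
Proof.
move=> acf x0 xy; have [ig ef] := acf.
by rewrite (ef y) (ef x) (int_oc_cat x0 xy (ig y)); ring.
Qed.

Lemma AC_diff_le f g (x y : R) : AC f g -> 0 <= x -> x <= y ->
  `|f y - f x| <= \int[mu]_(t in `]x, y]) `|g t|.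
Proof.
move=> acf x0 xy; rewrite (AC_diff acf x0 xy).
have ig := AC_integ y acf x0.
by apply: int_abs_le => //; [exact: integ_meas|exact: integ_abs].
Qed.

Lemma AC_continuous f g : AC f g -> continuous f.
Proof.
move=> [ig ef] x; pose a := - `|x| - 1; pose b := `|x| + 1.
(* Cut to zero on the left, [g] has primitives that start at [a < 0], so that [x] is always interior
   to [[a, b]], even for [x <= 0]. *)
pose g0 := g \_ (@halfline R).
have a0 : a < 0 by rewrite /a; have := normr_ge0 x; lra.
have e y : f y = f 0 + \int[mu]_(t in `[a, y]) g0 t.
  rewrite (ef y) -[in RHS]Rintegral_mkcondr; congr (_ + Rintegral _ _ _).
  apply/seteqP; split=> z /=; rewrite /halfline/= !in_itv/= ?andbT.
    by move=> /andP[z0 ->]; rewrite z0 (ltW (lt_trans a0 z0)).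
  by move=> [/andP[_ ->] ->].
have ig0 : mu.-integrable `[a, b] (EFin \o g0).
  have : integ `[a, b] g0; last by [].
  apply: (@integ_sub _ `]-oo, b]) => //.
    by move=> z /=; rewrite !in_itv/= => /andP[].
  have eb : `]-oo, b]%classic `&` (@halfline R) = `]0, b]%classic.
    apply/seteqP; split=> z /=; rewrite /halfline/= !in_itv/= ?andbT.
      by move=> [-> ->].
    by move=> /andP[-> ->].
  have := ig b; rewrite /integ -eb => /(integrable_restrict _ _).
  by rewrite restrict_EFin; apply; exact: measurable_itv.
have ab : a < b by rewrite /a /b; have := normr_ge0 x; lra.
have /within_continuous_continuous := parameterized_integral_continuous (ltW ab) ig0.
have xab : x \in `]a, b[.
  by rewrite in_itv/=; apply/andP; split; rewrite /a /b;
    have := ler_norm x; have := lerNnormlW (lexx `|x|); lra.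
move=> /(_ x ab xab) cx.
rewrite (_ : f = fun y => f 0 + \int[mu]_(t in `[a, y]) g0 t); last exact/funext.
by apply: cvgD; [exact: cvg_cst|exact: cx].
Qed.

(** With [A] the primitive of [|g|], the defect [F] of the formula satisfies
    [|F v - F u| <= e * (A v - A u)] near each point, because [Phi] is differentiable at [f x] and
    [phi (f t)] is close to [phi (f x)]. By [local_mono] both [e * A + F] and [e * A - F] grow from
    [0] to [T], and [e] is arbitrary. *)
Lemma AC_comp f g (Phi phi : R -> R) : AC f g ->
  (forall x : R, is_derive x 1 Phi (phi x)) -> continuous phi ->
  AC (Phi \o f) (fun x => phi (f x) * g x).
Proof.
move=> acf dPhi cphi; have cf := AC_continuous acf.
have cpf : continuous (phi \o f).
  by move=> x; apply: continuous_comp; [exact: cf|exact: cphi].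
have ih T : integ `]0, T] (fun x => phi (f x) * g x).
  have [M hM] := cont_bounded 0 T cpf.
  apply: (@integ_mulb _ _ (phi \o f) g M) => //.
  - by apply: measurable_funTS; exact: continuous_measurable_fun.
  - by move=> x; rewrite /= in_itv/= => /andP[/ltW x0 xT]; apply: hM; rewrite x0.
  - exact: acf.1.
split=> // T; have [T0|T0] := leP T 0.
  by rewrite /= (AC_neg acf T0) set_itv_ge ?Rintegral_set0 ?addr0// bnd_simp -leNgt.
pose F y := Phi (f y) - \int[mu]_(t in `]0, y]) (phi (f t) * g t).
pose A y := \int[mu]_(t in `]0, y]) `|g t|.
have ia y : integ `]0, y] (fun t => `|g t|) by apply/integ_abs/acf.1.
have AD (u v : R) : 0 <= u -> u <= v -> A v - A u = \int[mu]_(t in `]u, v]) `|g t|.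
  by move=> u0 uv; rewrite /A (int_oc_cat u0 uv)//; ring.
have loc (e x : R) : 0 < e -> 0 <= x -> exists2 d : R, 0 < d & forall u v : R,
    0 <= u -> u <= v -> (u = x \/ v = x) -> `|u - x| < d -> `|v - x| < d ->
    `|F v - F u| <= e * (A v - A u).
  move=> e0 x0; have e20 : 0 < e / 2 by rewrite divr_gt0.
  have [r r0 hr] := deriv_eps (dPhi (f x)) e20.
  have [d1 d10 hd1] := cont_eps (cf x) r0.
  have [d2 d20 hd2] := cont_eps (cpf x) e20.
  exists (Num.min d1 d2); first by rewrite lt_min d10.
  move=> u v u0 uv uvx; rewrite !lt_min => /andP[ux1 ux2] /andP[vx1 vx2].
  have igv : integ `]u, v] g := AC_integ v acf u0.
  have ihv : integ `]u, v] (fun t => phi (f t) * g t).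
    apply: integ_sub (ih v) => // z /=.
    by rewrite !in_itv/= => /andP[/(le_lt_trans u0) -> ->].
  have -> : F v - F u = (Phi (f v) - Phi (f u) - phi (f x) * (f v - f u))
      - \int[mu]_(t in `]u, v]) (1 * (phi (f t) * g t) + (- phi (f x)) * g t).
    by rewrite /F (int_oc_cat u0 uv (ih v)) int_lin// -(AC_diff acf u0 uv); ring.
  rewrite (AD u v u0 uv); apply: le_trans (ler_normB _ _) _.
  have igva := integ_abs igv.
  have e2 : `|Phi (f v) - Phi (f u) - phi (f x) * (f v - f u)| <=
     e / 2 * \int[mu]_(t in `]u, v]) `|g t|.
    apply: (@le_trans _ _ (e / 2 * `|f v - f u|)); last first.
      by rewrite ler_pM2l//; exact: AC_diff_le.
    case: uvx => [ue|ve].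
      by rewrite ue; apply: hr; exact: hd1.
    rewrite ve -normrN [X in _ <= _ * X]distrC.
    have := hr (f u) (hd1 u ux1).
    by congr (_ <= _); congr (`|_|); ring.
  have e3 : `|\int[mu]_(t in `]u, v]) (1 * (phi (f t) * g t) + (- phi (f x)) * g t)|
     <= \int[mu]_(t in `]u, v]) (e / 2 * `|g t| + 0 * `|g t|).
    apply: int_abs_le => //; [by apply: integ_meas; exact: integ_lin|exact: integ_lin|].
    move=> t; rewrite /= in_itv/= => /andP[ut tv].
    rewrite (_ : _ + - phi (f x) * g t = (phi (f t) - phi (f x)) * g t); last by ring.
    rewrite mul0r addr0 normrM ler_wpM2r//.
    by apply/ltW/hd2; move: ux2 vx2; rewrite !ltr_norml; lra.
  rewrite [leRHS]int_lin// mul0r addr0 in e3.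
  by apply: le_trans (lerD e2 e3) _; rewrite -mulrDl -splitr.
have main (e : R) : 0 < e -> `|F T - F 0| <= e * A T.
  move=> e0; have A0 : A 0 = 0 by rewrite /A set_itv_ge ?Rintegral_set0// bnd_simp ltxx.
  have mono (s : R) : `|s| = 1 -> e * A 0 + s * F 0 <= e * A T + s * F T.
    move=> s1; apply: (@local_mono _ (fun y => e * A y + s * F y) 0 T (ltW T0)).
    move=> x /andP[x0 xT]; have [d d0 hd] := loc e x e0 x0; exists d => // y.
    move=> /andP[y0 yT] yd; have aux (u v : R) : `|F v - F u| <= e * (A v - A u) ->
        e * A u + s * F u <= e * A v + s * F v.
      move=> H; rewrite -subr_ge0.
      have -> : e * A v + s * F v - (e * A u + s * F u) =
        e * (A v - A u) + s * (F v - F u) by ring.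
      have : `|s * (F v - F u)| <= e * (A v - A u) by rewrite normrM s1 mul1r.
      by rewrite ler_norml => /andP[]; lra.
    split=> xy; apply: aux; apply: hd => //; rewrite ?subrr ?normr0//; [by left|by right].
  have := mono 1 (normr1 _); have := mono (-1) (normrN1 _).
  rewrite A0 ler_norml => h1 h2; apply/andP; split; lra.
have : F T - F 0 = 0.
  apply/eqP; rewrite -normr_le0; apply/ler_addgt0Pr => e e0; rewrite add0r.
  have AT : 0 <= A T by apply: Rintegral_ge0.
  have e' : 0 < e / (A T + 1) by rewrite divr_gt0// ltr_wpDl.
  apply: le_trans (main _ e') _; rewrite mulrAC ler_pdivrMr ?ltr_wpDl//.
  by rewrite ler_pM2l// lerDl.
rewrite /F (@set_itv_ge _ _ (BRight 0) (BRight 0)) ?bnd_simp ?ltxx//.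
by rewrite Rintegral_set0 /= subr0 => /eqP; rewrite subr_eq0 => /eqP <-; rewrite subrK.
Qed.

Lemma AC_lin a b f g h k : AC f g -> AC h k ->
  AC (fun x => a * f x + b * h x) (fun x => a * g x + b * k x).
Proof.
move=> [ig ef] [ik eh]; split=> [T|x]; first exact: integ_lin.
by rewrite int_lin// (ef x) (eh x); ring.
Qed.

(** Polarization: four times the product is the difference of the squares of [f + h] and [f - h],
    and squares fall under [AC_comp]. *)
Lemma AC_mul f g h k : AC f g -> AC h k ->
  AC (fun x => f x * h x) (fun x => g x * h x + f x * k x).
Proof.
move=> acf ach.
have dsq (x : R) : is_derive x 1 (fun x : R => x ^+ 2) (2 * x).
  have -> : (fun x : R => x ^+ 2) = (@id R) ^+ 2 by apply/funext.
  apply: is_derive_eq; rewrite /GRing.scale/=; ring.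
have csq : continuous (fun x : R => 2 * x).
  by move=> x; apply: cvgM; [exact: cvg_cst|exact: cvg_id].
have s1 := AC_comp (AC_lin 1 1 acf ach) dsq csq.
have s2 := AC_comp (AC_lin 1 (-1) acf ach) dsq csq.
have := AC_lin (4^-1) (- 4^-1) s1 s2.
congr AC; apply/funext => x /=; by field.
Qed.

Lemma AC_cst c : AC (fun=> c) (fun=> 0).
Proof.
split=> [T|x]; first exact: integ0.
by rewrite int_zero// addr0.
Qed.

(** The argument is clamped because an [AC] function is constant on the negative axis; the clamp
    itself is the primitive of 1. *)
Lemma AC_C1 (c c' : R -> R) : (forall x : R, is_derive x 1 c (c' x)) ->
  continuous c' -> AC (fun x => c (Num.max x 0)) (fun x => c' x).
Proof.
move=> dc cc'.
have acid : AC (fun x => Num.max x 0) (fun=> 1).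
  split=> [T|x]; first exact: integ_cst_oc.
  rewrite maxxx add0r; case: (leP x 0) => x0.
    by rewrite set_itv_ge ?Rintegral_set0// bnd_simp -leNgt.
  by rewrite int_cst_oc ?ltW// mul1r subr0.
have [ig ef] := AC_comp acid dc cc'.
have e (x t : R) : `]0, x]%classic t -> c' (Num.max t 0) * 1 = c' t.
  by rewrite /= in_itv/= mulr1 => /andP[t0 _]; rewrite max_l// ltW.
split=> [T|x]; first by apply: integ_eq (ig T) => // t /e.
by rewrite [LHS]ef; congr (_ + _); apply: int_eq => t /e.
Qed.

End AbsoluteContinuity.

(** * H^1 of the half-line and the quadratic form *)

Section H1Space.
Context {R : realType}.
Notation mu := (@lebesgue_measure R).
Notation E := ((R -> R) * (R -> R))%type.
Notation hl := (@halfline R).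
Implicit Types (u v w : E) (c : R -> R).

(* An element of H^1(0, oo) is carried together with its derivative. *)
Definition H1 u : Prop :=
  [/\ AC u.1 u.2, measurable_fun setT u.2,
      integ hl (fun x => u.1 x ^+ 2) & integ hl (fun x => u.2 x ^+ 2)].

Definition lc a u b v : E :=
  (fun x => a * u.1 x + b * v.1 x, fun x => a * u.2 x + b * v.2 x).

Definition n0 u : R := \int[mu]_(x in hl) (u.1 x ^+ 2).
Definition n1 u : R := \int[mu]_(x in hl) (u.2 x ^+ 2).

Lemma mhl : measurable hl. Proof. exact: measurable_halfline. Qed.
Hint Resolve mhl : core.

Lemma halflineE (x : R) : hl x = (0 < x) :> Prop.
Proof. by rewrite /halfline /= in_itv/= andbT. Qed.

Lemma integ_mul_sq D (f g : R -> R) : measurable D ->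
  measurable_fun D f -> measurable_fun D g ->
  integ D (fun x => f x ^+ 2) -> integ D (fun x => g x ^+ 2) ->
  integ D (fun x => f x * g x).
Proof.
move=> mD mf mg if2 ig2.
apply: integ_le (integD mD if2 ig2) => //; first exact: measurable_funM.
move=> x _; rewrite normrM; have := sqr_ge0 (`|f x| - `|g x|).
rewrite -(real_normK (num_real (f x))) -(real_normK (num_real (g x))).
have := mulr_ge0 (normr_ge0 (f x)) (normr_ge0 (g x)); nra.
Qed.

Lemma cauchy_schwarz D (f g : R -> R) : measurable D ->
  measurable_fun D f -> measurable_fun D g ->
  integ D (fun x => f x ^+ 2) -> integ D (fun x => g x ^+ 2) ->
  (\int[mu]_(x in D) (f x * g x)) ^+ 2 <=
  (\int[mu]_(x in D) (f x ^+ 2)) * \int[mu]_(x in D) (g x ^+ 2).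
Proof.
move=> mD mf mg if2 ig2; have ifg := integ_mul_sq mD mf mg if2 ig2.
set A := \int[mu]_(x in D) (f x ^+ 2); set C := \int[mu]_(x in D) (g x ^+ 2).
set B := \int[mu]_(x in D) (f x * g x).
have A0 : 0 <= A by apply: Rintegral_ge0 => x _; exact: sqr_ge0.
have C0 : 0 <= C by apply: Rintegral_ge0 => x _; exact: sqr_ge0.
have H s t : 0 <= s ^+ 2 * A + (2 * s * t) * B + t ^+ 2 * C.
  rewrite -[X in 0 <= X]mul1r -[t ^+ 2 * C]mul1r.
  have : 0 <= \int[mu]_(x in D)
     (1 * (s ^+ 2 * f x ^+ 2 + (2 * s * t) * (f x * g x)) + t ^+ 2 * g x ^+ 2).
    apply: Rintegral_ge0 => x _.
    by rewrite (_ : _ + _ = (s * f x + t * g x) ^+ 2) ?sqr_ge0//; ring.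
  rewrite int_lin//; last exact: integ_lin.
  by rewrite int_lin// !mul1r.
have [C00|Cn0] := eqVneq C 0.
  rewrite C00 mulr0; have [B0|Bn0] := eqVneq B 0; first by rewrite B0 expr0n.
  (* If [C = 0] and [B != 0], the quadratic form is affine in its second argument and takes the
     value [-1] here. *)
  have := H 1 (- (A + 1) / (2 * B)); rewrite C00.
  have -> : 1 ^+ 2 * A + 2 * 1 * (- (A + 1) / (2 * B)) * B +
    (- (A + 1) / (2 * B)) ^+ 2 * 0 = -1 by field.
  by lra.
have Cp : 0 < C by rewrite lt_neqAle eq_sym Cn0.
have := H C (- B); rewrite (_ : _ + _ = C * (A * C - B ^+ 2)); last by ring.
by rewrite pmulr_rge0// subr_ge0.
Qed.

Lemma H1_meas0 u D : H1 u -> measurable_fun D u.1.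
Proof.
move=> [ac _ _ _]; apply: measurable_funTS; apply: continuous_measurable_fun.
exact: AC_continuous ac.
Qed.

Lemma H1_meas1 u D : H1 u -> measurable_fun D u.2.
Proof. by move=> [_ m _ _]; exact: measurable_funTS. Qed.

Lemma H1_mul0 u v : H1 u -> H1 v -> integ hl (fun x => u.1 x * v.1 x).
Proof.
move=> hu hv; apply: integ_mul_sq => //; [exact: H1_meas0|exact: H1_meas0| |].
  by case: hu.
by case: hv.
Qed.

Lemma H1_mul1 u v : H1 u -> H1 v -> integ hl (fun x => u.2 x * v.2 x).
Proof.
move=> hu hv; apply: integ_mul_sq => //; [exact: H1_meas1|exact: H1_meas1| |].
  by case: hu.
by case: hv.
Qed.

Lemma H1_lc a b u v : H1 u -> H1 v -> H1 (lc a u b v).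
Proof.
move=> hu hv; have [acu mu2 iu1 iu2] := hu; have [acv mv2 iv1 iv2] := hv.
have i12 := H1_mul0 hu hv; have j12 := H1_mul1 hu hv; split => /=.
- exact: AC_lin.
- by apply: measurable_funD; apply: measurable_funM.
- apply: (@integ_eq _ _ (fun x => a ^+ 2 * u.1 x ^+ 2 +
    1 * (2 * a * b * (u.1 x * v.1 x) + b ^+ 2 * v.1 x ^+ 2))) => //.
    by move=> x _; ring.
  by apply: integ_lin => //; exact: integ_lin.
- apply: (@integ_eq _ _ (fun x => a ^+ 2 * u.2 x ^+ 2 +
    1 * (2 * a * b * (u.2 x * v.2 x) + b ^+ 2 * v.2 x ^+ 2))) => //.
    by move=> x _; ring.
  by apply: integ_lin => //; exact: integ_lin.
Qed.

Lemma n0_ge0 u : 0 <= n0 u.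
Proof. by apply: Rintegral_ge0 => x _; exact: sqr_ge0. Qed.

Lemma n1_ge0 u : 0 <= n1 u.
Proof. by apply: Rintegral_ge0 => x _; exact: sqr_ge0. Qed.

Lemma H1_holder u (x y : R) : H1 u -> 0 <= x -> x <= y ->
  (u.1 y - u.1 x) ^+ 2 <= (y - x) * n1 u.
Proof.
move=> hu x0 xy; have [ac m2 i1 i2] := hu.
have ig := AC_integ y ac x0; have ioc := integ_halfline_oc y x0 i2.
rewrite (AC_diff ac x0 xy).
have -> : \int[mu]_(t in `]x, y]) u.2 t = \int[mu]_(t in `]x, y]) (1 * u.2 t).
  by apply: int_eq => t _; rewrite mul1r.
apply: le_trans (cauchy_schwarz _ _ _ _ _) _ => //.
- exact: H1_meas1.
- by rewrite expr1n; exact: integ_cst_oc.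
- rewrite expr1n int_cst_oc// mul1r ler_wpM2l ?subr_ge0//.
  apply: int_sub_le => // z; rewrite ?halflineE/= ?in_itv/=.
    by move=> /andP[/(le_lt_trans x0)].
  by move=> _; exact: sqr_ge0.
Qed.

(** Average [u x ^+ 2 <= 2 * u y ^+ 2 + 2 * (u y - u x) ^+ 2] over [y] in []x, x + L]] and apply
    [H1_holder]. The free length [L] makes the coefficient of [n1] as small as desired, at the
    expense of that of [n0]. *)
Lemma H1_sobolev u (L x : R) : H1 u -> 0 < L ->
  u.1 x ^+ 2 <= 2 / L * n0 u + 2 * L * n1 u.
Proof.
move=> hu L0; have [ac m2 i1 i2] := hu.
wlog x0 : x / 0 <= x => [H|].
  have [|x0] := leP 0 x; first exact: H.
  by rewrite (AC_neg ac (ltW x0)); exact: H.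
have xL : x <= x + L by rewrite lerDl ltW.
have ioc := integ_halfline_oc (x + L) x0 i1.
suff : u.1 x ^+ 2 * L <= 2 * n0 u + 2 * L * n1 u * L.
  by rewrite -ler_pdivlMr// mulrDl mulfK ?gt_eqF// mulrAC.
have -> : u.1 x ^+ 2 * L = \int[mu]_(y in `]x, (x + L)]) (u.1 x ^+ 2).
  by rewrite int_cst_oc//; ring.
apply: (@le_trans _ _ (\int[mu]_(y in `]x, (x + L)])
   (2 * u.1 y ^+ 2 + 1 * (2 * L * n1 u)))).
  apply: int_le => //; first exact: integ_cst_oc.
    by apply: integ_lin => //; exact: integ_cst_oc.
  move=> y; rewrite /= in_itv/= => /andP[/ltW xy yL].
  have := H1_holder hu x0 xy; have := n1_ge0 u.
  have : (y - x) * n1 u <= L * n1 u by rewrite ler_wpM2r ?n1_ge0// lerBlDl.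
  have := sqr_ge0 (2 * u.1 y - u.1 x); rewrite !expr2; nra.
rewrite int_lin//; last exact: integ_cst_oc.
rewrite int_cst_oc// mul1r (_ : x + L - x = L); last by ring.
rewrite lerD2r ler_pM2l//; apply: int_sub_le => // z; rewrite ?halflineE/= ?in_itv/=.
  by move=> /andP[/(le_lt_trans x0)].
by move=> _; exact: sqr_ge0.
Qed.

Lemma H1_bound u (x : R) : H1 u -> u.1 x ^+ 2 <= 2 * (n0 u + n1 u).
Proof. by move=> hu; have := H1_sobolev x hu ltr01; lra. Qed.

Lemma H1_bounded u : H1 u -> exists M : R, forall x, `|u.1 x| <= M.
Proof.
move=> hu; exists (Num.sqrt (2 * (n0 u + n1 u))) => x.
rewrite -(@ler_pXn2r _ 2) ?nnegrE ?sqrtr_ge0//.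
rewrite real_normK ?num_real// sqr_sqrtr ?H1_bound//.
by rewrite mulr_ge0// addr_ge0 ?n0_ge0 ?n1_ge0.
Qed.

(* [c] acts on H^1 like an element of L^1 + L^oo with norms [c1] and [c2]. *)
Definition potential_bounds c (c1 c2 : R) : Prop :=
  [/\ measurable_fun hl c, 0 <= c1, 0 <= c2 &
  forall (k : R -> R) (B : R), measurable_fun hl k ->
    (forall x, 0 < x -> 0 <= k x <= B) -> integ hl k ->
    integ hl (fun x => c x * k x) /\
    \int[mu]_(x in hl) (`|c x| * k x) <= c1 * B + c2 * \int[mu]_(x in hl) k x].

Definition bil (al : R) c u v : R :=
  \int[mu]_(x in hl) (u.2 x * v.2 x) - al * (u.1 0 * v.1 0) +
  \int[mu]_(x in hl) (c x * (u.1 x * v.1 x)).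

Section Form.
Variables (al : R) (c : R -> R) (c1 c2 : R).
Hypothesis hc : potential_bounds c c1 c2.
Local Notation blf := (bil al c).

(** [potential_bounds] only speaks of nonnegative bounded weights; the product is recovered from the
    squares of [u + v] and [u - v]. *)
Lemma pot_mul u v : H1 u -> H1 v -> integ hl (fun x => c x * (u.1 x * v.1 x)).
Proof.
move=> hu hv.
have [M hM] := H1_bounded (H1_lc 1 1 hu hv).
have [M' hM'] := H1_bounded (H1_lc 1 (-1) hu hv).
have [mc _ _ hc'] := hc.
have aux w : H1 w -> integ hl (fun x => c x * w.1 x ^+ 2).
  move=> hw; have [N hN] := H1_bounded hw.
  apply: (hc' _ (N ^+ 2) _ _ _).1.
  - by apply: measurable_funX; exact: H1_meas0.
  - move=> x _; rewrite sqr_ge0 /= -[w.1 x ^+ 2]real_normK ?num_real//.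
    by rewrite ler_pXn2r ?nnegrE// (le_trans _ (hN 0)).
  - by case: hw.
have i1 := aux _ (H1_lc 1 1 hu hv); have i2 := aux _ (H1_lc 1 (-1) hu hv).
apply: integ_eq (integ_lin (4^-1) (- 4^-1) mhl i1 i2) => // x _ /=.
by field.
Qed.

Lemma pot_sq u (L : R) : H1 u -> 0 < L ->
  `|\int[mu]_(x in hl) (c x * (u.1 x * u.1 x))| <=
  c1 * (2 / L * n0 u + 2 * L * n1 u) + c2 * n0 u.
Proof.
move=> hu L0; have [mc c10 c20 hc'] := hc.
have [_ _ i1 _] := hu.
have mu2 : measurable_fun hl (fun x => u.1 x ^+ 2).
  by apply: measurable_funX; exact: H1_meas0.
have hk x : 0 < x -> 0 <= u.1 x ^+ 2 <= 2 / L * n0 u + 2 * L * n1 u.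
  by move=> _; rewrite sqr_ge0 H1_sobolev.
have [ii hle] := hc' _ _ mu2 hk i1.
apply: le_trans hle; apply: (@int_abs_le _ hl) => //.
- exact: integ_meas (pot_mul hu hu).
- apply: integ_eq (integ_abs ii) => // x _.
  by rewrite normrM (ger0_norm (sqr_ge0 _)).
- by move=> x _; rewrite normrM -expr2 (ger0_norm (sqr_ge0 _)).
Qed.

Lemma bilC u v : blf u v = blf v u.
Proof.
rewrite /bil; congr (_ - _ + _).
- by apply: int_eq => x _; rewrite mulrC.
- by rewrite (mulrC (u.1 0)).
- by apply: int_eq => x _; rewrite (mulrC (u.1 x)).
Qed.

Lemma bil_lc a b u v w : H1 u -> H1 v -> H1 w ->
  blf (lc a u b v) w = a * blf u w + b * blf v w.
Proof.
move=> hu hv hw; rewrite /bil /=.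
have -> : \int[mu]_(x in hl) ((a * u.2 x + b * v.2 x) * w.2 x) =
   a * \int[mu]_(x in hl) (u.2 x * w.2 x) + b * \int[mu]_(x in hl) (v.2 x * w.2 x).
  rewrite -int_lin//; [|exact: H1_mul1|exact: H1_mul1].
  by apply: int_eq => x _; ring.
have -> : \int[mu]_(x in hl) (c x * ((a * u.1 x + b * v.1 x) * w.1 x)) =
   a * \int[mu]_(x in hl) (c x * (u.1 x * w.1 x)) +
   b * \int[mu]_(x in hl) (c x * (v.1 x * w.1 x)).
  rewrite -int_lin//; [|exact: pot_mul|exact: pot_mul].
  by apply: int_eq => x _; ring.
by ring.
Qed.

Lemma bil_lcr a b u v w : H1 u -> H1 v -> H1 w ->
  blf w (lc a u b v) = a * blf w u + b * blf w v.
Proof. by move=> *; rewrite !(bilC w) bil_lc. Qed.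

Lemma bil_sq_lc a b u v : H1 u -> H1 v ->
  blf (lc a u b v) (lc a u b v) =
  a ^+ 2 * blf u u + 2 * a * b * blf u v + b ^+ 2 * blf v v.
Proof.
move=> hu hv; rewrite bil_lc ?bil_lcr//; try exact: H1_lc.
by rewrite (bilC v u); ring.
Qed.

(** A Garding inequality: the vertex term and the [L^1] part of the potential are controlled by
    [H1_sobolev] with a length [L] such that [2 * L * s = 2^-1], so that they consume only half of
    [n1]. *)
Lemma bil_low : exists2 C : R, 0 <= C &
  forall u, H1 u -> 2^-1 * n1 u - C * n0 u <= blf u u.
Proof.
have [mc c10 c20 _] := hc; pose s := `|al| + c1 + 1.
have s0 : 0 < s by rewrite /s; have := normr_ge0 al; lra.
pose L := (4 * s)^-1; have L0 : 0 < L by rewrite invr_gt0 mulr_gt0.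
exists (s * (2 / L) + c2).
  by rewrite addr_ge0// mulr_ge0 ?(ltW s0)// divr_ge0// ltW.
move=> u hu; have := pot_sq hu L0; have := H1_sobolev 0 hu L0.
set B := 2 / L * n0 u + 2 * L * n1 u => hB; rewrite ler_norml => /andP[hl_ _].
have B0 : 0 <= B by apply: le_trans hB; exact: sqr_ge0.
have h1 : al * (u.1 0 * u.1 0) <= `|al| * B.
  apply: (@le_trans _ _ (`|al| * (u.1 0 * u.1 0))).
    by rewrite ler_wpM2r// ?ler_norm// -expr2 sqr_ge0.
  by rewrite ler_wpM2l// -expr2.
have h2 : (`|al| + c1) * B <= s * B by rewrite ler_wpM2r// /s lerDl.
have h3 : s * B = s * (2 / L) * n0 u + 2^-1 * n1 u.
  by rewrite /B /L; field; rewrite gt_eqF.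
rewrite /bil (_ : \int[mu]_(x in hl) (u.2 x * u.2 x) = n1 u)//.
by move: h2; rewrite h3; nra.
Qed.

Lemma bil_up : exists2 C : R, 0 <= C &
  forall u, H1 u -> `|blf u u| <= C * (n0 u + n1 u).
Proof.
have [mc c10 c20 _] := hc.
exists (1 + (`|al| + c1) * 2 + c2).
  by rewrite !addr_ge0// mulr_ge0// addr_ge0.
move=> u hu; have hp := pot_sq hu ltr01; have := H1_sobolev 0 hu ltr01.
have hn0 := n0_ge0 u; have hn1 := n1_ge0 u.
rewrite /bil (_ : \int[mu]_(x in hl) (u.2 x * u.2 x) = n1 u)// => hs.
apply: le_trans (ler_normD _ _) _; apply: le_trans (lerD (ler_normB _ _) hp) _.
rewrite (ger0_norm hn1) normrM -expr2 (ger0_norm (sqr_ge0 _)).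
have := normr_ge0 al; move: hs; rewrite divr1 mulr1 => hs ha.
have h1 : `|al| * u.1 0 ^+ 2 <= `|al| * (2 * (n0 u + n1 u)).
  by rewrite ler_wpM2l//; lra.
nra.
Qed.

(** A convex combination, with weights [1 - s] and [s], of the lower bound by [d * n0] and of
    [bil_low]; [s] is so small that the loss [s * (d + C)] in the coefficient of [n0] stays below
    [d / 2]. *)
Lemma bil_coercive (d : R) : 0 < d ->
  (forall u, H1 u -> d * n0 u <= blf u u) ->
  exists2 k : R, 0 < k & forall u, H1 u -> k * (n0 u + n1 u) <= blf u u.
Proof.
move=> d0 hd; have [C C0 hC] := bil_low.
pose s := d / (2 * (d + C + 1)).
have sp : 0 < d + C + 1 by lra.
have s0 : 0 < s by rewrite divr_gt0// mulr_gt0.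
have es : s * (d + C + 1) = d / 2 by rewrite /s; field; rewrite gt_eqF.
have s1 : s <= 1.
  by rewrite ler_pdivrMr ?mulr_gt0//; lra.
exists (Num.min (d / 2) (s / 2)); first by rewrite lt_min; apply/andP; split; apply: divr_gt0.
move=> u hu; have h1 := hd u hu; have h2 := hC u hu.
have hn0 := n0_ge0 u; have hn1 := n1_ge0 u.
apply: (@le_trans _ _ (d / 2 * n0 u + s / 2 * n1 u)).
  by rewrite mulrDr lerD// ler_wpM2r// ge_min lexx ?orbT.
have : (1 - s) * (d * n0 u) + s * (2^-1 * n1 u - C * n0 u) <= blf u u.
  have -> : blf u u = (1 - s) * blf u u + s * blf u u by ring.
  by apply: lerD; apply: ler_wpM2l => //; lra.
have : d / 2 * n0 u = s * (d + C + 1) * n0 u by rewrite es.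
have : 0 <= s * n0 u by rewrite mulr_ge0// ltW.
nra.
Qed.

End Form.
End H1Space.

(** * The problem without potential on the line *)

Section Powers.
Context {R : realType}.
Implicit Types (x y e M : R).

(** The tangent line at [y] lies below the convex power. For [y = 1] this is Young's inequality for
    the product of [z] and 1; the general case follows by homogeneity. *)
Lemma bernoulli e x y : 1 < e -> 0 <= x -> 0 <= y ->
  y `^ e + e * y `^ (e - 1) * (x - y) <= x `^ e.
Proof.
move=> e1 x0; have e0 : 0 < e by lra.
rewrite le_eqVlt => /predU1P[<-|y0].
  rewrite !powR0 ?gt_eqF ?subr_gt0//.
  by rewrite add0r mulr0 mul0r powR_ge0.
pose z := x / y; have z0 : 0 <= z by rewrite divr_ge0// ltW.
have q0 : 0 < (1 - e^-1)^-1 by rewrite invr_gt0 subr_gt0 invf_lt1.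
have pq : e^-1 + ((1 - e^-1)^-1)^-1 = 1 by rewrite invrK; ring.
have := conjugate_powR z0 ler01 e0 q0 pq; rewrite mulr1 powR1 invrK mul1r => H.
have Hz : 1 + e * (z - 1) <= z `^ e.
  have := ler_wpM2l (ltW e0) H.
  have -> : e * (z `^ e / e + (1 - e^-1)) = z `^ e + e - 1 by field; rewrite gt_eqF.
  by lra.
have -> : x = z * y by rewrite /z mulfVK ?gt_eqF.
rewrite powRM// ?(ltW y0)// -(mulr_powRB1 (ltW y0) e0).
have := ler_wpM2r (mulr_ge0 (ltW y0) (powR_ge0 y (e - 1))) Hz.
by congr (_ <= _); ring.
Qed.

Lemma powR_lip e M x y : 1 < e -> 0 <= x <= M -> 0 <= y <= M ->
  `|x `^ e - y `^ e| <= e * M `^ (e - 1) * `|x - y|.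
Proof.
move=> e1; wlog xy : x y / x <= y => [H|].
  by case: (leP x y) => [/H//|/ltW yx] hx hy; rewrite distrC (distrC x); apply: H.
move=> /andP[x0 xM] /andP[y0 yM]; have e0 : 0 <= e by lra.
have := bernoulli e1 x0 y0.
have : x `^ e <= y `^ e by apply: ge0_ler_powR; rewrite ?nnegrE.
have : y `^ (e - 1) <= M `^ (e - 1).
  by apply: ge0_ler_powR; rewrite ?nnegrE//; lra.
move=> h1 h2 h3; rewrite ler0_norm ?subr_le0// ler0_norm ?subr_le0//.
have : e * y `^ (e - 1) * (y - x) <= e * M `^ (e - 1) * (y - x).
  by rewrite ler_wpM2r ?subr_ge0// ler_wpM2l.
lra.
Qed.

Lemma pabs_continuous e : 1 < e -> continuous (fun x => `|x| `^ e).
Proof.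
move=> e1 x; apply: eps_cont => eps eps0; pose M := `|x| + 1.
have M0 : 0 < M by rewrite ltr_wpDl.
have K0 : 0 < e * M `^ (e - 1) by rewrite mulr_gt0 ?powR_gt0//; lra.
exists (Num.min 1 (eps / (e * M `^ (e - 1)))).
  by rewrite lt_min ltr01 divr_gt0.
move=> y; rewrite lt_min => /andP[y1 ye].
have yM : `|y| <= M.
  by have := ler_distD x y 0; rewrite !subr0 /M; move: (ltW y1); lra.
apply: (@le_trans _ _ (e * M `^ (e - 1) * `| `|y| - `|x| |)).
  by apply: powR_lip; rewrite ?normr_ge0 ?yM//= /M lerDl.
rewrite mulrC -ler_pdivlMr//; apply: le_trans (ltW ye).
exact: ler_dist_dist.
Qed.

Lemma powR_square x : 0 <= x -> x `^ 2 = x ^+ 2.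
Proof. by move=> x0; rewrite -powR_mulrn. Qed.

Lemma pabs_split r x : 2 < r -> `|x| `^ r = `|x| `^ (r - 2) * x ^+ 2.
Proof.
move=> r2; rewrite -(real_normK (num_real x)) -powR_square//.
have [->|x0] := eqVneq `|x| 0; first by rewrite !powR0 ?mulr0 ?gt_eqF//; lra.
by rewrite -powRD ?x0 ?implybT// subrK.
Qed.

(** The primitive starts at a point [a] to the left of the support. To the right of [a] this is the
    fundamental theorem of calculus; around [a] and further left the integral is constantly 0, as is
    [phi]. *)
Lemma is_derive_cutoff_primitive (phi : R -> R) s : continuous phi -> 0 < s ->
  (forall x, s <= `|x| -> phi x = 0) ->
  exists Phi : R -> R, forall x, is_derive x 1 Phi (phi x).
Proof.
move=> cphi s0 phi0; pose a := - s - 1.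
exists (fun x => \int[lebesgue_measure]_(t in `[a, x]) phi t) => x.
have ip y : lebesgue_measure.-integrable `[a, y] (EFin \o phi).
  apply: continuous_compact_integrable; first exact: segment_compact.
  exact: continuous_subspaceT.
have [xs|xs] := leP x (- s - 2^-1).
  have e0 : forall y, y < - s ->
      \int[lebesgue_measure]_(t in `[a, y]) phi t = 0.
    move=> y ys; apply: int_zero => t; rewrite /= in_itv/= => /andP[_ ty].
    by apply: phi0; rewrite ltr0_norm; lra.
  rewrite phi0; last by rewrite ltr0_norm; lra.
  have nx : \forall y \near x, cst 0 y = \int[lebesgue_measure]_(t in `[a, y]) phi t.
    near=> y; apply/esym/e0; near: y; apply: lt_nbhsl; lra.
  exact: (near_eq_is_derive nx (is_derive_cst _ _ _)).
have ax : a < x by rewrite /a; lra.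
have xu : x < x + 1 by rewrite ltrDl.
have := @continuous_FTC1_closed R phi a x _ xu (ip _) ax (cphi x).
move=> [d1 <-]; rewrite derive1E; exact: derivableP.
Unshelve. all: by end_near. Qed.

End Powers.

(** * The nonlinear term on the half-line *)

Section Nonlinearity.
Context {R : realType}.
Notation mu := (@lebesgue_measure R).
Notation E := ((R -> R) * (R -> R))%type.
Notation hl := (@halfline R).
Implicit Types (u v w : E).

Definition bb (r : R) u : R := \int[mu]_(x in hl) (`|u.1 x| `^ r).

Lemma bb_ge0 r u : 0 <= bb r u.
Proof. by apply: Rintegral_ge0 => x _; exact: powR_ge0. Qed.

Lemma pabs_meas (r : R) u D : H1 u ->
  measurable_fun D (fun x => `|u.1 x| `^ r).
Proof.
move=> hu; apply: measurable_funTS; apply: (measurableT_comp (measurable_powR _)).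
apply: measurableT_comp => //; exact: H1_meas0.
Qed.

Lemma bb_le r u (B : R) : 2 < r -> H1 u -> (forall x, 0 < x -> `|u.1 x| <= B) ->
  integ hl (fun x => `|u.1 x| `^ r) /\ bb r u <= B `^ (r - 2) * n0 u.
Proof.
move=> r2 hu hB; have [_ _ i0 _] := hu.
have le x : hl x -> `|u.1 x| `^ r <= B `^ (r - 2) * u.1 x ^+ 2.
  rewrite halflineE => x0; rewrite pabs_split// ler_wpM2r ?sqr_ge0//.
  by apply: ge0_ler_powR; rewrite ?nnegrE ?hB//; [lra|exact: le_trans (hB x x0)].
have ib : integ hl (fun x => `|u.1 x| `^ r).
  apply: integ_le (integZ (B `^ (r - 2)) mhl i0) => //; first exact: mhl.
    exact: pabs_meas.
  by move=> x hx; rewrite ger0_norm ?powR_ge0// le.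
split=> //; rewrite /bb.
have -> : B `^ (r - 2) * n0 u = \int[mu]_(x in hl) (B `^ (r - 2) * u.1 x ^+ 2).
  have := @int_lin R hl (B `^ (r - 2)) 0 _ _ mhl i0 i0.
  by rewrite mul0r addr0 => <-; apply: int_eq => x _; ring.
apply: int_le => //; [exact: mhl|exact: integZ mhl i0].
Qed.

Lemma bb_integ r u : 2 < r -> H1 u -> integ hl (fun x => `|u.1 x| `^ r).
Proof.
move=> r2 hu; have [M hM] := H1_bounded hu.
by apply: (@bb_le r u M r2 hu _).1 => x _.
Qed.

Lemma bb_scale r u a : 0 < r -> H1 u -> integ hl (fun x => `|u.1 x| `^ r) ->
  bb r (lc a u 0 u) = `|a| `^ r * bb r u.
Proof.
move=> r0 hu ir; rewrite /bb /=.
have <- : \int[mu]_(x in hl) (`|a| `^ r * `|u.1 x| `^ r + 0 * `|u.1 x| `^ r)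
  = `|a| `^ r * \int[mu]_(x in hl) `|u.1 x| `^ r.
  by rewrite int_lin ?mul0r ?addr0//; exact: mhl.
by apply: int_eq => x _; rewrite !mul0r !addr0 normrM powRM.
Qed.

Lemma n0_scale u a : H1 u -> n0 (lc a u 0 u) = a ^+ 2 * n0 u.
Proof.
move=> [_ _ i0 _]; rewrite /n0 /=.
have <- : \int[mu]_(x in hl) (a ^+ 2 * u.1 x ^+ 2 + 0 * u.1 x ^+ 2)
  = a ^+ 2 * \int[mu]_(x in hl) u.1 x ^+ 2.
  by rewrite int_lin ?mul0r ?addr0//; exact: mhl.
by apply: int_eq => x _; ring.
Qed.

Lemma n1_scale u a : H1 u -> n1 (lc a u 0 u) = a ^+ 2 * n1 u.
Proof.
move=> [_ _ _ i1]; rewrite /n1 /=.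
have <- : \int[mu]_(x in hl) (a ^+ 2 * u.2 x ^+ 2 + 0 * u.2 x ^+ 2)
  = a ^+ 2 * \int[mu]_(x in hl) u.2 x ^+ 2.
  by rewrite int_lin ?mul0r ?addr0//; exact: mhl.
by apply: int_eq => x _; ring.
Qed.

(** In [H1_sobolev] only [2 * L * n1 u] remains, and [L] is arbitrary. *)
Lemma n0_eq0 u : H1 u -> n0 u = 0 -> forall x, u.1 x = 0.
Proof.
move=> hu n00 x; have n10 := n1_ge0 u.
have H (L : R) : 0 < L -> u.1 x ^+ 2 <= 2 * L * n1 u.
  by move=> L0; have := H1_sobolev x hu L0; rewrite n00 mulr0 add0r.
suff : u.1 x ^+ 2 <= 0 by rewrite le_eqVlt ltNge sqr_ge0 orbF sqrf_eq0 => /eqP.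
apply/ler_addgt0Pr => e e0; rewrite add0r.
have s0 : 0 < n1 u + 1 by lra.
apply: le_trans (H (e / (2 * (n1 u + 1))) _) _; first by rewrite divr_gt0// mulr_gt0.
have -> : 2 * (e / (2 * (n1 u + 1))) * n1 u = e * (n1 u / (n1 u + 1)).
  by field; rewrite gt_eqF.
by rewrite ler_piMr ?(ltW e0)// ler_pdivrMr//; lra.
Qed.

Lemma H1_small_at_infinity u (T e : R) : H1 u -> 0 < e ->
  exists2 x, T <= x & `|u.1 x| < e.
Proof.
move=> hu e0; apply: contrapT => H; have [_ _ i0 _] := hu.
have {}H x : T <= x -> e ^+ 2 <= u.1 x ^+ 2.
  move=> Tx; rewrite -(real_normK (num_real (u.1 x))) ler_pXn2r ?nnegrE ?(ltW e0)//.
  by rewrite leNgt; apply/negP => xe; apply: H; exists x.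
pose a := Num.max T 0; pose L := (n0 u + 1) / e ^+ 2.
have L0 : 0 <= L by rewrite divr_ge0 ?sqr_ge0// addr_ge0 ?n0_ge0.
have a0 : 0 <= a by rewrite le_max lexx orbT.
have aL : a <= a + L by rewrite lerDl.
have : \int[mu]_(x in `]a, (a + L)]) (e ^+ 2) <= \int[mu]_(x in `]a, (a + L)]) (u.1 x ^+ 2).
  apply: int_le => //; [exact: integ_cst_oc|exact: integ_halfline_oc|].
  move=> x; rewrite /= in_itv/= => /andP[ax _]; apply: H.
  by apply: le_trans (ltW ax); rewrite le_max lexx.
rewrite int_cst_oc// addrAC subrr add0r /L mulrCA mulfV ?mulr1; last first.
  by rewrite expf_neq0// gt_eqF.
have : \int[mu]_(x in `]a, (a + L)]) (u.1 x ^+ 2) <= n0 u; last by lra.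
apply: int_sub_le => //; first exact: mhl.
  by move=> z; rewrite /= in_itv/= halflineE => /andP[/(le_lt_trans a0)].
by move=> x _; exact: sqr_ge0.
Qed.

End Nonlinearity.

(** * Calibration and the constant of the soliton *)

Section SharpConstant.
Context {R : realType}.
Notation mu := (@lebesgue_measure R).
Notation E := ((R -> R) * (R -> R))%type.
Notation hl := (@halfline R).
Implicit Types (u v w : E).
Variables (r om : R).
Hypotheses (r2 : 2 < r) (om0 : 0 < om).

(* For [om]-solitons, [Q'^2 = GG Q]; [stop] is the maximum of [Q]. *)
Definition GG (s : R) := om * s ^+ 2 - 2 / r * `|s| `^ r.
Definition stop : R := (om * r / 2) `^ ((r - 2)^-1).

Lemma stop_gt0 : 0 < stop.
Proof. by rewrite powR_gt0// divr_gt0// mulr_gt0//; (move: r2; lra). Qed.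

Lemma stop_pow : 2 / r * stop `^ (r - 2) = om.
Proof.
rewrite /stop -powRrM mulVf ?gt_eqF ?subr_gt0// powRr1; last first.
  by rewrite divr_ge0// mulr_ge0//; (move: r2 om0; lra).
by field; rewrite gt_eqF//; (move: r2; lra).
Qed.

Lemma GGE (s : R) : GG s = s ^+ 2 * (om - 2 / r * `|s| `^ (r - 2)).
Proof. by rewrite /GG pabs_split//; ring. Qed.

Lemma GG_ge0 (s : R) : `|s| <= stop -> 0 <= GG s.
Proof.
move=> h; rewrite GGE mulr_ge0 ?sqr_ge0// subr_ge0 -{1}stop_pow ler_wpM2l//.
  by rewrite divr_ge0//; (move: r2; lra).
by apply: ge0_ler_powR; rewrite ?nnegrE// ?(ltW stop_gt0)//; (move: r2; lra).
Qed.

Lemma GG_le0 (s : R) : stop <= `|s| -> GG s <= 0.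
Proof.
move=> h; rewrite GGE mulr_ge0_le0 ?sqr_ge0// subr_le0 -{1}stop_pow ler_wpM2l//.
  by rewrite divr_ge0//; (move: r2; lra).
by apply: ge0_ler_powR; rewrite ?nnegrE// ?(ltW stop_gt0)//; (move: r2; lra).
Qed.

Lemma sqrtGG_continuous : continuous (fun s => Num.sqrt (GG s)).
Proof.
move=> s; apply: (@continuous_comp _ _ _ GG); last exact: sqrt_continuous.
apply: cvgB; apply: cvgM; try exact: cvg_cst.
  exact: exprn_continuous.
by apply: pabs_continuous; (move: r2; lra).
Qed.

(** [Num.sqrt] returns 0 on negative numbers, so [sqrt (GG s)] vanishes for [|s| >= stop] and the
    cut-off form of the primitive applies. *)
Lemma exists_HH : exists HH : R -> R, forall x : R, is_derive x 1 HH (Num.sqrt (GG x)).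
Proof.
apply: is_derive_cutoff_primitive stop_gt0 _; first exact: sqrtGG_continuous.
by move=> x xs; rewrite ler0_sqrtr// GG_le0.
Qed.

Definition HH : R -> R := sval (cid exists_HH).

Lemma HH_derive (x : R) : is_derive x 1 HH (Num.sqrt (GG x)).
Proof. exact: (svalP (cid exists_HH)). Qed.

Lemma HH_continuous : continuous HH.
Proof.
move=> x; have d := HH_derive x; apply: differentiable_continuous.
by apply/derivable1_diffP.
Qed.

Lemma HH_le (a b : R) : a <= b -> HH a <= HH b.
Proof.
rewrite le_eqVlt => /predU1P[->//|ab].
have [c _ e] := MVT ab (fun x _ => HH_derive x) (continuous_subspaceT HH_continuous).
by rewrite -subr_ge0 e mulr_ge0 ?sqrtr_ge0// subr_ge0 ltW.
Qed.

(* The level of the soliton on the whole line, i.e. of a minimizing sequence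
   escaping to infinity. *)
Definition KK : R := 4 * (HH stop - HH 0).

(** Completing the square gives [u' ^ 2 + GG u >= 2 * |sqrt (GG u) * u'|], and the right-hand side
    is the derivative of [2 * HH u] up to sign. The plus sign is used up to [x1], the minus sign
    from there to a point where [u] is almost 0: rising to [u x1] and coming back each cost
    [2 * (HH (u x1) - HH 0)]. *)
Lemma calibration u (x1 : R) : H1 u -> u.1 0 = 0 ->
  (forall x, `|u.1 x| <= stop) -> 0 <= x1 ->
  4 * (HH (u.1 x1) - HH 0) <= n1 u + om * n0 u - 2 / r * bb r u.
Proof.
move=> hu u00 us x10; have [ac m2 i0 i1] := hu; have ir := bb_integ r2 hu.
pose phi s := Num.sqrt (GG s).
have acH : AC (HH \o u.1) (fun x => phi (u.1 x) * u.2 x).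
  by apply: AC_comp ac _ _; [exact: HH_derive|exact: sqrtGG_continuous].
pose h x := 1 * u.2 x ^+ 2 + 1 * (om * u.1 x ^+ 2 + (- (2 / r)) * `|u.1 x| `^ r).
have ih : integ hl h by apply: integ_lin => //; [exact: mhl|apply: integ_lin => //; exact: mhl].
have hE x : h x = u.2 x ^+ 2 + phi (u.1 x) ^+ 2.
  by rewrite /h /phi sqr_sqrtr ?GG_ge0// /GG; ring.
have Ih : \int[mu]_(x in hl) h x = n1 u + om * n0 u - 2 / r * bb r u.
  rewrite int_lin//; [|exact: mhl|apply: integ_lin => //; exact: mhl].
  by rewrite int_lin//; [rewrite -/(n1 u) -/(n0 u) -/(bb r u); ring|exact: mhl].
have h0 x : 0 <= h x by rewrite hE addr_ge0 ?sqr_ge0.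
rewrite -Ih; apply/ler_addgt0Pr => e e0.
have [d d0 hd] := cont_eps (HH_continuous (x := 0)) (divr_gt0 e0 (ltr0n _ 2)).
have [T x1T Td] := H1_small_at_infinity x1 hu d0.
have hT : `|HH (u.1 T) - HH 0| < e / 2 by apply: hd; rewrite subr0.
have ihT := integ_halfline_oc T (lexx 0) ih.
have T0 : 0 <= T := le_trans x10 x1T.
have step1 : \int[mu]_(x in `]0, T]) h x <= \int[mu]_(x in hl) h x.
  apply: int_sub_le => //; first exact: mhl.
  by move=> z; rewrite /= in_itv/= halflineE => /andP[].
rewrite (int_oc_cat x10 x1T ihT) in step1.
have ig (a b : R) : 0 <= a -> integ `]a, b] (fun x => phi (u.1 x) * u.2 x).
  by move=> a0; apply: AC_integ acH a0.
have s1 : 2 * (HH (u.1 x1) - HH 0) <= \int[mu]_(x in `]0, x1]) h x.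
  have := AC_diff acH (lexx 0) x10; rewrite /= u00 => ->.
  rewrite -[leLHS]addr0 -[X in _ + X](mul0r (\int[mu]_(x in `]0, x1]) 0)).
  rewrite -int_lin//; [|exact: ig|exact: integ0].
  apply: int_le => //; [|exact: integ_halfline_oc|].
    by apply: integ_lin => //; [exact: ig|exact: integ0].
  by move=> x _; rewrite hE; have := sqr_ge0 (phi (u.1 x) - u.2 x); rewrite !expr2; nra.
have s2 : - 2 * (HH (u.1 T) - HH (u.1 x1)) <= \int[mu]_(x in `]x1, T]) h x.
  have := AC_diff acH x10 x1T; rewrite /= => ->.
  rewrite -[leLHS]addr0 -[X in _ + X](mul0r (\int[mu]_(x in `]x1, T]) 0)).
  rewrite -int_lin//; [|exact: ig|exact: integ0].
  apply: int_le => //; [|exact: integ_halfline_oc|].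
    by apply: integ_lin => //; [exact: ig|exact: integ0].
  by move=> x _; rewrite hE; have := sqr_ge0 (phi (u.1 x) + u.2 x); rewrite !expr2; nra.
move: hT; rewrite ltr_norml => /andP[_ hT].
lra.
Qed.

(** [t] scales the supremum of [|u|] to [stop], the height of the soliton, and [calibration] is
    applied at points [x1] where the supremum is almost reached. The sign of [s] makes [s * u x1]
    nonnegative, since [KK] measures the rise from 0 to [+ stop]. *)
Lemma line_level u : H1 u -> u.1 0 = 0 -> u.1 <> cst 0 ->
  exists2 t : R, 0 < t & KK <= t ^+ 2 * (n1 u + om * n0 u) - 2 / r * t `^ r * bb r u.
Proof.
move=> hu u00 unz; have r0 : 0 < r by move: r2; lra.
have [x0 ux0] : exists x, u.1 x != 0.
  apply: contrapT => H; apply: unz; apply/funext => x; apply/eqP.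
  by apply: contrapT => /negP ux; apply: H; exists x.
have [M hM] := H1_bounded hu; pose A := range (fun x => `|u.1 x|).
have hA : has_sup A.
  by split; [exists `|u.1 x0|; exists x0|exists M => _ [x _ <-]].
pose S := sup A; have AS x : `|u.1 x| <= S.
  by apply: ub_le_sup; [exact: hA.2|exists x].
have S0 : 0 < S by apply: lt_le_trans (AS x0); rewrite normr_gt0.
have stop0 := stop_gt0.
pose t := stop / S; have t0 : 0 < t by rewrite divr_gt0.
have tS : t * S = stop by rewrite /t mulfVK ?gt_eqF.
exists t => //.
have key s (x1 : R) : `|s| = t -> 4 * (HH (s * u.1 x1) - HH 0) <=
    t ^+ 2 * (n1 u + om * n0 u) - 2 / r * t `^ r * bb r u.
  move=> st; wlog x10 : x1 / 0 <= x1 => [H|].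
    have [x10|/ltW x10] := leP 0 x1; first exact: H.
    by case: hu => ac _ _ _; rewrite (AC_neg ac x10) H.
  have h := H1_lc s 0 hu hu.
  have := @calibration (lc s u 0 u) x1 h _ _ x10.
  rewrite /= mul0r addr0 n0_scale// n1_scale// bb_scale//; last exact: bb_integ.
  rewrite mul0r addr0 -(real_normK (num_real s)) st u00 mulr0 => /(_ erefl) H.
  apply: le_trans (H _) _.
    by move=> x; rewrite mul0r addr0 normrM st -tS ler_pM2l.
  by rewrite le_eqVlt; apply/orP; left; apply/eqP; ring.
apply/ler_addgt0Pr => e e0.
have e40 : 0 < e / 4 by rewrite divr_gt0.
have [d d0 hd] := cont_eps (HH_continuous (x := stop)) e40.
have [_ [x1 _ <-] x1S] := sup_adherent (divr_gt0 d0 t0) hA.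
pose s := if 0 <= u.1 x1 then t else - t.
have st : `|s| = t by rewrite /s; case: ifP => _; rewrite ?normrN gtr0_norm.
have su : s * u.1 x1 = t * `|u.1 x1|.
  rewrite /s; case: ifPn => [h|]; first by rewrite ger0_norm.
  by rewrite -ltNge => /ltr0_norm ->; rewrite mulrN mulNr.
have := key s x1 st; rewrite su.
have : `|HH (t * `|u.1 x1|) - HH stop| < e / 4.
  apply: hd; rewrite distrC ger0_norm ?subr_ge0; last first.
    by rewrite -tS ler_pM2l.
  rewrite -tS -mulrBr mulrC -ltr_pdivlMr//; move: x1S; rewrite -/S; lra.
rewrite ltr_norml /KK; lra.
Qed.

(* [mline] is the common value of the energy and of the nonlinear term on the soliton. *)
Definition mline : R := KK * r / (r - 2).

Lemma KK_ge0 : 0 <= KK.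
Proof. by rewrite mulr_ge0// subr_ge0 HH_le// ltW ?stop_gt0. Qed.

Lemma mline_ge0 : 0 <= mline.
Proof. by apply: divr_ge0; [apply: mulr_ge0; first exact: KK_ge0|]; move: r2; lra. Qed.

(** As a function of [t ^+ 2] the bound on [KK] is concave, with its maximum at [y0], where
    [y0 ^ (e - 1) = A / B] for [e = r / 2]. [bernoulli] at [y0] bounds it by the maximal value
    [(1 - 1 / e) * A * y0], so [mline <= A * y0], and the power [e - 1] of this inequality is free
    of [t]. *)
Lemma level_to_ratio (A B t : R) : 0 < A -> 0 <= B -> 0 < t ->
  KK <= t ^+ 2 * A - 2 / r * t `^ r * B ->
  mline `^ (r / 2 - 1) * B <= A `^ (r / 2).
Proof.
move=> A0 B0 t0 hK; pose e := r / 2; have e1 : 1 < e by rewrite /e; (move: r2; lra).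
have e0 : 0 < e by lra.
have r0 : 0 < r by move: r2; lra.
have [->|Bn0] := eqVneq B 0; first by rewrite mulr0 powR_ge0.
have Bp : 0 < B by rewrite lt_neqAle eq_sym Bn0.
have AB : 0 < A / B by rewrite divr_gt0.
pose y0 := (A / B) `^ ((e - 1)^-1); have y00 : 0 < y0 by rewrite powR_gt0.
have y0e : y0 `^ (e - 1) = A / B.
  by rewrite /y0 -powRrM mulVf ?gt_eqF ?subr_gt0// powRr1// ltW.
have y0e' : y0 `^ e = y0 * (A / B) by rewrite -y0e mulr_powRB1// ltW.
have tr : t `^ r = (t ^+ 2) `^ e.
  by rewrite -powR_square ?ltW// -powRrM /e; congr (_ `^ _); field.
have bern := bernoulli e1 (sqr_ge0 t) (ltW y00).
rewrite y0e y0e' -tr in bern.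
have le1 : KK <= (1 - e^-1) * (A * y0).
  apply: le_trans hK _.
  have Be : 0 <= B / e by rewrite divr_ge0// ltW.
  have := ler_wpM2l Be bern.
  have -> : B / e * (y0 * (A / B) + e * (A / B) * (t ^+ 2 - y0)) =
     y0 * A / e + A * (t ^+ 2 - y0) by field; rewrite !gt_eqF.
  have -> : 2 / r * t `^ r * B = B / e * t `^ r by rewrite /e; field; rewrite !gt_eqF.
  lra.
have my0 : mline <= A * y0.
  have -> : mline = KK / (1 - e^-1).
    by rewrite /mline /e; field; rewrite !gt_eqF//; (move: r2; lra).
  rewrite ler_pdivrMr; first by rewrite mulrC.
  by rewrite subr_gt0 invf_lt1.
have : mline `^ (e - 1) <= (A * y0) `^ (e - 1).
  apply: ge0_ler_powR => //; rewrite ?nnegrE ?mline_ge0 ?mulr_ge0 ?ltW//; lra.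
rewrite powRM ?(ltW A0) ?(ltW y00)// y0e => /(ler_wpM2r B0) /le_trans; apply.
by rewrite -(mulr_powRB1 (ltW A0) e0) le_eqVlt; apply/orP; left; apply/eqP; field; rewrite gt_eqF.
Qed.

(** A function that vanishes at the vertex extends by 0 to the whole line, which is why the constant
    is that of the soliton. *)
Lemma line_inequality u : H1 u -> u.1 0 = 0 ->
  mline `^ (r / 2 - 1) * bb r u <= (n1 u + om * n0 u) `^ (r / 2).
Proof.
move=> hu u00; have r0 : 0 < r by move: r2; lra.
have [u1z|u1nz] := pselect (u.1 = cst 0).
  rewrite (_ : bb r u = 0) ?mulr0 ?powR_ge0//; apply: int_zero => x _.
  by rewrite u1z normr0 powR0// gt_eqF.
have [t t0 hK] := line_level hu u00 u1nz.
apply: level_to_ratio t0 hK; last exact: bb_ge0.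
have n00 : 0 < n0 u.
  rewrite lt_neqAle n0_ge0 andbT; apply/eqP => /esym n00; apply: u1nz.
  by apply/funext => x; rewrite (n0_eq0 hu n00).
by rewrite ltr_wpDl ?n1_ge0// mulr_gt0.
Qed.

End SharpConstant.

(** * Fatou's lemma and tails of integrals *)

Section Limits.
Context {R : realType}.
Notation mu := (@lebesgue_measure R).
Notation hl := (@halfline R).
Implicit Types (f g h k : R -> R) (D : set R).

Lemma int_EFin D h : measurable D -> integ D h ->
  (\int[mu]_(x in D) (h x)%:E)%E = (\int[mu]_(x in D) h x)%:E.
Proof.
move=> mD ih; rewrite /Rintegral fineK//.
exact (integrable_fin_num (measurableR_cast mD) ih).
Qed.

Lemma integ_ge0_lty D h : measurable D -> measurable_fun D h ->
  (forall x, D x -> 0 <= h x) -> (\int[mu]_(x in D) (h x)%:E < +oo)%E ->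
  integ D h.
Proof.
move=> mD mh h0 hlt; apply/integrableP; split; first exact/measurable_EFinP.
apply: le_lt_trans hlt; rewrite le_eqVlt; apply/orP; left; apply/eqP.
by apply: eq_integral => x /set_mem Dx /=; rewrite ger0_norm// h0.
Qed.

Lemma cvg_ge_cst (u : nat -> R) (l M : R) :
  u n @[n --> \oo] --> l -> (forall n, M <= u n) -> M <= l.
Proof.
by move=> ul uM; apply: (ler_cvg_to (cvg_cst M) ul); apply: nearW.
Qed.

Lemma cvg_le_cst (u : nat -> R) (l M : R) :
  u n @[n --> \oo] --> l -> (forall n, u n <= M) -> l <= M.
Proof.
by move=> ul uM; apply: (ler_cvg_to ul (cvg_cst M)); apply: nearW.
Qed.

Lemma fatou_real D (h_ : nat -> R -> R) h (M : R) : measurable D ->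
  (forall n, integ D (h_ n)) -> (forall n x, D x -> 0 <= h_ n x) ->
  measurable_fun D h ->
  (forall x, D x -> h_ n x @[n --> \oo] --> h x) ->
  (forall n, \int[mu]_(x in D) h_ n x <= M) ->
  integ D h /\ \int[mu]_(x in D) h x <= M.
Proof.
move=> mD ih h0 mh ch hM.
have hx0 x : D x -> 0 <= h x.
  by move=> Dx; apply: (cvg_ge_cst (ch x Dx)) => n; exact: h0.
have mD' := measurableR_cast mD.
have H : (\int[mu]_(x in D) limn_einf (fun n => (h_ n x)%:E) <=
    limn_einf (fun n => \int[mu]_(x in D) (h_ n x)%:E))%E.
  apply: (fatou mu mD') => [n|n x Dx]; last by rewrite lee_fin h0.
  by apply/measurable_EFinP; exact: integ_meas (ih n).
have e1 : (\int[mu]_(x in D) limn_einf (fun n => (h_ n x)%:E) =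
           \int[mu]_(x in D) (h x)%:E)%E.
  apply: eq_integral => x /set_mem Dx.
  have c : (h_ n x)%:E @[n --> \oo] --> (h x)%:E.
    by apply: cvg_EFin; [exact: nearW|exact: ch].
  rewrite is_cvg_limn_einfE; first exact/cvg_lim.
  by apply/cvg_ex; eexists; exact: c.
have le : (\int[mu]_(x in D) (h x)%:E <= M%:E)%E.
  rewrite -e1; apply: le_trans H _; rewrite limn_einf_lim.
  apply: lime_le; first exact: is_cvg_einfs.
  apply: nearW => n; apply: le_trans (_ : _ <= \int[mu]_(x in D) (h_ n x)%:E)%E _.
    by apply: ereal_inf_lbound; exists n => /=.
  by rewrite int_EFin// lee_fin.
have ih' : integ D h by apply: integ_ge0_lty => //; exact: le_lt_trans le (ltry _).
by split=> //; rewrite -lee_fin -int_EFin.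
Qed.

Lemma integ_sup h (a M : R) : measurable_fun `]a, +oo[ h ->
  (forall x, a < x -> 0 <= h x) ->
  (forall T, a <= T -> integ `]a, T] h /\ \int[mu]_(x in `]a, T]) h x <= M) ->
  integ `]a, +oo[ h /\ \int[mu]_(x in `]a, +oo[) h x <= M.
Proof.
move=> mh h0 hT; pose I n := `]a, a + n%:R]%classic.
pose h_ n := h \_ (I n).
have sub n : I n `<=` `]a, +oo[%classic.
  by move=> x; rewrite /I /= !in_itv/= andbT => /andP[].
have aI n : a <= a + n%:R by rewrite lerDl.
apply: (@fatou_real _ h_) => //.
- move=> n; have := (hT _ (aI n)).1; rewrite /integ.
  rewrite -[X in mu.-integrable X _](setIidr (@sub n)).
  move=> /(integrable_restrict _ _); rewrite restrict_EFin; apply; exact: measurable_itv.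
- move=> n x; rewrite /= in_itv/= andbT => ax; rewrite /h_ patchE.
  by case: ifP => // _; exact: h0.
- move=> x; rewrite /= in_itv/= andbT => ax; apply: cvg_near_cst.
  near=> n; rewrite /h_ patchE mem_set// /I /= in_itv/= ax/=.
  rewrite -lerBlDl; near: n; exact: nbhs_infty_ger.
- move=> n; rewrite /h_ -Rintegral_mkcondr (_ : _ `&` _ = I n).
    exact: (hT _ (aI n)).2.
  exact: setIidr.
Unshelve. all: by end_near. Qed.

(** Otherwise every tail exceeds [e], each integral over []a, T]] is at most [I - e], and so is [I]
    itself. *)
Lemma tail_small h (a e : R) : integ `]a, +oo[ h -> 0 < e ->
  exists2 T, a <= T & forall T', T <= T' -> \int[mu]_(x in `]T', +oo[) `|h x| <= e.
Proof.
move=> ih e0; apply: contrapT => H.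
have iah := integ_abs ih.
pose I := \int[mu]_(x in `]a, +oo[) `|h x|.
have : integ `]a, +oo[ (fun x => `|h x|) /\
    \int[mu]_(x in `]a, +oo[) `|h x| <= I - e.
  apply: integ_sup => //; first exact: integ_meas.
  move=> T aT; split.
    by apply: integ_sub iah => // x /=; rewrite !in_itv/= andbT => /andP[].
  rewrite leNgt; apply/negP => IT; apply: H; exists T => // T' TT'.
  have aT' := le_trans aT TT'.
  have : I = \int[mu]_(x in `]a, T]) `|h x| + \int[mu]_(x in `]T, +oo[) `|h x|.
    exact: int_oy_cat.
  have : \int[mu]_(x in `]T', +oo[) `|h x| <= \int[mu]_(x in `]T, +oo[) `|h x|.
    apply: int_sub_le => //.
      by move=> x; rewrite /= !in_itv/= !andbT; exact: le_lt_trans.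
    by apply: integ_sub iah => // x; rewrite /= !in_itv/= !andbT; exact: le_lt_trans.
  lra.
by move=> [_]; rewrite -/I; lra.
Qed.

End Limits.

(** * Gluing two functions at a point *)

Section Glue.
Context {R : realType}.
Notation mu := (@lebesgue_measure R).
Notation E := ((R -> R) * (R -> R))%type.
Notation hl := (@halfline R).
Implicit Types (u v w : E).

Definition glue (s : R) u v : E :=
  (fun x => if x <= s then u.1 x else v.1 x,
   fun x => if x <= s then u.2 x else v.2 x).

Lemma int_split (s : R) (h : R -> R) : 0 <= s -> integ hl h ->
  \int[mu]_(x in hl) h x =
  \int[mu]_(x in `]0, s]) h x + \int[mu]_(x in `]s, +oo[) h x.
Proof. exact: int_oy_cat. Qed.

Lemma integ_setU (D F : set R) (h : R -> R) : measurable D -> measurable F ->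
  [disjoint D & F] -> integ D h -> integ F h -> integ (D `|` F) h.
Proof.
move=> mD mF DF iD iF.
have mh : measurable_fun (D `|` F) h.
  by apply/measurable_funU => //; split; exact: integ_meas.
apply/integrableP; split; first exact/measurable_EFinP.
rewrite ge0_integral_setU//=; last first.
  by apply/measurable_EFinP; apply: measurableT_comp.
by apply: lte_add_pinfty; [case/integrableP: iD|case/integrableP: iF].
Qed.

Lemma disj_oc_oc (a b c : R) : [disjoint `]a, b]%classic & `]b, c]%classic].
Proof.
apply/disj_set2P/seteqP; split=> x //= [].
by rewrite !in_itv/= => /andP[_ xb] /andP[/(le_lt_trans xb)]; rewrite ltxx.
Qed.

Lemma disj_oc_oy (a b : R) : [disjoint `]a, b]%classic & `]b, +oo[%classic].
Proof.
apply/disj_set2P/seteqP; split=> x //= [].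
by rewrite !in_itv/= andbT => /andP[_ xb] /(le_lt_trans xb); rewrite ltxx.
Qed.

Lemma integ_split (s : R) (h : R -> R) : 0 <= s -> integ `]0, s] h ->
  integ `]s, +oo[ h -> integ hl h.
Proof.
move=> s0; rewrite /halfline (itv_oy_cat s0) => i1 i2.
by apply: integ_setU => //; exact: disj_oc_oy.
Qed.

Lemma if_le_left (s x : R) (T : Type) (a b : T) :
  `]0, s]%classic x -> (if x <= s then a else b) = a.
Proof. by rewrite /= in_itv/= => /andP[_ ->]. Qed.

Lemma if_le_right (s x : R) (T : Type) (a b : T) (B : itv_bound R) :
  [set` Interval (BRight s) B] x -> (if x <= s then a else b) = b.
Proof. by rewrite /= in_itv/= => /andP[sx _]; rewrite leNgt sx. Qed.

Lemma integ_glue (s : R) (h k : R -> R) : 0 <= s -> integ `]0, s] h ->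
  integ `]s, +oo[ k -> integ hl (fun x => if x <= s then h x else k x).
Proof.
move=> s0 i1 i2; apply: (integ_split s0).
  by apply: integ_eq i1 => // x xs; rewrite if_le_left.
by apply: integ_eq i2 => // x xs; rewrite (if_le_right _ _ xs).
Qed.

Lemma int_glue (s : R) (h k : R -> R) : 0 <= s -> integ `]0, s] h ->
  integ `]s, +oo[ k ->
  \int[mu]_(x in hl) (if x <= s then h x else k x) =
  \int[mu]_(x in `]0, s]) h x + \int[mu]_(x in `]s, +oo[) k x.
Proof.
move=> s0 i1 i2; rewrite (int_split s0); last exact: integ_glue.
congr (_ + _).
  by apply: int_eq => x xs; rewrite if_le_left.
by apply: int_eq => x xs; rewrite (if_le_right _ _ xs).
Qed.

Lemma AC_glue (s : R) u v : 0 <= s -> AC u.1 u.2 -> AC v.1 v.2 ->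
  u.1 s = v.1 s -> AC (glue s u v).1 (glue s u v).2.
Proof.
move=> s0 acu acv uv; pose g := (glue s u v).2.
have i1 T : T <= s -> integ `]0, T] g.
  move=> Ts; apply: integ_eq (acu.1 T) => // x; rewrite /= in_itv/= => /andP[_ xT].
  by rewrite /g /= (le_trans xT Ts).
have i2 T : integ `]s, T] g.
  apply: integ_eq (AC_integ T acv s0) => // x xs.
  by rewrite /g /= (if_le_right _ _ xs).
have iT T : integ `]0, T] g.
  have [Ts|/ltW sT] := leP T s; first exact: i1.
  rewrite (itv_oc_cat s0 sT); apply: integ_setU => //; first exact: disj_oc_oc.
  exact: i1.
split=> [T|T]; first exact: iT.
have left (x : R) : x <= s -> u.1 x = u.1 0 + \int[mu]_(t in `]0, x]) g t.
  move=> xs; rewrite {1}(acu.2 x); congr (_ + _); apply: int_eq => t.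
  by rewrite /= in_itv/= => /andP[_ tx]; rewrite /g /= (le_trans tx xs).
rewrite /= s0; case: (leP T s) => Ts; first exact: left.
rewrite (int_oc_cat s0 (ltW Ts) (iT T)) addrA -left// uv.
rewrite (_ : \int[mu]_(t in `]s, T]) g t = \int[mu]_(t in `]s, T]) v.2 t).
  by rewrite -(AC_diff acv s0 (ltW Ts)); ring.
by apply: int_eq => t ts; rewrite /g /= (if_le_right _ _ ts).
Qed.

Lemma glue_meas (s : R) (f g : R -> R) D : measurable D -> measurable_fun D f ->
  measurable_fun D g -> measurable_fun D (fun x => if x <= s then f x else g x).
Proof.
move=> mD mf mg; apply: measurable_fun_if => //.
- have : measurable_fun D (fun x : R => x <= s); last by [].
  by apply: measurable_fun_ler => //; exact: measurable_id.
- by apply: measurable_funS mf => //; exact: subIsetl.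
- by apply: measurable_funS mg => //; exact: subIsetl.
Qed.

(* The left piece only matters on [0, s], and need not be in H^1. *)
Lemma H1_glue (s : R) u v : 0 <= s -> AC u.1 u.2 -> measurable_fun setT u.2 ->
  integ `]0, s] (fun x => u.2 x ^+ 2) -> H1 v -> u.1 s = v.1 s ->
  H1 (glue s u v).
Proof.
move=> s0 acu mu2 iu2 hv uv; have [acv mv2 i0 i1] := hv; split.
- exact: AC_glue.
- exact: glue_meas.
- rewrite (_ : (fun x => _) = fun x => if x <= s then u.1 x ^+ 2 else v.1 x ^+ 2).
    have [M hM] := cont_bounded 0 s (AC_continuous acu).
    apply: integ_glue => //; last first.
      by apply: integ_sub i0 => //; [exact: mhl|move=> x; rewrite /= in_itv/= andbT halflineE; exact: le_lt_trans].
    apply: integ_le (integ_cst_oc 0 s (M ^+ 2)) => //.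
      apply: measurable_funX; apply: measurable_funTS; apply: continuous_measurable_fun.
      exact: AC_continuous acu.
    move=> x; rewrite /= in_itv/= => /andP[x0 xs]; rewrite normrX.
    by rewrite lerXn2r ?nnegrE ?(le_trans _ (hM x _)) ?hM// ltW.
  by apply/funext => x /=; case: ifP.
- rewrite (_ : (fun x => _) = fun x => if x <= s then u.2 x ^+ 2 else v.2 x ^+ 2).
    apply: integ_glue => //.
    by apply: integ_sub i1 => //; [exact: mhl|move=> x; rewrite /= in_itv/= andbT halflineE; exact: le_lt_trans].
  by apply/funext => x /=; case: ifP.
Qed.

Lemma H1_zero : H1 ((fun=> 0 : R), (fun=> 0 : R)).
Proof.
have i : integ hl (fun=> (0 : R) ^+ 2) by rewrite expr0n; exact: integ0.
split => //=; first exact: AC_cst.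
Qed.

End Glue.

(** * Rules of differentiation *)

Section PointwiseDerivatives.
Context {R : realType}.
Implicit Types (f g : R -> R) (x a b : R).

Lemma dEq f x a b : is_derive x 1 f a -> a = b -> is_derive x 1 f b.
Proof. by move=> ? <-. Qed.

Lemma dMul f g x a b : is_derive x 1 f a -> is_derive x 1 g b ->
  is_derive x 1 (fun t => f t * g t) (a * g x + f x * b).
Proof.
move=> d1 d2; have d : is_derive x 1 (f * g) (f x *: b + g x *: a) by exact: is_deriveM.
apply: (dEq (f := f * g)) d _.
by rewrite /GRing.scale/= addrC; congr (_ + _); rewrite mulrC.
Qed.

Lemma dAdd f g x a b : is_derive x 1 f a -> is_derive x 1 g b ->
  is_derive x 1 (fun t => f t + g t) (a + b).
Proof. by move=> d1 d2; have : is_derive x 1 (f + g) (a + b) by exact: is_deriveD. Qed.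

Lemma dScale f x c a : is_derive x 1 f a -> is_derive x 1 (fun t => c * f t) (c * a).
Proof.
move=> d; apply: dEq (dMul (is_derive_cst c x 1) d) _.
by rewrite mul0r add0r.
Qed.

Lemma dComp f g x a b : is_derive (g x) 1 f a -> is_derive x 1 g b ->
  is_derive x 1 (fun t => f (g t)) (a * b).
Proof. by move=> d1 d2; apply: dEq (is_derive1_comp d1 d2) _; rewrite mulrC. Qed.

Lemma dInv f x a : f x != 0 -> is_derive x 1 f a ->
  is_derive x 1 (fun t => (f t)^-1) (- (f x) ^- 2 * a).
Proof. by move=> f0 d; exact: is_deriveV. Qed.

Lemma dShift f x c a : is_derive (x + c) 1 f a -> is_derive x 1 (fun t => f (t + c)) a.
Proof.
move=> d; apply: dEq (dComp (g := fun t => t + c) d (dAdd (is_derive_id x 1) (is_derive_cst c x 1))) _.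
by rewrite addr0 mulr1.
Qed.

End PointwiseDerivatives.

(** * The explicit soliton *)

Section Soliton.
Context {R : realType}.
Notation mu := (@lebesgue_measure R).
Notation E := ((R -> R) * (R -> R))%type.
Notation hl := (@halfline R).
Implicit Types (t x y : R).
Variables (r om : R).
Hypotheses (r2 : 2 < r) (om0 : 0 < om).
Let kap : R := Num.sqrt om.
Let m : R := 2 / (r - 2).
Let bet : R := kap * (r - 2) / 2.

Lemma kap_gt0 : 0 < kap. Proof. by rewrite sqrtr_gt0. Qed.
Lemma kap_sq : kap ^+ 2 = om. Proof. by rewrite sqr_sqrtr// ltW. Qed.
Lemma r2_gt0 : 0 < r - 2. Proof. by rewrite subr_gt0. Qed.
Lemma mpos : 0 < m. Proof. by rewrite divr_gt0 ?r2_gt0. Qed.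
Lemma bet_gt0 : 0 < bet.
Proof. by rewrite divr_gt0// mulr_gt0 ?kap_gt0 ?r2_gt0. Qed.
Lemma mbet : m * bet = kap.
Proof. by rewrite /m /bet; field; rewrite gt_eqF ?r2_gt0. Qed.

Definition ch t : R := (expR t + expR (- t)) / 2.
Definition sh t : R := (expR t - expR (- t)) / 2.

Lemma ch_gt0 t : 0 < ch t.
Proof. by rewrite divr_gt0// addr_gt0 ?expR_gt0. Qed.

Lemma ch_sh t : ch t ^+ 2 = 1 + sh t ^+ 2.
Proof.
have h : expR t * expR (- t) = 1 by rewrite -expRD subrr expR0.
rewrite /ch /sh !expr_div_n.
have -> : (expR t + expR (- t)) ^+ 2 = (expR t - expR (- t)) ^+ 2 + 4 * (expR t * expR (- t)).
  by ring.
by rewrite h; field.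
Qed.

Lemma ch_ge1 t : 1 <= ch t.
Proof.
rewrite -(@ler_pXn2r _ 2) ?nnegrE//; last exact: ltW (ch_gt0 t).
by rewrite expr1n ch_sh lerDl sqr_ge0.
Qed.

Lemma is_derive_expRN x : is_derive x 1 (fun t => expR (- t)) (- expR (- x)).
Proof.
have d : is_derive x 1 (fun t : R => - t) (-1).
  by have : is_derive x 1 (- @id R) (- 1) by exact: is_deriveN.
by apply: dEq (dComp (is_derive_expR (- x)) d) _; rewrite mulrN1.
Qed.

Lemma ch_derive x : is_derive x 1 ch (sh x).
Proof.
have -> : ch = fun t => 2^-1 * (expR t + expR (- t)) by apply/funext => t; rewrite mulrC.
apply: dEq (dScale 2^-1 (dAdd (is_derive_expR x) (is_derive_expRN x))) _.
by rewrite mulrC.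
Qed.

Lemma sh_derive x : is_derive x 1 sh (ch x).
Proof.
have d := dScale (-1) (is_derive_expRN x).
have -> : sh = fun t => 2^-1 * (expR t + -1 * expR (- t)).
  by apply/funext => t; rewrite mulN1r mulrC.
apply: dEq (dScale 2^-1 (dAdd (is_derive_expR x) d)) _.
by rewrite mulN1r opprK mulrC.
Qed.

Lemma is_derive_comp_scale (f : R -> R) (df a : R) x : is_derive (a * x) 1 f df ->
  is_derive x 1 (fun t => f (a * t)) (a * df).
Proof.
move=> d; apply: dEq (dComp d (dScale a (is_derive_id x 1))) _.
by rewrite mulr1 mulrC.
Qed.

Definition lc_ t : R := ln (ch (bet * t)).
Definition th t : R := sh (bet * t) / ch (bet * t).
(** The soliton [stop * ch (bet * t) ^ (- m)], a power of the hyperbolic secant centered at 0. The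
    power is written as an exponential; [lc_] is log cosh and [th] is tanh, both at [bet * t]. *)
Definition q t : R := stop r om * expR (- m * lc_ t).
Definition p t : R := - kap * th t * q t.

Lemma lc_derive x : is_derive x 1 lc_ (bet * th x).
Proof.
have d := is_derive_comp_scale (ch_derive (bet * x)).
apply: dEq (dComp (g := fun t => ch (bet * t)) (is_derive1_ln (ch_gt0 (bet * x))) d) _.
by rewrite /th; field; rewrite gt_eqF ?ch_gt0.
Qed.

Lemma q_derive x : is_derive x 1 q (p x).
Proof.
have d1 := dScale (- m) (lc_derive x).
apply: dEq (dScale (stop r om) (dComp (g := fun t => - m * lc_ t) (is_derive_expR _) d1)) _.
by rewrite /p /q -mbet; ring.
Qed.

Lemma q_gt0 t : 0 < q t.
Proof. by rewrite mulr_gt0 ?expR_gt0// stop_gt0. Qed.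

Lemma q_le_stop t : q t <= stop r om.
Proof.
rewrite /q ler_piMr ?(ltW (stop_gt0 r2 om0))// -expR0 ler_expR.
by rewrite mulNr oppr_le0 mulr_ge0 ?(ltW mpos)// ln_ge0 ?ch_ge1.
Qed.

Lemma q0 : q 0 = stop r om.
Proof.
by rewrite /q /lc_ mulr0 /ch oppr0 expR0 divff ?ln1 ?mulr0 ?expR0 ?mulr1.
Qed.

Lemma q_pow t : q t `^ (r - 2) = om * r / 2 * (ch (bet * t)) ^- 2.
Proof.
rewrite /q powRM ?expR_ge0 ?(ltW (stop_gt0 r2 om0))//; congr (_ * _).
  have := stop_pow r2 om0 => h; rewrite -[in RHS]h; field.
  by rewrite gt_eqF//; move: r2; lra.
rewrite /powR gt_eqF ?expR_gt0// expRK.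
have -> : (r - 2) * (- m * lc_ t) = - (lc_ t *+ 2).
  by rewrite /m mulr2n; field; rewrite gt_eqF ?r2_gt0.
by rewrite expRN mulr2n expRD lnK ?posrE ?ch_gt0.
Qed.

Lemma th_sq t : th t ^+ 2 = 1 - (ch (bet * t)) ^- 2.
Proof.
rewrite /th expr_div_n -[RHS](mulfK (_ : ch (bet * t) ^+ 2 != 0)); last first.
  by rewrite expf_neq0// gt_eqF ?ch_gt0.
congr (_ / _); rewrite mulrBl mul1r mulVf; last by rewrite expf_neq0// gt_eqF ?ch_gt0.
by rewrite ch_sh; ring.
Qed.

Lemma th_derive x : is_derive x 1 th (bet * (ch (bet * x)) ^- 2).
Proof.
have d1 := is_derive_comp_scale (sh_derive (bet * x)).
have d2 := is_derive_comp_scale (ch_derive (bet * x)).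
have c0 : ch (bet * x) != 0 by rewrite gt_eqF ?ch_gt0.
apply: dEq (dMul d1 (dInv (f := fun t => ch (bet * t)) c0 d2)) _.
have e : sh (bet * x) ^+ 2 = ch (bet * x) ^+ 2 - 1 by rewrite ch_sh; ring.
transitivity (bet * (1 - sh (bet * x) ^+ 2 * ch (bet * x) ^- 2)); first by field.
by rewrite e; field.
Qed.

Lemma p_sq t : p t ^+ 2 = GG r om (q t).
Proof.
rewrite GGE// (gtr0_norm (q_gt0 t)) q_pow /p.
have -> : (- kap * th t * q t) ^+ 2 = kap ^+ 2 * th t ^+ 2 * q t ^+ 2 by ring.
rewrite kap_sq th_sq.
by field; rewrite ?gt_eqF ?ch_gt0//; move: r2; lra.
Qed.

Lemma p_derive x : is_derive x 1 p (om * q x - q x * q x `^ (r - 2)).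
Proof.
apply: dEq (dMul (dScale (- kap) (th_derive x)) (q_derive x)) _.
rewrite q_pow /p.
have -> : - kap * th x * (- kap * th x * q x) = kap ^+ 2 * th x ^+ 2 * q x by ring.
have -> : - kap * (bet * ch (bet * x) ^- 2) * q x =
   - (kap ^+ 2 * ((r - 2) / 2)) * q x * ch (bet * x) ^- 2.
  by rewrite /bet; field; rewrite gt_eqF ?ch_gt0.
by rewrite th_sq kap_sq; field; rewrite gt_eqF ?ch_gt0.
Qed.

Lemma sh_ge0 t : 0 <= t -> 0 <= sh t.
Proof. by move=> t0; rewrite divr_ge0// subr_ge0 ler_expR; lra. Qed.

Lemma sh_le0 t : t <= 0 -> sh t <= 0.
Proof.
by move=> t0; rewrite /sh pmulr_lle0 ?invr_gt0// subr_le0 ler_expR; lra.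
Qed.

Lemma p_ge0 t : t <= 0 -> 0 <= p t.
Proof.
move=> t0; rewrite mulr_ge0 ?(ltW (q_gt0 t))// mulNr oppr_ge0 pmulr_rle0 ?kap_gt0//.
rewrite pmulr_lle0 ?invr_gt0 ?ch_gt0// sh_le0// pmulr_rle0 ?bet_gt0//.
Qed.

Lemma p_le0 t : 0 <= t -> p t <= 0.
Proof.
move=> t0; rewrite pmulr_lle0 ?q_gt0// mulNr oppr_le0 pmulr_rge0 ?kap_gt0//.
by rewrite divr_ge0 ?(ltW (ch_gt0 _))// sh_ge0// mulr_ge0 ?(ltW bet_gt0).
Qed.

Lemma pE t : t <= 0 -> p t = Num.sqrt (GG r om (q t)).
Proof. by move=> t0; rewrite -p_sq sqrtr_sqr ger0_norm ?p_ge0. Qed.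

Lemma pNE t : 0 <= t -> p t = - Num.sqrt (GG r om (q t)).
Proof. by move=> t0; rewrite -p_sq sqrtr_sqr ler0_norm ?p_le0 ?opprK. Qed.

Lemma q_small (e : R) : 0 < e -> exists2 t, t <= 0 & q t < e.
Proof.
move=> e0; pose a := ln (stop r om / e) / m.
(* As [bet * N = 2 * expR a], the bound [1 + x <= expR x] gives [ch (bet * N) > expR a], and [a] is
   such that [stop * expR (- m * a) = e]. *)
pose N := 2 * expR a / bet; exists (- N).
  by rewrite oppr_le0 divr_ge0 ?(ltW bet_gt0)// mulr_ge0 ?expR_ge0.
have c1 : expR a < ch (bet * (- N)).
  have : 1 + bet * N <= expR (bet * N) by exact: expR_ge1Dx.
  have -> : bet * N = 2 * expR a by rewrite /N mulrCA mulfV ?mulr1// gt_eqF ?bet_gt0.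
  rewrite mulrN /N mulrCA mulfV ?gt_eqF ?bet_gt0// mulr1 /ch opprK => h.
  by rewrite ltr_pdivlMr// mulrC; have := expR_gt0 (- (2 * expR a)); lra.
have s0 := stop_gt0 r2 om0.
have -> : e = stop r om * (stop r om / e)^-1 by field; rewrite !gt_eqF.
rewrite /q ltr_pM2l// -[X in X^-1](lnK (x := stop r om / e)) ?posrE ?divr_gt0// -expRN ltr_expR.
have -> : ln (stop r om / e) = m * a by rewrite /a [RHS]mulrC mulfVK ?gt_eqF ?mpos.
rewrite mulNr ltrN2 ltr_pM2l ?mpos// -[a]expRK.
by rewrite ltr_ln ?posrE ?expR_gt0 ?ch_gt0.
Qed.

End Soliton.

(** * A competitor below the soliton level *)

Section LinearGain.
Context {R : realType}.
Notation mu := (@lebesgue_measure R).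
Notation E := ((R -> R) * (R -> R))%type.
Notation hl := (@halfline R).
Implicit Types (u v w : E) (W : R -> R).

Lemma FTC_oc (f f' : R -> R) (a b : R) : (forall x : R, is_derive x 1 f (f' x)) ->
  continuous f' -> 0 <= a -> a <= b ->
  integ `]a, b] f' /\ \int[mu]_(x in `]a, b]) f' x = f b - f a.
Proof.
move=> df cf a0 ab; have ac := AC_C1 df cf; split; first exact: AC_integ ac a0.
by rewrite -(AC_diff ac a0 ab) !max_l// (le_trans a0 ab).
Qed.

Lemma is_derive_expRZ (k x : R) : is_derive x 1 (fun t : R => expR (k * t)) (k * expR (k * x)).
Proof. exact: is_derive_comp_scale (is_derive_expR (k * x)). Qed.

Lemma expRZ_continuous (k : R) : continuous (fun t : R => k * expR (k * t)).
Proof.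
move=> x; apply: cvgM; first exact: cvg_cst.
apply: (@continuous_comp _ _ _ (fun t : R => k * t) expR).
  by apply: cvgM; [exact: cvg_cst|exact: cvg_id].
exact: continuous_expR.
Qed.

(** Let [Y] be the primitive of [expR (k * x) * h x]. Integrating [h = expR (- k * x) * Y'] by parts
    writes the integral of [h] over []0, T]] as an average of values of [Y]: the weights are
    [expR (- k * T)] at [T] and the density [k * expR (- k * x)] before [T], of total mass 1. *)
Lemma exp_weight_average (h : R -> R) (k Z0 : R) : 0 < k -> integ hl h ->
  (forall s, 0 < s -> Z0 <= \int[mu]_(x in `]0, s]) (expR (k * x) * h x)) ->
  Z0 <= \int[mu]_(x in hl) h x.
Proof.
move=> k0 ih hZ; pose EE x := expR (k * x).
have cE : continuous EE.
  move=> x; apply: (@continuous_comp _ _ _ (fun t : R => k * t) expR).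
    by apply: cvgM; [exact: cvg_cst|exact: cvg_id].
  exact: continuous_expR.
have mE D : measurable_fun D EE.
  by apply: measurable_funTS; exact: continuous_measurable_fun.
have iEh T : integ `]0, T] (fun x => EE x * h x).
  have [M hM] := cont_bounded 0 T cE; apply: (@integ_mulb _ _ EE h M) => //.
    by move=> x; rewrite /= in_itv/= => /andP[x0 xT]; rewrite hM// (ltW x0).
  exact: integ_halfline_oc.
pose Y x := \int[mu]_(t in `]0, x]) (EE t * h t).
have Y0 : Y 0 = 0 by rewrite /Y set_itv_ge ?Rintegral_set0// bnd_simp ltxx.
have acY : AC Y (fun x => EE x * h x) by split=> // x; rewrite Y0 add0r.
have acD := AC_C1 (is_derive_expRZ (- k)) (expRZ_continuous (k := - k)).
have acYD := AC_mul acY acD.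
have main T : 0 < T -> Z0 <= \int[mu]_(x in `]0, T]) h x.
  move=> T0; have ihT := integ_halfline_oc T (lexx 0) ih.
  have iYD := AC_integ T acYD (lexx 0).
  have e1 := AC_diff acYD (lexx 0) (ltW T0).
  rewrite /= Y0 mul0r subr0 max_l in e1; last exact: ltW.
  pose g x := Y x * (k * expR (- k * x)).
  have eg x : `]0, T]%classic x ->
    1 * h x + (-1) * (EE x * h x * expR (- k * Num.max x 0) + Y x * (- k * expR (- k * x))) = g x.
    rewrite /= in_itv/= => /andP[x0 _]; rewrite max_l ?ltW// /g /EE mulrAC -expRD.
    by rewrite (_ : k * x + - k * x = 0) ?expR0; ring.
  have ig : integ `]0, T] g.
    by apply: integ_eq (integ_lin 1 (-1) _ ihT iYD) => //; exact: eg.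
  have e2 : \int[mu]_(x in `]0, T]) g x = \int[mu]_(x in `]0, T]) h x - Y T * expR (- k * T).
    by rewrite -(int_eq eg) int_lin// mul1r -e1; ring.
  have [iD e3] := FTC_oc (is_derive_expRZ (- k)) (expRZ_continuous (k := - k)) (lexx 0) (ltW T0).
  have le : \int[mu]_(x in `]0, T]) ((- Z0) * (- k * expR (- k * x)) + 0 * (- k * expR (- k * x))) <= \int[mu]_(x in `]0, T]) g x.
    apply: int_le => //; first exact: integ_lin.
    move=> x; rewrite /= in_itv/= => /andP[x0 _]; rewrite mul0r addr0 /g.
    rewrite (_ : - Z0 * _ = Z0 * (k * expR (- k * x))); last by ring.
    by rewrite ler_wpM2r ?hZ// mulr_ge0 ?expR_ge0// ltW.
  rewrite int_lin// e3 e2 mulr0 expR0 mul0r addr0 in le.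
  have := ler_wpM2r (expR_ge0 (- k * T)) (hZ T T0); rewrite -/(Y T).
  lra.
apply/ler_addgt0Pr => e e0.
have [T T0 hT] := tail_small ih e0.
pose T1 := T + 1; have T10 : 0 < T1 by rewrite /T1; lra.
have := hT T1; rewrite lerDl ler01 => /(_ isT) htail.
have := int_split (ltW T10) ih => ->.
have i2 : integ `]T1, +oo[ h.
  apply: integ_sub ih => //; first exact: mhl.
  by move=> x; rewrite /= in_itv/= andbT halflineE; exact: lt_trans.
have := int_abs_le (measurable_itv _) (integ_meas i2) (integ_abs i2) (fun x _ => lexx _).
rewrite ler_norml => /andP[h1 _]; have := main T1 T10; lra.
Qed.

Variables (om al : R) (W : R -> R) (c1 c2 : R).
Hypotheses (om0 : 0 < om) (hW : potential_bounds W c1 c2).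
Let kap := Num.sqrt om.

(* The left-hand side minus the right-hand side is, up to a boundary term at [s], the
   form of [expR (kap * x) * u x] on [0, s]. If the inequality failed for all [s],
   integrating it against [expR (- 2 * kap * s)] would give [0 <= bil al W u u]. *)
Lemma exists_gain u : H1 u -> bil al W u u < 0 -> exists2 s, 0 < s &
  \int[mu]_(x in `]0, s]) (expR (2 * kap * x) * (u.2 x ^+ 2 + W x * u.1 x ^+ 2))
  < (al + kap) * u.1 0 ^+ 2.
Proof.
move=> hu hneg; apply: contrapT => H.
have k0 : 0 < kap by rewrite sqrtr_gt0.
have i1 := H1_mul1 hu hu; have i2 := pot_mul hW hu hu.
pose h x := u.2 x ^+ 2 + W x * u.1 x ^+ 2.
have ih : integ hl h.
  by apply: integ_eq (integD mhl i1 i2) => [|x _]; [exact: mhl|rewrite /h !expr2].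
have : (al + kap) * u.1 0 ^+ 2 <= \int[mu]_(x in hl) h x.
  apply: (@exp_weight_average h (2 * kap)) => //; first by rewrite mulr_gt0.
  move=> s s0; rewrite leNgt; apply/negP => hs; apply: H; exists s => //.
have -> : \int[mu]_(x in hl) h x = bil al W u u + al * (u.1 0 * u.1 0).
  rewrite /bil addrAC subrK -[X in _ = X + _]mul1r -[X in _ = _ + X]mul1r.
  rewrite -int_lin//; last exact: mhl.
  by apply: int_eq => x _; rewrite /h !expr2 !mul1r.
have := mulr_ge0 (ltW k0) (sqr_ge0 (u.1 0)); rewrite !expr2; lra.
Qed.

Lemma pot_shift : potential_bounds (fun x => W x + om) c1 (c2 + om).
Proof.
have [mW c10 c20 hW'] := hW; split => //.
- by apply: measurable_funD.
- by rewrite addr_ge0// ltW.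
- move=> k B mk hk ik; have [ii le] := hW' k B mk hk ik.
  have ii2 : integ hl (fun x => (W x + om) * k x).
    apply: integ_eq (integ_lin 1 om mhl ii ik) => [|x _]; [exact: mhl|ring].
  split=> //; apply: (@le_trans _ _ (\int[mu]_(x in hl) (1 * (`|W x| * k x) + om * k x))).
    have ia : integ hl (fun x => `|W x| * k x).
      apply: integ_eq (integ_abs ii) => [|x]; first exact: mhl.
      by rewrite halflineE => x0; rewrite normrM (ger0_norm (x := k x))//; case/andP: (hk x x0).
    apply: int_le; [exact: mhl| |exact: integ_lin mhl ia ik|].
      apply: integ_eq (integ_abs ii2) => [|x]; first exact: mhl.
      by rewrite halflineE => x0; rewrite normrM (ger0_norm (x := k x))//; case/andP: (hk x x0).
    move=> x; rewrite halflineE => x0; have /andP[kx0 _] := hk x x0.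
    rewrite mul1r -mulrDl ler_wpM2r//; apply: le_trans (ler_normD _ _) _.
    by rewrite (gtr0_norm om0).
  have ia : integ hl (fun x => `|W x| * k x).
    apply: integ_eq (integ_abs ii) => [|x]; first exact: mhl.
    by rewrite halflineE => x0; rewrite normrM (ger0_norm (x := k x))//; case/andP: (hk x x0).
  rewrite int_lin//; last exact: mhl.
  by rewrite mul1r mulrDl addrA lerD2r.
Qed.

(** The bounds on the potential are tested with the indicator of []0, T]]. *)
Lemma pot_loc (T : R) : integ `]0, T] W.
Proof.
have [|T0] := leP T 0; first by move=> T0; rewrite set_itv_ge ?bnd_simp -?leNgt//; exact: integrable_set0.
have [mW c10 c20 hW'] := hW; pose k x : R := if x <= T then 1 else 0.
have ik : integ hl k.
  by apply: integ_glue; [exact: ltW|exact: integ_cst_oc|exact: integ0].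
have k01 x : 0 < x -> 0 <= k x <= 1.
  by move=> _; rewrite /k; case: ifP; rewrite ?lexx ?ler01.
have [ii _] := hW' k 1 (integ_meas ik) k01 ik.
have sub : `]0, T]%classic `<=` hl.
  by move=> x; rewrite /= in_itv/= halflineE => /andP[].
have ii' : integ `]0, T] (fun x => W x * k x) by apply: integ_sub ii; [exact: mhl| |].
apply: integ_eq ii' => // x.
by rewrite /k /= in_itv/= => /andP[_ ->]; rewrite mulr1.
Qed.

(* Test with [u] cut off linearly on [s, s + d] and let [d] tend to 0. *)
Lemma pot_tail_le0 (s : R) v : 0 <= s -> H1 v ->
  (forall u, H1 u -> \int[mu]_(x in hl) (W x * (u.1 x * u.1 x)) <= 0) ->
  \int[mu]_(x in `]s, +oo[) (W x * (v.1 x * v.1 x)) <= 0.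
Proof.
move=> s0 hv hneg; have [M hM] := H1_bounded hv.
have fin1 (K I e : R) : I * (2 * K + 1) < e -> 0 <= I -> 2 * K * I <= e by lra.
have fin2 (I1 I2 T A K e : R) : 1 * I1 + (-1) * I2 <= 2 * K * A + 0 * A ->
  I2 + T <= 0 -> 2 * K * A <= e -> I1 + T <= e by lra.
have iW T := pot_loc T.
have acW : AC (fun x => \int[mu]_(t in `]0, x]) `|W t|) (fun t => `|W t|).
  split=> [T|x]; first exact: integ_abs.
  by rewrite (@set_itv_ge _ _ (BRight 0) (BRight 0)) ?bnd_simp ?ltxx// Rintegral_set0 add0r.
have ivv := pot_mul hW hv hv.
have isub (a : R) : 0 <= a -> integ `]a, +oo[ (fun x => W x * (v.1 x * v.1 x)).
  move=> a0; apply: integ_sub ivv => //; first exact: mhl.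
  by move=> x; rewrite /= in_itv/= andbT halflineE; exact: le_lt_trans.
have M0 : 0 <= M by apply: le_trans (hM 0).
apply/ler_addgt0Pr => e e0; rewrite add0r.
have e' : 0 < e / (2 * M ^+ 2 + 1) by rewrite divr_gt0// ltr_wpDl// mulr_ge0// sqr_ge0.
have [d d0 hd] := cont_eps (AC_continuous acW (x := s)) e'.
pose d2 := d / 2; have d20 : 0 < d2 by rewrite divr_gt0.
have s20 : 0 <= s + d2 by rewrite addr_ge0// ltW.
have ss2 : s <= s + d2 by rewrite lerDl ltW.
pose b := v.1 (s + d2).
have acid : AC (fun x : R => Num.max x 0) (fun=> 1).
  by apply: (@AC_C1 _ id (fun=> 1)) => x; exact: cvg_cst.
(* [ramp] is the affine function from 0 at [s] to [v (s + d2)] at [s + d2], bounded by [M] in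
   between. Replacing [v] by it changes the integral by at most [2 * M ^+ 2] times the integral of
   [|W|] over []s, s + d2]], which the choice of [d] makes at most [e]. *)
pose ramp : E := (fun x => b / d2 * Num.max x 0 + - (b * s / d2) * 1, fun=> b / d2 * 1 + - (b * s / d2) * 0).
have acr : AC ramp.1 ramp.2 by exact: AC_lin acid (AC_cst 1).
pose z : E := (fun=> 0, fun=> 0).
have acz : AC z.1 z.2 by exact: AC_cst.
have z_s : z.1 s = ramp.1 s by rewrite /= max_l//; field; rewrite gt_eqF.
pose L := glue s z ramp.
have acL : AC L.1 L.2 by exact: AC_glue.
have Ls2 : L.1 (s + d2) = v.1 (s + d2).
  rewrite /= leNgt ltrDl d20/= max_l// -/b; field; rewrite gt_eqF//.
have Lle x : x <= s + d2 -> `|L.1 x| <= M.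
  move=> xs; rewrite /=; case: ifPn => [_|]; first by rewrite normr0.
  rewrite -ltNge => sx; rewrite max_l; last exact: le_trans s0 (ltW sx).
  rewrite (_ : _ + _ = b * ((x - s) / d2)); last by field; rewrite gt_eqF.
  rewrite normrM -[M]mulr1; apply: ler_pM => //; first exact: hM.
  rewrite ger0_norm; last by rewrite divr_ge0 ?subr_ge0// ltW.
  by rewrite ler_pdivrMr// mul1r lerBlDl.
have mL : measurable_fun setT L.2 by apply: glue_meas => //; exact: measurable_cst.
have iL : integ `]0, (s + d2)] (fun x => L.2 x ^+ 2).
  apply: (@integ_le _ _ _ (fun=> (b / d2) ^+ 2)) (integ_cst_oc _ _ _) => //.
    by apply: measurable_funX; exact: measurable_funTS.
  move=> x _; rewrite /=; case: ifP => _; first by rewrite expr0n normr0 sqr_ge0.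
  by rewrite mulr0 addr0 mulr1 ger0_norm ?sqr_ge0.
have hg : H1 (glue (s + d2) L v) by exact: H1_glue.
have := hneg _ hg.
have iLW : integ `]0, (s + d2)] (fun x => W x * (L.1 x * L.1 x)).
  apply: (@integ_le _ _ _ (fun x => M ^+ 2 * `|W x|)) => //; last exact/integZ/integ_abs.
    apply: measurable_funM; first exact: integ_meas (iW _).
    by apply: measurable_funM; apply: measurable_funTS; apply: continuous_measurable_fun;
      exact: AC_continuous acL.
  move=> x; rewrite /= in_itv/= => /andP[_ xs]; rewrite normrM mulrC ler_wpM2r//.
  by rewrite normrM expr2; apply: ler_pM => //; exact: Lle.
have -> : \int[mu]_(x in hl) (W x * ((glue (s + d2) L v).1 x * (glue (s + d2) L v).1 x)) =
   \int[mu]_(x in `]0, (s + d2)]) (W x * (L.1 x * L.1 x)) +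
   \int[mu]_(x in `](s + d2), +oo[) (W x * (v.1 x * v.1 x)).
  rewrite -int_glue//; last exact: isub.
  by apply: int_eq => x _ /=; case: ifP.
rewrite (int_oc_cat s0 ss2 iLW).
have -> : \int[mu]_(x in `]0, s]) (W x * (L.1 x * L.1 x)) = 0.
  apply: int_zero => x; rewrite /= in_itv/= => /andP[_ ->].
  by rewrite mulr0 mulr0.
rewrite add0r (int_oy_cat ss2 (isub s s0)) => hle.
have iWs : integ `]s, (s + d2)] W.
  by apply: integ_sub (iW (s + d2)) => // x; rewrite /= !in_itv/= => /andP[/(le_lt_trans s0) -> ->].
have iLWs : integ `]s, (s + d2)] (fun x => W x * (L.1 x * L.1 x)).
  by apply: integ_sub iLW => // x; rewrite /= !in_itv/= => /andP[/(le_lt_trans s0) -> ->].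
have ivs : integ `]s, (s + d2)] (fun x => W x * (v.1 x * v.1 x)).
  by apply: integ_sub (isub s s0) => // x; rewrite /= !in_itv/= => /andP[->].
have hdiff : \int[mu]_(x in `]s, (s + d2)]) (1 * (W x * (v.1 x * v.1 x)) + (-1) * (W x * (L.1 x * L.1 x)))
   <= \int[mu]_(x in `]s, (s + d2)]) (2 * M ^+ 2 * `|W x| + 0 * `|W x|).
  apply: int_le => //; [exact: integ_lin|apply: integ_lin => //; exact: integ_abs|].
  move=> x; rewrite /= in_itv/= => /andP[sx xs].
  rewrite mul0r addr0 mul1r mulN1r -mulrBr.
  apply: le_trans (ler_norm _) _; rewrite normrM mulrC ler_wpM2r//.
  apply: le_trans (ler_normB _ _) _; rewrite mulr2n mulrDl mul1r.
  by rewrite !normrM expr2; apply: lerD; apply: ler_pM => //; exact: Lle.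
rewrite !int_lin// in hdiff; try exact: integ_abs.
have := hd (s + d2); rewrite addrAC subrr add0r gtr0_norm// => /(_ _).
rewrite ltr_pdivrMr// ltr_pMr// ltr1n => /(_ isT).
rewrite (AC_diff acW s0 ss2) ltr_norml => /andP[_ hW2].
have hMe : 2 * M ^+ 2 * \int[mu]_(t in `]s, (s + d2)]) `|W t| <= e.
  have q1 : 0 < 2 * M ^+ 2 + 1 by rewrite ltr_wpDl// mulr_ge0// sqr_ge0.
  move: hW2; rewrite ltr_pdivlMr// => hW2.
  have I0 : 0 <= \int[mu]_(t in `]s, (s + d2)]) `|W t| by exact: Rintegral_ge0.
  exact: fin1.
exact: fin2 hdiff hle hMe.
Qed.

End LinearGain.

(** * Energy of a soliton to the right of a point *)

Section SolitonTail.
Context {R : realType}.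
Notation mu := (@lebesgue_measure R).
Notation E := ((R -> R) * (R -> R))%type.
Notation hl := (@halfline R).
Implicit Types (t x : R).
Variables (r om : R).
Hypotheses (r2 : 2 < r) (om0 : 0 < om).
Variable y : R.
Let Q (x : R) : R := q r om (x - y).
Let P (x : R) : R := p r om (x - y).

Lemma Q_derive x : is_derive x 1 Q (P x).
Proof. by apply: dShift; exact: q_derive. Qed.

Lemma P_derive x : is_derive x 1 P (om * Q x - Q x * Q x `^ (r - 2)).
Proof. by apply: (dShift (f := p r om)); exact: p_derive. Qed.

Lemma deriv_continuous (f f' : R -> R) : (forall x : R, is_derive x 1 f (f' x)) ->
  continuous f.
Proof.
move=> df x; have d := df x; apply: differentiable_continuous.
by apply/derivable1_diffP.
Qed.

Lemma Q_continuous : continuous Q.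
Proof. exact: deriv_continuous Q_derive. Qed.

Lemma P_continuous : continuous P.
Proof. exact: deriv_continuous P_derive. Qed.

Lemma Q_gt0 x : 0 < Q x. Proof. exact: q_gt0. Qed.

Lemma Q_le_stop x : Q x <= stop r om. Proof. exact: q_le_stop. Qed.

Lemma Qr x : Q x `^ r = Q x ^+ 2 * Q x `^ (r - 2).
Proof.
have := pabs_split (Q x) r2; rewrite (gtr0_norm (Q_gt0 x)) => ->.
by rewrite mulrC.
Qed.

Lemma Qr_continuous : continuous (fun x => Q x `^ r).
Proof.
have -> : (fun x => Q x `^ r) = (fun x => `|Q x| `^ r).
  by apply/funext => x; rewrite gtr0_norm ?Q_gt0.
move=> x; apply: (@continuous_comp _ _ _ Q (fun z => `|z| `^ r)); first exact: Q_continuous.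
by apply: pabs_continuous; move: r2; lra.
Qed.

Lemma PQ_sq x : P x ^+ 2 = om * Q x ^+ 2 - 2 / r * Q x `^ r.
Proof. by rewrite /P p_sq// /GG (gtr0_norm (q_gt0 r2 om0 _)). Qed.

Lemma contM (f g : R -> R) : continuous f -> continuous g -> continuous (fun x => f x * g x).
Proof. by move=> cf cg x; apply: cvgM; [exact: cf|exact: cg]. Qed.

Lemma contX (f : R -> R) : continuous f -> continuous (fun x => f x ^+ 2).
Proof. by move=> cf; exact: contM. Qed.

Lemma contL (a b : R) (f g : R -> R) : continuous f -> continuous g ->
  continuous (fun x => a * f x + b * g x).
Proof.
by move=> cf cg x; apply: cvgD; (apply: cvgM; first exact: cvg_cst);
  [exact: cf|exact: cg].
Qed.

Lemma cont_integ (f : R -> R) (a b : R) : continuous f -> integ `]a, b] f.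
Proof.
move=> cf; have [M hM] := cont_bounded a b cf.
apply: integ_le (integ_cst_oc a b M) => //.
  by apply: measurable_funTS; exact: continuous_measurable_fun.
by move=> x; rewrite /= in_itv/= => /andP[/ltW ax xb]; rewrite hM// ax.
Qed.

(** [sqrt (GG s)] is [s] times a factor that decreases in [s], hence at least [k * s] on [[0, e]],
    where [k] is the factor at [e]; integrating gives [HH e - HH 0 >= k * e ^+ 2 / 2]. *)
Lemma HH_low (e : R) : 0 <= e -> e <= stop r om ->
  e * Num.sqrt (GG r om e) <= 2 * (HH r2 om0 e - HH r2 om0 0).
Proof.
move=> e0 es; pose k := Num.sqrt (om - 2 / r * e `^ (r - 2)).
have r0 : 0 < r by move: r2; lra.
have sG (s : R) : 0 <= s -> Num.sqrt (GG r om s) = s * Num.sqrt (om - 2 / r * s `^ (r - 2)).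
  by move=> s0; rewrite GGE// ger0_norm// sqrtrM ?sqr_ge0// sqrtr_sqr ger0_norm.
rewrite sG// -/k.
have [->|en0] := eqVneq e 0; first by rewrite !mul0r subrr mulr0.
have ep : 0 < e by rewrite lt_neqAle eq_sym en0.
have dD x : is_derive x 1 (fun s => HH r2 om0 s + (- (k / 2)) * (s * s))
    (Num.sqrt (GG r om x) + (- (k / 2)) * (1 * x + x * 1)).
  apply: dAdd; first exact: HH_derive.
  by apply: dScale; apply: dMul; exact: is_derive_id.
have cD := deriv_continuous dD.
have [z] := MVT ep (fun x _ => dD x) (continuous_subspaceT cD).
rewrite in_itv/= => /andP[z0 ze] eq.
have : 0 <= Num.sqrt (GG r om z) + (- (k / 2)) * (1 * z + z * 1).
  rewrite (_ : _ + _ = Num.sqrt (GG r om z) - z * k); last by field.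
  rewrite subr_ge0 sG ?(ltW z0)// ler_pM2l//; apply: ler_wsqrtr.
  rewrite lerB// ler_wpM2l ?divr_ge0 ?(ltW r0)//.
  by apply: ge0_ler_powR; rewrite ?nnegrE ?(ltW z0) ?(ltW ze)//; move: r2; lra.
move=> h; have := mulr_ge0 h (_ : 0 <= e - 0); rewrite -eq subr0 => /(_ e0).
lra.
Qed.

Lemma P_sq_left (a b : R) : 0 <= a -> a <= b -> b <= y ->
  \int[mu]_(x in `]a, b]) (P x ^+ 2) = HH r2 om0 (Q b) - HH r2 om0 (Q a).
Proof.
move=> a0 ab yb.
have d x : is_derive x 1 (fun t => HH r2 om0 (Q t)) (Num.sqrt (GG r om (Q x)) * P x).
  by apply: (dComp (g := Q)); [exact: HH_derive|exact: Q_derive].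
have c : continuous (fun x => Num.sqrt (GG r om (Q x)) * P x).
  apply: contM; last exact: P_continuous.
  move=> x; apply: (@continuous_comp _ _ _ Q (fun s => Num.sqrt (GG r om s))).
    exact: Q_continuous.
  exact: sqrtGG_continuous.
have [_ <-] := FTC_oc d c a0 ab; apply: int_eq => x; rewrite /= in_itv/= => /andP[_ xb].
by rewrite expr2 {1}/P pE ?subr_le0// (le_trans xb yb).
Qed.

Lemma P_sq_right (a b : R) : 0 <= a -> a <= b -> y <= a ->
  \int[mu]_(x in `]a, b]) (P x ^+ 2) = HH r2 om0 (Q a) - HH r2 om0 (Q b).
Proof.
move=> a0 ab ya.
have d x : is_derive x 1 (fun t => (-1) * HH r2 om0 (Q t)) ((-1) * (Num.sqrt (GG r om (Q x)) * P x)).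
  by apply: dScale; apply: (dComp (g := Q)); [exact: HH_derive|exact: Q_derive].
have c : continuous (fun x => (-1) * (Num.sqrt (GG r om (Q x)) * P x)).
  apply: contM; first by move=> x; exact: cvg_cst.
  apply: contM; last exact: P_continuous.
  move=> x; apply: (@continuous_comp _ _ _ Q (fun s => Num.sqrt (GG r om s))).
    exact: Q_continuous.
  exact: sqrtGG_continuous.
have [_ e] := FTC_oc d c a0 ab.
have aux (z w : R) : z - w = -1 * w - -1 * z by ring.
rewrite aux.
rewrite -e; apply: int_eq => x; rewrite /= in_itv/= => /andP[ax _].
have yx : 0 <= x - y by rewrite subr_ge0 (le_trans ya (ltW ax)).
by rewrite expr2 {1}(_ : P x = - Num.sqrt (GG r om (Q x))) ?mulNr ?mul1r//; exact: pNE.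
Qed.

Lemma mlineE : (1 - 2 / r) * mline r2 om0 = KK r2 om0.
Proof.
rewrite /mline; move: (KK r2 om0) => K.
by field; rewrite !gt_eqF//; move: r2; lra.
Qed.

(** Here [a], [ob] and [g] stand for the integrals of [P ^ 2], [om * Q ^ 2] and [Q ^ r] over []s,
    T]], [QP] and [QPT] for the values of [Q * P] at [s] and [T], the [H] variables for values of
    [HH], [ir] for [2 / r] and [mm] for [mline]. *)
Lemma tail_arith (a ob g QP QPT Hs HT Hst H0 ir mm : R) :
  0 < 1 - ir -> (1 - ir) * mm = 4 * (Hst - H0) -> a = ob - ir * g ->
  1 * (1 * a + ob) + (-1) * g = QPT - QP -> a = Hst - Hs + (Hst - HT) ->
  QP <= 2 * (Hs - H0) -> - QPT <= 2 * (HT - H0) -> QPT <= 0 ->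
  a + ob <= mm - QP /\ a + ob <= g - QP.
Proof.
move=> ir1 em e1 e2 e3 h1 h2 h3; split; last by lra.
rewrite -(ler_pM2l ir1) mulrBr em.
have -> : (1 - ir) * (a + ob) = 2 * a - ir * (QPT - QP) by rewrite -e2 e1; ring.
have : (1 - ir) * QPT <= 0 by rewrite pmulr_rle0.
lra.
Qed.

Section Bounds.
Variable s : R.
Hypotheses (s0 : 0 <= s) (sy : s <= y).

(** Three identities: [PQ_sq] integrated; the integral of the derivative
    [P ^ 2 + om * Q ^ 2 - Q ^ r] of [Q * P]; and the integral of [P ^ 2], explicit through [HH]
    because [Q] rises to [stop] at [y] and then falls. In the second bound [Q s * P s] is the
    boundary term; in the first it is the least that the missing part of the soliton left of [s] is
    worth, by [HH_low]. *)
Lemma tail_bounds (T : R) : y <= T ->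
  \int[mu]_(x in `]s, T]) (P x ^+ 2 + om * Q x ^+ 2) <= mline r2 om0 - Q s * P s /\
  \int[mu]_(x in `]s, T]) (P x ^+ 2 + om * Q x ^+ 2) <=
  \int[mu]_(x in `]s, T]) (Q x `^ r) - Q s * P s.
Proof.
move=> yT; have y0 := le_trans s0 sy; have sT := le_trans sy yT.
have r0 : 0 < r by move: r2; lra.
have cP2 := contX P_continuous; have cQ2 := contX Q_continuous.
have iP : integ `]s, T] (fun x => P x ^+ 2) by exact: cont_integ.
have iQ : integ `]s, T] (fun x => Q x ^+ 2) by exact: cont_integ.
have iQr : integ `]s, T] (fun x => Q x `^ r) by apply: cont_integ; exact: Qr_continuous.
set a := \int[mu]_(x in `]s, T]) (P x ^+ 2).
set b := \int[mu]_(x in `]s, T]) (Q x ^+ 2).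
set g := \int[mu]_(x in `]s, T]) (Q x `^ r).
have -> : \int[mu]_(x in `]s, T]) (P x ^+ 2 + om * Q x ^+ 2) = a + om * b.
  by rewrite -[a]mul1r -int_lin//; apply: int_eq => x _; rewrite mul1r.
have e1 : a = om * b - 2 / r * g.
  rewrite -mulNr -int_lin//; apply: int_eq => x _.
  by rewrite PQ_sq mulNr.
have d x : is_derive x 1 (fun t => Q t * P t) (P x * P x + Q x * (om * Q x - Q x * Q x `^ (r - 2))).
  by apply: dMul; [exact: Q_derive|exact: P_derive].
have eqd x : P x * P x + Q x * (om * Q x - Q x * Q x `^ (r - 2)) =
   1 * (1 * P x ^+ 2 + om * Q x ^+ 2) + (-1) * Q x `^ r.
  by rewrite Qr; ring.
have c : continuous (fun x => P x * P x + Q x * (om * Q x - Q x * Q x `^ (r - 2))).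
  rewrite (_ : (fun x => _) = fun x => 1 * (1 * P x ^+ 2 + om * Q x ^+ 2) + (-1) * Q x `^ r).
    by apply: contL; [exact: contL|exact: Qr_continuous].
  exact/funext.
have [_ e2] := FTC_oc d c s0 sT.
rewrite (int_eq (fun x _ => eqd x)) int_lin// in e2; last exact: integ_lin.
rewrite int_lin// -/a -/b -/g in e2.
have e3 : a = (HH r2 om0 (stop r om) - HH r2 om0 (Q s)) +
   (HH r2 om0 (stop r om) - HH r2 om0 (Q T)).
  rewrite /a (int_oc_cat sy yT)//.
  rewrite P_sq_left// P_sq_right//.
  by rewrite (_ : Q y = stop r om)// /Q subrr q0.
have h1 := HH_low (ltW (Q_gt0 s)) (Q_le_stop s).
have h2 := HH_low (ltW (Q_gt0 T)) (Q_le_stop T).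
have PT : P T = - Num.sqrt (GG r om (Q T)) by rewrite /P pNE ?subr_ge0.
have Ps : P s = Num.sqrt (GG r om (Q s)) by rewrite /P pE ?subr_le0.
have PT0 : Q T * P T <= 0.
  by rewrite PT mulrN oppr_le0 mulr_ge0 ?sqrtr_ge0 ?(ltW (Q_gt0 T)).
have r3 : 0 < 1 - 2 / r by rewrite subr_gt0 ltr_pdivrMr// mul1r.
have em := mlineE; rewrite /KK in em.
rewrite -Ps in h1.
have swap (a' b' z t : R) : a' = - b' -> z * b' <= t -> - (z * a') <= t.
  by move=> ->; rewrite mulrN opprK.
have {}h2 := swap _ _ _ _ PT h2.
exact: tail_arith r3 em e1 e2 e3 h1 h2 PT0.
Qed.

Lemma soliton_tail :
  [/\ integ `]s, +oo[ (fun x => P x ^+ 2), integ `]s, +oo[ (fun x => Q x ^+ 2),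
      integ `]s, +oo[ (fun x => Q x `^ r),
      \int[mu]_(x in `]s, +oo[) (P x ^+ 2 + om * Q x ^+ 2) <= mline r2 om0 - Q s * P s &
      \int[mu]_(x in `]s, +oo[) (P x ^+ 2 + om * Q x ^+ 2) <=
      \int[mu]_(x in `]s, +oo[) (Q x `^ r) - Q s * P s].
Proof.
have r0 : 0 < r by move: r2; lra.
pose h x := P x ^+ 2 + om * Q x ^+ 2.
have cP2 := contX P_continuous; have cQ2 := contX Q_continuous.
have h0 x : 0 <= h x by rewrite addr_ge0 ?sqr_ge0// mulr_ge0 ?sqr_ge0// ltW.
have ch : continuous h.
  rewrite (_ : h = fun x => 1 * P x ^+ 2 + om * Q x ^+ 2); first exact: contL.
  by apply/funext => x; rewrite mul1r.
have cmeas (f : R -> R) D : continuous f -> measurable_fun D f.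
  by move=> cf; apply: measurable_funTS; exact: continuous_measurable_fun.
have bound M : (forall T, y <= T -> \int[mu]_(x in `]s, T]) h x <= M) ->
    integ `]s, +oo[ h /\ \int[mu]_(x in `]s, +oo[) h x <= M.
  move=> hM; apply: integ_sup => //; first exact: cmeas.
  move=> T sT; split; first exact: cont_integ.
  have yT : y <= Num.max y T by rewrite le_max lexx.
  apply: le_trans (hM _ yT); apply: int_sub_le => //; last exact: cont_integ.
  move=> x; rewrite /= !in_itv/= => /andP[-> xT].
  by rewrite le_max xT orbT.
have [ih b1] := bound _ (fun T yT => (tail_bounds yT).1).
have iP : integ `]s, +oo[ (fun x => P x ^+ 2).
  apply: integ_le ih => //; first exact: cmeas.
  by move=> x _; rewrite ger0_norm ?sqr_ge0// lerDl mulr_ge0 ?sqr_ge0// ltW.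
have iQ : integ `]s, +oo[ (fun x => Q x ^+ 2).
  apply: integ_le (integZ om^-1 _ ih) => //; first exact: cmeas.
  move=> x _; rewrite ger0_norm ?sqr_ge0// -ler_pdivrMl ?invr_gt0// invrK.
  by rewrite lerDr sqr_ge0.
have iQr : integ `]s, +oo[ (fun x => Q x `^ r).
  apply: integ_le (integZ (r / 2 * om) _ iQ) => //; first by apply: cmeas; exact: Qr_continuous.
  move=> x _; rewrite ger0_norm ?powR_ge0//; have := PQ_sq x; have := sqr_ge0 (P x).
  move=> a e; rewrite e in a.
  have r20 : 0 <= r / 2 by rewrite divr_ge0// ltW.
  have := mulr_ge0 r20 a.
  by rewrite mulrBr mulrA (_ : r / 2 * (2 / r * Q x `^ r) = Q x `^ r) ?subr_ge0//; field; rewrite gt_eqF.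
split=> //; apply: (bound _ _).2 => T yT.
apply: le_trans (tail_bounds yT).2 _; rewrite lerD2r; apply: int_sub_le => //.
  by move=> x; rewrite /= !in_itv/= => /andP[->].
by move=> x _; exact: powR_ge0.
Qed.

End Bounds.
End SolitonTail.

(** * Soliton tails as elements of [H^1] *)

Section Profile.
Context {R : realType}.
Notation mu := (@lebesgue_measure R).
Notation E := ((R -> R) * (R -> R))%type.
Notation hl := (@halfline R).
Variables (r om : R).
Hypotheses (r2 : 2 < r) (om0 : 0 < om).

Definition soliton (y : R) : E :=
  (fun x => q r om (Num.max x 0 - y), fun x => p r om (x - y)).

Lemma H1_max0 (f g : R -> R) : AC (fun x => f (Num.max x 0)) g -> continuous g ->
  integ hl (fun x => g x ^+ 2) -> integ hl (fun x => f x ^+ 2) ->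
  H1 (fun x => f (Num.max x 0), g).
Proof.
move=> ac cg i1 i2; split => //=; first exact: continuous_measurable_fun.
apply: integ_eq i2 => [|x x0]; first exact: mhl.
by rewrite max_l//; move: x0; rewrite halflineE => /ltW.
Qed.

Lemma H1_soliton (y : R) : 0 <= y -> H1 (soliton y).
Proof.
move=> y0; have [i1 i2 _ _ _] := soliton_tail r2 om0 (lexx 0) y0.
have cP := P_continuous r2 om0 (y := y).
exact (H1_max0 (AC_C1 (Q_derive om r2 y) cP) cP i1 i2).
Qed.

Lemma profile_clamp (s m X : R) (f g : R -> R) : 0 < s ->
  (forall x, 0 < f x) ->
  \int[mu]_(x in `]s, +oo[) (g x ^+ 2 + om * f x ^+ 2) <= m - f s * X ->
  \int[mu]_(x in `]s, +oo[) (g x ^+ 2 + om * f x ^+ 2) <=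
    \int[mu]_(x in `]s, +oo[) (f x `^ r) - f s * X ->
  let v : E := (fun x => f (Num.max x 0), g) in
  [/\ v.1 s = f s,
   \int[mu]_(x in `]s, +oo[) (v.2 x ^+ 2 + om * v.1 x ^+ 2) <= m - f s * X &
   \int[mu]_(x in `]s, +oo[) (v.2 x ^+ 2 + om * v.1 x ^+ 2) <=
     \int[mu]_(x in `]s, +oo[) `|v.1 x| `^ r - f s * X].
Proof.
move=> s0 f0 h1 h2 v.
have vE x : s <= x -> v.1 x = f x by move=> sx; rewrite /v /= max_l// (le_trans (ltW s0) sx).
have eA : \int[mu]_(x in `]s, +oo[) (v.2 x ^+ 2 + om * v.1 x ^+ 2) =
   \int[mu]_(x in `]s, +oo[) (g x ^+ 2 + om * f x ^+ 2).
  by apply: int_eq => x; rewrite /= in_itv/= andbT => sx; rewrite -(vE x (ltW sx)).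
have eB : \int[mu]_(x in `]s, +oo[) (`|v.1 x| `^ r) = \int[mu]_(x in `]s, +oo[) (f x `^ r).
  apply: int_eq => x hx; have sx : s < x by move: hx; rewrite /= in_itv/= andbT.
  by rewrite (vE x (ltW sx)) gtr0_norm.
by rewrite eA eB vE.
Qed.

(* The witness is a soliton centered far to the right of [s]. *)
Lemma exists_profile (s e : R) : 0 < s -> 0 < e ->
  exists v : E, [/\ H1 v, 0 < v.1 s, v.1 s < e,
   \int[mu]_(x in `]s, +oo[) (v.2 x ^+ 2 + om * v.1 x ^+ 2) <=
     mline r2 om0 - v.1 s * Num.sqrt (GG r om (v.1 s)) &
   \int[mu]_(x in `]s, +oo[) (v.2 x ^+ 2 + om * v.1 x ^+ 2) <=
     \int[mu]_(x in `]s, +oo[) `|v.1 x| `^ r - v.1 s * Num.sqrt (GG r om (v.1 s))].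
Proof.
move=> s0 e0; have [t0 t00 qt] := q_small r2 om0 e0.
have [y [sy eqs]] : exists y, s <= y /\ s - y = t0.
  by exists (s - t0); split; [lra|ring].
have y0 : 0 <= y by apply: le_trans sy; exact: ltW.
have [_ _ _ hA1 hA2] := soliton_tail r2 om0 (ltW s0) sy.
have Ps : p r om (s - y) = Num.sqrt (GG r om (q r om (s - y))).
  by apply: pE => //; rewrite eqs.
rewrite Ps in hA1 hA2.
have [vs hB1 hB2] := profile_clamp s0 (fun x => q_gt0 r2 om0 (x - y)) hA1 hA2.
rewrite eqs in vs hB1 hB2.
exists (soliton y); split.
- exact: H1_soliton.
- rewrite [X in _ < X]vs; exact: q_gt0.
- rewrite [X in X < _]vs; exact: qt.
- rewrite [X in _ - X * _]vs [X in GG _ _ X]vs; exact: hB1.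
- rewrite [X in _ - X * _]vs [X in GG _ _ X]vs; exact: hB2.
Qed.

End Profile.

(** * The twisted function glued to a soliton tail *)

Section Competitor.
Context {R : realType}.
Notation mu := (@lebesgue_measure R).
Notation E := ((R -> R) * (R -> R))%type.
Notation hl := (@halfline R).
Implicit Types (u v w : E).
Variables (r om al : R) (W : R -> R) (c1 c2 : R).
Hypotheses (r2 : 2 < r) (om0 : 0 < om) (hW : potential_bounds W c1 c2).
Let kap := Num.sqrt om.
Let c := fun x => W x + om.

Definition twisted u : E :=
  (fun x => expR (kap * Num.max x 0) * u.1 x,
   fun x => kap * expR (kap * x) * u.1 x + expR (kap * Num.max x 0) * u.2 x).

Lemma AC_twisted u : H1 u -> AC (twisted u).1 (twisted u).2.
Proof.
move=> [ac _ _ _].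
exact: AC_mul (AC_C1 (is_derive_expRZ kap) (expRZ_continuous (k := kap))) ac.
Qed.

Lemma expZ_cont (k : R) : continuous (fun x : R => expR (k * x)).
Proof. exact: deriv_continuous (is_derive_expRZ k). Qed.

Lemma expZmax_cont (k : R) : continuous (fun x : R => expR (k * Num.max x 0)).
Proof. exact: AC_continuous (AC_C1 (is_derive_expRZ k) (expRZ_continuous (k := k))). Qed.

Lemma twisted_meas u : H1 u -> measurable_fun setT (twisted u).2.
Proof.
move=> hu; apply: measurable_funD; apply: measurable_funM.
- by apply: continuous_measurable_fun; exact: expRZ_continuous.
- exact: H1_meas0.
- by apply: continuous_measurable_fun; exact: expZmax_cont.
- exact: H1_meas1.
Qed.

Lemma twistedE u (x : R) : 0 < x -> (twisted u).1 x = expR (kap * x) * u.1 x /\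
  (twisted u).2 x = expR (kap * x) * (kap * u.1 x + u.2 x).
Proof. by move=> x0; rewrite /= !max_l ?ltW//; split => //; ring. Qed.

Lemma integ_exp_mul (k s : R) (h : R -> R) : integ `]0, s] h ->
  integ `]0, s] (fun x => expR (k * x) * h x).
Proof.
move=> ih; have [M hM] := cont_bounded 0 s (expZ_cont (k := k)).
apply: (@integ_mulb _ _ _ _ M) => //.
  by apply: measurable_funTS; apply: continuous_measurable_fun; exact: expZ_cont.
by move=> x; rewrite /= in_itv/= => /andP[x0 xs]; rewrite hM// (ltW x0).
Qed.

Lemma expR_sq (x : R) : expR (kap * x) ^+ 2 = expR (2 * kap * x).
Proof. by rewrite expr2 -expRD; congr expR; ring. Qed.

Lemma twisted_sq_integ u (s : R) : H1 u -> integ `]0, s] (fun x => (twisted u).2 x ^+ 2).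
Proof.
move=> hu; have [ac mu2 i0 i1] := hu.
have i01 : integ hl (fun x => u.1 x * u.2 x).
  by apply: integ_mul_sq; [exact: mhl|exact: H1_meas0|exact: H1_meas1| |].
have i : integ hl (fun x => 1 * (kap ^+ 2 * u.1 x ^+ 2 + 1 * u.2 x ^+ 2) + (2 * kap) * (u.1 x * u.2 x)).
  by apply: integ_lin; [exact: mhl|apply: integ_lin; [exact: mhl| |]|].
have := integ_exp_mul (2 * kap) (integ_halfline_oc s (lexx 0) i).
apply: integ_eq => // x hx; have x0 : 0 < x by move: hx; rewrite /= in_itv/= => /andP[].
by have [_ ->] := twistedE u x0; rewrite exprMn expR_sq; ring.
Qed.

Definition left_form u (s : R) : R :=
  \int[mu]_(x in `]0, s]) ((twisted u).2 x ^+ 2 + c x * (twisted u).1 x ^+ 2)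
  - al * (twisted u).1 0 ^+ 2.

Lemma cE_integ u (s : R) : H1 u ->
  integ `]0, s] (fun x => u.2 x ^+ 2 + W x * u.1 x ^+ 2).
Proof.
move=> hu; apply: integ_halfline_oc => //.
have i1 := H1_mul1 hu hu; have i2 := pot_mul hW hu hu.
by apply: integ_eq (integD mhl i1 i2) => [|x _]; [exact: mhl|rewrite !expr2].
Qed.

Lemma left_formE u (s : R) : H1 u -> 0 < s ->
  integ `]0, s] (fun x => (twisted u).2 x ^+ 2 + c x * (twisted u).1 x ^+ 2) /\
  left_form u s =
  \int[mu]_(x in `]0, s]) (expR (2 * kap * x) * (u.2 x ^+ 2 + W x * u.1 x ^+ 2))
  - (al + kap) * u.1 0 ^+ 2 + kap * (twisted u).1 s ^+ 2.
Proof.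
move=> hu s0; have acU := AC_twisted hu; have acUU := AC_mul acU acU.
have i1 := integ_exp_mul (2 * kap) (cE_integ s hu).
have i2 := AC_integ s acUU (lexx 0).
have eqx x : `]0, s]%classic x ->
   1 * (expR (2 * kap * x) * (u.2 x ^+ 2 + W x * u.1 x ^+ 2)) +
   kap * ((twisted u).2 x * (twisted u).1 x + (twisted u).1 x * (twisted u).2 x) =
   (twisted u).2 x ^+ 2 + c x * (twisted u).1 x ^+ 2.
  move=> hx; have x0 : 0 < x by move: hx; rewrite /= in_itv/= => /andP[].
  have [-> ->] := twistedE u x0; rewrite /c -expR_sq.
  have -> : om = kap ^+ 2 by rewrite sqr_sqrtr// ltW.
  ring.
split; first by apply: integ_eq (integ_lin 1 kap _ i1 i2).
rewrite /left_form -(int_eq eqx) int_lin//.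
rewrite -(AC_diff acUU (lexx 0) (ltW s0)) mul1r.
have -> : (twisted u).1 0 = u.1 0 by rewrite /= maxxx mulr0 expR0 mul1r.
ring.
Qed.

Lemma glue_form u v (s C : R) : H1 u -> H1 v -> 0 < s ->
  C * (twisted u).1 s = v.1 s ->
  H1 (glue s (lc C (twisted u) 0 (twisted u)) v) /\
  bil al c (glue s (lc C (twisted u) 0 (twisted u)) v)
    (glue s (lc C (twisted u) 0 (twisted u)) v) =
  C ^+ 2 * left_form u s +
  \int[mu]_(x in `]s, +oo[) (v.2 x ^+ 2 + c x * v.1 x ^+ 2).
Proof.
move=> hu hv s0 Cs; have acU := AC_twisted hu.
set U := twisted u; set CU := lc C U 0 U; set w := glue s CU v.
have acCU : AC CU.1 CU.2 by exact: AC_lin.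
have e1 x : CU.1 x = C * U.1 x by rewrite /CU /lc /=; ring.
have e2 x : CU.2 x = C * U.2 x by rewrite /CU /lc /=; ring.
have sU := twisted_sq_integ s hu.
have i2 : integ `]0, s] (fun x => CU.2 x ^+ 2).
  apply: integ_eq (integZ (C ^+ 2) _ sU) => // x _.
  by rewrite e2 exprMn.
have hw : H1 w.
  apply: H1_glue => //; first exact: ltW.
    by apply: measurable_funD; apply: measurable_funM => //; exact: twisted_meas.
  by rewrite e1.
split=> //.
have [ilf _] := left_formE hu s0.
have pc := pot_shift om0 hW.
have iv1 := H1_mul1 hv hv; have iv2 := pot_mul pc hv hv.
have iw1 := H1_mul1 hw hw; have iw2 := pot_mul pc hw hw.
have -> : bil al c w w = \int[mu]_(x in hl) (w.2 x ^+ 2 + c x * w.1 x ^+ 2)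
    - al * (w.1 0 * w.1 0).
  rewrite /bil addrAC -[X in X + _ - _]mul1r -[X in _ + X - _]mul1r -int_lin//; last exact: mhl.
  congr (_ - _); apply: int_eq => x _; ring.
have -> : \int[mu]_(x in hl) (w.2 x ^+ 2 + c x * w.1 x ^+ 2) =
   \int[mu]_(x in hl) (if x <= s then C ^+ 2 * (U.2 x ^+ 2 + c x * U.1 x ^+ 2)
     else v.2 x ^+ 2 + c x * v.1 x ^+ 2).
  apply: int_eq => x _; rewrite /w /glue /=.
  by case: ifP => // _; ring.
rewrite int_glue; [|exact: ltW|exact: integZ|]; last first.
  have : integ hl (fun x => v.2 x ^+ 2 + c x * v.1 x ^+ 2).
    by apply: integ_eq (integD mhl iv1 iv2) => [|x _]; [exact: mhl|rewrite !expr2].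
  apply: integ_sub => //; first exact: mhl.
  by move=> x; rewrite /= in_itv/= andbT halflineE; exact: lt_trans.
have -> : w.1 0 = C * U.1 0 by rewrite /w /glue /= (ltW s0) /=; ring.
have -> : \int[mu]_(x in `]0, s]) (C ^+ 2 * (U.2 x ^+ 2 + c x * U.1 x ^+ 2)) =
   C ^+ 2 * \int[mu]_(x in `]0, s]) (U.2 x ^+ 2 + c x * U.1 x ^+ 2).
  by rewrite RintegralZl//; exact: measurableR_cast.
by rewrite /left_form; ring.
Qed.

(** Cutting the soliton at [s], where its height is [eps], saves [eps * sqrt (GG eps)], about
    [kap * eps ^+ 2], whereas the rescaled [twisted u] put in its place costs
    [(kap - eta) * eps ^+ 2], with [eta > 0] provided by [exists_gain]. For small [eps] the glued
    function has its form below both [mline] and its own [bb]; combining the power [r / 2 - 1] of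
    the first bound with the second gives the claim. *)
Lemma competitor (d : R) : 0 < d ->
  (forall u, H1 u -> d * n0 u <= bil al c u u) ->
  (forall u, H1 u -> \int[mu]_(x in hl) (W x * (u.1 x * u.1 x)) <= 0) ->
  (exists2 u, H1 u & bil al W u u < 0) ->
  exists2 w, H1 w &
    0 < bil al c w w /\
    bil al c w w `^ (r / 2) < mline r2 om0 `^ (r / 2 - 1) * bb r w.
Proof.
move=> d0 hd hneg [u hu un].
have [s s0 hs] := exists_gain om0 hW hu un.
have [ilf elf] := left_formE hu s0.
set Z := (X in left_form u s = X + _) in elf.
have Z0 : Z < 0 by rewrite /Z subr_lt0.
have k0 : 0 < kap by rewrite sqrtr_gt0.
(* If [twisted u] vanished at [s], its continuation by 0 would be an element of [H^1] with form
   [Z < 0], against [hd]. *)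
have Unz : (twisted u).1 s != 0.
  apply/eqP => U0; have := glue_form (C := 1) hu H1_zero s0; rewrite U0 mulr0 => /(_ erefl).
  move=> [hw]; rewrite elf U0 expr0n mulr0 addr0 expr1n mul1r.
  rewrite (int_zero (h := fun x => _)); last by move=> x _ /=; rewrite mulr0 addr0.
  have := hd _ hw; have := n0_ge0 (glue s (lc 1 (twisted u) 0 (twisted u)) ((fun=> 0 : R), (fun=> 0 : R))).
  move=> n00 h e; rewrite e addr0 in h; have := mulr_ge0 (ltW d0) n00.
  by move=> h'; have := le_lt_trans (le_trans h' h) Z0; rewrite ltxx.
pose eta := - Z / (twisted u).1 s ^+ 2.
have U2 : 0 < (twisted u).1 s ^+ 2 by rewrite exprn_even_gt0//= orbC Unz.
have eta0 : 0 < eta by rewrite divr_gt0// oppr_gt0.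
have r0 : 0 < r by move: r2; lra.
(* For [eps] below this threshold [2 / r * eps ^ (r - 2) < eta ^+ 2], which yields [kap - eta < sqrt
   (om - 2 / r * eps ^ (r - 2))]. *)
have e0 : 0 < (r / 2 * eta ^+ 2) `^ ((r - 2)^-1).
  by rewrite powR_gt0// mulr_gt0 ?exprn_gt0// divr_gt0.
have [v [hv eps0 epse hA1 hA2]] := exists_profile r2 om0 s0 e0.
set eps := v.1 s in eps0 epse hA1 hA2.
pose C := eps / (twisted u).1 s.
have hC : C * (twisted u).1 s = v.1 s by rewrite /C mulfVK.
have [hw ew] := glue_form hu hv s0 hC.
move: hw ew; move ewd : (glue s _ _) => w hw ew; exists w => //.
move: hA1 hA2; move eA : (\int[mu]_(x in `]s, +oo[) (_ + om * _)) => A hA1 hA2.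
have iv1 := H1_mul1 hv hv; have iv0 := H1_mul0 hv hv.
have isub h : integ hl h -> integ `]s, +oo[ h.
  apply: integ_sub => //; first exact: mhl.
  by move=> x; rewrite /= in_itv/= andbT halflineE; exact: lt_trans.
have tail : \int[mu]_(x in `]s, +oo[) (v.2 x ^+ 2 + c x * v.1 x ^+ 2) <= A.
  have hWle := pot_tail_le0 hW (ltW s0) hv hneg.
  have iW := isub _ (pot_mul hW hv hv).
  have iA : integ `]s, +oo[ (fun x => v.2 x ^+ 2 + om * v.1 x ^+ 2).
    by apply: integD => //; [exact: isub iv1|apply: integZ => //; exact: isub iv0].
  have -> : \int[mu]_(x in `]s, +oo[) (v.2 x ^+ 2 + c x * v.1 x ^+ 2) =
    \int[mu]_(x in `]s, +oo[) (1 * (v.2 x ^+ 2 + om * v.1 x ^+ 2) +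
       1 * (W x * (v.1 x * v.1 x))).
    by apply: int_eq => x _; rewrite /c; ring.
  by rewrite int_lin// !mul1r eA gerDl.
have elow : left_form u s = (kap - eta) * (twisted u).1 s ^+ 2.
  by rewrite elf mulrBl /eta mulNr mulNr opprK mulfVK ?gt_eqF//; ring.
have hC2 : C ^+ 2 * left_form u s = (kap - eta) * eps ^+ 2.
  by rewrite elow /C; field.
have hgg : Num.sqrt (GG r om eps) = eps * Num.sqrt (om - 2 / r * eps `^ (r - 2)).
  by rewrite GGE// (gtr0_norm eps0) sqrtrM ?sqr_ge0// sqrtr_sqr gtr0_norm.
pose X := Num.sqrt (om - 2 / r * eps `^ (r - 2)).
have X0 : 0 <= X by exact: sqrtr_ge0.
have hX : kap - eta < X.
  rewrite ltNge; apply/negP => hX.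
  have X2 : om - 2 / r * eps `^ (r - 2) <= X ^+ 2.
    have [h|h] := leP 0 (om - 2 / r * eps `^ (r - 2)); first by rewrite sqr_sqrtr.
    by apply: le_trans (ltW h) (sqr_ge0 _).
  have ek : om = kap ^+ 2 by rewrite sqr_sqrtr// ltW.
  have : eps `^ (r - 2) < ((r / 2 * eta ^+ 2) `^ ((r - 2)^-1)) `^ (r - 2).
    by apply: gt0_ltr_powR; rewrite ?nnegrE ?(ltW eps0) ?(ltW e0)//; exact: r2_gt0.
  rewrite -powRrM mulVf ?gt_eqF ?r2_gt0// powRr1; last first.
    by rewrite mulr_ge0 ?sqr_ge0// divr_ge0// ltW.
  rewrite -(ltr_pM2l (_ : 0 < 2 / r)) ?divr_gt0//.
  have -> : 2 / r * (r / 2 * eta ^+ 2) = eta ^+ 2 by field; rewrite gt_eqF.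
  move: X2; rewrite ek; move: (2 / r * _) => T X2 hT.
  have : X ^+ 2 <= (kap - eta) ^+ 2 by rewrite ler_pXn2r ?nnegrE// (le_trans X0).
  have : 0 <= eta * (kap - eta) by rewrite mulr_ge0 ?(ltW eta0)// (le_trans X0).
  have aux (a b T' Y : R) : a ^+ 2 - T' <= Y -> T' < b ^+ 2 -> 0 <= b * (a - b) ->
    Y <= (a - b) ^+ 2 -> False by nra.
  by move=> h1 h2; exact: aux X2 hT h1 h2.
have n0w : 0 < n0 w.
  rewrite lt_neqAle n0_ge0 andbT; apply/eqP => /esym n00.
  have := n0_eq0 hw n00 s; rewrite -ewd /glue /= lexx => hz.
  have : C * (twisted u).1 s = 0 by rewrite -hz /=; ring.
  by rewrite hC => /eqP; rewrite gt_eqF.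
have B0 : 0 < bil al c w w.
  by apply: lt_le_trans (hd _ hw); rewrite mulr_gt0.
have eps2 : 0 < eps ^+ 2 by rewrite exprn_gt0.
have hBA : bil al c w w <= (kap - eta) * eps ^+ 2 + A by rewrite ew hC2 lerD2l.
have hlt : (kap - eta) * eps ^+ 2 < eps * Num.sqrt (GG r om eps).
  by rewrite hgg mulrA -expr2 mulrC ltr_pM2l.
have arith (B a A' g m : R) : B <= a + A' -> a < g -> A' <= m - g -> B < m by lra.
have B1 : bil al c w w < mline r2 om0 := arith _ _ _ _ _ hBA hlt hA1.
have B2 : bil al c w w < \int[mu]_(x in `]s, +oo[) `|v.1 x| `^ r :=
  arith _ _ _ _ _ hBA hlt hA2.
have B3 : \int[mu]_(x in `]s, +oo[) `|v.1 x| `^ r <= bb r w.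
  have -> : \int[mu]_(x in `]s, +oo[) `|v.1 x| `^ r =
     \int[mu]_(x in `]s, +oo[) `|w.1 x| `^ r.
    apply: int_eq => x; rewrite /= in_itv/= andbT => sx.
    by rewrite -ewd /glue /= leNgt sx.
  apply: int_sub_le => //; first exact: mhl.
  - by move=> x; rewrite /= in_itv/= andbT halflineE; exact: lt_trans.
  - exact: bb_integ.
split=> //.
have r20 : 0 < r / 2 by rewrite divr_gt0.
rewrite -(mulr_powRB1 (ltW B0) r20) mulrC.
apply: (@le_lt_trans _ _ (mline r2 om0 `^ (r / 2 - 1) * bil al c w w)).
  rewrite ler_pM2r//; apply: ge0_ler_powR; rewrite ?nnegrE ?(ltW B0) ?(ltW B1)//.
    by move: r2; lra.
  exact: ltW (lt_trans B0 B1).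
rewrite ltr_pM2l; first exact: lt_le_trans B2 B3.
by rewrite powR_gt0// (lt_trans B0 B1).
Qed.

End Competitor.

(** * Existence of a maximizer *)

Section Cutoff.
Context {R : realType}.
Notation mu := (@lebesgue_measure R).
Notation E := ((R -> R) * (R -> R))%type.
Notation hl := (@halfline R).
Implicit Types (u v w chi eta : E).

(* [x |-> min (max (x - M) 0) L] together with its derivative. *)
Definition clamp (M L : R) : E :=
  glue M ((fun=> 0), (fun=> 0))
    (glue (M + L) ((fun x => Num.max x 0 - M), (fun=> 1)) ((fun=> L), (fun=> 0))).

Lemma AC_clamp (M L : R) : 0 <= M -> 0 <= L -> AC (clamp M L).1 (clamp M L).2.
Proof.
move=> M0 L0; have ML : 0 <= M + L by rewrite addr_ge0.
apply: AC_glue => //; first exact: AC_cst.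
  apply: AC_glue => //; last by rewrite /= max_l//; ring.
    have d (x : R) : is_derive x 1 (fun t : R => t - M) 1.
      by have := is_deriveB (is_derive_id x 1) (is_derive_cst M x 1); rewrite subr0.
    apply: (AC_C1 d); exact: cst_continuous.
  exact: AC_cst.
by rewrite /glue /= lerDl L0 max_l// subrr.
Qed.

Lemma clamp_meas (M L : R) : measurable_fun setT (clamp M L).2.
Proof. apply: glue_meas; [exact: measurableT|exact: measurable_cst|].
apply: glue_meas; [exact: measurableT|exact: measurable_cst|exact: measurable_cst]. Qed.

Lemma clamp_low (M L x : R) : x <= M -> (clamp M L).1 x = 0.
Proof. by move=> xM; rewrite /clamp /glue /= xM. Qed.

Lemma clamp_mid (M L x : R) : 0 <= M -> M <= x <= M + L -> (clamp M L).1 x = x - M.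
Proof.
move=> M0 /andP[Mx xML]; rewrite /clamp /glue /= xML max_l; last exact: le_trans Mx.
by case: ifP => // xM; apply/esym/eqP; rewrite subr_eq0; apply/eqP/le_anti; rewrite xM.
Qed.

Lemma clamp_high (M L x : R) : 0 <= M -> 0 <= L -> M + L <= x -> (clamp M L).1 x = L.
Proof.
move=> M0 L0; rewrite le_eqVlt => /orP[/eqP <-|h].
  by rewrite clamp_mid ?lexx ?lerDl ?L0//; ring.
rewrite /clamp /glue /= !leNgt h.
by rewrite (le_lt_trans _ h) ?lerDl.
Qed.

Lemma clamp_deriv (M L x : R) : 0 <= (clamp M L).2 x <= 1.
Proof. by rewrite /clamp /glue /=; repeat case: ifP => _; rewrite lexx ler01. Qed.

(** Cosine and sine of [k] times a clamp, so that the squares add up to 1 and the squared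
    derivatives to at most [k ^+ 2 = e]. The transition has length [L = pi / (2 * k)] wherever it
    starts, so [L] is fixed before [M]; [tightness] chooses its window afterwards. *)
Lemma exists_cutoffs (e : R) : 0 < e -> exists2 L : R, 0 < L & forall M : R, 0 <= M ->
  exists chi eta : E,
  [/\ AC chi.1 chi.2 /\ AC eta.1 eta.2,
      measurable_fun setT chi.2 /\ measurable_fun setT eta.2,
      forall x, chi.1 x ^+ 2 + eta.1 x ^+ 2 = 1,
      forall x, chi.1 x * chi.2 x + eta.1 x * eta.2 x = 0 /\
                chi.2 x ^+ 2 + eta.2 x ^+ 2 <= e &
      forall x, (x <= M -> chi.1 x = 1 /\ eta.1 x = 0) /\
                (M + L <= x -> chi.1 x = 0 /\ eta.1 x = 1)].
Proof.
move=> e0; pose k := Num.sqrt e; have k0 : 0 < k by rewrite sqrtr_gt0.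
pose L := pi / 2 / k; have L0 : 0 < L by rewrite !divr_gt0// pi_gt0.
exists L => // M M0; have ac := AC_clamp M0 (ltW L0).
have m1 := clamp_meas M L; have cd := clamp_deriv M L.
have clo x := @clamp_low M L x; have chigh x := @clamp_high M L x M0 (ltW L0).
move: ac m1 cd clo chigh; move: (clamp M L) => cl ac m1 cd clo chigh.
have dl (x : R) : is_derive x 1 (fun t : R => k * t) k.
  by apply: dEq (dScale k (is_derive_id x 1)) _; rewrite mulr1.
have dc (x : R) : is_derive x 1 (fun t : R => cos (k * t)) (- k * sin (k * x)).
  have := dComp (is_derive_cos (k * x)) (dl x).
  by move=> h; apply: dEq h _; ring.
have ds (x : R) : is_derive x 1 (fun t : R => sin (k * t)) (k * cos (k * x)).
  have := dComp (is_derive_sin (k * x)) (dl x).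
  by move=> h; apply: dEq h _; ring.
have cc : continuous (fun x : R => k * cos (k * x)).
  move=> x; apply: cvgM; first exact: cvg_cst.
  apply: (@continuous_comp _ _ _ (fun t : R => k * t) cos); last exact: continuous_cos.
  by apply: cvgM; [exact: cvg_cst|exact: cvg_id].
have cs : continuous (fun x : R => - k * sin (k * x)).
  move=> x; apply: cvgM; first exact: cvg_cst.
  apply: (@continuous_comp _ _ _ (fun t : R => k * t) sin); last exact: continuous_sin.
  by apply: cvgM; [exact: cvg_cst|exact: cvg_id].
have m0 : measurable_fun setT cl.1.
  by apply: continuous_measurable_fun; exact: AC_continuous ac.
exists (fun x => cos (k * cl.1 x), fun x => - k * sin (k * cl.1 x) * cl.2 x).
exists (fun x => sin (k * cl.1 x), fun x => k * cos (k * cl.1 x) * cl.2 x).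
have kL : k * L = pi / 2 by rewrite /L; field; rewrite gt_eqF.
split => /=.
- by split; [exact: AC_comp ac dc cs|exact: AC_comp ac ds cc].
- split; apply: measurable_funM => //.
    apply: (measurableT_comp (f := fun x : R => - k * sin (k * x))) => //.
    exact: continuous_measurable_fun.
  apply: (measurableT_comp (f := fun x : R => k * cos (k * x))) => //.
  exact: continuous_measurable_fun.
- by move=> x; exact: cos2Dsin2.
- move=> x; split; first by ring.
  have -> : (- k * sin (k * cl.1 x) * cl.2 x) ^+ 2 + (k * cos (k * cl.1 x) * cl.2 x) ^+ 2
    = k ^+ 2 * cl.2 x ^+ 2 * (cos (k * cl.1 x) ^+ 2 + sin (k * cl.1 x) ^+ 2) by ring.
  rewrite cos2Dsin2 mulr1 sqr_sqrtr ?(ltW e0)// ler_piMr ?(ltW e0)//.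
  by have /andP[h0 h1] := cd x; rewrite exprn_ile1.
- move=> x; split => hx.
    by rewrite clo// mulr0 cos0 sin0.
  by rewrite chigh// kL cos_pihalf sin_pihalf.
Qed.

Definition mulE u v : E :=
  (fun x => u.1 x * v.1 x, fun x => u.2 x * v.1 x + u.1 x * v.2 x).

Lemma H1_mulE u v (B : R) : H1 u -> AC v.1 v.2 -> measurable_fun setT v.2 ->
  (forall x, v.1 x ^+ 2 <= B) -> (forall x, v.2 x ^+ 2 <= B) -> H1 (mulE u v).
Proof.
move=> hu ac m2 b1 b2; have [acu mu2 i0 i1] := hu.
have m1 : measurable_fun setT v.1.
  by apply: continuous_measurable_fun; exact: AC_continuous ac.
have m0 := H1_meas0 (D := setT) hu.
have mm : measurable_fun setT (mulE u v).2.
  by apply: measurable_funD; apply: measurable_funM.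
split => //.
- exact: AC_mul.
- apply: integ_le (integZ B mhl i0); first exact: mhl.
    by apply: measurable_funX; apply: measurable_funTS; apply: measurable_funM.
  move=> x _; rewrite ger0_norm ?sqr_ge0// exprMn mulrC.
  by rewrite ler_wpM2r ?sqr_ge0.
- apply: integ_le (integ_lin (2 * B) (2 * B) mhl i0 i1); first exact: mhl.
    by apply: measurable_funX; exact: measurable_funTS mm.
  move=> x _; rewrite ger0_norm ?sqr_ge0//=.
  have h1 := ler_wpM2l (sqr_ge0 (u.1 x)) (b2 x).
  have h2 := ler_wpM2l (sqr_ge0 (u.2 x)) (b1 x).
  have := sqr_ge0 (u.2 x * v.1 x - u.1 x * v.2 x); rewrite !expr2 in h1 h2 *; nra.
Qed.

(* The IMS localization formula. *)
Lemma bil_cutoffs (al : R) c (c1 c2 e : R) u chi eta : potential_bounds c c1 c2 ->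
  H1 u -> H1 (mulE u chi) -> H1 (mulE u eta) ->
  (forall x, chi.1 x ^+ 2 + eta.1 x ^+ 2 = 1) ->
  (forall x, chi.1 x * chi.2 x + eta.1 x * eta.2 x = 0 /\
                chi.2 x ^+ 2 + eta.2 x ^+ 2 <= e) ->
  bil al c (mulE u chi) (mulE u chi) + bil al c (mulE u eta) (mulE u eta)
  <= bil al c u u + e * n0 u.
Proof.
move=> hc hu h1 h2 e1 e2; have [_ _ i0 _] := hu.
have j1 := H1_mul1 h1 h1; have j2 := H1_mul1 h2 h2; have j := H1_mul1 hu hu.
have k1 := pot_mul hc h1 h1; have k2 := pot_mul hc h2 h2.
rewrite /bil; set v1 := mulE u chi; set v2 := mulE u eta.
have eK : \int[mu]_(x in hl) (c x * (u.1 x * u.1 x)) =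
   \int[mu]_(x in hl) (c x * (v1.1 x * v1.1 x)) + \int[mu]_(x in hl) (c x * (v2.1 x * v2.1 x)).
  rewrite -[X in X + _]mul1r -[X in _ + X]mul1r -int_lin//; last exact: mhl.
  apply: int_eq => x _; transitivity (c x * (u.1 x * u.1 x) * (chi.1 x ^+ 2 + eta.1 x ^+ 2)).
    by rewrite e1 mulr1.
  by rewrite /v1 /v2 /mulE /=; ring.
have e0 : u.1 0 * u.1 0 = v1.1 0 * v1.1 0 + v2.1 0 * v2.1 0.
  transitivity (u.1 0 * u.1 0 * (chi.1 0 ^+ 2 + eta.1 0 ^+ 2)); first by rewrite e1 mulr1.
  by rewrite /v1 /v2 /mulE /=; ring.
have lJ : \int[mu]_(x in hl) (v1.2 x * v1.2 x) + \int[mu]_(x in hl) (v2.2 x * v2.2 x) <=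
   \int[mu]_(x in hl) (u.2 x * u.2 x) + e * n0 u.
  rewrite /n0 -[X in X + _ <= _]mul1r -[X in _ + X <= _]mul1r -[X in _ <= X + _]mul1r.
  rewrite -!int_lin//; try exact: mhl.
  apply: int_le; [exact: mhl|apply: integ_lin => //; exact: mhl|apply: integ_lin => //; exact: mhl|].
  move=> x _; have [h3 h4] := e2 x; have h5 := ler_wpM2l (sqr_ge0 (u.1 x)) h4.
  have -> : 1 * (v1.2 x * v1.2 x) + 1 * (v2.2 x * v2.2 x) =
    u.2 x ^+ 2 * (chi.1 x ^+ 2 + eta.1 x ^+ 2) +
    2 * u.1 x * u.2 x * (chi.1 x * chi.2 x + eta.1 x * eta.2 x) +
    u.1 x ^+ 2 * (chi.2 x ^+ 2 + eta.2 x ^+ 2) by rewrite /v1 /v2 /mulE /=; ring.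
  by rewrite e1 h3 mulr0 addr0 mulr1 mul1r -expr2 lerD2l (mulrC e).
rewrite eK e0; move: lJ.
move: (\int[mu]_(x in hl) (v1.2 x * v1.2 x)) (\int[mu]_(x in hl) (v2.2 x * v2.2 x)).
move: (\int[mu]_(x in hl) (u.2 x * u.2 x)) (e * n0 u) (\int[mu]_(x in hl) (c x * (v1.1 x * v1.1 x))).
move: (\int[mu]_(x in hl) (c x * (v2.1 x * v2.1 x))) (v1.1 0 * v1.1 0) (v2.1 0 * v2.1 0).
by move=> *; lra.
Qed.

(** The windows are consecutive and disjoint. The one that is found is where a function can be cut
    at little expense. *)
Lemma pigeonhole (h : R -> R) (M L e B : R) (J : nat) : 0 <= M -> 0 < L ->
  integ hl h -> (forall x, hl x -> 0 <= h x) -> \int[mu]_(x in hl) h x <= B ->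
  B < J%:R * e -> exists2 j : nat, (j < J)%N &
  \int[mu]_(x in `](M + j%:R * L), (M + j%:R * L + L)]) h x <= e.
Proof.
move=> M0 L0 ih h0 hB BJ; apply: contrapT => H.
have h0' (a b : R) : 0 <= a -> 0 <= \int[mu]_(x in `]a, b]) h x.
  move=> a0; apply: Rintegral_ge0 => x; rewrite /= in_itv/= => /andP[ax _].
  by apply: h0; rewrite halflineE (le_lt_trans a0).
suff K j : (j <= J)%N -> j%:R * e <= \int[mu]_(x in `]M, (M + j%:R * L)]) h x.
  have := le_lt_trans hB BJ; apply/negP; rewrite -leNgt; apply: le_trans (K J (leqnn _)) _.
  apply: int_sub_le => //; first exact: mhl.
  by move=> x; rewrite /= in_itv/= halflineE => /andP[/(le_lt_trans M0)].
elim: j => [_|j IH jJ]; first by rewrite mul0r h0'.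
have jL : 0 <= j%:R * L by rewrite mulr_ge0// ltW.
have -> : M + j.+1%:R * L = M + j%:R * L + L by rewrite -natr1; ring.
rewrite (@int_oc_cat _ _ (M + j%:R * L)) ?lerDl// ?(ltW L0)//; last exact: integ_halfline_oc.
rewrite -natr1 mulrDl mul1r lerD ?IH ?(ltnW jJ)// ltW// ltNge; apply/negP => hj.
by apply: H; exists j.
Qed.

End Cutoff.

(** * Tightness of almost maximizers *)

Section Tightness.
Context {R : realType}.
Notation mu := (@lebesgue_measure R).
Notation E := ((R -> R) * (R -> R))%type.
Notation hl := (@halfline R).
Implicit Types (u v w chi eta : E).

Lemma one_powR (x : R) : 1 `^ x = 1. Proof. by rewrite powR1. Qed.

Lemma powR_le1 (x a : R) : 0 <= a -> 0 <= x -> x <= 1 -> x `^ a <= 1.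
Proof.
by move=> a0 x0 x1; rewrite -(one_powR a); apply: ge0_ler_powR; rewrite ?nnegrE.
Qed.

Lemma shift_arith (x y a n s : R) : x + y <= a + n -> a <= 1 -> n <= s / 2 ->
  x + (y + s / 2) <= 1 + s.
Proof. by lra. Qed.

(** [x] and [y] are the forms of the inner and outer parts, [Lam] and [Li] the constants that govern
    them. On [[0, s]] the power [z ^ ex] is at most [s ^ (ex - 1) * z], so the bound on [B] is
    nearly linear: form placed in [y] is lost at the rate [Lam - Li], while [B] is within [t] of
    [Lam]. *)
Lemma split_arith (Lam Li ex x y s B t : R) : 1 < ex -> 0 <= Li -> Li <= Lam ->
  0 <= x -> 0 <= y -> x + y <= s -> 1 <= s ->
  B <= Lam * x `^ ex + Li * y `^ ex + t -> Lam - t <= B ->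
  (Lam - Li) * y <= Lam * (s `^ ex - 1) + 2 * t.
Proof.
move=> ex1 Li0 LL x0 y0 xys s1 hB hB'; have ex0 : 0 < ex by lra.
have s0 : 0 <= s by lra.
set S := s `^ (ex - 1); have S1 : 1 <= S.
  by rewrite -(one_powR (ex - 1)) /S; apply: ge0_ler_powR; rewrite ?nnegrE//; lra.
have le z : 0 <= z -> z <= s -> z `^ ex <= S * z.
  move=> z0 zs; rewrite -(mulr_powRB1 z0 ex0) mulrC ler_wpM2r//.
  by apply: ge0_ler_powR; rewrite ?nnegrE//; lra.
have xs : x `^ ex <= S * x by apply: le => //; lra.
have ys : y `^ ex <= S * y by apply: le => //; lra.
rewrite -(mulr_powRB1 s0 ex0) -/S.
have h1 := ler_wpM2l (le_trans Li0 LL) xs; have h2 := ler_wpM2l Li0 ys.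
have h3 : 0 <= Lam * (S * (s - x - y)).
  by rewrite mulr_ge0 ?mulr_ge0//; lra.
have h4 : 0 <= (Lam - Li) * y * (S - 1) by rewrite !mulr_ge0//; lra.
nra.
Qed.

Variables (r om al : R) (W : R -> R) (c1 c2 d Lam : R).
Hypotheses (r2 : 2 < r) (om0 : 0 < om) (hW : potential_bounds W c1 c2).
Hypothesis hWinf : forall e : R, 0 < e ->
  exists2 T : R, 0 <= T & forall x, T <= x -> `|W x| <= e.
Let c := fun x => W x + om.
Hypotheses (d0 : 0 < d) (hd : forall u, H1 u -> d * n0 u <= bil al c u u).
Hypothesis hLam : forall u, H1 u -> bb r u <= Lam * bil al c u u `^ (r / 2).
Hypothesis hgap : 1 < mline r2 om0 `^ (r / 2 - 1) * Lam.

Lemma tail_form u eta (M e : R) : H1 u -> H1 (mulE u eta) ->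
  (forall x, x <= M -> eta.1 x = 0) -> (forall x, eta.1 x ^+ 2 <= 1) ->
  0 <= M -> 0 <= e -> (forall x, M <= x -> `|W x| <= e) ->
  n1 (mulE u eta) + om * n0 (mulE u eta) <=
  bil al c (mulE u eta) (mulE u eta) + e * n0 u.
Proof.
move=> hu hv eta0 eta1 M0 e0 hWe; have [_ _ i0 _] := hu.
set v := mulE u eta in hv *; have [_ _ j0 _] := hv.
have iv0 := H1_mul0 hv hv.
have ic := pot_mul (pot_shift om0 hW) hv hv.
have v0 : v.1 0 = 0 by rewrite /v /mulE /= eta0 ?mulr0.
rewrite /bil v0 !mulr0 subr0.
have -> : \int[mu]_(x in hl) (v.2 x * v.2 x) = n1 v by [].
rewrite -addrA lerD2l /n0 -[X in _ <= X + _]mul1r -int_lin//; last exact: mhl.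
rewrite -[X in X <= _]addr0 -[X in _ + X <= _](mul0r (\int[mu]_(x in hl) (v.1 x ^+ 2))).
rewrite -int_lin//; last exact: mhl.
apply: int_le; [exact: mhl|apply: integ_lin => //; exact: mhl|apply: integ_lin => //; exact: mhl|].
move=> x _; rewrite /c mul1r mul0r addr0 -expr2 mulrDl -addrA addrCA -[X in X <= _]addr0 lerD2l.
have [xM|/ltW Mx] := leP x M.
  by rewrite /v /mulE /= eta0// mulr0 expr0n mulr0 add0r mulr_ge0// sqr_ge0.
have h1 : v.1 x ^+ 2 <= u.1 x ^+ 2 by rewrite /v /mulE /= exprMn ler_piMr ?sqr_ge0.
have := hWe x Mx; rewrite ler_norml => /andP[h2 _].
have h3 := ler_wpM2r (sqr_ge0 (v.1 x)) h2; have h4 := ler_wpM2l e0 h1.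
by rewrite mulNr in h3; lra.
Qed.

Lemma mass_split u chi eta (M L : R) : H1 u -> H1 (mulE u chi) -> H1 (mulE u eta) ->
  0 <= M -> 0 <= L -> (forall x, (x <= M -> chi.1 x = 1) /\ (M + L <= x -> eta.1 x = 1)) ->
  bb r u <= bb r (mulE u chi) + bb r (mulE u eta) +
    \int[mu]_(x in `]M, (M + L)]) (`|u.1 x| `^ r).
Proof.
move=> hu h1 h2 M0 L0 he; have i := bb_integ r2 hu.
have ML : M <= M + L by rewrite lerDl.
rewrite /bb (int_split (le_trans M0 ML))// (int_oc_cat M0 ML); last exact: integ_halfline_oc.
have le3 (A B D A' D' : R) : A <= A' -> D <= D' -> A + B + D <= A' + D' + B by lra.
apply: le3.
  have -> : \int[mu]_(x in `]0, M]) (`|u.1 x| `^ r) =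
    \int[mu]_(x in `]0, M]) (`|(mulE u chi).1 x| `^ r).
    apply: int_eq => x; rewrite /= in_itv/= => /andP[_ xM].
    by rewrite (he x).1// mulr1.
  apply: int_sub_le => //; [exact: mhl| |exact: bb_integ].
  by move=> x; rewrite /= in_itv/= halflineE => /andP[].
have -> : \int[mu]_(x in `](M + L), +oo[) (`|u.1 x| `^ r) =
    \int[mu]_(x in `](M + L), +oo[) (`|(mulE u eta).1 x| `^ r).
  apply: int_eq => x; rewrite /= in_itv/= andbT => /ltW xM.
  by rewrite (he x).2// mulr1.
apply: int_sub_le => //; [exact: mhl| |exact: bb_integ].
by move=> x; rewrite /= in_itv/= andbT halflineE; apply: le_lt_trans; exact: le_trans ML.
Qed.

(** Cutting [u] in a window that carries little of [bb] gives an inner and an outer part whose forms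
    add up to nearly 1 by [bil_cutoffs]. The outer part obeys the inequality of the line, whose
    constant is smaller than [Lam] by [hgap], so [split_arith] bounds its form and hence its [n0].
    The window depends on [u], but it lies in a range that does not. *)
Lemma tightness (e : R) : 0 < e -> exists T del : R, [/\ 0 <= T, 0 < del &
  forall u, H1 u -> bil al c u u <= 1 -> Lam - del <= bb r u ->
  \int[mu]_(x in `]T, +oo[) (u.1 x ^+ 2) <= e].
Proof.
move=> e0; have pc := pot_shift om0 hW.
have [k k0 hk] := bil_coercive pc d0 hd.
have ex1 : 1 < r / 2 by move: r2; lra.
have m0 : 0 < mline r2 om0 `^ (r / 2 - 1).
  rewrite lt_neqAle powR_ge0 andbT; apply/negP => /eqP m0.
  by move: hgap; rewrite -m0 mul0r ltNge ler01.
have Lam0 : 0 < Lam by move: hgap; rewrite -(pmulr_rgt0 _ m0) => /(lt_trans ltr01).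
pose Li := (mline r2 om0 `^ (r / 2 - 1))^-1.
have Li0 : 0 < Li by rewrite invr_gt0.
have LL : Li < Lam by rewrite /Li -div1r ltr_pdivrMr// mulrC.
(* Three losses of size [t] are allowed: the window, the deficit of [u], and the growth of
   [(1 + sg) ^ (r / 2)]. *)
pose t := (Lam - Li) * e * k / 3.
have t0 : 0 < t by rewrite divr_gt0// !mulr_gt0// subr_gt0.
(* [D] is [Lam] times a Lipschitz constant of the power [r / 2] on [[0, 2]]. One half of [sg] is
   spent on the cut-off error, the other on the potential beyond [M0]. *)
pose D := Lam * (r / 2 * 2 `^ (r / 2 - 1)).
have D0 : 0 < D by rewrite !mulr_gt0 ?powR_gt0//; move: r2; lra.
pose sg := Num.min 1 (t / D).
have sg0 : 0 < sg by rewrite lt_min ltr01 divr_gt0.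
have sg1 : sg <= 1 by rewrite ge_min lexx.
have hs : Lam * ((1 + sg) `^ (r / 2) - 1) <= t.
  apply: (@le_trans _ _ (D * sg)); last first.
    by rewrite -ler_pdivlMl// mulrC ge_min lexx orbT.
  rewrite /D -mulrA ler_wpM2l// ?(ltW Lam0)//.
  have := @powR_lip _ (r / 2) 2 (1 + sg) 1 ex1; rewrite powR1.
  have -> : 1 + sg - 1 = sg by ring.
  rewrite (gtr0_norm sg0) => h; apply: le_trans (ler_norm _) _; apply: h.
    by move: sg0 sg1; lra.
  by rewrite ler01 ler1n.
have [M0 M00 hM0] := hWinf (mulr_gt0 k0 (divr_gt0 sg0 (ltr0n _ 2))).
have [L L0 hL] := exists_cutoffs (mulr_gt0 k0 (divr_gt0 sg0 (ltr0n R 2))).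
pose J := Num.bound (Lam / t).
have hJ : Lam < J%:R * t.
  by rewrite -ltr_pdivrMr//; apply: archi_boundP; rewrite divr_ge0// ltW.
exists (M0 + J%:R * L), t; split => //.
  by rewrite addr_ge0// mulr_ge0// ltW.
move=> u hu au bu; have [_ _ i0 _] := hu.
have ir := bb_integ r2 hu.
have bL : bb r u <= Lam.
  apply: le_trans (hLam hu) _; rewrite ler_piMr ?(ltW Lam0)//.
  apply: powR_le1 => //; first by move: r2; lra.
  by apply: le_trans (hd hu); rewrite mulr_ge0 ?n0_ge0// ltW.
have [j jJ hj] := pigeonhole M00 L0 ir (fun x _ => powR_ge0 _ _) bL hJ.
set M := M0 + j%:R * L in hj.
have M0M : M0 <= M by rewrite lerDl mulr_ge0// ltW.
have M_0 : 0 <= M := le_trans M00 M0M.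
have [chi [eta [[acx ace] [mx me] h1 h2 h3]]] := hL M M_0.
pose B := Num.max 1 (k * (sg / 2)).
have B1 : 1 <= B by rewrite le_max lexx.
have B2 : k * (sg / 2) <= B by rewrite le_max lexx orbT.
have cx : forall x, chi.1 x ^+ 2 <= 1.
  by move=> x; rewrite -(h1 x) lerDl sqr_ge0.
have ce : forall x, eta.1 x ^+ 2 <= 1.
  by move=> x; rewrite -(h1 x) lerDr sqr_ge0.
have hx : H1 (mulE u chi).
  apply: (@H1_mulE _ _ _ B) => // x; first exact: le_trans (cx x) B1.
  by apply: le_trans B2; apply: le_trans (h2 x).2; rewrite lerDl sqr_ge0.
have hy : H1 (mulE u eta).
  apply: (@H1_mulE _ _ _ B) => // x; first exact: le_trans (ce x) B1.
  by apply: le_trans B2; apply: le_trans (h2 x).2; rewrite lerDr sqr_ge0.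
have loc := bil_cutoffs al pc hu hx hy h1 h2.
have kn : k * n0 u <= 1.
  by apply: le_trans au; apply: le_trans (hk u hu); rewrite ler_pM2l// lerDl n1_ge0.
have kn2 : k * (sg / 2) * n0 u <= sg / 2.
  by rewrite mulrAC ler_piMl// divr_ge0// ltW.
have tf := tail_form hu hy (fun x hx => ((h3 x).1 hx).2) ce M_0
  (ltW (mulr_gt0 k0 (divr_gt0 sg0 (ltr0n R 2)))) (fun x Mx => hM0 x (le_trans M0M Mx)).
have ms := mass_split hu hx hy M_0 (ltW L0)
  (fun x => conj (fun hx => ((h3 x).1 hx).1) (fun hx => ((h3 x).2 hx).2)).
have line : bb r (mulE u eta) <= Li * (n1 (mulE u eta) + om * n0 (mulE u eta)) `^ (r / 2).
  rewrite /Li mulrC ler_pdivlMr// mulrC; apply: line_inequality => //.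
  by rewrite /mulE /= ((h3 0).1 M_0).2 mulr0.
have x0 : 0 <= bil al c (mulE u chi) (mulE u chi).
  by apply: le_trans (hd hx); rewrite mulr_ge0 ?n0_ge0// ltW.
have y0 : 0 <= n1 (mulE u eta) + om * n0 (mulE u eta).
  by rewrite addr_ge0 ?n1_ge0// mulr_ge0 ?n0_ge0// ltW.
set y := n1 _ + _ in tf line y0.
pose y' := bil al c (mulE u eta) (mulE u eta) + sg / 2.
have yy' : y <= y' by apply: le_trans tf _; rewrite lerD2l.
have hB : bb r u <= Lam * bil al c (mulE u chi) (mulE u chi) `^ (r / 2) + Li * y' `^ (r / 2) + t.
  apply: le_trans ms _; apply: lerD => //; apply: lerD; first exact: hLam.
  apply: le_trans line _; rewrite ler_pM2l//; apply: ge0_ler_powR; rewrite ?nnegrE//.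
    by move: r2; lra.
  exact: le_trans yy'.
have hxy : bil al c (mulE u chi) (mulE u chi) + y' <= 1 + sg.
  exact: shift_arith loc au kn2.
have := split_arith ex1 (ltW Li0) (ltW LL) x0 (le_trans y0 yy') hxy _ hB bu.
have -> : (1 <= 1 + sg) by rewrite lerDl ltW.
move=> /(_ isT) fin.
have fin2 : (Lam - Li) * y' <= (Lam - Li) * (e * k).
  apply: le_trans fin _; apply: (@le_trans _ _ (t + 2 * t)); first by rewrite lerD2r.
  by rewrite le_eqVlt; apply/orP; left; apply/eqP; rewrite /t; field.
rewrite ler_pM2l ?subr_gt0// in fin2.
have n0e : n0 (mulE u eta) <= e.
  rewrite -(ler_pM2l k0) (mulrC k e); apply: le_trans fin2.
  apply: (@le_trans _ _ (bil al c (mulE u eta) (mulE u eta))).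
    by apply: le_trans (hk _ hy); rewrite ler_pM2l// lerDl n1_ge0.
  by rewrite /y' lerDl divr_ge0// ltW.
apply: le_trans n0e.
have sT : M + L <= M0 + J%:R * L.
  rewrite /M -addrA lerD2l -[X in _ + X]mul1r -mulrDl ler_pM2r//.
  by rewrite natr1 ler_nat.
have -> : \int[mu]_(x in `](M0 + J%:R * L), +oo[) (u.1 x ^+ 2) =
  \int[mu]_(x in `](M0 + J%:R * L), +oo[) ((mulE u eta).1 x ^+ 2).
  apply: int_eq => x; rewrite /= in_itv/= andbT => /ltW Tx.
  by rewrite ((h3 x).2 (le_trans sT Tx)).2 mulr1.
have [_ _ j0 _] := hy.
apply: int_sub_le => //; first exact: mhl.
  move=> x; rewrite /= in_itv/= andbT halflineE; apply: le_lt_trans.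
  by apply: le_trans sT; rewrite addr_ge0// ltW.
by move=> x _; exact: sqr_ge0.
Qed.

End Tightness.

(** * Null sets and pointwise convergence *)

Section NegligibleSets.
Context {R : realType}.
Notation mu := (@lebesgue_measure R).
Implicit Types (f g h k : R -> R) (D N : set R).

Lemma int_negl D N h k : measurable D -> measurable N -> mu N = 0%E ->
  integ D h -> measurable_fun D k -> (forall x, D x -> ~ N x -> h x = k x) ->
  integ D k /\ \int[mu]_(x in D) k x = \int[mu]_(x in D) h x.
Proof.
move=> mD mN N0 ih mk hk.
have mDN : measurable (D `\` N) by exact: measurableD.
have ihN : integ (D `\` N) h by apply: integ_sub ih => // x [].
have ikN : integ (D `\` N) k.
  by apply: integ_eq ihN => // x [Dx Nx]; exact: hk.
have mk' : measurable_fun (D : set (measurableTypeR R)) (EFin \o k).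
  exact/measurable_EFinP.
have ik : integ D k.
  exact (iffRL (negligible_integrable (measurableR_cast mN) (measurableR_cast mD) mk' N0) ikN).
split=> //; rewrite /Rintegral; congr fine.
have e1 := negligible_integral (measurableR_cast mN) (measurableR_cast mD) ih N0.
have e2 := negligible_integral (measurableR_cast mN) (measurableR_cast mD) ik N0.
transitivity (\int[mu]_(x in D `\` N) (k x)%:E)%E; first exact: e2.
transitivity (\int[mu]_(x in D `\` N) (h x)%:E)%E; last exact/esym/e1.
by apply: eq_integral => x /set_mem [Dx Nx] /=; rewrite hk.
Qed.

(** By monotone convergence the sum of the series is integrable, hence finite off a null set. *)
Lemma series_ae D (h_ : nat -> R -> R) (B : R) : measurable D ->
  (forall n, integ D (h_ n)) -> (forall n x, D x -> 0 <= h_ n x) ->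
  (forall n, \sum_(0 <= k < n) \int[mu]_(x in D) h_ k x <= B) ->
  exists N, [/\ measurable N, mu N = 0%E & forall x, D x -> ~ N x ->
    exists M : R, forall n, \sum_(0 <= k < n) h_ k x <= M].
Proof.
move=> mD ih h0 hB; have mD' := measurableR_cast mD.
have mh n : measurable_fun (D : set (measurableTypeR R)) (EFin \o h_ n).
  by apply/measurable_EFinP; exact: integ_meas (ih n).
have h0' n x : D x -> (0 <= (EFin \o h_ n) x)%E by move=> Dx; rewrite lee_fin h0.
have int := integral_nneseries mu mD' mh h0'.
pose S x := (\sum_(0 <= n <oo) (h_ n x)%:E)%E.
have S0 x : D x -> (0 <= S x)%E by move=> Dx; apply: nneseries_ge0 => n _ _; exact: h0'.
have iS : mu.-integrable D S.
  apply/integrableP; split.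
    exact (@ge0_emeasurable_sum _ _ _ (D : set (measurableTypeR R)) (fun n => EFin \o h_ n) predT (fun n x Dx _ => h0' n x Dx) (fun n _ => mh n)).
  have eS : (\int[mu]_(x in D) `|S x| = \int[mu]_(x in D) S x)%E.
    by apply: eq_integral => x /set_mem Dx; rewrite gee0_abs// S0.
  have le : (\int[mu]_(x in D) `|S x| <= B%:E)%E.
    rewrite eS int; apply: lime_le.
      by apply: is_cvg_nneseries => n _ _; apply: integral_ge0 => x Dx; exact: h0'.
    apply: nearW => n; rewrite /= (eq_bigr (fun k : nat => (\int[mu]_(x in D) h_ k x)%:E)).
      by rewrite sumEFin lee_fin.
    by move=> k _; exact: int_EFin.
  exact: le_lt_trans le (ltry _).
have [N [mN N0 sub]] := integrable_ae mD' iS.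
exists N; split => // x Dx Nx.
have Sf : S x \is a fin_num by apply: contrapT => h; apply: Nx; apply: sub => /(_ Dx).
exists (fine (S x)) => n; rewrite -lee_fin fineK// -sumEFin.
by apply: nneseries_lim_ge => k _ _; exact: h0'.
Qed.

Lemma geometric_half (n : nat) : \sum_(0 <= k < n) (2 ^+ k)^-1 <= 2 :> R.
Proof.
suff -> : \sum_(0 <= k < n) (2 ^+ k)^-1 = 2 - 2 * (2 ^+ n)^-1 :> R.
  by rewrite lerBlDr lerDl mulr_ge0// invr_ge0 exprn_ge0.
elim: n => [|n IH]; first by rewrite big_nil expr0 invr1; ring.
by rewrite big_nat_recr//= IH exprS invfM; field; rewrite expf_neq0.
Qed.

(** By the inequality of means [|u k| <= (2 ^ (- k) + 2 ^ k * u k ^ 2) / 2], so the increments are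
    absolutely summable. *)
Lemma cvg_of_weighted_squares (a : nat -> R) (M : R) :
  (forall n, \sum_(0 <= k < n) 2 ^+ k * (a k.+1 - a k) ^+ 2 <= M) ->
  cvgn a.
Proof.
move=> hM; pose u := telescope a.
have uE (k : nat) : u k = a k.+1 - a k by [].
have hb (n : nat) : \sum_(0 <= k < n) `|u k| <= 1 + M / 2.
  apply: (@le_trans _ _ (2^-1 * (\sum_(0 <= k < n) ((2 ^+ k)^-1 + 2 ^+ k * (a k.+1 - a k) ^+ 2)))).
    rewrite mulr_sumr; apply: ler_sum => k _; rewrite uE.
    have := sqr_ge0 (1 - 2 ^+ k * `|a k.+1 - a k|).
    have p : 0 < 2 ^+ k :> R by rewrite exprn_gt0.
    rewrite -(real_normK (num_real (a k.+1 - a k))).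
    move: (2 ^+ k) p `|_| => s s0 d h.
    rewrite -(ler_pM2l s0).
    have -> : s * (2^-1 * (s^-1 + s * d ^+ 2)) = 2^-1 * (1 + (s * d) ^+ 2) by field; rewrite gt_eqF.
    by nra.
  rewrite big_split/= mulrDr; apply: lerD; last by rewrite mulrC ler_pM2r.
  by have := geometric_half n; lra.
have c1 : cvgn (series (fun k : nat => `|u k|)).
  apply: nondecreasing_is_cvgn; last by exists (1 + M / 2) => _ [n _ <-]; exact: hb.
  by apply: nondecreasing_series => n _ _; exact: normr_ge0.
have c2 := normed_cvg c1.
have -> : a = (fun n => a 0%N + series u n).
  by apply/funext => n; rewrite {1}(eq_sum_telescope a).
by apply: is_cvgD => //; exact: is_cvg_cst.
Qed.

End NegligibleSets.

(** * Completeness of [H^1] *)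

Section Completeness.
Context {R : realType}.
Notation mu := (@lebesgue_measure R).
Notation E := ((R -> R) * (R -> R))%type.
Notation hl := (@halfline R).
Implicit Types (u v w : E).

Definition subE u v : E := lc 1 u (-1) v.

Lemma sub1 u v x : (subE u v).1 x = u.1 x - v.1 x.
Proof. by rewrite /subE /lc /=; ring. Qed.

Lemma sub2 u v x : (subE u v).2 x = u.2 x - v.2 x.
Proof. by rewrite /subE /lc /=; ring. Qed.

Lemma H1_sub u v : H1 u -> H1 v -> H1 (subE u v).
Proof. exact: H1_lc. Qed.

Lemma n0_sub u v : n0 (subE u v) = \int[mu]_(x in hl) ((u.1 x - v.1 x) ^+ 2).
Proof. by apply: int_eq => x _; rewrite sub1. Qed.

Lemma n1_sub u v : n1 (subE u v) = \int[mu]_(x in hl) ((u.2 x - v.2 x) ^+ 2).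
Proof. by apply: int_eq => x _; rewrite sub2. Qed.

Lemma quarter_sq (n : nat) : (2 ^+ n)^-1 ^+ 2 = (4 ^+ n)^-1 :> R.
Proof. by rewrite -exprVn -exprM mulnC exprM exprVn expr2 -natrM exprVn. Qed.

Lemma eq0_of_quarter (z C : R) : (forall n, z ^+ 2 <= C * (4 ^+ n)^-1) -> z = 0.
Proof.
move=> h; apply/eqP; rewrite -sqrf_eq0 eq_le sqr_ge0 andbT.
have C0 : 0 <= C by have := h 0%N; rewrite expr0 invr1 mulr1; exact: le_trans (sqr_ge0 _).
apply/ler_addgt0Pr => e e0; rewrite add0r.
have [n hn] : exists n : nat, C / e < n%:R.
  by exists (Num.bound (C / e)); apply: archi_boundP; rewrite divr_ge0// ltW.
apply: le_trans (h n) _; rewrite ler_pdivrMr ?exprn_gt0// mulrC -ler_pdivrMr//.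
apply: le_trans (ltW hn) _; rewrite -natrX ler_nat ltnW//.
exact: ltn_expl.
Qed.

Lemma weighted_quarter (a : nat -> R) (C : R) : 0 <= C ->
  (forall n, (a n.+1 - a n) ^+ 2 <= C * (4 ^+ n)^-1) ->
  forall n, \sum_(0 <= k < n) 2 ^+ k * (a k.+1 - a k) ^+ 2 <= C * 2.
Proof.
move=> C0 h n; apply: (@le_trans _ _ (C * \sum_(0 <= k < n) (2 ^+ k)^-1)).
  rewrite mulr_sumr; apply: ler_sum => k _.
  have p : 0 < 2 ^+ k :> R by rewrite exprn_gt0.
  apply: le_trans (ler_wpM2l (ltW p) (h k)) _.
  by rewrite -quarter_sq le_eqVlt; apply/orP; left; apply/eqP; field; rewrite gt_eqF.
by rewrite ler_wpM2l// geometric_half.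
Qed.

(** The argument of Riesz and Fischer: the functions converge at every point by [H1_bound], the
    derivatives off a null set by [series_ae], and Fatou's lemma carries the estimates over to the
    limit. The rate [4 ^ (- n)] leaves room for the weights [2 ^ n]. *)
Lemma H1_complete (v_ : nat -> E) : (forall n, H1 (v_ n)) ->
  (forall n m, (n <= m)%N ->
    n0 (subE (v_ m) (v_ n)) + n1 (subE (v_ m) (v_ n)) <= (4 ^+ n)^-1) ->
  exists2 v, H1 v & forall n,
    n0 (subE v (v_ n)) <= (4 ^+ n)^-1 /\ n1 (subE v (v_ n)) <= (4 ^+ n)^-1.
Proof.
move=> hv hc.
have c0 n m : (n <= m)%N -> n0 (subE (v_ m) (v_ n)) <= (4 ^+ n)^-1.
  by move=> nm; apply: le_trans (hc n m nm); rewrite lerDl n1_ge0.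
have c1 n m : (n <= m)%N -> n1 (subE (v_ m) (v_ n)) <= (4 ^+ n)^-1.
  by move=> nm; apply: le_trans (hc n m nm); rewrite lerDr n0_ge0.
have cx n m x : (n <= m)%N -> ((v_ m).1 x - (v_ n).1 x) ^+ 2 <= 2 * (4 ^+ n)^-1.
  move=> nm; rewrite -sub1; apply: le_trans (H1_bound x (H1_sub (hv m) (hv n))) _.
  by rewrite ler_pM2l// hc.
have cf x : cvgn (fun n => (v_ n).1 x).
  apply: (@cvg_of_weighted_squares _ _ (2 * 2)).
  by apply: weighted_quarter => // n; exact: cx.
pose f x := limn (fun n => (v_ n).1 x).
have cvf x : (v_ n).1 x @[n --> \oo] --> f x by exact: cf.
have fx n x : (f x - (v_ n).1 x) ^+ 2 <= 2 * (4 ^+ n)^-1.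
  apply: (@cvg_le_cst _ (fun m => ((v_ (m + n)%N).1 x - (v_ n).1 x) ^+ 2)).
    have : ((v_ (m + n)%N).1 x - (v_ n).1 x) @[m --> \oo] --> f x - (v_ n).1 x.
      apply: cvgB; last exact: cvg_cst.
      by have := cvf x; rewrite -(cvg_shiftn n).
    move=> c; rewrite expr2; under eq_cvg do rewrite expr2; exact: cvgM.
  by move=> m; apply: cx; exact: leq_addl.
pose dd k x := 2 ^+ k * ((v_ k.+1).2 x - (v_ k).2 x) ^+ 2.
have idd k : integ hl (fun x => ((v_ k.+1).2 x - (v_ k).2 x) ^+ 2).
  have [_ _ _ i] := H1_sub (hv k.+1) (hv k); apply: integ_eq i => [|x _]; first exact: mhl.
  by rewrite sub2.
have [N [mN N0 hN]] : exists N, [/\ measurable N, mu N = 0%E & forall x, hl x -> ~ N x ->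
    exists M : R, forall n, \sum_(0 <= k < n) dd k x <= M].
  apply: (@series_ae _ _ _ 2); first exact: mhl.
  - by move=> k; apply: integZ => //; exact: mhl.
  - by move=> k x _; rewrite mulr_ge0 ?sqr_ge0// exprn_ge0.
  - move=> n; apply: le_trans (geometric_half n); apply: ler_sum => k _.
    have p : 0 < 2 ^+ k :> R by rewrite exprn_gt0.
    have -> : \int[mu]_(x in hl) dd k x = 2 ^+ k * n1 (subE (v_ k.+1) (v_ k)).
      rewrite n1_sub -[LHS]addr0 -[X in _ + X](mul0r (\int[mu]_(x in hl) ((v_ k.+1).2 x - (v_ k).2 x) ^+ 2)).
      rewrite -[X in X + _]mul1r -[RHS]addr0.
      have -> : 2 ^+ k * \int[mu]_(x in hl) ((v_ k.+1).2 x - (v_ k).2 x) ^+ 2 =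
        \int[mu]_(x in hl) dd k x; last by ring.
      have mh := mhl (R := R).
      have := int_lin (2 ^+ k) 0 mh (idd k) (idd k); rewrite mul0r addr0 => <-.
      by apply: int_eq => x _; rewrite mul0r addr0.
    apply: le_trans (ler_wpM2l (ltW p) (c1 k k.+1 (leqnSn k))) _.
    by rewrite -quarter_sq le_eqVlt; apply/orP; left; apply/eqP; field; rewrite gt_eqF.
(* Outside [G] the derivatives are set to 0, so that they converge at every point and their limit is
   measurable. *)
pose G := hl `\` N; have mG : measurable G by apply: measurableD => //; exact: mhl.
pose g_ n x := (v_ n).2 x * \1_G x.
have gE n x : hl x -> ~ N x -> (v_ n).2 x = g_ n x.
  by move=> hx Nx; rewrite /g_ indicE mem_set ?mulr1.
have mg n : measurable_fun setT (g_ n).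
  apply: measurable_funM; first by case: (hv n).
  exact: measurable_indic.
have cg x : cvgn (fun n => g_ n x).
  have [hG|hG] := pselect (G x); last first.
    rewrite (_ : (fun n => _) = cst 0); first exact: is_cvg_cst.
    by apply/funext => n; rewrite /g_ indicE memNset//= mulr0.
  have [M hM] := hN x hG.1 hG.2.
  apply: (@cvg_of_weighted_squares _ _ M) => n; apply: le_trans (hM n).
  by apply: ler_sum => k _; rewrite /dd -!(gE _ _ hG.1 hG.2).
pose g x := limn (fun n => g_ n x).
have cvg' x : g_ n x @[n --> \oo] --> g x by exact: cg.
have mgg : measurable_fun setT g by apply: (measurable_fun_cvg mg) => x _; exact: cvg'.
pose v : E := (f, g).
have idg n m : integ hl (fun x => (g_ m x - g_ n x) ^+ 2) /\
    \int[mu]_(x in hl) ((g_ m x - g_ n x) ^+ 2) = n1 (subE (v_ m) (v_ n)).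
  have [_ _ _ i] := H1_sub (hv m) (hv n).
  apply: (int_negl _ mN N0 i); first exact: mhl.
    by apply: measurable_funTS; apply: measurable_funX; exact: measurable_funB.
  by move=> x hx Nx; rewrite sub2 !gE.
have cvs (a : nat -> R) (l b : R) n : a m @[m --> \oo] --> l ->
    (a (m + n)%N - b) ^+ 2 @[m --> \oo] --> (l - b) ^+ 2.
  move=> c; have : (a (m + n)%N - b) @[m --> \oo] --> l - b.
    by apply: cvgB; [rewrite (cvg_shiftn n a)|exact: cvg_cst].
  by move=> c'; rewrite expr2; under eq_cvg do rewrite expr2; exact: cvgM.
have Fg n : integ hl (fun x => (g x - g_ n x) ^+ 2) /\
    \int[mu]_(x in hl) ((g x - g_ n x) ^+ 2) <= (4 ^+ n)^-1.
  apply: (@fatou_real _ _ (fun m x => (g_ (m + n)%N x - g_ n x) ^+ 2)); first exact: mhl.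
  - by move=> m; exact: (idg _ _).1.
  - by move=> m x _; exact: sqr_ge0.
  - by apply: measurable_funTS; apply: measurable_funX; exact: measurable_funB.
  - by move=> x _; apply: (cvs (g_^~ x)).
  - by move=> m; rewrite (idg _ _).2 c1 ?leq_addl.
have mf : measurable_fun hl f.
  apply: (@measurable_fun_cvg _ _ _ _ (fun n => (v_ n).1)) => [n|x _]; last exact: cvf.
  exact: H1_meas0.
have idf n m : integ hl (fun x => ((v_ m).1 x - (v_ n).1 x) ^+ 2).
  have [_ _ i _] := H1_sub (hv m) (hv n).
  by apply: integ_eq i => [|x _]; [exact: mhl|rewrite sub1].
have Ff n : integ hl (fun x => (f x - (v_ n).1 x) ^+ 2) /\
    \int[mu]_(x in hl) ((f x - (v_ n).1 x) ^+ 2) <= (4 ^+ n)^-1.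
  apply: (@fatou_real _ _ (fun m x => ((v_ (m + n)%N).1 x - (v_ n).1 x) ^+ 2)); first exact: mhl.
  - by move=> m; exact: idf.
  - by move=> m x _; exact: sqr_ge0.
  - by apply: measurable_funX; apply: measurable_funB => //; exact: H1_meas0.
  - by move=> x _; apply: (cvs (fun n => (v_ n).1 x)); exact: cvf.
  - by move=> m; rewrite -n0_sub c0 ?leq_addl.
have sqb (a b : R) : `|a ^+ 2| <= 2 * (a - b) ^+ 2 + 2 * b ^+ 2.
  by rewrite ger0_norm ?sqr_ge0//; have := sqr_ge0 (a - 2 * b); rewrite !expr2; nra.
have [_ _ i00 i01] := hv 0%N.
have if2 : integ hl (fun x => f x ^+ 2).
  apply: integ_le (integ_lin 2 2 mhl (Ff 0%N).1 i00); first exact: mhl.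
    exact: measurable_funX.
  by move=> x _; exact: sqb.
have ig0 n : integ hl (fun x => g_ n x ^+ 2).
  have [_ _ _ i] := hv n; apply: (int_negl _ mN N0 i _ _).1; first exact: mhl.
    by apply: measurable_funTS; exact: measurable_funX.
  by move=> x hx Nx; rewrite gE.
have ig2 : integ hl (fun x => g x ^+ 2).
  apply: integ_le (integ_lin 2 2 mhl (Fg 0%N).1 (ig0 0%N)); first exact: mhl.
    by apply: measurable_funTS; exact: measurable_funX.
  by move=> x _; exact: sqb.
have oc_hl (T : R) : `]0, T]%classic `<=` hl.
  by move=> x; rewrite /= in_itv/= halflineE => /andP[].
have loc (T : R) (h : R -> R) : measurable_fun setT h -> integ hl (fun x => h x ^+ 2) -> integ `]0, T] h.
  move=> mh ih; have := integ_halfline_oc T (lexx 0) ih => ih'.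
  apply: integ_le (integD _ (integ_cst_oc 0 T 1) ih') => //; first exact: measurable_funTS.
  move=> x _; rewrite -(real_normK (num_real (h x))); have := sqr_ge0 (`|h x| - 1).
  by rewrite !expr2; have := normr_ge0 (h x); nra.
(* For every [n] the squared defect of the primitive formula is at most a fixed multiple of
   [4 ^ (- n)]: compare with [v_ n], for which there is no defect. *)
have acv : AC f g.
  split=> [T|x]; first exact: loc.
  have [x0|x0] := leP x 0.
    rewrite set_itv_ge ?Rintegral_set0 ?addr0; last by rewrite bnd_simp -leNgt.
    apply/eqP; rewrite -subr_eq0; apply/eqP/(@eq0_of_quarter _ 8) => n.
    have [acn _ _ _] := hv n; have e := AC_neg acn x0.
    have := fx n x; have := fx n 0; rewrite e; move: ((v_ n).1 0) => b.
    have := sqr_ge0 (f x - b + (f 0 - b)); move: ((4 ^+ n)^-1) => q; rewrite !expr2; nra.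
  apply/eqP; rewrite -subr_eq0; apply/eqP/(@eq0_of_quarter _ (3 * (4 + x))) => n.
  have [acn _ _ _] := hv n.
  have ign := loc x _ (mg n) (ig0 n).
  have igg := loc x _ mgg ig2.
  have en : (v_ n).1 x - (v_ n).1 0 = \int[mu]_(t in `]0, x]) g_ n t.
    rewrite (AC_diff acn (lexx 0) (ltW x0)); apply/esym.
    apply: (int_negl _ mN N0 (AC_integ x acn (lexx 0)) _ _).2 => //.
      exact: measurable_funTS.
    by move=> t /oc_hl ht Nt; exact: gE.
  have cs : (\int[mu]_(t in `]0, x]) g t - \int[mu]_(t in `]0, x]) g_ n t) ^+ 2 <= x * (4 ^+ n)^-1.
    have -> : \int[mu]_(t in `]0, x]) g t - \int[mu]_(t in `]0, x]) g_ n t =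
      \int[mu]_(t in `]0, x]) (1 * (g t - g_ n t)).
      rewrite -[X in X - _]mul1r -mulN1r -int_lin//; apply: int_eq => t _; ring.
    have iB := integ_halfline_oc x (lexx 0) (Fg n).1.
    apply: le_trans (cauchy_schwarz _ _ _ _ _) _ => //.
    - by apply: measurable_funTS; exact: measurable_funB.
    - by rewrite expr1n; exact: integ_cst_oc.
    rewrite expr1n int_cst_oc ?(ltW x0)// mul1r subr0 ler_pM2l//.
    apply: le_trans (Fg n).2; apply: int_sub_le => //; first exact: mhl.
      exact: (Fg n).1.
    by move=> t _; exact: sqr_ge0.
  have := fx n x; have := fx n 0; move: cs en.
  move: (\int[mu]_(t in `]0, x]) g t) (\int[mu]_(t in `]0, x]) g_ n t) => I In cs en.
  move: cs; rewrite -en; move: ((v_ n).1 0) ((v_ n).1 x) ((4 ^+ n)^-1) (f x) (f 0) => b a q fx' f0'.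
  have aux (A B C : R) : (A - B - C) ^+ 2 <= 3 * (A ^+ 2 + B ^+ 2 + C ^+ 2).
    have := sqr_ge0 (A + B); have := sqr_ge0 (A + C); have := sqr_ge0 (B - C).
    by rewrite !expr2; nra.
  move=> h1 h2 h3; have := aux (fx' - a) (f0' - b) (I - (a - b)).
  have -> : fx' - a - (f0' - b) - (I - (a - b)) = fx' - (f0' + I) by ring.
  by lra.
have H1v : H1 v by split.
exists v => // n; split; first by rewrite n0_sub; exact: (Ff n).2.
have [_ _ _ i] := H1_sub H1v (hv n).
have -> : n1 (subE v (v_ n)) = \int[mu]_(x in hl) ((g x - g_ n x) ^+ 2).
  apply/esym; apply: (int_negl _ mN N0 i _ _).2; first exact: mhl.
    by apply: measurable_funTS; apply: measurable_funX; exact: measurable_funB.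
  by move=> x hx Nx; rewrite sub2 gE.
exact: (Fg n).2.
Qed.

End Completeness.

(** * Local compactness along an ultrafilter *)

Section Ultrafilter.
Context {R : realType}.
Notation mu := (@lebesgue_measure R).
Notation E := ((R -> R) * (R -> R))%type.
Notation hl := (@halfline R).
Implicit Types (u v w : E) (U : set_system nat).

(** Take the supremum of the levels [t] such that [t <= a n] for [U]-most [n]; an ultrafilter
    decides on which side of any level the sequence lies. One [U] serves all points and all
    precisions at once and so takes the place of diagonal subsequences. *)
Lemma ultra_bounded U (a : nat -> R) (B e : R) : UltraFilter U ->
  (forall n, `|a n| <= B) -> 0 < e ->
  exists2 A, U A & forall n m, A n -> A m -> `|a n - a m| <= e.
Proof.
move=> UU aB e0; pose S := [set t : R | U [set n | t <= a n]].
have B0 : S (- B).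
  rewrite /S /= (_ : [set n | _] = setT); first exact: filterT.
  by apply/seteqP; split => // n _ /=; have := aB n; rewrite ler_norml => /andP[].
have hS : has_sup S.
  split; first by exists (- B).
  exists B => t St; apply: contrapT => tB; apply: (@filter_not_empty _ U _).
  rewrite (_ : set0 = [set n | t <= a n])//.
  apply/esym/seteqP; split => // n /= tn; apply: tB; apply: le_trans tn _.
  by have := aB n; rewrite ler_norml => /andP[].
have e20 : 0 < e / 2 by rewrite divr_gt0.
have [t St ht] := sup_adherent e20 hS.
have nS : ~ S (sup S + e / 2).
  move=> h; have := ub_le_sup hS.2 h; move: (sup S) => s; lra.
have U2 : U (~` [set n | sup S + e / 2 <= a n]).
  by have [|] := in_ultra_setVsetC [set n | sup S + e / 2 <= a n] UU.
exists ([set n | t <= a n] `&` ~` [set n | sup S + e / 2 <= a n]); first exact: filterI.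
move: ht; move: (sup S) => s ht n m [/= h1 /negP]; rewrite -ltNge => h2 [/= h3 /negP].
by rewrite -ltNge => h4; rewrite ler_norml; apply/andP; split; lra.
Qed.

Lemma ultra_grid U (J : nat) (P : nat -> nat -> nat -> Prop) : UltraFilter U ->
  (forall j, exists2 A, U A & forall n m, A n -> A m -> P j n m) ->
  exists2 A, U A & forall j n m, (j <= J)%N -> A n -> A m -> P j n m.
Proof.
move=> UU h; elim: J => [|J [A UA hA]].
  have [A UA hA] := h 0%N; exists A => // j n m; rewrite leqn0 => /eqP ->; exact: hA.
have [A' UA' hA'] := h J.+1; exists (A `&` A'); first exact: filterI.
move=> j n m; rewrite leq_eqVlt ltnS => /orP[/eqP -> [_ ?] [_ ?]|jJ [? _] [? _]].
  exact: hA'.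
exact: hA.
Qed.

(** As in the theorems of Rellich and Arzela-Ascoli, finitely many grid values are close for
    [U]-most indices, [H1_holder] and the bound on [n1] control the values between grid points, and
    the tails are small by hypothesis. *)
Lemma ultra_L2 U (u_ : nat -> E) (K : R) : UltraFilter U -> 0 < K ->
  (forall n, H1 (u_ n)) -> (forall n, n0 (u_ n) + n1 (u_ n) <= K) ->
  (forall e : R, 0 < e -> exists2 T : R, 0 <= T & exists2 A, U A &
     forall n, A n -> \int[mu]_(x in `]T, +oo[) ((u_ n).1 x ^+ 2) <= e) ->
  forall e : R, 0 < e -> exists2 A, U A &
    forall n m, A n -> A m -> n0 (subE (u_ m) (u_ n)) <= e.
Proof.
move=> UU K0 hu hK ht e e0.
have [T0 T00 [A0 UA0 hA0]] := ht (e / 8) (divr_gt0 e0 (ltr0n _ 8)).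
pose T := Num.max T0 1; have T_0 : 0 < T by rewrite lt_max ltr01 orbT.
(* On [[0, T]] the squared difference is to be at most [q]. It is at most 3 times the sum of two
   Holder errors [h * K = q / 12] and of a squared grid difference [de ^+ 2 = q / 6]. *)
pose q := e / (2 * T); have q0 : 0 < q by rewrite divr_gt0// mulr_gt0.
pose h := q / (12 * K); have h0 : 0 < h by rewrite divr_gt0// mulr_gt0.
pose J := Num.bound (T / h).
have hJ : T < J%:R * h by rewrite -ltr_pdivrMr//; apply: archi_boundP; rewrite divr_ge0// ltW.
pose de := Num.sqrt (q / 6); have de0 : 0 < de by rewrite sqrtr_gt0 divr_gt0.
have Kn0 n : n1 (u_ n) <= K by apply: le_trans (hK n); rewrite lerDr n0_ge0.
have bnd n x : `|(u_ n).1 x| <= Num.sqrt (2 * K).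
  rewrite -(@ler_pXn2r _ 2) ?nnegrE ?sqrtr_ge0//.
  rewrite real_normK ?num_real// sqr_sqrtr ?mulr_ge0 ?(ltW K0)//.
  by apply: le_trans (H1_bound x (hu n)) _; rewrite ler_pM2l.
have [A1 UA1 hA1] := @ultra_grid U J (fun j n m => `|(u_ n).1 (j%:R * h) - (u_ m).1 (j%:R * h)| <= de)
  UU (fun j => ultra_bounded UU (fun n => bnd n _) de0).
exists (A0 `&` A1); first exact: filterI.
move=> n m [A0n A1n] [A0m A1m].
have hd := H1_sub (hu m) (hu n); have [_ _ id _] := hd.
rewrite /n0 (int_split (ltW T_0))//.
have -> : e = e / 2 + e / 2 by field.
apply: lerD.
  have -> : e / 2 = \int[mu]_(x in `]0, T]) q.
    by rewrite int_cst_oc ?(ltW T_0)// subr0 /q; field; rewrite gt_eqF.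
  apply: int_le => //; [exact: integ_halfline_oc|exact: integ_cst_oc|].
  move=> x hx; have [x0 xT] : 0 < x /\ x <= T by move: hx; rewrite /= in_itv/= => /andP[].
  pose j := Num.truncn (x / h).
  have xh0 : 0 <= x / h by rewrite divr_ge0// ltW.
  have /andP[j1 j2] := truncn_itv xh0.
  rewrite -/j in j1 j2; rewrite ler_pdivlMr// in j1; rewrite ltr_pdivrMr// in j2.
  have jJ : (j <= J)%N.
    rewrite -(ler_nat R) -(ler_pM2r h0); apply: le_trans j1 _.
    exact: le_trans xT (ltW hJ).
  have jh0 : 0 <= j%:R * h by rewrite mulr_ge0// ltW.
  have gr := hA1 j n m jJ A1n A1m.
  have xj : x - j%:R * h <= h by move: j2; rewrite -natr1 mulrDl mul1r; lra.
  have ho (i : nat) : ((u_ i).1 x - (u_ i).1 (j%:R * h)) ^+ 2 <= h * K.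
    apply: le_trans (H1_holder (hu i) jh0 j1) _.
    by apply: ler_pM => //; [rewrite subr_ge0|exact: n1_ge0].
  have gr2 : ((u_ n).1 (j%:R * h) - (u_ m).1 (j%:R * h)) ^+ 2 <= q / 6.
    have q60 : 0 <= q / 6 by apply: divr_ge0 => //; exact: ltW.
    rewrite -(sqr_sqrtr q60).
    by rewrite -real_normK ?num_real// ler_pXn2r ?nnegrE// ltW.
  have hK' : h * K = q / 12 by rewrite /h; field; rewrite gt_eqF.
  have := ho n; have := ho m; rewrite hK' sub1; move: gr2.
  move: ((u_ n).1 x) ((u_ n).1 (j%:R * h)) ((u_ m).1 x) ((u_ m).1 (j%:R * h)) => a b c d.
  have aux (A B C : R) : (A - B - C) ^+ 2 <= 3 * (A ^+ 2 + B ^+ 2 + C ^+ 2).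
    have := sqr_ge0 (A + B); have := sqr_ge0 (A + C); have := sqr_ge0 (B - C).
    by rewrite !expr2; nra.
  move=> h1 h2 h3; have := aux (c - d) (a - b) (b - d).
  have -> : c - d - (a - b) - (b - d) = c - a by ring.
  by lra.
have sub (i : nat) : integ `]T, +oo[ (fun x => (u_ i).1 x ^+ 2).
  have [_ _ ii _] := hu i; apply: integ_sub ii => //; first exact: mhl.
  by move=> x; rewrite /= in_itv/= andbT halflineE; exact: lt_trans.
have tl (i : nat) : A0 i -> \int[mu]_(x in `]T, +oo[) ((u_ i).1 x ^+ 2) <= e / 8.
  move=> A0i; apply: le_trans (hA0 _ A0i).
  apply: int_sub_le => //.
  - by move=> x; rewrite /= !in_itv/= !andbT; apply: le_lt_trans; rewrite le_max lexx.
  - have [_ _ ii _] := hu i; apply: integ_sub ii => //; first exact: mhl.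
    by move=> x; rewrite /= in_itv/= andbT halflineE; exact: le_lt_trans.
  - by move=> x _; exact: sqr_ge0.
apply: (@le_trans _ _ (\int[mu]_(x in `]T, +oo[) (2 * (u_ m).1 x ^+ 2 + 2 * (u_ n).1 x ^+ 2))).
  apply: int_le => //.
  - apply: integ_sub id => //; first exact: mhl.
    by move=> x; rewrite /= in_itv/= andbT halflineE; exact: lt_trans.
  - exact: integ_lin.
  - move=> x _; rewrite sub1; move: ((u_ m).1 x) ((u_ n).1 x) => a b.
    by have := sqr_ge0 (a + b); rewrite !expr2; nra.
rewrite int_lin//; have := tl _ A0n; have := tl _ A0m; lra.
Qed.

End Ultrafilter.

(** * The variational problem on the ball *)

Section Maximizer.
Context {R : realType}.
Notation mu := (@lebesgue_measure R).
Notation E := ((R -> R) * (R -> R))%type.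
Notation hl := (@halfline R).
Implicit Types (u v w : E).

Lemma sq_powR (t r : R) : 0 <= t -> (t ^+ 2) `^ (r / 2) = t `^ r.
Proof. by move=> t0; rewrite -powR_square// -powRrM; congr (_ `^ _); field. Qed.

Lemma half_sq (y z : R) : (2^-1 * y + 2^-1 * z - y) ^+ 2 <= (z - y) ^+ 2.
Proof.
have -> : 2^-1 * y + 2^-1 * z - y = (z - y) / 2 by field.
by rewrite expr_div_n; have := sqr_ge0 (z - y); lra.
Qed.

Lemma pabs_tangent (r x y : R) : 2 < r ->
  `|y| `^ r + r * (`|y| `^ (r - 2) * y * (x - y)) <= `|x| `^ r.
Proof.
move=> r2; have r1 : 1 < r by lra.
have := @bernoulli R r `|x| `|y| r1 (normr_ge0 x) (normr_ge0 y).
have -> : `|y| `^ (r - 1) = `|y| * `|y| `^ (r - 2).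
  have -> : r - 2 = r - 1 - 1 by ring.
  by rewrite mulr_powRB1//; lra.
move=> h; apply: le_trans h; rewrite lerD2l -(mulrA r) ler_pM2l; last by lra.
have -> : `|y| `^ (r - 2) * y * (x - y) = `|y| `^ (r - 2) * (y * (x - y)) by ring.
have -> : `|y| * `|y| `^ (r - 2) * (`|x| - `|y|) = `|y| `^ (r - 2) * (`|y| * (`|x| - `|y|)) by ring.
apply: ler_wpM2l; first exact: powR_ge0.
rewrite !mulrBr -expr2 -[X in _ <= _ - X]expr2 real_normK ?num_real// lerD2r.
by rewrite -normrM mulrC ler_norm.
Qed.

(** The tangent inequality for [|x| ^ r] is integrated and its linear term split by Young's
    inequality. Since [t] is free, closeness in [n0] alone makes the loss small. *)
Lemma bb_lower (r : R) u v (B t : R) : 2 < r -> H1 u -> H1 v ->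
  (forall x, `|u.1 x| <= B) -> 0 < t ->
  bb r u - r * B `^ (r - 2) * (t * n0 u + t^-1 * n0 (subE v u)) <= bb r v.
Proof.
move=> r2 hu hv hB t0; have iu := bb_integ r2 hu; have iv := bb_integ r2 hv.
have hd := H1_sub hv hu; have [_ _ i0 _] := hu; have [_ _ j0 _] := hd.
have mh := mhl (R := R).
set D := r * B `^ (r - 2); have D0 : 0 <= D by rewrite mulr_ge0 ?powR_ge0//; lra.
have -> : bb r u - D * (t * n0 u + t^-1 * n0 (subE v u)) =
  \int[mu]_(x in hl) (1 * `|u.1 x| `^ r + (- D) * (t * u.1 x ^+ 2 + t^-1 * (subE v u).1 x ^+ 2)).
  by rewrite int_lin ?int_lin//; [rewrite /bb /n0; ring|exact: integ_lin].
apply: int_le => //; first by apply: integ_lin => //; exact: integ_lin.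
move=> x _; apply: le_trans (pabs_tangent (v.1 x) (u.1 x) r2).
rewrite mul1r lerD2l mulNr lerNl sub1.
have aux (p a d b : R) : 0 <= p -> p <= b -> - (p * a * d) <= b * (t * a ^+ 2 + t^-1 * d ^+ 2).
  move=> p0 pb; apply: (@le_trans _ _ (p * (t * a ^+ 2 + t^-1 * d ^+ 2))); last first.
    by rewrite ler_wpM2r// addr_ge0// mulr_ge0 ?sqr_ge0 ?invr_ge0 ?(ltW t0).
  have -> : - (p * a * d) = p * (- (a * d)) by ring.
  rewrite ler_wpM2l// -(ler_pM2l t0).
  have -> : t * (t * a ^+ 2 + t^-1 * d ^+ 2) = (t * a) ^+ 2 + d ^+ 2 by field; rewrite gt_eqF.
  have := sqr_ge0 (t * a + d); have := sqr_ge0 (t * a); have := sqr_ge0 d; rewrite !expr2; nra.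
rewrite /D -[X in _ <= X]mulrA -mulrN; apply: ler_wpM2l; first by lra.
apply: aux; first exact: powR_ge0.
by apply: ge0_ler_powR; rewrite ?nnegrE//; [lra|exact: le_trans (hB x)].
Qed.

Variables (r om al : R) (W : R -> R) (c1 c2 d : R).
Hypotheses (r2 : 2 < r) (om0 : 0 < om) (hW : potential_bounds W c1 c2).
Hypothesis hWinf : forall e : R, 0 < e ->
  exists2 T : R, 0 <= T & forall x, T <= x -> `|W x| <= e.
Let c := fun x => W x + om.
Let pc : potential_bounds c c1 (c2 + om). Proof. exact: pot_shift. Qed.
Local Notation "'aa' u" := (bil al c u u) (at level 10, u at level 9).
Hypotheses (d0 : 0 < d) (hd : forall u, H1 u -> d * n0 u <= aa u).
Hypothesis comp : exists2 w, H1 w &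
  0 < aa w /\ aa w `^ (r / 2) < mline r2 om0 `^ (r / 2 - 1) * bb r w.

Let r_ge0 : 0 <= r. Proof. by move: r2; lra. Qed.
Let r20 : 0 < r / 2. Proof. by move: r2; lra. Qed.
Let r21 : 0 <= r / 2 - 1. Proof. by move: r2; lra. Qed.

Lemma a_scale t u : H1 u -> aa (lc t u 0 u) = t ^+ 2 * aa u.
Proof. by move=> hu; rewrite (bil_sq_lc al pc) //; ring. Qed.

Lemma a_ge0 u : H1 u -> 0 <= aa u.
Proof. by move=> hu; apply: le_trans (hd hu); rewrite mulr_ge0 ?n0_ge0// ltW. Qed.

Lemma coercive : exists2 k : R, 0 < k & forall u, H1 u -> k * (n0 u + n1 u) <= aa u.
Proof. exact (bil_coercive pc d0 hd). Qed.

Lemma unit_ball_bounds : exists K B : R, [/\ 0 < K, 0 <= B &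
  forall u, H1 u -> aa u <= 1 -> [/\ n0 u + n1 u <= K, n0 u <= K &
    forall x, `|u.1 x| <= B]].
Proof.
have [k k0 hk] := coercive; exists k^-1, (Num.sqrt (2 / k)).
have K0 : 0 < k^-1 by rewrite invr_gt0.
split => [//||u hu au]; first exact: sqrtr_ge0.
have nK : n0 u + n1 u <= k^-1.
  by rewrite -(ler_pM2l k0) mulfV ?gt_eqF// (le_trans (hk _ hu)).
split => // [|x]; first by apply: le_trans nK; rewrite lerDl n1_ge0.
rewrite -(@ler_pXn2r _ 2) ?nnegrE ?sqrtr_ge0//.
rewrite real_normK ?num_real// sqr_sqrtr ?divr_ge0 ?(ltW k0)//.
by apply: le_trans (H1_bound x hu) _; rewrite ler_pM2l.
Qed.

Definition Lambda : R := sup [set bb r u | u in [set u | H1 u /\ aa u <= 1]].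

Lemma Lambda_has_sup : has_sup [set bb r u | u in [set u | H1 u /\ aa u <= 1]].
Proof.
have [K [B [K0 B0 hKB]]] := unit_ball_bounds; split.
  exists (bb r ((fun=> 0), (fun=> 0))); exists ((fun=> 0), (fun=> 0)) => //.
  split; first exact: H1_zero.
  have -> : bil al c ((fun=> 0), (fun=> 0)) ((fun=> 0), (fun=> 0)) = 0; last exact: ler01.
  rewrite /bil /= !int_zero; first by ring.
    by move=> x _; ring.
  by move=> x _; ring.
exists (B `^ (r - 2) * K) => _ [u [hu au] <-]; have [_ nK uB] := hKB u hu au.
apply: le_trans (bb_le r2 hu (fun x _ => uB x)).2 _.
by rewrite ler_wpM2l ?powR_ge0.
Qed.

Lemma Lambda_ge u : H1 u -> aa u <= 1 -> bb r u <= Lambda.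
Proof. by move=> hu au; apply: ub_le_sup; [exact: Lambda_has_sup.2|exists u]. Qed.

Lemma Lambda_ineq u : H1 u -> bb r u <= Lambda * aa u `^ (r / 2).
Proof.
move=> hu; have := a_ge0 hu; rewrite le_eqVlt => /orP[/eqP a0|a0].
  have n00 : n0 u = 0.
    apply/eqP; rewrite eq_le n0_ge0 andbT -(ler_pM2l d0) mulr0 a0; exact: hd.
  rewrite /bb int_zero; last first.
    by move=> x _; rewrite (n0_eq0 hu n00) normr0 powR0// gt_eqF//; move: r2; lra.
  rewrite -a0 powR0 ?mulr0// gt_eqF// divr_gt0//; move: r2; lra.
set A := aa u in a0 *; pose t := A `^ (- 2^-1); have t0 : 0 < t by rewrite powR_gt0.
have r0 : 0 < r by move: r2; lra.
have t2 : t ^+ 2 * A = 1.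
  rewrite -powR_square ?(ltW t0)// /t -powRrM mulNr mulVf// powRN powRr1 ?(ltW a0)//.
  by rewrite mulVf ?gt_eqF.
have := Lambda_ge (H1_lc t 0 hu hu); rewrite a_scale// -/A t2 lexx => /(_ isT).
rewrite bb_scale// ?(gtr0_norm t0); last exact: bb_integ.
have tr : t `^ r * A `^ (r / 2) = 1.
  rewrite /t -powRrM -powRD; last by rewrite (gt_eqF a0) implybT.
  by rewrite (_ : _ + _ = 0) ?powRr0//; ring.
move=> h; have := ler_wpM2r (powR_ge0 A (r / 2)) h.
by rewrite mulrAC tr mul1r.
Qed.

Lemma Lambda_gap : 1 < mline r2 om0 `^ (r / 2 - 1) * Lambda.
Proof.
have [w hw [aw lt]] := comp; have p : 0 < aa w `^ (r / 2) by rewrite powR_gt0.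
rewrite -(ltr_pM2r p) mul1r -mulrA; apply: lt_le_trans lt _.
by apply: ler_wpM2l; [exact: powR_ge0|exact: Lambda_ineq].
Qed.

Lemma Lambda_gt0 : 0 < Lambda.
Proof.
have := lt_trans ltr01 Lambda_gap.
have := powR_ge0 (mline r2 om0) (r / 2 - 1); rewrite le_eqVlt => /orP[/eqP <-|p].
  by rewrite mul0r ltxx.
by rewrite pmulr_rgt0.
Qed.

Lemma parallelogram u v : H1 u -> H1 v -> aa u <= 1 -> aa v <= 1 ->
  aa (subE v u) <= 4 - 4 * aa (lc 2^-1 u 2^-1 v) /\ aa (lc 2^-1 u 2^-1 v) <= 1.
Proof.
move=> hu hv au av.
have hs := a_ge0 (H1_sub hv hu); move: hs; rewrite /subE !(bil_sq_lc al pc) //.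
rewrite (bilC al c v u); move: au av.
move: (bil al _ u u) (bil al _ v v) (bil al _ u v) => A B C au av.
by move=> h; split; lra.
Qed.

(* The midpoint of two almost maximizers is an almost maximizer, hence has form almost 1;
   the parallelogram law then makes the maximizing sequence Cauchy. *)
Lemma exists_maximizer_ball : exists v, [/\ H1 v, aa v <= 1 & bb r v = Lambda].
Proof.
have [K [B [K0 B0 hKB]]] := unit_ball_bounds.
have [k k0 hk] := coercive; have L0 := Lambda_gt0.
have ex (n : nat) : exists u, [/\ H1 u, aa u <= 1 & Lambda - n.+1%:R^-1 <= bb r u].
  have n0 : 0 < n.+1%:R^-1 :> R by rewrite invr_gt0.
  have [_ [u [hu au] <-] lt] := sup_adherent n0 Lambda_has_sup.
  by exists u; split => //; exact: ltW.
have [u_ hu_] := choice ex.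
have hu n : H1 (u_ n) by case: (hu_ n).
have au n : aa (u_ n) <= 1 by case: (hu_ n).
have bu n : Lambda - n.+1%:R^-1 <= bb r (u_ n) by case: (hu_ n).
(* [U] contains all final segments, so whatever holds eventually, such as being maximal up to [s],
   holds along [U]. *)
have [U [UU hU]] := ultraFilterLemma eventually_filter.
have near_max (s : R) : 0 < s -> U [set n | Lambda - s <= bb r (u_ n)].
  move=> s0; apply: hU; exists (Num.bound s^-1) => // n /= hn.
  apply: le_trans (bu n); rewrite lerD2l lerN2 -[X in _ <= X]invrK lef_pV2 ?posrE ?invr_gt0//.
  apply: le_trans (ltW (archi_boundP _)) _; first by rewrite invr_ge0 ltW.
  by rewrite ler_nat; exact: leqW.
have L2 := @ultra_L2 _ U u_ K UU K0 hu (fun n => let: And3 h _ _ := hKB _ (hu n) (au n) in h).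
have tight (e : R) : 0 < e -> exists2 T : R, 0 <= T & exists2 A, U A &
     forall n, A n -> \int[mu]_(x in `]T, +oo[) ((u_ n).1 x ^+ 2) <= e.
  move=> e0; have [T [del [T0 del0 hT]]] := tightness hW hWinf d0 hd Lambda_ineq Lambda_gap e0.
  exists T => //; exists [set n | Lambda - del <= bb r (u_ n)]; first exact: near_max.
  by move=> n hn; exact: hT.
have {}L2 := L2 tight.
have close (e : R) : 0 < e -> exists2 A, U A & forall n m, A n -> A m ->
    n0 (subE (u_ m) (u_ n)) + n1 (subE (u_ m) (u_ n)) <= e.
  (* A midpoint within [s] of [Lambda] leaves at most [4 * s / Lambda] in the parallelogram law;
     this is [k * e], which by coercivity bounds the squared [H^1] distance by [e]. *)
  move=> e0; pose s := Lambda * k * e / 4.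
  have s0 : 0 < s by rewrite divr_gt0// !mulr_gt0.
  pose D := r * B `^ (r - 2) + 1.
  have D0 : 0 < D by rewrite ltr_wpDl// mulr_ge0 ?powR_ge0.
  pose t := s / (3 * D * K); have t0 : 0 < t by rewrite divr_gt0// !mulr_gt0.
  have [A UA hA] := L2 (s * t / (3 * D)) (divr_gt0 (mulr_gt0 s0 t0) (mulr_gt0 (ltr0n _ 3) D0)).
  exists (A `&` [set n | Lambda - s / 3 <= bb r (u_ n)]).
    by apply: filterI => //; apply: near_max; rewrite divr_gt0.
  move=> n m [An /= bn] [Am _].
  have [p1 p2] := parallelogram (hu n) (hu m) (au n) (au m).
  set mid := lc 2^-1 (u_ n) 2^-1 (u_ m) in p1 p2.
  have hmid : H1 mid by exact: H1_lc.
  have [_ nK uB] := hKB _ (hu n) (au n).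
  have low := bb_lower r2 (hu n) hmid uB t0.
  have nm : n0 (subE mid (u_ n)) <= s * t / (3 * D).
    apply: le_trans (hA n m An Am); rewrite !n0_sub.
    have := H1_sub (hu m) (hu n); have := H1_sub hmid (hu n).
    move=> [_ _ i1 _] [_ _ i2 _]; apply: int_le; first exact: mhl.
    - by apply: integ_eq i1 => [|x _]; [exact: mhl|rewrite sub1].
    - by apply: integ_eq i2 => [|x _]; [exact: mhl|rewrite sub1].
    - move=> x _; rewrite /mid /lc /=; move: ((u_ n).1 x) ((u_ m).1 x) => y z.
      exact: half_sq.
  have up : bb r mid <= Lambda * aa mid.
    apply: le_trans (Lambda_ineq hmid) _; rewrite ler_pM2l//.
    rewrite -(mulr_powRB1 (a_ge0 hmid) r20) ler_piMr ?a_ge0//.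
    by apply: powR_le1; rewrite ?a_ge0.
  have q1 : r * B `^ (r - 2) * (t * n0 (u_ n) + t^-1 * n0 (subE mid (u_ n))) <= s / 3 + s / 3.
    apply: (@le_trans _ _ (D * (t * K + t^-1 * (s * t / (3 * D))))).
      apply: ler_pM.
      - by rewrite mulr_ge0 ?powR_ge0.
      - by rewrite addr_ge0// mulr_ge0 ?n0_ge0 ?invr_ge0// ltW.
      - by rewrite /D lerDl.
      - by apply: lerD; rewrite ler_pM2l ?invr_gt0.
    by rewrite le_eqVlt; apply/orP; left; apply/eqP; rewrite /t; field; rewrite !gt_eqF.
  have q2 : Lambda - s <= Lambda * aa mid.
    apply: le_trans up; apply: le_trans low; move: q1 bn.
    by move: (r * _ * _) (bb r (u_ n)) => X Y; lra.
  rewrite -(ler_pM2l k0); apply: le_trans (hk _ (H1_sub (hu m) (hu n))) _.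
  apply: le_trans p1 _; rewrite -(ler_pM2l L0).
  have -> : Lambda * (4 - 4 * aa mid) = 4 * (Lambda - Lambda * aa mid) by ring.
  have -> : Lambda * (k * e) = 4 * s by rewrite /s; field.
  by rewrite ler_pM2l// lerBlDr -lerBlDl.
have [A hA] : exists A : nat -> set nat, forall i, U (A i) /\ forall n m, A i n -> A i m ->
    n0 (subE (u_ m) (u_ n)) + n1 (subE (u_ m) (u_ n)) <= (4 ^+ i)^-1.
  have q (i : nat) : exists A, U A /\ forall n m, A n -> A m ->
      n0 (subE (u_ m) (u_ n)) + n1 (subE (u_ m) (u_ n)) <= (4 ^+ i)^-1.
    have p : 0 < (4 ^+ i)^-1 :> R by rewrite invr_gt0 exprn_gt0.
    by have [A UA hA] := close _ p; exists A.
  by have [A hA] := choice q; exists A.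
(* The index [f i] lies in [A 0], ..., [A i] at once and is at least [i], so the chosen sequence is
   Cauchy at the rate [4 ^ (- i)] and still maximizing. *)
have [f hf] : exists f : nat -> nat, forall i, (i <= f i)%N /\ forall j, (j <= i)%N -> A j (f i).
  have q (i : nat) : exists n, (i <= n)%N /\ forall j, (j <= i)%N -> A j n.
    have UB : U [set n | forall j, (j <= i)%N -> A j n].
      elim: i => [|i IH].
        apply: filterS (hA 0%N).1 => n An j; by rewrite leqn0 => /eqP ->.
      apply: filterS (filterI IH (hA i.+1).1) => n [h1 h2] j.
      by rewrite leq_eqVlt ltnS => /orP[/eqP ->//|]; exact: h1.
    have UN : U [set n | (i <= n)%N] by apply: hU; exists i.
    by have [n [h1 h2]] := filter_ex (filterI UN UB); exists n.
  by have [f hf] := choice q; exists f.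
have [v hv hvn] := @H1_complete _ (u_ \o f) (fun n => hu (f n)) (fun n m nm =>
  (hA n).2 (f n) (f m) ((hf n).2 n (leqnn n)) ((hf m).2 n nm)).
have [Cu Cu0 hCu] := bil_up al pc.
have small (e : R) : 0 < e -> exists N, forall n, (N <= n)%N ->
    n0 (subE v (u_ (f n))) <= e /\ n1 (subE v (u_ (f n))) <= e.
  move=> e0; exists (Num.bound e^-1) => n hn.
  have : (4 ^+ n)^-1 <= e.
    rewrite -[e]invrK lef_pV2 ?posrE ?invr_gt0 ?exprn_gt0//.
    apply: le_trans (ltW (archi_boundP _)) _; first by rewrite invr_ge0 ltW.
    by rewrite -natrX ler_nat (leq_trans hn)// ltnW// ltn_expl.
  by move=> h; have [h1 h2] := hvn n; split; [exact: le_trans h1 h|exact: le_trans h2 h].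
have av : aa v <= 1.
  apply/ler_addgt0Pr => e2 e20.
  have [e e0 ->] : exists2 e : R, 0 < e & e2 = 2 * e.
    by exists (e2 / 2); [rewrite divr_gt0|field].
  have e1 : 0 < e / (2 * (1 + e^-1) * (Cu + 1)).
    have p1 : 0 < 1 + e^-1 by rewrite addr_gt0// invr_gt0.
    have p2 : 0 < Cu + 1 by rewrite ltr_wpDl.
    by rewrite divr_gt0// !mulr_gt0.
  have [N hN] := small _ e1; have [s0 s1] := hN N (leqnn N).
  set w := u_ (f N) in s0 s1; have hw : H1 w := hu _; have aw : aa w <= 1 := au _.
  have hs := H1_sub hv hw.
  have hZ := le_trans (ler_norm _) (hCu _ hs).
  have hZ2 : (1 + e^-1) * aa (subE v w) <= e.
    have e'0 : 0 < 1 + e^-1 by rewrite addr_gt0// invr_gt0.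
    rewrite -ler_pdivlMl//; apply: le_trans hZ _.
    apply: (@le_trans _ _ ((Cu + 1) * (2 * (e / (2 * (1 + e^-1) * (Cu + 1)))))).
      apply: ler_pM => //; [by rewrite addr_ge0 ?n0_ge0 ?n1_ge0|by rewrite lerDl|].
      by move: s0 s1; lra.
    have e'n : 1 + e^-1 != 0 by rewrite gt_eqF.
    have cn : Cu + 1 != 0 by rewrite gt_eqF// ltr_wpDl.
    rewrite le_eqVlt; apply/orP; left; apply/eqP; move: e'n cn.
    by move: (1 + e^-1) (Cu + 1) => X Y X0 Y0; field; rewrite X0 Y0.
  (* Positivity of the form at [v - (1 + e) * w] amounts to the weighted Cauchy-Schwarz inequality
     [aa v <= (1 + e) * aa w + (1 + e^-1) * aa (v - w)]. *)
  have := a_ge0 (H1_lc 1 (- (1 + e)) hv hw); rewrite (bil_sq_lc al pc)//.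
  move: hZ2; rewrite /subE (bil_sq_lc al pc)//; move: aw.
  move: (bil al c v v) (bil al c v w) (bil al c w w) => V C Y aw.
  rewrite -(ler_pM2l e0).
  have -> : e * ((1 + e^-1) * (1 ^+ 2 * V + 2 * 1 * -1 * C + (-1) ^+ 2 * Y)) =
    (1 + e) * (V - 2 * C + Y) by field; rewrite gt_eqF.
  move=> h1 h2; rewrite -(ler_pM2l e0).
  have h3 := ler_wpM2l (ltW (mulr_gt0 e0 (addr_gt0 ltr01 e0))) aw.
  by nra.
exists v; split => //.
apply/eqP; rewrite eq_le Lambda_ge//=.
apply/ler_addgt0Pr => e e0.
pose D := r * B `^ (r - 2) + 1.
have D0 : 0 < D by rewrite ltr_wpDl// mulr_ge0 ?powR_ge0.
pose t := e / (3 * D * K); have t0 : 0 < t by rewrite divr_gt0// !mulr_gt0.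
have [N1 hN1] := small (e * t / (3 * D)) (divr_gt0 (mulr_gt0 e0 t0) (mulr_gt0 (ltr0n _ 3) D0)).
pose N := maxn N1 (Num.bound (e / 3)^-1).
have [s0 _] := hN1 N (leq_maxl _ _).
have bN : Lambda - e / 3 <= bb r (u_ (f N)).
  have e30 : 0 < e / 3 by rewrite divr_gt0.
  apply: le_trans (bu _); rewrite lerD2l lerN2 -[X in _ <= X]invrK lef_pV2 ?posrE ?invr_gt0//.
  apply: le_trans (ltW (archi_boundP _)) _; first by rewrite invr_ge0 ltW.
  by rewrite ler_nat; apply: leqW; apply: leq_trans (hf N).1; exact: leq_maxr.
set w := u_ (f N) in s0 bN; have hw : H1 w := hu _; have aw : aa w <= 1 := au _.
have [_ nK uB] := hKB w hw aw.
have low := bb_lower r2 hw hv uB t0.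
have q1 : r * B `^ (r - 2) * (t * n0 w + t^-1 * n0 (subE v w)) <= e / 3 + e / 3.
  apply: (@le_trans _ _ (D * (t * K + t^-1 * (e * t / (3 * D))))).
    apply: ler_pM.
    - by rewrite mulr_ge0 ?powR_ge0.
    - by rewrite addr_ge0// mulr_ge0 ?n0_ge0 ?invr_ge0// ltW.
    - by rewrite /D lerDl.
    - by apply: lerD; rewrite ler_pM2l ?invr_gt0.
  by rewrite le_eqVlt; apply/orP; left; apply/eqP; rewrite /t; field; rewrite !gt_eqF.
apply: (@le_trans _ _ (bb r w - r * B `^ (r - 2) * (t * n0 w + t^-1 * n0 (subE v w)) + e)).
  by move: q1 bN; move: (r * _ * _) (bb r w) => X Y; lra.
by rewrite lerD2r.
Qed.

(** A maximizer has [aa = 1] and [bb = Lambda]. Along its ray [aa] scales like [t ^ 2] and [bb] like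
    [t ^ r], so [t ^ (r - 2) = 1 / Lambda] makes them equal. Their common value [m] satisfies
    [m ^ (r / 2 - 1) * Lambda = 1], which turns [Lambda_ineq] into the last clause. *)
Lemma exists_minimizer : exists w (m : R), [/\ H1 w, 0 < m, aa w = m, bb r w = m &
  forall u, H1 u -> m `^ (r / 2 - 1) * bb r u <= aa u `^ (r / 2)].
Proof.
have [v [hv av bv]] := exists_maximizer_ball; have L0 := Lambda_gt0.
have e1 : 0 < r / 2 - 1 by move: r2; lra.
have rn : r - 2 != 0 by rewrite gt_eqF//; move: r2; lra.
have av1 : aa v = 1.
  apply/eqP; rewrite eq_le av /= leNgt; apply/negP => lt1.
  have := Lambda_ineq hv; rewrite bv -{1}[Lambda]mulr1 ler_pM2l//.
  rewrite leNgt => /negP; apply; rewrite -{2}(one_powR (r / 2)).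
  by apply: gt0_ltr_powR; rewrite ?nnegrE ?a_ge0//; move: e1; lra.
pose t := Lambda `^ (- (r - 2)^-1); have t0 : 0 < t by rewrite powR_gt0.
pose m := t ^+ 2; have m0 : 0 < m by rewrite exprn_gt0.
have mE : m `^ (r / 2 - 1) * Lambda = 1.
  rewrite /m -powR_square ?(ltW t0)// /t -!powRrM.
  rewrite (_ : - _ * (2 * _) = -1); last by field; rewrite rn.
  by rewrite powRN powRr1 ?(ltW L0)// mulVf ?gt_eqF.
have tr : t `^ r * Lambda = m.
  have -> : t `^ r = m * m `^ (r / 2 - 1).
    rewrite mulr_powRB1 ?(ltW m0)//.
    exact/esym/sq_powR/ltW.
  by rewrite -mulrA mE mulr1.
exists (lc t v 0 v), m; split => //.
- exact: H1_lc.
- by rewrite a_scale// av1 mulr1.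
- rewrite bb_scale ?bv ?(gtr0_norm t0)//; first by move: r2; lra.
  exact: bb_integ.
- move=> u hu; have := ler_wpM2l (powR_ge0 m (r / 2 - 1)) (Lambda_ineq hu).
  by rewrite mulrA mE mul1r.
Qed.

End Maximizer.

(** * Weak derivatives and functions on the star graph *)

Section WeakDerivatives.
Context {R : realType}.
Notation mu := (@lebesgue_measure R).
Notation E := ((R -> R) * (R -> R))%type.
Notation hl := (@halfline R).
Implicit Types (u v w : E) (f g h k phi : R -> R).

Lemma cont_int_eq0 h (a b : R) : 0 <= a -> continuous h -> (forall x, 0 <= h x) ->
  integ `]a, b] h -> \int[mu]_(x in `]a, b]) h x = 0 -> forall x, a < x < b -> h x = 0.
Proof.
move=> a0 ch h0 ih i0 x /andP[ax xb]; apply/eqP; rewrite eq_le h0 andbT leNgt.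
apply/negP => hx; have [d dp hd] := cont_eps (ch x) (divr_gt0 hx (ltr0n _ 2)).
pose e := Num.min (d / 2) (b - x).
have e0 : 0 < e by rewrite lt_min divr_gt0//= subr_gt0.
have eb : e <= b - x by rewrite ge_min lexx orbT.
have ed : e < d by apply: (@le_lt_trans _ _ (d / 2)); [rewrite ge_min lexx|lra].
have sub : `]x, (x + e)]%classic `<=` `]a, b]%classic.
  by move=> y; rewrite /= !in_itv/= => /andP[y1 y2]; apply/andP; split; lra.
have : \int[mu]_(y in `]x, (x + e)]) (h x / 2) <= \int[mu]_(y in `]a, b]) h y.
  apply: le_trans (int_sub_le _ _ sub ih _) => //.
  apply: int_le => //; [exact: integ_cst_oc|exact: integ_sub ih|].
  move=> y; rewrite /= in_itv/= => /andP[y1 y2].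
  have : `|y - x| < d by rewrite gtr0_norm; lra.
  by move=> /hd; rewrite ltr_norml => /andP[l _]; lra.
rewrite i0 int_cst_oc; last by lra.
by rewrite leNgt mulr_gt0 ?divr_gt0//; lra.
Qed.

Lemma derive_const f (a b : R) : a <= b -> (forall x : R, a < x < b -> is_derive x 1 f 0) ->
  continuous f -> f a = f b.
Proof.
move=> ab df cf.
have df' x : x \in `]a, b[ -> is_derive x 1 f 0 by rewrite in_itv/=; exact: df.
have [c _ h] := @MVT_segment _ f (fun=> 0) a b ab df' (continuous_subspaceT cf).
by apply/eqP; rewrite eq_sym -subr_eq0 h mul0r.
Qed.

Lemma is_derive_cont f (df : R -> R) : (forall x : R, is_derive x 1 f (df x)) -> continuous f.
Proof.
move=> d x; have dx := d x; apply: differentiable_continuous.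
by apply/derivable1_diffP; exact: ex_derive.
Qed.

Lemma derive_eq0_right f (x y d : R) : is_derive x 1 f d -> x < y ->
  (forall z, x <= z < y -> f z = 0) -> d = 0.
Proof.
move=> df xy f0; apply/eqP; rewrite -normr_eq0 eq_le normr_ge0 andbT.
apply/ler_addgt0Pr => e e0; rewrite add0r.
have [r r0 hr] := deriv_eps df e0.
pose q := Num.min (r / 2) ((y - x) / 2).
have q0 : 0 < q by rewrite lt_min !divr_gt0// subr_gt0.
have qr : q < r by apply: (@le_lt_trans _ _ (r / 2)); [rewrite ge_min lexx|lra].
have qy : x + q < y.
  by rewrite -ltrBrDl; apply: (@le_lt_trans _ _ ((y - x) / 2)); [rewrite ge_min lexx orbT|lra].
have := hr (x + q); rewrite !f0 ?lexx//; last by rewrite lerDl ltW.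
by rewrite addrC addKr (gtr0_norm q0) subrr sub0r normrN normrM (gtr0_norm q0) ler_pM2r//; exact.
Qed.

Lemma exists_test k (a b : R) : 0 < a -> a <= b -> continuous k ->
  (forall x, ~ (a <= x <= b) -> k x = 0) -> \int[mu]_(x in `]a, b]) k x = 0 ->
  exists phi, test_function phi /\ forall x : R, is_derive x 1 phi (k x).
Proof.
move=> a0 ab ck k0 ik.
have [|x hx|Phi dPhi] := is_derive_cutoff_primitive ck (s := b + 1); first by lra.
  apply: k0 => /andP[ax xb]; move: hx; rewrite ger0_norm; lra.
have cPhi := is_derive_cont dPhi.
have d (x : R) : is_derive x 1 (fun t : R => Phi t - Phi a) (k x).
  by apply: dEq (dAdd (dPhi x) (is_derive_cst (- Phi a) x 1)) _; rewrite addr0.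
exists (fun t => Phi t - Phi a); split => //; split.
- by move=> x; have dx := d x; exact: ex_derive.
- move=> x; rewrite (_ : derive1 _ = k); first exact: ck.
  by apply/funext => y; have dy := d y; rewrite derive1E derive_val.
- exists a, b; split => // x hx; apply/eqP; rewrite subr_eq0; apply/eqP.
  have [xa|ax] := leP x a.
    apply: derive_const => // y /andP[_ ya]; rewrite -(k0 y)//.
    by move=> /andP[]; rewrite leNgt ya.
  have bx : b <= x by rewrite leNgt; apply/negP => xb; apply: hx; rewrite !ltW.
  transitivity (Phi b).
    apply/esym/derive_const => // y /andP[yb _]; rewrite -(k0 y)//.
    by move=> /andP[_]; rewrite leNgt yb.
  apply/eqP; rewrite -subr_eq0.
  by have [_ <-] := FTC_oc dPhi ck (ltW a0) ab; rewrite ik.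
Qed.

Lemma test_derive phi : test_function phi -> forall x : R, is_derive x 1 phi (derive1 phi x).
Proof.
by move=> [d _ _] x; apply: DeriveDef; [exact: d|rewrite derive1E].
Qed.

Lemma AC_ibp f g phi : AC f g -> measurable_fun setT g -> test_function phi ->
  [/\ integ hl (fun x => f x * derive1 phi x), integ hl (fun x => g x * phi x) &
  \int[mu]_(x in hl) (f x * derive1 phi x) = - \int[mu]_(x in hl) (g x * phi x)].
Proof.
move=> ac mg tp; have dphi := test_derive tp; have [_ cd [a [b [a0 supp]]]] := tp.
have cphi := is_derive_cont dphi; have cf := AC_continuous ac.
pose T := Num.max b 0 + 1.
have T0 : 0 < T by rewrite ltr_wpDl// le_max lexx orbT.
have Tb : b < T by apply: (@le_lt_trans _ _ (Num.max b 0)); rewrite ?le_max ?lexx// /T ltrDl.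
have phi0 x : T <= x -> phi x = 0.
  by move=> Tx; apply: supp => /andP[_]; rewrite leNgt (lt_le_trans Tb Tx).
have dphi0 x : T <= x -> derive1 phi x = 0.
  move=> Tx; have x1 : x < x + 1 by rewrite ltrDl.
  apply: (derive_eq0_right (dphi x) x1) => z /andP[xz _]; apply: phi0; exact: le_trans xz.
have p0 : phi 0 = 0 by apply: supp => /andP[]; rewrite leNgt a0.
have acp := AC_C1 dphi cd.
have acm := AC_mul ac acp.
have ig T' := AC_integ T' ac (lexx 0).
have M1 := cont_bounded 0 T cphi; have M2 := cont_bounded 0 T cd; have M3 := cont_bounded 0 T cf.
have i1 : integ `]0, T] (fun x => derive1 phi x * f x).
  have [M hM] := M2; apply: (@integ_mulb _ _ _ _ M) => //.
  - by apply: measurable_funTS; exact: continuous_measurable_fun.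
  - by move=> x; rewrite /= in_itv/= => /andP[x0 xT]; rewrite hM// (ltW x0).
  - have [M' hM'] := M3; apply: integ_le (integ_cst_oc 0 T M') => //.
      by apply: measurable_funTS; exact: continuous_measurable_fun.
    by move=> x; rewrite /= in_itv/= => /andP[x0 xT]; rewrite hM'// (ltW x0).
have i2 : integ `]0, T] (fun x => phi x * g x).
  have [M hM] := M1; apply: (@integ_mulb _ _ _ _ M) => //.
  - by apply: measurable_funTS; exact: continuous_measurable_fun.
  - by move=> x; rewrite /= in_itv/= => /andP[x0 xT]; rewrite hM// (ltW x0).
have z1 x : `]T, +oo[%classic x -> 0 = f x * derive1 phi x.
  by rewrite /= in_itv/= andbT => /ltW Tx; rewrite dphi0// mulr0.
have z2 x : `]T, +oo[%classic x -> 0 = g x * phi x.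
  by rewrite /= in_itv/= andbT => /ltW Tx; rewrite phi0// mulr0.
have i1' : integ `]0, T] (fun x => f x * derive1 phi x).
  by apply: integ_eq i1 => // x _; rewrite mulrC.
have i2' : integ `]0, T] (fun x => g x * phi x).
  by apply: integ_eq i2 => // x _; rewrite mulrC.
have j1 : integ hl (fun x => f x * derive1 phi x).
  by apply: (integ_split (ltW T0)) => //; apply: integ_eq (integ0 _).
have j2 : integ hl (fun x => g x * phi x).
  by apply: (integ_split (ltW T0)) => //; apply: integ_eq (integ0 _).
split => //; rewrite (int_split (ltW T0) j1) (int_split (ltW T0) j2).
rewrite (int_zero (fun x hx => esym (z1 x hx))) (int_zero (fun x hx => esym (z2 x hx))) !addr0.
apply/eqP; rewrite -addr_eq0 addrC -[X in X + _]mul1r -[X in _ + X]mul1r -int_lin//.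
apply/eqP; transitivity ((f T * phi (Num.max T 0)) - (f 0 * phi (Num.max 0 0))).
  rewrite (AC_diff acm (lexx 0) (ltW T0)); apply: int_eq => x.
  by rewrite /= in_itv/= => /andP[x0 _]; rewrite max_l ?ltW//; ring.
by rewrite max_l ?(ltW T0)// maxxx phi0// p0 !mulr0 subrr.
Qed.

Lemma int_supp h (a b : R) : 0 <= a -> a <= b -> integ `]a, b] h ->
  (forall x, ~ (a < x <= b) -> h x = 0) ->
  integ hl h /\ \int[mu]_(x in hl) h x = \int[mu]_(x in `]a, b]) h x.
Proof.
move=> a0 ab ih h0; have b0 := le_trans a0 ab.
have z1 x : `]0, a]%classic x -> h x = 0.
  by rewrite /= in_itv/= => /andP[_ xa]; apply: h0; rewrite ltNge xa.
have z2 x : `]b, +oo[%classic x -> h x = 0.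
  by rewrite /= in_itv/= andbT => bx; apply: h0; rewrite leNgt bx andbF.
have i1 : integ `]0, b] h.
  rewrite (itv_oc_cat a0 ab); apply: integ_setU => //; first exact: disj_oc_oc.
  by apply: integ_eq (integ0 _) => // x /z1 ->.
have i2 : integ hl h.
  by apply: (integ_split b0) => //; apply: integ_eq (integ0 _) => // x /z2 ->.
split => //; rewrite (int_split b0)// (int_oc_cat a0 ab)//.
by rewrite (int_zero z1) (int_zero z2) add0r addr0.
Qed.

Lemma continuous_clip (a : R) (F : R -> R) : (forall x : R, 0 < x -> {for x, continuous F}) -> 0 < a ->
  continuous (fun x => F (Num.max x a)).
Proof.
move=> cF a0 x; apply: continuous_comp.
  by apply: continuous_max; [exact: cvg_id|exact: cvg_cst].
by apply: cF; rewrite lt_max a0 orbT.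
Qed.

(* Test with a primitive of [(D - m) * chi], where [chi] is a bump on [a, b] and [m] the
   mean of [D] weighted by [chi]. *)
Lemma const_of_weak (D : R -> R) : (forall x : R, 0 < x -> {for x, continuous D}) ->
  (forall phi, test_function phi -> \int[mu]_(x in hl) (D x * derive1 phi x) = 0) ->
  forall a b, 0 < a -> a < b -> D a = D b.
Proof.
move=> cD hD a0 b0 a00 ab0.
pose a := a0 / 2; pose b := b0 + 1.
have a_0 : 0 < a by rewrite divr_gt0.
have aa0 : a < a0 by rewrite /a; lra.
have bb0 : b0 < b by rewrite /b; lra.
have ab : a < b by apply: lt_trans bb0; exact: lt_trans ab0.
pose D0 x := D (Num.max x a).
have cD0 : continuous D0 by exact: continuous_clip.
pose chi x := Num.max 0 (x - a) * Num.max 0 (b - x).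
have cchi : continuous chi.
  have cp : continuous (fun t : R => Num.max 0 t).
    by move=> t; apply: continuous_max; [exact: cvg_cst|exact: cvg_id].
  move=> x; apply: cvgM.
    apply: (@continuous_comp _ _ _ (fun x : R => x - a)); last exact: cp.
    by apply: cvgB; [exact: cvg_id|exact: cvg_cst].
  apply: (@continuous_comp _ _ _ (fun x : R => b - x)); last exact: cp.
  by apply: cvgB; [exact: cvg_cst|exact: cvg_id].
have chi0 x : 0 <= chi x by rewrite mulr_ge0// le_max lexx.
have chip x : a < x < b -> 0 < chi x.
  by move=> /andP[h1 h2]; rewrite mulr_gt0// lt_max subr_gt0 ?h1 ?h2 orbT.
have chiz x : ~ (a < x <= b) -> chi x = 0.
  move=> h; rewrite /chi; have [xa|ax] := leP x a.
    by rewrite max_l ?mul0r// subr_le0.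
  have bx : b <= x by rewrite leNgt; apply/negP => xb; apply: h; rewrite ax ltW.
  by rewrite [Num.max 0 (b - x)]max_l ?mulr0// subr_le0.
have ichi : integ `]a, b] chi by exact: cont_integ.
pose I0 := \int[mu]_(x in `]a, b]) chi x.
have I0n : I0 != 0.
  apply/eqP => z; have := cont_int_eq0 (ltW a_0) cchi chi0 ichi z (x := a0).
  by rewrite aa0 (lt_trans ab0 bb0) => /(_ isT) e; have := chip a0; rewrite aa0 (lt_trans ab0 bb0) e ltxx => /(_ isT).
have cDchi : continuous (fun x => D0 x * chi x) by move=> x; apply: cvgM; [exact: cD0|exact: cchi].
have iDchi : integ `]a, b] (fun x => D0 x * chi x) by exact: cont_integ.
pose m := (\int[mu]_(x in `]a, b]) (D0 x * chi x)) / I0.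
pose k x := (D0 x - m) * chi x.
have ck : continuous k.
  move=> x; apply: cvgM; last exact: cchi.
  by apply: cvgB; [exact: cD0|exact: cvg_cst].
have ik : integ `]a, b] k by exact: cont_integ.
have k0 : \int[mu]_(x in `]a, b]) k x = 0.
  have -> : \int[mu]_(x in `]a, b]) k x =
    \int[mu]_(x in `]a, b]) (1 * (D0 x * chi x) + (- m) * chi x).
    by apply: int_eq => x _; rewrite /k; ring.
  by rewrite int_lin// -/I0 /m; field.
have kz x : ~ (a < x <= b) -> k x = 0 by move=> h; rewrite /k chiz// mulr0.
have kz' x : ~ (a <= x <= b) -> k x = 0.
  by move=> hx; apply: kz => /andP[h1 h2]; apply: hx; rewrite (ltW h1).
have [phi [tphi dphi]] := exists_test a_0 (ltW ab) ck kz' k0.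
have ephi x : derive1 phi x = k x by have d := dphi x; rewrite derive1E derive_val.
have ck2 : continuous (fun x => (D0 x - m) * k x).
  move=> x; apply: cvgM; last exact: ck.
  by apply: cvgB; [exact: cD0|exact: cvg_cst].
have ik2 : integ `]a, b] (fun x => (D0 x - m) * k x) by exact: cont_integ.
have cDk : continuous (fun x => D0 x * k x) by move=> x; apply: cvgM; [exact: cD0|exact: ck].
have iDk : integ `]a, b] (fun x => D0 x * k x) by exact: cont_integ.
have e0 : \int[mu]_(x in `]a, b]) (D0 x * k x) = 0.
  have iDk' : integ `]a, b] (fun x => D x * derive1 phi x).
    apply: integ_eq iDk => // x; rewrite /= in_itv/= => /andP[ax _].
    by rewrite ephi /D0 max_l// ltW.
  have [_ <-] : integ hl (fun x => D x * derive1 phi x) /\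
      \int[mu]_(x in hl) (D x * derive1 phi x) = \int[mu]_(x in `]a, b]) (D0 x * k x).
    have [h1 h2] := int_supp (ltW a_0) (ltW ab) iDk' (fun x hx => etrans (congr1 (fun z => D x * z) (etrans (ephi x) (kz x hx))) (mulr0 _)).
    split => //; rewrite h2; apply: int_eq => x; rewrite /= in_itv/= => /andP[ax _].
    by rewrite ephi /D0 max_l// ltW.
  exact: hD.
have e1 : \int[mu]_(x in `]a, b]) ((D0 x - m) * k x) = 0.
  have -> : \int[mu]_(x in `]a, b]) ((D0 x - m) * k x) =
    \int[mu]_(x in `]a, b]) (1 * (D0 x * k x) + (- m) * k x).
    by apply: int_eq => x _; ring.
  by rewrite int_lin// e0 k0 !mulr0 addr0.
have pos x : 0 <= (D0 x - m) * k x.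
  by rewrite /k mulrA -expr2 mulr_ge0 ?sqr_ge0.
have Dm x : a < x < b -> D x = m.
  move=> hx; have := cont_int_eq0 (ltW a_0) ck2 pos ik2 e1 hx.
  rewrite /k mulrA -expr2 => /eqP; rewrite mulf_eq0 (gt_eqF (chip x hx)) orbF sqrf_eq0 subr_eq0.
  by move: hx => /andP[ax _]; rewrite /D0 max_l ?(ltW ax)// => /eqP.
by rewrite !Dm// ?aa0 ?(lt_trans ab0 bb0)// bb0 (lt_trans aa0 ab0).
Qed.

(** [const_of_weak] applies to [F - h], where [h] is the primitive of [g], since [AC_ibp] gives both
    functions the same weak derivative; the limit at 0 identifies the constant. *)
Lemma du_Bois_Reymond (F g : R -> R) (l : R) : (forall x : R, 0 < x -> {for x, continuous F}) ->
  F x @[x --> 0^'+] --> l -> measurable_fun setT g -> (forall T, integ `]0, T] g) ->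
  (forall phi, test_function phi ->
    \int[mu]_(x in hl) (F x * derive1 phi x) = - \int[mu]_(x in hl) (g x * phi x)) ->
  forall x, 0 < x -> F x = l + \int[mu]_(t in `]0, x]) g t.
Proof.
move=> cF Fl mg ig weak; pose h x := \int[mu]_(t in `]0, x]) g t.
have h0 : h 0 = 0 by rewrite /h set_itv_ge ?Rintegral_set0// bnd_simp ltxx.
have ach : AC h g by split => // x; rewrite h0 add0r.
have ch := AC_continuous ach.
have cD x : 0 < x -> {for x, continuous (fun x => F x - h x)}.
  by move=> x0; apply: cvgB; [exact: cF|exact: ch].
have weakD phi : test_function phi -> \int[mu]_(x in hl) ((F x - h x) * derive1 phi x) = 0.
  move=> tp; have [i1 i2 e] := AC_ibp ach mg tp.
  have dphi := test_derive tp; have [_ cd [a [b [a0 supp]]]] := tp.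
  have [ab|ba] := leP a b; last first.
    rewrite int_zero// => x _.
    have x1 : x < x + 1 by rewrite ltrDl.
    rewrite (derive_eq0_right (dphi x) x1) ?mulr0// => z _; apply: supp => /andP[az zb].
    by have := le_trans az zb; rewrite leNgt ba.
  have dz x : ~ (a / 2 < x <= b) -> derive1 phi x = 0.
    move=> hx; have [xa|ax] := ltP x a.
      apply: (derive_eq0_right (dphi x) xa) => z /andP[_ za]; apply: supp.
      by rewrite leNgt za.
    have bx : b < x.
      by rewrite ltNge; apply/negP => xb; apply: hx; rewrite xb andbT (lt_le_trans _ ax)// ltr_pdivrMr// ltr_pMr// ltr1n.
    have x1 : x < x + 1 by rewrite ltrDl.
    apply: (derive_eq0_right (dphi x) x1) => z /andP[xz _]; apply: supp.
    by rewrite [z <= b]leNgt (lt_le_trans bx xz) andbF.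
  have {}ab : a / 2 <= b by apply: le_trans ab; rewrite ler_pdivrMr// ler_peMr ?ler1n// ltW.
  have a20 : 0 < a / 2 by rewrite divr_gt0.
  move: {supp a0} (a / 2) a20 ab dz => {}a a0 ab dz.
  have iF : integ `]a, b] (fun x => F x * derive1 phi x).
    have : integ `]a, b] (fun x => F (Num.max x a) * derive1 phi x).
      apply: cont_integ => x; apply: cvgM; last exact: cd.
      exact: continuous_clip.
    apply: integ_eq => // x; rewrite /= in_itv/= => /andP[ax _].
    by rewrite max_l// ltW.
  have [iF' _] := int_supp (ltW a0) ab iF (fun x hx => etrans (congr1 (fun z => F x * z) (dz x hx)) (mulr0 _)).
  have -> : \int[mu]_(x in hl) ((F x - h x) * derive1 phi x) =
    \int[mu]_(x in hl) (1 * (F x * derive1 phi x) + (-1) * (h x * derive1 phi x)).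
    by apply: int_eq => x _; ring.
  by rewrite int_lin//; [rewrite weak// e; ring|exact: mhl].
have cst := const_of_weak cD weakD.
move=> x x0; apply/eqP; rewrite -subr_eq; apply/eqP.
have c1 : (F y - h y) @[y --> 0^'+] --> l.
  have el : l = l - h 0 by rewrite h0 subr0.
  rewrite [X in _ --> X]el; apply: cvgB => //; apply: cvg_at_right_filter; exact: ch.
have c2 : (F y - h y) @[y --> 0^'+] --> F x - h x.
  apply: cvg_near_cst; near=> y; have y0 : 0 < y by [].
  have [yx|xy|->//] := ltgtP y x; first exact: cst.
  by apply/esym/cst.
exact: cvg_unique c2 c1.
Unshelve. all: by end_near. Qed.

Lemma sq_loc_integ g (T : R) : measurable_fun setT g -> integ hl (fun x => g x ^+ 2) ->
  integ `]0, T] g.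
Proof.
move=> mg ig; have ig' := integ_halfline_oc T (lexx 0) ig.
apply: integ_le (integD _ (integ_cst_oc 0 T 1) ig') => //; first exact: measurable_funTS.
move=> x _; rewrite -(real_normK (num_real (g x))); have := sqr_ge0 (`|g x| - 1).
by rewrite !expr2; have := normr_ge0 (g x); nra.
Qed.

(** The derivative component is [g] itself on the half-line, so that pointwise identities for a
    chosen weak derivative carry over to [u.2]; on the left it is continued by 0. *)
Lemma weak_H1 (F g : R -> R) (l : R) : (forall x : R, 0 < x -> {for x, continuous F}) ->
  F x @[x --> 0^'+] --> l -> measurable_fun hl g ->
  integ hl (fun x => F x ^+ 2) -> integ hl (fun x => g x ^+ 2) ->
  (forall phi, test_function phi ->
    \int[mu]_(x in hl) (F x * derive1 phi x) = - \int[mu]_(x in hl) (g x * phi x)) ->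
  exists u, [/\ H1 u, u.1 0 = l, forall x, 0 < x -> u.1 x = F x &
     forall x, 0 < x -> u.2 x = g x].
Proof.
move=> cF Fl mg iF ig weak; pose g' := g \_ hl.
have g'E x : 0 < x -> g' x = g x.
  by move=> x0; rewrite /g' patchE mem_set ?halflineE.
have mg' : measurable_fun setT g'.
  by apply: (iffLR (measurable_restrictT _ _)) => //; exact: mhl.
have ig' : integ hl (fun x => g' x ^+ 2).
  by apply: integ_eq ig => [|x]; [exact: mhl|rewrite halflineE => x0; rewrite g'E].
have il T : integ `]0, T] g' by exact: sq_loc_integ.
have weak' phi : test_function phi ->
    \int[mu]_(x in hl) (F x * derive1 phi x) = - \int[mu]_(x in hl) (g' x * phi x).
  move=> tp; rewrite weak//; congr (- _); apply: int_eq => x.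
  by rewrite halflineE => x0; rewrite g'E.
have FE := du_Bois_Reymond cF Fl mg' il weak'.
exists (fun x => l + \int[mu]_(t in `]0, x]) g' t, g').
have l0 : l + \int[mu]_(t in `]0, 0]) g' t = l.
  by rewrite set_itv_ge ?Rintegral_set0 ?addr0// bnd_simp ltxx.
split => //=; last by move=> x x0; rewrite FE.
split => //=; first by split => // x; rewrite l0.
by apply: integ_eq iF => [|x]; [exact: mhl|rewrite halflineE => x0; rewrite FE].
Qed.

(** All integrals of [u.2] over []0, y]] vanish, so [u.2] vanishes almost everywhere by Lebesgue's
    differentiation theorem. The value at 0, which the hypothesis leaves open, is reached through
    [H1_holder]. *)
Lemma AC_deriv_unique u : H1 u -> (forall x, 0 < x -> u.1 x = 0) -> n1 u = 0.
Proof.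
move=> hu u0; have [ac m2 _ i1] := hu.
have u0' x : u.1 x = 0.
  have [x0|/(u0 x)//] := leP x 0.
  rewrite (AC_neg ac x0); apply/eqP; rewrite -sqrf_eq0 eq_le sqr_ge0 andbT.
  apply/ler_addgt0Pr => e e0; rewrite add0r.
  have p : 0 < n1 u + 1 by rewrite ltr_wpDl ?n1_ge0.
  have q : 0 < e / (n1 u + 1) by rewrite divr_gt0.
  have := H1_holder hu (lexx 0) (ltW q); rewrite u0// sub0r sqrrN subr0 => h.
  by apply: le_trans h _; rewrite mulrAC ler_pdivrMr// ler_pM2l// lerDl ler01.
apply/eqP; rewrite eq_le n1_ge0 andbT.
have /(_ _)[] // := @integ_sup R (fun x => u.2 x ^+ 2) 0 0.
- by apply: measurable_funTS; exact: measurable_funX.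
- by move=> x _; exact: sqr_ge0.
move=> T T0; split; first exact: integ_halfline_oc.
pose d := u.2 \_ `]0, T].
have idT : integ `]0, T] u.2 by exact: AC_integ ac (lexx 0).
have mT : measurable (`]0, T]%classic : set (measurableTypeR R)) by [].
have id : integ setT d.
  by have := iffLR (integrable_mkcond _ mT) idT; rewrite restrict_EFin.
have int0 (y : R) : \int[mu]_(t in `]0, y]) d t = 0.
  rewrite -Rintegral_mkcondr.
  have [y0|y0] := leP y 0.
    by rewrite set_itv_ge ?set0I ?Rintegral_set0// bnd_simp -leNgt.
  have -> : `]0, y] `&` `]0, T] = `]0, (Num.min y T)]%classic.
    apply/seteqP; split => x /=; rewrite !in_itv/= le_min.
      by move=> [/andP[-> ->] /andP[_ ->]].
    by move=> /andP[-> /andP[-> ->]].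
  have yT : 0 <= Num.min y T by rewrite le_min (ltW y0) T0.
  by rewrite -(AC_diff ac (lexx 0) yT) !u0' subrr.
have F0 : (fun x => \int[mu]_(t in `]0, x]) d t) = cst 0 by apply/funext.
have loc : locally_integrable [set: R] d.
  exact (open_integrable_locally openT id).
have := @FTC1 R d (BRight 0) (fun y => integ_sub measurableT (measurable_itv _) (@subsetT _ _) id) loc.
rewrite /= => -[N [mN N0 sub]].
have aed x : `]0, T]%classic x -> ~ N x -> (0 : R) = u.2 x ^+ 2.
  move=> hx Nx; have := contrapT (fun nx => Nx (sub x nx)).
  have x0 : 0 < x by move: hx; rewrite /= in_itv/= => /andP[].
  rewrite /= lte_fin x0 => /(_ isT) [_].
  have -> : (fun x => \int[mu]_(t in [set` Interval (BRight 0) (BRight x)]) d t) = cst 0 by exact: F0.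
  by rewrite derive1_cst /d patchE mem_set// => <-; rewrite expr0n.
have mm : measurable_fun `]0, T] (fun x => u.2 x ^+ 2).
  by apply: measurable_funTS; exact: measurable_funX.
have [_ ->] := int_negl (measurable_itv _) mN N0 (integ0 `]0, T]) mm aed.
by rewrite int_zero.
Qed.

End WeakDerivatives.

(** * Complex limits by components *)

Section ComplexLimits.
Context {R : realType}.
Implicit Types (z l : R[i]) (f : R -> R[i]).

Lemma modulus_sq z : modulus z ^+ 2 = complex.Re z ^+ 2 + complex.Im z ^+ 2.
Proof.
by case: z => a b; rewrite /modulus /ComplexField.Normc.normc /= sqr_sqrtr// addr_ge0// sqr_ge0.
Qed.

Lemma modulus_ge0 z : 0 <= modulus z.
Proof. by case: z => a b; exact: sqrtr_ge0. Qed.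

Lemma normE z : `|z| = (modulus z)%:C.
Proof. by rewrite normc_def; case: z. Qed.

Lemma Re_le_modulus z : `|complex.Re z| <= modulus z.
Proof.
rewrite -(@ler_pXn2r _ 2) ?nnegrE ?modulus_ge0// modulus_sq real_normK ?num_real//.
by rewrite lerDl sqr_ge0.
Qed.

Lemma Im_le_modulus z : `|complex.Im z| <= modulus z.
Proof.
rewrite -(@ler_pXn2r _ 2) ?nnegrE ?modulus_ge0// modulus_sq real_normK ?num_real//.
by rewrite lerDr sqr_ge0.
Qed.

Lemma modulus_le z : modulus z <= `|complex.Re z| + `|complex.Im z|.
Proof.
rewrite -(@ler_pXn2r _ 2) ?nnegrE ?modulus_ge0 ?addr_ge0// modulus_sq sqrrD.
rewrite !real_normK ?num_real// lerD2r lerDl mulrn_wge0// mulr_ge0//.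
Qed.

Lemma ReB z l : complex.Re (z - l) = complex.Re z - complex.Re l.
Proof. by case: z l => [a b] [c d]. Qed.

Lemma ImB z l : complex.Im (z - l) = complex.Im z - complex.Im l.
Proof. by case: z l => [a b] [c d]. Qed.

Lemma cvg_complexP (F : set_system R) (FF : Filter F) f l :
  ((f x : R[i]^o) @[x --> F] --> (l : R[i]^o)) <->
  (complex.Re (f x) @[x --> F] --> complex.Re l /\
   complex.Im (f x) @[x --> F] --> complex.Im l).
Proof.
split=> [/cvgrPdist_lt h|[/cvgrPdist_lt h1 /cvgrPdist_lt h2]].
  have key (e : R) : 0 < e -> \near F, modulus (l - f F) < e.
    move=> e0; have e0' : 0 < e%:C :> R[i] by rewrite ltcR.
    by apply: filterS (h _ e0') => x; rewrite normE ltcR.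
  split; apply/cvgrPdist_lt => e e0; apply: filterS (key e e0) => x; apply: le_lt_trans.
    by rewrite -ReB Re_le_modulus.
  by rewrite -ImB Im_le_modulus.
apply/cvgrPdist_lt => -[e e'] he.
(* In the order of [R[i]] a positive radius is real. *)
have [e0 ->] : 0 < e /\ e' = 0 by move: he; rewrite ltcE /= => /andP[/eqP -> ->].
have e20 : 0 < e / 2 by rewrite divr_gt0.
apply: filterS (filterI (h1 _ e20) (h2 _ e20)) => x [k1 k2].
rewrite normE; change ((modulus (l - f x))%:C < e%:C); rewrite ltcR.
apply: le_lt_trans (modulus_le _) _; rewrite ReB ImB.
by move: k1 k2; lra.
Qed.

Lemma complex_eq z l : complex.Re z = complex.Re l -> complex.Im z = complex.Im l -> z = l.
Proof. by case: z l => [a b] [c d] /= -> ->. Qed.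

End ComplexLimits.

(** * Complex functions as pairs of real ones *)

Section ComplexPairs.
Context {R : realType}.
Notation mu := (@lebesgue_measure R).
Notation E := ((R -> R) * (R -> R))%type.
Notation hl := (@halfline R).
Implicit Types (u v w : E) (f g : R -> R[i]).

Definition pair_of u w (x : R) : R[i] := u.1 x +i* w.1 x.

Lemma square_integrableP f : square_integrable f <->
  [/\ measurable_fun hl (fun x => complex.Re (f x)), measurable_fun hl (fun x => complex.Im (f x)),
      integ hl (fun x => complex.Re (f x) ^+ 2) & integ hl (fun x => complex.Im (f x) ^+ 2)].
Proof.
split=> [[m1 m2 i]|[m1 m2 i1 i2]].
  have i' : integ hl (fun x => modulus (f x) ^+ 2) by [].
  split => //; apply: integ_le i'; try exact: mhl; try exact: measurable_funX.
    by move=> x _; rewrite ger0_norm ?sqr_ge0// modulus_sq lerDl sqr_ge0.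
  by move=> x _; rewrite ger0_norm ?sqr_ge0// modulus_sq lerDr sqr_ge0.
split => //; have := integD mhl i1 i2; apply: integ_eq => [|x _]; first exact: mhl.
by rewrite modulus_sq.
Qed.

Lemma ReMr z (a : R) : complex.Re (z * a%:C) = complex.Re z * a.
Proof. by case: z => b c /=; ring. Qed.

Lemma ImMr z (a : R) : complex.Im (z * a%:C) = complex.Im z * a.
Proof. by case: z => b c /=; ring. Qed.

Lemma weak_derivativeP f g : weak_derivative f g <->
  forall phi, test_function phi ->
   (\int[mu]_(x in hl) (complex.Re (f x) * derive1 phi x) =
      - \int[mu]_(x in hl) (complex.Re (g x) * phi x)) /\
   (\int[mu]_(x in hl) (complex.Im (f x) * derive1 phi x) =
      - \int[mu]_(x in hl) (complex.Im (g x) * phi x)).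
Proof.
have eR h (k : R -> R) : integral_halfline (fun x => complex.Re (h x * (k x)%:C)) =
    \int[mu]_(x in hl) (complex.Re (h x) * k x).
  by apply: int_eq => x _; rewrite ReMr.
have eI h (k : R -> R) : integral_halfline (fun x => complex.Im (h x * (k x)%:C)) =
    \int[mu]_(x in hl) (complex.Im (h x) * k x).
  by apply: int_eq => x _; rewrite ImMr.
split=> h phi tp.
  have := h phi tp; rewrite /cintegral_halfline !eR !eI => e.
  by split; [exact: (congr1 (@complex.Re R) e)|exact: (congr1 (@complex.Im R) e)].
have [h1 h2] := h phi tp; rewrite /cintegral_halfline !eR !eI h1 h2.
exact: complex_eq.
Qed.

Lemma pairs_of_weak f g (l : R[i]) :
  (forall x : R, 0 < x -> {for x, continuous (f : R -> R[i]^o)}) ->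
  (f x : R[i]^o) @[x --> (0 : R)^'+] --> (l : R[i]^o) ->
  square_integrable f -> square_integrable g -> weak_derivative f g ->
  exists u w, [/\ H1 u, H1 w, l = pair_of u w 0, forall x, 0 < x -> f x = pair_of u w x &
    forall x, 0 < x -> g x = u.2 x +i* w.2 x].
Proof.
move=> cf fl /square_integrableP[mf1 mf2 if1 if2] /square_integrableP[mg1 mg2 ig1 ig2].
move=> /weak_derivativeP weak.
have /cvg_complexP[l1 l2] := fl.
have c1 (x : R) : 0 < x -> {for x, continuous (fun x => complex.Re (f x))}.
  by move=> x0; have /cvg_complexP[] := cf x x0.
have c2 (x : R) : 0 < x -> {for x, continuous (fun x => complex.Im (f x))}.
  by move=> x0; have /cvg_complexP[] := cf x x0.
have [u [hu u0 uf ug]] := weak_H1 c1 l1 mg1 if1 ig1 (fun phi tp => (weak phi tp).1).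
have [w [hw w0 wf wg]] := weak_H1 c2 l2 mg2 if2 ig2 (fun phi tp => (weak phi tp).2).
exists u, w; split => //.
- by apply: complex_eq.
- by move=> x x0; apply: complex_eq => /=; rewrite ?uf ?wf.
- by move=> x x0; apply: complex_eq => /=; rewrite ?ug ?wg.
Qed.

Lemma H1_halfline_pair u w f : H1 u -> H1 w -> (forall x, 0 < x -> f x = pair_of u w x) ->
  [/\ forall x : R, 0 < x -> {for x, continuous (f : R -> R[i]^o)},
      (f x : R[i]^o) @[x --> (0 : R)^'+] --> (pair_of u w 0 : R[i]^o),
      square_integrable f, square_integrable (fun x => u.2 x +i* w.2 x) &
      weak_derivative f (fun x => u.2 x +i* w.2 x)].
Proof.
move=> hu hw fE; have [acu mu2 iu0 iu1] := hu; have [acw mw2 iw0 iw1] := hw.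
have cu := AC_continuous acu; have cw := AC_continuous acw.
have nearE (x : R) : 0 < x -> \forall y \near x, pair_of u w y = f y.
  move=> x0; near=> y; rewrite fE//; near: y.
  exact: lt_nbhsr.
split.
- move=> x x0; change ((f y : R[i]^o) @[y --> x] --> (f x : R[i]^o)).
  rewrite [X in _ --> X](fE x x0).
  apply: cvg_trans (_ : (pair_of u w y : R[i]^o) @[y --> x] --> _).
    by apply: near_eq_cvg; exact: nearE.
  by apply/cvg_complexP; split; [exact: cu|exact: cw].
- apply: cvg_trans (_ : (pair_of u w y : R[i]^o) @[y --> 0^'+] --> _).
    by apply: near_eq_cvg; near=> y; rewrite fE.
  by apply/cvg_complexP; split; apply: cvg_at_right_filter; [exact: cu|exact: cw].
- apply/square_integrableP; split.
  + have : measurable_fun hl u.1 by exact: H1_meas0.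
    by apply: eq_measurable_fun => x /set_mem; rewrite halflineE => x0; rewrite fE.
  + have : measurable_fun hl w.1 by exact: H1_meas0.
    by apply: eq_measurable_fun => x /set_mem; rewrite halflineE => x0; rewrite fE.
  + by apply: integ_eq iu0 => [|x]; [exact: mhl|rewrite halflineE => x0; rewrite fE].
  + by apply: integ_eq iw0 => [|x]; [exact: mhl|rewrite halflineE => x0; rewrite fE].
- by apply/square_integrableP; split => //=; exact: H1_meas1.
- apply/weak_derivativeP => phi tp; have [_ _ e1] := AC_ibp acu mu2 tp.
  have [_ _ e2] := AC_ibp acw mw2 tp; split => /=.
    by rewrite -e1; apply: int_eq => x; rewrite halflineE => x0; rewrite fE.
  by rewrite -e2; apply: int_eq => x; rewrite halflineE => x0; rewrite fE.
Unshelve. all: by end_near. Qed.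

End ComplexPairs.

(** * The functionals on the graph in terms of a pair *)

Section GraphValues.
Context {R : realType} {n : nat}.
Notation mu := (@lebesgue_measure R).
Notation E := ((R -> R) * (R -> R))%type.
Notation hl := (@halfline R).
Implicit Types (u w : E) (v : graph_function R n).

(** One pair serves all edges. It fixes the values of [v] on [(0, +oo)], but not the chosen
    [graph_derivative], which is compared with [u.2] and [w.2] through its norm. *)
Definition rep v u w : Prop :=
  [/\ H1 u, H1 w & forall e x, 0 < x -> v e x = pair_of u w x].

Definition NN : R := n.+1%:R.

Lemma NN_gt0 : 0 < NN. Proof. by rewrite ltr0n. Qed.

Lemma vertex_rep v u w e : rep v u w -> vertex_value v e = pair_of u w 0.
Proof.
move=> [hu hw ve]; have [_ c _ _ _] := H1_halfline_pair hu hw (ve e).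
exact: (cvg_lim (@norm_hausdorff _ _) c).
Qed.

Lemma rep_H1_eq v u w : rep v u w -> H1_eq v.
Proof.
move=> rv; have [hu hw ve] := rv; split; last by move=> e e' x x0; rewrite !ve.
split; last first.
  move=> e; have [_ _ s1 s2 wk] := H1_halfline_pair hu hw (ve e).
  by split => //; exists (fun x => u.2 x +i* w.2 x).
split.
- by move=> e; have [] := H1_halfline_pair hu hw (ve e).
- move=> e; have [_ c _ _ _] := H1_halfline_pair hu hw (ve e).
  by apply/cvg_ex; eexists; exact: c.
- by move=> e e'; rewrite !(vertex_rep _ rv).
Qed.

Lemma H1_eq_deriv v e : H1_eq v -> exists u w, rep v u w /\
  forall x, 0 < x -> graph_derivative v e x = u.2 x +i* w.2 x.
Proof.
move=> [[[cv cl _] hh] he]; have [sv hex] := hh e.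
have [sd wd] : square_integrable (graph_derivative v e) /\ weak_derivative (v e) (graph_derivative v e).
  exact: (@xgetPex _ _ [set g | square_integrable g /\ weak_derivative (v e) g]).
have [u [w [hu hw _ vE dE]]] := pairs_of_weak (cv e) (cl e) sv sd wd.
exists u, w; split => //; split => // e' x x0; by rewrite (he e' e)// vE.
Qed.

Lemma H1_eq_rep v : H1_eq v -> exists u w, rep v u w.
Proof. by move=> /(H1_eq_deriv ord0) [u [w [rv _]]]; exists u, w. Qed.

Lemma n1_unique u u' : H1 u -> H1 u' -> (forall x, 0 < x -> u.1 x = u'.1 x) -> n1 u = n1 u'.
Proof.
move=> hu hu' e; have hd := H1_sub hu hu'.
have d0 : n1 (subE u u') = 0.
  by apply: AC_deriv_unique => // x x0; rewrite sub1 e// subrr.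
have [_ _ _ i1] := hu'; have [_ _ _ i2] := hd.
have cs := cauchy_schwarz mhl (H1_meas1 hu') (H1_meas1 hd) i1 i2.
move: cs; rewrite -[X in _ <= _ * X]/(n1 (subE u u')) d0 mulr0 => cs.
have c0 : \int[mu]_(x in hl) (u'.2 x * (subE u u').2 x) = 0.
  by apply/eqP; rewrite -sqrf_eq0 eq_le cs sqr_ge0.
have i12 := H1_mul1 hu' hd.
transitivity (\int[mu]_(x in hl) (1 * (1 * u'.2 x ^+ 2 + 2 * (u'.2 x * (subE u u').2 x)) + 1 * (subE u u').2 x ^+ 2)).
  by apply: int_eq => x _; rewrite sub2; ring.
rewrite int_lin//; [|exact: mhl|apply: integ_lin => //; exact: mhl].
rewrite int_lin//; last exact: mhl.
by rewrite c0 -[X in _ + _ * X]/(n1 (subE u u')) d0 /n1; ring.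
Qed.

Lemma rep_unique v u w u' w' : rep v u w -> rep v u' w' ->
  forall x, 0 < x -> u.1 x = u'.1 x /\ w.1 x = w'.1 x.
Proof.
move=> [_ _ h] [_ _ h'] x x0; have := h ord0 x x0; rewrite (h' ord0 x x0) /pair_of.
by move=> [-> ->].
Qed.

Lemma sum_edges (a : R) : \sum_(e < n.+1) a = NN * a.
Proof. by rewrite sumr_const card_ord mulr_natl. Qed.

Lemma int_sum2 (f g : R -> R) : integ hl f -> integ hl g ->
  \int[mu]_(x in hl) (f x + g x) = \int[mu]_(x in hl) f x + \int[mu]_(x in hl) g x.
Proof.
move=> i1 i2; rewrite -[X in X + _]mul1r -[X in _ + X]mul1r -int_lin//; last exact: mhl.
by apply: int_eq => x _; rewrite !mul1r.
Qed.

Lemma L2_of (h : graph_function R n) (u w : R -> R) :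
  integ hl (fun x => u x ^+ 2) -> integ hl (fun x => w x ^+ 2) ->
  (forall e x, 0 < x -> modulus (h e x) ^+ 2 = u x ^+ 2 + w x ^+ 2) ->
  Lq_norm 2 h ^+ 2 = NN * (\int[mu]_(x in hl) (u x ^+ 2) + \int[mu]_(x in hl) (w x ^+ 2)).
Proof.
move=> iu iw hh.
have e1 : integral_graph (fun e x => modulus (h e x) `^ 2) =
   NN * (\int[mu]_(x in hl) (u x ^+ 2) + \int[mu]_(x in hl) (w x ^+ 2)).
  rewrite /integral_graph -sum_edges; apply: eq_bigr => e _.
  rewrite -int_sum2//; apply: int_eq => x; rewrite halflineE => x0.
  by rewrite powR_square ?modulus_ge0// hh.
rewrite /Lq_norm e1 -powR_square ?powR_ge0// -powRrM mulVf// powRr1//.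
rewrite mulr_ge0 ?(ltW NN_gt0)// addr_ge0//; apply: Rintegral_ge0 => x _; exact: sqr_ge0.
Qed.

Lemma L2_rep v u w : rep v u w -> Lq_norm 2 v ^+ 2 = NN * (n0 u + n0 w).
Proof.
move=> [hu hw ve]; have [_ _ iu _] := hu; have [_ _ iw _] := hw.
by apply: L2_of => // e x x0; rewrite modulus_sq ve.
Qed.

(** On each edge the chosen derivative comes with a pair of its own, by [H1_eq_deriv]. That pair has
    the same values as [u] and [w], hence the same energy by [n1_unique]. *)
Lemma L2_deriv_rep v u w : rep v u w -> Lq_norm 2 (graph_derivative v) ^+ 2 = NN * (n1 u + n1 w).
Proof.
move=> rv; have [u' [w' [rv' _]]] := H1_eq_deriv ord0 (rep_H1_eq rv).
have [hu hw _] := rv; have [_ _ _ iu] := hu; have [_ _ _ iw] := hw.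
have e1 : integral_graph (fun e x => modulus (graph_derivative v e x) `^ 2) = NN * (n1 u + n1 w).
  rewrite /integral_graph -sum_edges; apply: eq_bigr => e _.
  have [u1 [w1 [rv1 d1]]] := H1_eq_deriv e (rep_H1_eq rv).
  have [hu1 hw1 _] := rv1; have [_ _ _ iu1] := hu1; have [_ _ _ iw1] := hw1.
  rewrite (n1_unique hu hu1 (fun x x0 => (rep_unique rv rv1 x0).1)).
  rewrite (n1_unique hw hw1 (fun x x0 => (rep_unique rv rv1 x0).2)).
  rewrite -int_sum2//; apply: int_eq => x; rewrite halflineE => x0.
  by rewrite powR_square ?modulus_ge0// modulus_sq d1.
rewrite /Lq_norm e1 -powR_square ?powR_ge0// -powRrM mulVf// powRr1//.
by rewrite mulr_ge0 ?(ltW NN_gt0)// addr_ge0// n1_ge0.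
Qed.

Definition BB (r : R) u w : R := \int[mu]_(x in hl) ((u.1 x ^+ 2 + w.1 x ^+ 2) `^ (r / 2)).

Lemma BB_ge0 r u w : 0 <= BB r u w.
Proof. by apply: Rintegral_ge0 => x _; exact: powR_ge0. Qed.

Lemma Lq_rep v u w (q : R) : 0 < q -> rep v u w -> Lq_norm q v `^ q = NN * BB q u w.
Proof.
move=> q0 [hu hw ve].
have e1 : integral_graph (fun e x => modulus (v e x) `^ q) = NN * BB q u w.
  rewrite /integral_graph -sum_edges; apply: eq_bigr => e _.
  apply: int_eq => x; rewrite halflineE => x0.
  by rewrite -sq_powR ?modulus_ge0// modulus_sq ve.
rewrite /Lq_norm e1 -powRrM mulVf ?gt_eqF// powRr1//.
by rewrite mulr_ge0 ?(ltW NN_gt0)// BB_ge0.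
Qed.

Lemma H1_norm_rep v u w : rep v u w ->
  H1_norm v = Num.sqrt (NN * (n0 u + n0 w + (n1 u + n1 w))).
Proof.
move=> rv; transitivity (Num.sqrt (NN * (n0 u + n0 w) + NN * (n1 u + n1 w))).
  exact (f_equal2 (fun a b => Num.sqrt (a + b)) (L2_rep rv) (L2_deriv_rep rv)).
by rewrite -mulrDr.
Qed.

Variables (gamma : R) (V : potential R n) (c1 c2 : R).
Hypotheses (hsym : symmetric_potential V) (hW : potential_bounds (V ord0) c1 c2).

Definition alpha : R := gamma / NN.

Lemma F_rep v u w : rep v u w -> F_functional gamma V v =
  NN * (bil alpha (V ord0) u u + bil alpha (V ord0) w w).
Proof.
move=> rv; have [hu hw ve] := rv.
rewrite /F_functional (L2_deriv_rep rv) (vertex_rep _ rv) modulus_sq.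
have iu := pot_mul hW hu hu; have iw := pot_mul hW hw hw.
have -> : integral_graph (fun e x => V e x * modulus (v e x) ^+ 2) =
  NN * (\int[mu]_(x in hl) (V ord0 x * (u.1 x * u.1 x)) +
        \int[mu]_(x in hl) (V ord0 x * (w.1 x * w.1 x))).
  rewrite /integral_graph -sum_edges; apply: eq_bigr => e _.
  rewrite -int_sum2//; apply: int_eq => x; rewrite halflineE => x0.
  by rewrite modulus_sq ve//= (hsym e ord0)//; ring.
rewrite /bil /alpha /=.
have -> : \int[mu]_(x in hl) (u.2 x * u.2 x) = n1 u by [].
have -> : \int[mu]_(x in hl) (w.2 x * w.2 x) = n1 w by [].
have N0 : NN != 0 by rewrite gt_eqF// NN_gt0.
by field.
Qed.

Variables (p omega : R).
Hypothesis (hp : 1 < p).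
Let c := fun x => V ord0 x + omega.

Definition AA u w : R := bil alpha (fun x => V ord0 x + omega) u u
  + bil alpha (fun x => V ord0 x + omega) w w.

Lemma bil_shift u : H1 u -> bil alpha c u u = bil alpha (V ord0) u u + omega * n0 u.
Proof.
move=> hu; have [_ _ i0 _] := hu; have iu := pot_mul hW hu hu.
rewrite /bil /n0 -[RHS]addrA; congr (_ + _).
rewrite -[X in X + _]mul1r -int_lin//; last exact: mhl.
by apply: int_eq => x _; rewrite /c; ring.
Qed.

Lemma S_rep v u w : rep v u w ->
  S_action p gamma omega V v = NN * (2^-1 * AA u w - (p + 1)^-1 * BB (p + 1) u w).
Proof.
move=> rv; have [hu hw _] := rv.
rewrite /S_action (F_rep rv) (L2_rep rv) (Lq_rep _ rv); last by move: hp; lra.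
rewrite /AA (bil_shift hu) (bil_shift hw).
have p0 : p + 1 != 0 by rewrite gt_eqF//; move: hp; lra.
by field.
Qed.

Lemma I_rep v u w : rep v u w ->
  I_nehari p gamma omega V v = NN * (AA u w - BB (p + 1) u w).
Proof.
move=> rv; have [hu hw _] := rv.
rewrite /I_nehari (F_rep rv) (L2_rep rv) (Lq_rep _ rv); last by move: hp; lra.
rewrite /AA (bil_shift hu) (bil_shift hw); ring.
Qed.

End GraphValues.

(** * Consequences of the hypotheses on the potential *)

Section PotentialHypotheses.
Context {R : realType} {n : nat}.
Notation mu := (@lebesgue_measure R).
Notation E := ((R -> R) * (R -> R))%type.
Notation hl := (@halfline R).
Implicit Types (u w : E).
Variables (gamma omega : R) (V : potential R n).

Lemma potential_bounds_of_L1_Loo : potential_L1_Loo V ->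
  exists c1 c2, potential_bounds (V ord0) c1 c2.
Proof.
move=> [V1 [V2 [i1 m2 VE]]]; have {}i1 : integ hl (V1 ord0) := i1 ord0.
have [mV2 [M0 [N [mN N0 sub]]]] := m2 ord0.
pose M := Num.max M0 0; have M_0 : 0 <= M by rewrite le_max lexx orbT.
have V2M x : hl x -> ~ N x -> `|V2 ord0 x| <= M.
  move=> hx Nx; have := contrapT (fun nx => Nx (sub x nx)) => /(_ hx) le.
  by rewrite le_max le.
exists (\int[mu]_(x in hl) `|V1 ord0 x|), M.
have mV : measurable_fun hl (V ord0).
  have : measurable_fun hl (fun x => V1 ord0 x + V2 ord0 x).
    by apply: measurable_funD => //; exact: integ_meas i1.
  by apply: eq_measurable_fun => x /set_mem; rewrite halflineE => x0; rewrite VE.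
split => //; first by apply: Rintegral_ge0 => x _; exact: normr_ge0.
move=> k B mk hk ik.
have hkE x : hl x -> 0 <= k x <= B by rewrite halflineE; exact: hk.
have kN x : hl x -> `|k x| <= B by move=> /hkE /andP[k0 kB]; rewrite ger0_norm.
have ia1 : integ hl (fun x => `|V1 ord0 x|) := integ_abs i1.
(* [V2] is set to 0 on the null set where its essential bound may fail, so that the bound holds at
   every point. *)
pose G := ~` N; have mG : measurable (G : set R) by exact: measurableC.
pose V2' x := V2 ord0 x * \1_G x.
have mV2' : measurable_fun hl V2'.
  by apply: measurable_funM => //; apply: measurable_funTS; exact: measurable_indic.
have V2'M x : hl x -> `|V2' x| <= M.
  move=> hx; rewrite /V2' indicE; have [Nx|Nx] := pselect (N x).
    by rewrite memNset//= ?mulr0 ?normr0// => /(_ Nx).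
  by rewrite mem_set// mulr1 V2M.
have V2'E x : hl x -> ~ N x -> V2' x = V2 ord0 x.
  by move=> _ Nx; rewrite /V2' indicE mem_set// mulr1.
have j1 : integ hl (fun x => V1 ord0 x * k x).
  by apply: integ_eq (integ_mulb mhl mk kN i1) => [|x _]; [exact: mhl|rewrite mulrC].
have j2' : integ hl (fun x => V2' x * k x) by apply: integ_mulb mV2' V2'M ik; exact: mhl.
have mjk : measurable_fun hl (fun x => V2 ord0 x * k x) by exact: measurable_funM.
have [j2 _] : integ hl (fun x => V2 ord0 x * k x) /\ _ :=
  int_negl mhl mN N0 j2' mjk (fun x hx Nx => congr1 (fun z => z * k x) (V2'E x hx Nx)).
have iV : integ hl (fun x => V ord0 x * k x).
  apply: integ_eq (integD mhl j1 j2) => [|x]; first exact: mhl.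
  by rewrite halflineE => x0; rewrite VE// mulrDl.
split => //.
have ja1 : integ hl (fun x => `|V1 ord0 x| * k x).
  by apply: integ_eq (integ_mulb mhl mk kN ia1) => [|x _]; [exact: mhl|rewrite mulrC].
have ja2 : integ hl (fun x => `|V2' x| * k x).
  by apply: integ_eq (integ_abs j2') => [|x hx]; [exact: mhl|rewrite normrM (ger0_norm (andP (hkE x hx)).1)].
have jV : integ hl (fun x => `|V ord0 x| * k x).
  by apply: integ_eq (integ_abs iV) => [|x hx]; [exact: mhl|rewrite normrM (ger0_norm (andP (hkE x hx)).1)].
have mm : measurable_fun hl (fun x => `|V1 ord0 x| * k x + `|V2 ord0 x| * k x).
  apply: measurable_funD; apply: measurable_funM => //; apply: measurableT_comp => //.
  exact: integ_meas i1.
have [js es] := int_negl mhl mN N0 (integD mhl ja1 ja2) mm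
  (fun x hx Nx => congr1 (fun z => `|V1 ord0 x| * k x + `|z| * k x) (V2'E x hx Nx)).
apply: (@le_trans _ _ (\int[mu]_(x in hl) (`|V1 ord0 x| * k x + `|V2 ord0 x| * k x))).
  apply: int_le => //; first exact: mhl.
  move=> x hx; have x0 : 0 < x by rewrite -halflineE.
  by rewrite VE// -mulrDl ler_wpM2r ?ler_normD//; case/andP: (hkE x hx).
rewrite es int_sum2//; apply: lerD.
  have -> : \int[mu]_(x in hl) `|V1 ord0 x| * B = B * \int[mu]_(x in hl) `|V1 ord0 x| + 0 * \int[mu]_(x in hl) `|V1 ord0 x|.
    by ring.
  rewrite -int_lin//; last exact: mhl.
  apply: int_le => //; [exact: mhl|apply: integ_lin => //; exact: mhl|].
  move=> x hx; rewrite mul0r addr0 mulrC ler_wpM2r//.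
  by case/andP: (hkE x hx).
have -> : M * \int[mu]_(x in hl) k x = M * \int[mu]_(x in hl) k x + 0 * \int[mu]_(x in hl) k x.
  by ring.
rewrite -int_lin//; last exact: mhl.
apply: int_le => //; [exact: mhl|apply: integ_lin => //; exact: mhl|].
move=> x hx; rewrite mul0r addr0 ler_wpM2r ?V2'M//.
by case/andP: (hkE x hx).
Qed.

Lemma potential_le0 c1 c2 : potential_negative V -> potential_bounds (V ord0) c1 c2 ->
  forall u, H1 u -> \int[mu]_(x in hl) (V ord0 x * (u.1 x * u.1 x)) <= 0.
Proof.
move=> hV hW u hu; pose z : E := (fun=> 0, fun=> 0); have hz : H1 z := H1_zero.
pose f := pair_of u z.
have [_ _ s1 s2 wk] := H1_halfline_pair (f := f) hu hz (fun x _ => erefl).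
have hf : H1_halfline f by split => //; eexists; split; [exact: s2|exact: wk].
have fE x : modulus (f x) ^+ 2 = u.1 x * u.1 x by rewrite modulus_sq /f /pair_of /= expr0n addr0 expr2.
have [nz|/contrapT [N [mN N0 sub]]] := pselect (nonzero_ae f).
  have /ltW := hV ord0 f hf nz; rewrite /integral_halfline.
  by rewrite (int_eq (k := fun x => V ord0 x * (u.1 x * u.1 x))) // => x _; rewrite fE.
have iu := pot_mul hW hu hu.
have mh := mhl (R := R).
have zN x : hl x -> ~ N x -> V ord0 x * (u.1 x * u.1 x) = 0.
  move=> hx Nx; have fx := contrapT (fun nx => Nx (sub x nx)) hx.
  by rewrite -fE fx modulus_sq /= expr0n addr0 mulr0.
have mc : measurable_fun hl (fun _ : R => 0 : R) by exact: measurable_cst.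
by have [_ <-] := int_negl mh mN N0 iu mc zN; rewrite int_zero.
Qed.

Lemma vanishing_eps : potential_vanishing V -> forall e : R, 0 < e ->
  exists2 T : R, 0 <= T & forall x, T <= x -> `|V ord0 x| <= e.
Proof.
move=> hV e e0; have /cvgrPdist_lt /(_ e e0) := hV ord0.
move=> [T [Tr hT]]; exists (Num.max 0 (T + 1)); first by rewrite le_max lexx.
move=> x; rewrite ge_max => /andP[_ Tx]; have : T < x by lra.
by move=> /hT /=; rewrite sub0r normrN => /ltW.
Qed.

Variables (c1 c2 : R).
Hypotheses (hsym : symmetric_potential V) (hW : potential_bounds (V ord0) c1 c2).
Hypotheses (w0 : (0 < omega0_eq gamma V)%E) (w1 : (omega0_eq gamma V < omega%:E)%E).

Lemma omega_gt0 : 0 < omega.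
Proof. by have := lt_trans w0 w1; rewrite lte_fin. Qed.

(** A negative infimum provides a complex [v] with [F < 0], and [F] is [NN] times the sum of the
    forms of the real and imaginary parts, one of which must be negative. *)
Lemma exists_negative_form : exists2 u, H1 u & bil (@alpha R n gamma) (V ord0) u u < 0.
Proof.
have : (ereal_inf [set (F_functional gamma V v)%:E | v in [set v | H1_eq v /\ Lq_norm 2 v = 1%R]] < 0)%E.
  by have := w0; rewrite /omega0_eq oppe_gt0.
move=> /ereal_inf_lt [_ [v [hv _] <-]]; rewrite lte_fin.
have [u [w rv]] := H1_eq_rep hv; have [hu hw _] := rv.
rewrite (F_rep gamma hsym hW rv) pmulr_rlt0 ?NN_gt0// => h.
have [uneg|upos] := ltP (bil (@alpha R n gamma) (V ord0) u u) 0; first by exists u.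
by exists w => //; move: h upos; lra.
Qed.

(** The constant is the distance from [omega0_eq] to [omega]. The two bounds on [omega0_eq] make the
    infimum a real number [l], and the function [t * u] on all [NN] edges, with
    [t ^+ 2 = 1 / (NN * n0 u)], has unit norm and can be compared with it. *)
Lemma form_lower_bound : exists2 d : R, 0 < d &
  forall u, H1 u -> d * n0 u <= bil (@alpha R n gamma) (fun x => V ord0 x + omega) u u.
Proof.
pose S := [set (F_functional gamma V v)%:E | v in [set v | H1_eq v /\ Lq_norm 2 v = 1%R]].
have e0 : (0 < - ereal_inf S)%E := w0; have e1 : (- ereal_inf S < omega%:E)%E := w1.
have [l el] : exists l : R, ereal_inf S = l%:E.
  move: e0 e1; case: (ereal_inf S) => [l _ _|//|//]; by exists l.
rewrite el -EFinN lte_fin in e1.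
exists (omega + l); first by move: e1; lra.
move=> u hu; rewrite (bil_shift gamma hW omega hu) mulrDl addrC lerD2r.
have := n0_ge0 u; rewrite le_eqVlt => /orP[/eqP n00|np].
  have u0 := n0_eq0 hu (esym n00); rewrite -n00 mulr0 /bil !u0 !mulr0 subr0.
  rewrite [X in _ + X]int_zero ?addr0; last by move=> x _; rewrite u0 !mulr0.
  exact: n1_ge0.
pose z : E := (fun=> 0, fun=> 0); have hz : H1 z := H1_zero.
pose t := (Num.sqrt (@NN R n * n0 u))^-1.
have Nn : 0 < @NN R n * n0 u by rewrite mulr_gt0// NN_gt0.
have t2 : t ^+ 2 = (@NN R n * n0 u)^-1 by rewrite exprVn sqr_sqrtr// ltW.
pose v : graph_function R n := fun e x => pair_of (lc t u 0 u) z x.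
have rv : rep v (lc t u 0 u) z by split => //; exact: H1_lc.
have n0z : n0 z = 0 by apply: int_zero => x _; rewrite /= expr0n.
have v1 : Lq_norm 2 v = 1.
  apply/eqP; rewrite -(@pexpr_eq1 _ _ 2)//; last exact: powR_ge0.
  rewrite (L2_rep rv) n0_scale// n0z addr0 t2; apply/eqP.
  by field; rewrite !gt_eqF// NN_gt0.
have : (ereal_inf S <= (F_functional gamma V v)%:E)%E.
  by apply: ereal_inf_lbound; exists v => //; split => //; exact: rep_H1_eq rv.
rewrite el lee_fin (F_rep gamma hsym hW rv) (bil_sq_lc _ hW)//.
have -> : bil (@alpha R n gamma) (V ord0) z z = 0.
  rewrite /bil /= !mulr0 subr0 !int_zero ?addr0// => x _; rewrite ?mulr0//.
rewrite addr0 t2 !mulr0 expr0n !mul0r !addr0 => h.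
have N0 := @NN_gt0 R n; rewrite -(ler_pM2l (_ : 0 < (n0 u)^-1)) ?invr_gt0//.
have -> : (n0 u)^-1 * (l * n0 u) = l by field; rewrite gt_eqF.
apply: le_trans h _; rewrite le_eqVlt; apply/orP; left; apply/eqP; field.
by rewrite !gt_eqF.
Qed.

End PotentialHypotheses.

(** * Convexity and Taylor estimates for powers of the modulus *)

Section VectorPowers.
Context {R : realType}.
Implicit Types (a b p q e s t x y : R).

Lemma powR_convex e s t th : 1 < e -> 0 <= s -> 0 <= t -> 0 <= th <= 1 ->
  (th * s + (1 - th) * t) `^ e <= th * s `^ e + (1 - th) * t `^ e.
Proof.
move=> e1 s0 t0 /andP[h0 h1]; set y := th * s + (1 - th) * t.
have h1' : 0 <= 1 - th by lra.
have y0 : 0 <= y by rewrite addr_ge0// mulr_ge0.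
have b1 := ler_wpM2l h0 (bernoulli e1 s0 y0).
have b2 := ler_wpM2l h1' (bernoulli e1 t0 y0).
apply: le_trans (lerD b1 b2); rewrite le_eqVlt; apply/orP; left; apply/eqP.
transitivity (y `^ e + e * y `^ (e - 1) * (th * s + (1 - th) * t - y)); last by ring.
by rewrite subrr mulr0 addr0.
Qed.

Lemma sq_norm_powR (r a : R) : (a ^+ 2) `^ (r / 2) = `|a| `^ r.
Proof. by rewrite -(real_normK (num_real a)) sq_powR. Qed.

Lemma vec_tangent e a b p q : 1 < e ->
  (a ^+ 2 + b ^+ 2) `^ e
    + 2 * e * ((a ^+ 2 + b ^+ 2) `^ (e - 1) * (a * (p - a) + b * (q - b)))
  <= (p ^+ 2 + q ^+ 2) `^ e.
Proof.
move=> e1; have n0 (c d : R) : 0 <= c ^+ 2 + d ^+ 2 by rewrite addr_ge0 ?sqr_ge0.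
apply: le_trans (bernoulli e1 (n0 p q) (n0 a b)); rewrite lerD2l.
have -> : 2 * e * ((a ^+ 2 + b ^+ 2) `^ (e - 1) * (a * (p - a) + b * (q - b))) =
  e * (a ^+ 2 + b ^+ 2) `^ (e - 1) * (2 * (a * (p - a) + b * (q - b))) by ring.
apply: ler_wpM2l; first by rewrite mulr_ge0 ?powR_ge0//; lra.
by have := sqr_ge0 (p - a); have := sqr_ge0 (q - b); rewrite !expr2; lra.
Qed.

(** For [k < 1] the power [k] is not Lipschitz at 0. The factor [x] repairs this, because the
    left-hand side is at most [|x ^ (k + 1) - y ^ (k + 1)|]; this covers exponents [r] close to
    2. *)
Lemma powR_diff_mul (k M x y : R) : 0 < k -> 0 <= x <= M -> 0 <= y <= M ->
  `|x `^ k - y `^ k| * x <= (k + 1) * M `^ k * `|x - y|.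
Proof.
move=> k0 /andP[x0 xM] /andP[y0 yM].
have k1 : 1 < k + 1 by lra.
have kk : k = k + 1 - 1 by ring.
have e z : 0 <= z -> z `^ k * z = z `^ (k + 1).
  by move=> z0; rewrite mulrC {1}kk mulr_powRB1//; lra.
have l := powR_lip k1 (introT andP (conj x0 xM)) (introT andP (conj y0 yM)).
rewrite -kk in l; apply: le_trans l.
have mono z z' : 0 <= z -> z <= z' -> z `^ k <= z' `^ k.
  by move=> z0 zz; apply: ge0_ler_powR; rewrite ?nnegrE ?(ltW k0)// (le_trans z0).
have mono1 z z' : 0 <= z -> z <= z' -> z `^ (k + 1) <= z' `^ (k + 1).
  by move=> z0 zz; apply: ge0_ler_powR; rewrite ?nnegrE//; [lra|exact: le_trans zz].
have [xy|/ltW yx] := leP x y.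
  rewrite ler0_norm ?subr_le0 ?mono// ler0_norm ?subr_le0 ?mono1//.
  rewrite !opprB mulrBl e// -(e y)// lerD2r; apply: ler_wpM2l => //; exact: powR_ge0.
rewrite ger0_norm ?subr_ge0 ?mono// ger0_norm ?subr_ge0 ?mono1//.
rewrite mulrBl e// -(e y)// lerD2l lerN2; apply: ler_wpM2l => //; exact: powR_ge0.
Qed.

(** The tangent inequality is written at the new point [(a + h, b + k)], where it bounds the
    increment from above with the weight of that point; [powR_diff_mul] moves the weight back to
    [(a, b)] at a quadratic cost. *)
Lemma vec_taylor (r M a b h k : R) : 2 < r ->
  a ^+ 2 + b ^+ 2 <= M ^+ 2 -> (a + h) ^+ 2 + (b + k) ^+ 2 <= M ^+ 2 -> 0 <= M ->
  ((a + h) ^+ 2 + (b + k) ^+ 2) `^ (r / 2) <=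
  (a ^+ 2 + b ^+ 2) `^ (r / 2)
   + r * ((a ^+ 2 + b ^+ 2) `^ (r / 2 - 1) * (a * h + b * k))
   + r * r * M `^ (r - 2) * (h ^+ 2 + k ^+ 2).
Proof.
move=> r2 yM xM M0; have e1 : 1 < r / 2 by lra.
set x := (a + h) ^+ 2 + _ in xM *; set y := a ^+ 2 + b ^+ 2 in yM *.
set H2 := h ^+ 2 + k ^+ 2.
have x0 : 0 <= x by rewrite addr_ge0 ?sqr_ge0.
have y0 : 0 <= y by rewrite addr_ge0 ?sqr_ge0.
have H0 : 0 <= H2 by rewrite addr_ge0 ?sqr_ge0.
pose X := Num.sqrt x; pose Y := Num.sqrt y; pose H := Num.sqrt H2.
have X0 : 0 <= X by exact: sqrtr_ge0.
have Y0 : 0 <= Y by exact: sqrtr_ge0.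
have Hp : 0 <= H by exact: sqrtr_ge0.
have XM : X <= M by rewrite -(ler_pXn2r (n := 2))// sqr_sqrtr.
have YM : Y <= M by rewrite -(ler_pXn2r (n := 2))// sqr_sqrtr.
have pw z : 0 <= z -> z `^ (r / 2 - 1) = Num.sqrt z `^ (r - 2).
  move=> z0; rewrite -{1}(sqr_sqrtr z0) -powR_square ?sqrtr_ge0// -powRrM.
  by congr (_ `^ _); field.
have tan := vec_tangent (a + h) (b + k) a b e1.
rewrite -/x -/y in tan.
have dXY : `|X - Y| <= H.
  rewrite -(ler_pXn2r (n := 2)) ?nnegrE// real_normK ?num_real// sqrrB !sqr_sqrtr//.
  have cs : (a + h) * a + (b + k) * b <= X * Y.
    apply: le_trans (ler_norm _) _; rewrite -(ler_pXn2r (n := 2)) ?nnegrE ?mulr_ge0//.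
    rewrite real_normK ?num_real// exprMn !sqr_sqrtr// /x /y.
    by have := sqr_ge0 ((a + h) * b - (b + k) * a); rewrite !expr2; lra.
  rewrite mulr2n; move: cs; rewrite /x /y /H2 !expr2; lra.
have cs2 : `|(a + h) * h + (b + k) * k| <= X * H.
  rewrite -(ler_pXn2r (n := 2)) ?nnegrE ?mulr_ge0//.
  rewrite real_normK ?num_real// exprMn !sqr_sqrtr// /x /H2.
  by have := sqr_ge0 ((a + h) * k - (b + k) * h); rewrite !expr2; lra.
have key : (x `^ (r / 2 - 1) - y `^ (r / 2 - 1)) * ((a + h) * h + (b + k) * k) <=
  (r - 1) * M `^ (r - 2) * H2.
  rewrite !pw// -/X -/Y.
  apply: le_trans (ler_norm _) _; rewrite normrM.
  apply: le_trans (ler_wpM2l (normr_ge0 _) cs2) _; rewrite mulrA.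
  have k0 : 0 < r - 2 by lra.
  have pd := powR_diff_mul k0 (introT andP (conj X0 XM)) (introT andP (conj Y0 YM)).
  have kp : 0 <= (r - 2 + 1) * M `^ (r - 2) by rewrite mulr_ge0 ?powR_ge0//; lra.
  apply: le_trans (ler_wpM2r Hp (le_trans pd (ler_wpM2l kp dXY))) _.
  have HH : H2 = H * H by rewrite -expr2 sqr_sqrtr.
  by rewrite [X in _ <= _ * X]HH mulrA (_ : r - 2 + 1 = r - 1); last by ring.
have key2 : y `^ (r / 2 - 1) * H2 <= M `^ (r - 2) * H2.
  rewrite ler_wpM2r// pw//; apply: ge0_ler_powR; rewrite ?nnegrE//; lra.
have -> : a * h + b * k = (a + h) * h + (b + k) * k - H2 by rewrite /H2; ring.
move: tan key key2; rewrite (_ : 2 * (r / 2) = r); last by field.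
have -> : a - (a + h) = - h by ring. have -> : b - (b + k) = - k by ring.
have -> : (a + h) * - h + (b + k) * - k = - ((a + h) * h + (b + k) * k) by ring.
move: (x `^ (r / 2)) (y `^ (r / 2)) (x `^ _) (y `^ _) (M `^ _) (_ + (b + k) * k) => A B C D G Q tan key key2.
have r0 : 0 <= r by lra.
have := ler_wpM2l r0 key; have := ler_wpM2l r0 key2; move: tan.
by clearbody H2; lra.
Qed.

Lemma powR_cvg (a x0 : R) : 0 < x0 -> {for x0, continuous (fun x => x `^ a)}.
Proof.
move=> x00; have d := is_derive1_powR a x00.
by apply: differentiable_continuous; apply/derivable1_diffP; exact: ex_derive.
Qed.

End VectorPowers.

(** * Minimizers and critical points *)

Section VariationArithmetic.
Context {R : realType}.

Lemma ratio_powR (a A e : R) : 0 < a -> 0 < A -> (a / A)^-1 `^ e * a `^ e = A `^ e.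
Proof.
move=> a0 A0; rewrite -powRM ?invr_ge0 ?divr_ge0 ?(ltW a0) ?(ltW A0)//.
by congr (_ `^ _); field; rewrite !gt_eqF.
Qed.

Lemma weighted_arith (m1 B q1 q2 b1 b2 A1 A2 : R) : 0 <= m1 -> 0 <= q1 -> 0 <= q2 ->
  B <= q1 * b1 + q2 * b2 -> m1 * b1 <= A1 -> m1 * b2 <= A2 -> m1 * B <= q1 * A1 + q2 * A2.
Proof.
move=> m10 q10 q20 hB h1 h2; apply: le_trans (ler_wpM2l m10 hB) _.
have := ler_wpM2l q10 h1; have := ler_wpM2l q20 h2; lra.
Qed.

Lemma tangent_arith (A B D m r tj P : R) : A + r / 2 * B * (m - D) <= m * P ->
  P * (m + r * tj) <= A -> r * tj * P <= r / 2 * B * (D - m).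
Proof. by lra. Qed.

Lemma cvg_powR (F : set_system R) (FF : Filter F) (f : R -> R) (a l : R) : 0 < l ->
  f x @[x --> F] --> l -> f x `^ a @[x --> F] --> l `^ a.
Proof.
move=> l0 cf; have c := @powR_cvg _ a _ l0.
exact: (@cvg_comp _ _ _ f (fun x => x `^ a) F (nbhs l) (nbhs (l `^ a)) cf c).
Qed.

End VariationArithmetic.

(** * The Euler-Lagrange equation of a minimizer *)

Section Variation.
Context {R : realType}.
Notation mu := (@lebesgue_measure R).
Notation E := ((R -> R) * (R -> R))%type.
Notation hl := (@halfline R).
Implicit Types (u w h k : E).
Variable (r : R).
Hypothesis (r2 : 2 < r).

Definition addE u h : E := lc 1 u 1 h.

Lemma add1 u h x : (addE u h).1 x = u.1 x + h.1 x.
Proof. by rewrite /addE /lc /= !mul1r. Qed.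

Lemma H1_add u h : H1 u -> H1 h -> H1 (addE u h).
Proof. exact: H1_lc. Qed.

(** This is [|z| ^ (r - 2)] for [z = (u, w)]. With [rho] frozen, the equation of each component
    becomes linear. *)
Definition rho u w (x : R) : R := (u.1 x ^+ 2 + w.1 x ^+ 2) `^ (r / 2 - 1).

Let e1 : 1 < r / 2. Proof. by move: r2; lra. Qed.
Let r20 : 0 < r / 2. Proof. by move: r2; lra. Qed.
Let r_ge0 : 0 <= r. Proof. by move: r2; lra. Qed.

Lemma pair_bounded u w : H1 u -> H1 w -> exists2 M : R, 0 <= M &
  forall x, u.1 x ^+ 2 + w.1 x ^+ 2 <= M ^+ 2.
Proof.
move=> hu hw; exists (Num.sqrt (2 * (n0 u + n1 u) + 2 * (n0 w + n1 w))); first exact: sqrtr_ge0.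
move=> x; rewrite sqr_sqrtr; last by rewrite addr_ge0// mulr_ge0// addr_ge0 ?n0_ge0 ?n1_ge0.
by apply: lerD; exact: H1_bound.
Qed.

Lemma rho_ge0 u w x : 0 <= rho u w x. Proof. exact: powR_ge0. Qed.

Lemma pair_meas u w (D : set R) : H1 u -> H1 w ->
  measurable_fun D (fun x => u.1 x ^+ 2 + w.1 x ^+ 2).
Proof.
by move=> hu hw; apply: measurable_funD; apply: measurable_funX; exact: H1_meas0.
Qed.

Lemma rho_meas u w (D : set R) : H1 u -> H1 w -> measurable_fun D (rho u w).
Proof.
move=> hu hw; apply: measurable_funTS; apply: (measurableT_comp (measurable_powR _)).
exact: pair_meas.
Qed.

Lemma rho_bounded u w : H1 u -> H1 w -> exists2 M : R, 0 <= M & forall x, rho u w x <= M.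
Proof.
move=> hu hw; have [M M0 hM] := pair_bounded hu hw; exists ((M ^+ 2) `^ (r / 2 - 1)).
  exact: powR_ge0.
move=> x; apply: ge0_ler_powR; [by move: e1; lra| | |exact: hM].
  by rewrite nnegrE addr_ge0 ?sqr_ge0.
by rewrite nnegrE sqr_ge0.
Qed.

Lemma integ_rho u w h k : H1 u -> H1 w -> H1 h -> H1 k ->
  integ hl (fun x => rho u w x * (h.1 x * k.1 x)).
Proof.
move=> hu hw hh hk; have [M M0 hM] := rho_bounded hu hw.
apply: (@integ_mulb _ _ _ _ M); [exact: mhl|exact: rho_meas| |exact: H1_mul0].
by move=> x _; rewrite ger0_norm ?rho_ge0.
Qed.

(** [r * JJ u w h] is the derivative of [BB r] at the pair when the first component moves in the
    direction [h]. *)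
Definition JJ u w h : R := \int[mu]_(x in hl) (rho u w x * (u.1 x * h.1 x)).

Lemma rhoC u w x : rho u w x = rho w u x.
Proof. by rewrite /rho addrC. Qed.

Lemma BBC u w : BB r u w = BB r w u.
Proof. by apply: int_eq => x _; rewrite addrC. Qed.

Lemma pair_powR_le (a b : R) :
  (a ^+ 2 + b ^+ 2) `^ (r / 2) <= 2^-1 * ((2 `^ (r / 2)) * `|a| `^ r) + 2^-1 * ((2 `^ (r / 2)) * `|b| `^ r).
Proof.
have := @powR_convex R (r / 2) (2 * a ^+ 2) (2 * b ^+ 2) 2^-1 e1 (mulr_ge0 (ler0n _ 2) (sqr_ge0 a)) (mulr_ge0 (ler0n _ 2) (sqr_ge0 b)).
rewrite (powRM _ (ler0n _ 2) (sqr_ge0 a)) (powRM _ (ler0n _ 2) (sqr_ge0 b)) !sq_norm_powR (_ : 1 - 2^-1 = 2^-1); last by field.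
have -> : 2^-1 * (2 * a ^+ 2) + 2^-1 * (2 * b ^+ 2) = a ^+ 2 + b ^+ 2 by field.
by apply; rewrite invr_ge0 ler0n invf_le1// ler1n.
Qed.

Lemma integ_BB u w : H1 u -> H1 w -> integ hl (fun x => (u.1 x ^+ 2 + w.1 x ^+ 2) `^ (r / 2)).
Proof.
move=> hu hw; have i1 := bb_integ r2 hu; have i2 := bb_integ r2 hw.
apply: integ_le (integ_lin 2^-1 2^-1 mhl (integZ (2 `^ (r / 2)) mhl i1) (integZ (2 `^ (r / 2)) mhl i2)).
- exact: mhl.
- apply: measurable_funTS; apply: (measurableT_comp (measurable_powR _)); exact: pair_meas.
- by move=> x _; rewrite ger0_norm ?powR_ge0// pair_powR_le.
Qed.

Lemma BB_eq_bb u w : (forall x, u.1 x = 0) -> BB r u w = bb r w.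
Proof. by move=> u0; apply: int_eq => x _; rewrite u0 expr0n add0r sq_norm_powR. Qed.

Definition KK2 u w h k : R := \int[mu]_(x in hl) (rho u w x * (u.1 x * h.1 x + w.1 x * k.1 x)).

Lemma KK2E u w h k : H1 u -> H1 w -> H1 h -> H1 k ->
  integ hl (fun x => rho u w x * (u.1 x * h.1 x + w.1 x * k.1 x)) /\
  KK2 u w h k = JJ u w h + JJ w u k.
Proof.
move=> hu hw hh hk; have i1 := integ_rho hu hw hu hh; have i2 := integ_rho hu hw hw hk.
split.
  by apply: integ_eq (integD mhl i1 i2) => [|x _]; [exact: mhl|rewrite mulrDr].
rewrite /KK2 /JJ.
have -> : \int[mu]_(x in hl) (rho w u x * (w.1 x * k.1 x)) =
  \int[mu]_(x in hl) (rho u w x * (w.1 x * k.1 x)).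
  by apply: int_eq => x _; rewrite rhoC.
by rewrite -int_sum2//; apply: int_eq => x _; rewrite mulrDr.
Qed.

Lemma BB_tangent u w h k : H1 u -> H1 w -> H1 h -> H1 k ->
  BB r u w + r * KK2 u w h k <= BB r (addE u h) (addE w k).
Proof.
move=> hu hw hh hk; have [ik _] := KK2E hu hw hh hk.
have i1 := integ_BB hu hw; have i2 := integ_BB (H1_add hu hh) (H1_add hw hk).
rewrite /BB /KK2 -[X in X + _]mul1r -int_lin//; last exact: mhl.
apply: int_le => //; [exact: mhl|apply: integ_lin => //; exact: mhl|].
move=> x _; rewrite !add1 mul1r.
have := vec_tangent (u.1 x) (w.1 x) (u.1 x + h.1 x) (w.1 x + k.1 x) e1.
rewrite (_ : 2 * (r / 2) = r); last by field.
by rewrite !(addrAC _ _ (- _)) !subrr !add0r.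
Qed.

Lemma BB_taylor u w h k (M : R) : H1 u -> H1 w -> H1 h -> H1 k -> 0 <= M ->
  (forall x, u.1 x ^+ 2 + w.1 x ^+ 2 <= M ^+ 2) ->
  (forall x, (u.1 x + h.1 x) ^+ 2 + (w.1 x + k.1 x) ^+ 2 <= M ^+ 2) ->
  BB r (addE u h) (addE w k) <=
  BB r u w + r * KK2 u w h k + r * r * M `^ (r - 2) * (n0 h + n0 k).
Proof.
move=> hu hw hh hk M0 b1 b2; have [ik _] := KK2E hu hw hh hk.
have i1 := integ_BB hu hw; have i2 := integ_BB (H1_add hu hh) (H1_add hw hk).
have [_ _ j1 _] := hh; have [_ _ j2 _] := hk.
have ij := integD mhl j1 j2.
set X := (X in _ <= X).
have -> : X = \int[mu]_(x in hl) (1 * (1 * (u.1 x ^+ 2 + w.1 x ^+ 2) `^ (r / 2) +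
   r * (rho u w x * (u.1 x * h.1 x + w.1 x * k.1 x))) +
   (r * r * M `^ (r - 2)) * (h.1 x ^+ 2 + k.1 x ^+ 2)).
  rewrite int_lin//; [|exact: mhl|apply: integ_lin => //; exact: mhl].
  rewrite int_lin//; last exact: mhl.
  by rewrite int_sum2// /X /BB /KK2 /n0; ring.
apply: int_le => //; [exact: mhl|by repeat (apply: integ_lin => //; try exact: mhl)|].
move=> x _; rewrite !add1 !mul1r; exact: vec_taylor.
Qed.

Variables (om al : R) (W : R -> R) (c1 c2 d m : R).
Hypotheses (om0 : 0 < om) (hW : potential_bounds W c1 c2).
Let c := fun x => W x + om.
Local Notation "'aa' u" := (bil al c u u) (at level 10, u at level 9).
Hypotheses (d0 : 0 < d) (hd : forall u, H1 u -> d * n0 u <= aa u).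
Hypotheses (m0 : 0 < m).
Hypothesis (hm : forall u, H1 u -> m `^ (r / 2 - 1) * bb r u <= aa u `^ (r / 2)).
Let pc : potential_bounds c c1 (c2 + om). Proof. exact: pot_shift. Qed.

Lemma aa_ge0 u : H1 u -> 0 <= aa u.
Proof. by move=> hu; apply: le_trans (hd hu); rewrite mulr_ge0 ?n0_ge0// ltW. Qed.

Lemma aa_eq0 u : H1 u -> aa u = 0 -> forall x, u.1 x = 0.
Proof.
move=> hu a0; apply: n0_eq0 => //; apply/eqP; rewrite eq_le n0_ge0 andbT.
by rewrite -(ler_pM2l d0) mulr0 -a0 hd.
Qed.

(** Minkowski's inequality in [L^(r / 2)] for [u ^ 2 + w ^ 2]: pointwise convexity with weights
    proportional to [aa u] and [aa w] gives pairs the same constant as single functions. If one of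
    the forms is 0, that component vanishes and [hm] applies to the other. *)
Lemma BB_le u w : H1 u -> H1 w -> m `^ (r / 2 - 1) * BB r u w <= (aa u + aa w) `^ (r / 2).
Proof.
move=> hu hw; have := aa_ge0 hu; rewrite le_eqVlt => /orP[/eqP a0|a1].
  by rewrite -a0 add0r (BB_eq_bb _ (aa_eq0 hu (esym a0))) hm.
have := aa_ge0 hw; rewrite le_eqVlt => /orP[/eqP a0|a2].
  by rewrite -a0 addr0 BBC (BB_eq_bb _ (aa_eq0 hw (esym a0))) hm.
set a := aa u in a1 *; set b := aa w in a2 *.
have A0 : 0 < a + b by rewrite addr_gt0.
pose th := a / (a + b); have th0 : 0 < th by rewrite divr_gt0.
have thE : 1 - th = b / (a + b) by rewrite /th; field; rewrite gt_eqF.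
have th1 : 0 < 1 - th by rewrite thE divr_gt0.
pose q1 := th * th^-1 `^ (r / 2); pose q2 := (1 - th) * (1 - th)^-1 `^ (r / 2).
have pw x : (u.1 x ^+ 2 + w.1 x ^+ 2) `^ (r / 2) <= q1 * `|u.1 x| `^ r + q2 * `|w.1 x| `^ r.
  have h01 : 0 <= th <= 1 by rewrite ltW//= -subr_ge0 ltW.
  have p1 : 0 <= th^-1 by rewrite invr_ge0 ltW.
  have p2 : 0 <= (1 - th)^-1 by rewrite invr_ge0 ltW.
  have := powR_convex e1 (mulr_ge0 p1 (sqr_ge0 (u.1 x))) (mulr_ge0 p2 (sqr_ge0 (w.1 x))) h01.
  rewrite (powRM _ p1 (sqr_ge0 (u.1 x))) (powRM _ p2 (sqr_ge0 (w.1 x))) !sq_norm_powR.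
  rewrite !mulrA !mulfV ?gt_eqF// !mul1r.
  by [].
have i1 := bb_integ r2 hu; have i2 := bb_integ r2 hw.
have le1 : BB r u w <= q1 * bb r u + q2 * bb r w.
  rewrite /BB /bb -int_lin//; last exact: mhl.
  apply: int_le; [exact: mhl|exact: integ_BB|apply: integ_lin => //; exact: mhl|].
  by move=> x _; exact: pw.
have q10 : 0 <= q1 by rewrite mulr_ge0 ?powR_ge0// ltW.
have q20 : 0 <= q2 by rewrite mulr_ge0 ?powR_ge0// ltW.
have P1 : q1 * a `^ (r / 2) = th * (a + b) `^ (r / 2).
  by rewrite /q1 -mulrA ratio_powR.
have P2 : q2 * b `^ (r / 2) = (1 - th) * (a + b) `^ (r / 2).
  by rewrite /q2 -mulrA thE ratio_powR.
apply: le_trans (weighted_arith (powR_ge0 m _) q10 q20 le1 (hm hu) (hm hw)) _.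
have -> : aa u = a by []. have -> : aa w = b by [].
by rewrite P1 P2 -mulrDl (_ : th + (1 - th) = 1) ?mul1r//; ring.
Qed.

Definition minimizer u w := [/\ H1 u, H1 w, aa u + aa w = m & BB r u w = m].

Lemma minimizer_sym u w : minimizer u w -> minimizer w u.
Proof.
by move=> [hu hw hA hB]; split; [exact: hw|exact: hu|rewrite addrC|rewrite BBC].
Qed.

(** Along [u + t * h] the lower bound [BB_tangent] and the upper bound [BB_le] for [BB] agree at
    [t = 0]. Dividing by [t > 0], then by [- t], and letting [t] tend to 0 squeezes their linear
    terms together. *)
Lemma euler u w h : minimizer u w -> H1 h -> bil al c u h = JJ u w h.
Proof.
move=> [hu hw Am Bm] hh; have z := @H1_zero R.
pose b := bil al c u h; pose q := aa h; pose j := JJ u w h.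
pose X t := m + 2 * t * b + t ^+ 2 * q.
have Xa t : aa (addE u (lc t h 0 h)) + aa w = X t.
  rewrite /addE (bil_sq_lc al pc)//; last exact: H1_lc.
  rewrite (bil_sq_lc al pc)// (bil_lcr al pc)// /X -Am /b /q; ring.
have X0 t : 0 <= X t.
  by rewrite -Xa addr_ge0// aa_ge0//; apply: H1_add => //; exact: H1_lc.
have up t : r * (t * j) * m `^ (r / 2 - 1) <= r / 2 * X t `^ (r / 2 - 1) * (X t - m).
  have ht := H1_lc t 0 hh hh.
  have := BB_tangent hu hw ht z.
  have [_ ->] := KK2E hu hw ht z.
  have -> : JJ w u ((fun=> 0), (fun=> 0)) = 0.
    by apply: int_zero => x _ /=; ring.
  have -> : JJ u w (lc t h 0 h) = t * j.
    rewrite /j /JJ -[RHS]addr0 -(mul0r j) /j /JJ -int_lin//.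
    - by apply: int_eq => x _ /=; ring.
    - exact: mhl.
    - exact: integ_rho.
    - exact: integ_rho.
  have -> : BB r (addE u (lc t h 0 h)) (addE w ((fun=> 0), (fun=> 0))) = BB r (addE u (lc t h 0 h)) w.
    by apply: int_eq => x _; rewrite [(addE w _).1 x]add1 addr0.
  rewrite addr0 Bm => lo.
  have := BB_le (H1_add hu ht) hw; rewrite Xa => hi.
  have P0 : 0 <= m `^ (r / 2 - 1) by exact: powR_ge0.
  have lohi := le_trans (ler_wpM2l P0 lo) hi.
  have := bernoulli e1 (ltW m0) (X0 t).
  rewrite -[m `^ (r / 2)](mulr_powRB1 (ltW m0) r20) => hb.
  exact: tangent_arith hb lohi.
have slope t : 0 < t -> 2 * j * m `^ (r / 2 - 1) <= X t `^ (r / 2 - 1) * (2 * b + t * q) /\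
   X (- t) `^ (r / 2 - 1) * (2 * b - t * q) <= 2 * j * m `^ (r / 2 - 1).
  move=> t0; have rt : 0 < r / 2 * t by rewrite mulr_gt0//; move: e1; lra.
  split; rewrite -(ler_pM2l rt).
    have := up t; rewrite /X; move: ((_ + _ + _) `^ _) (m `^ _) => B C.
    by move=> h1; apply: le_trans (le_trans h1 _); rewrite le_eqVlt; apply/orP; left; apply/eqP; field.
  have := up (- t); rewrite /X; move: ((_ + _ + _) `^ _) (m `^ _) => B C.
  move=> h1; apply: (@le_trans _ _ (- (r / 2 * B * (m + 2 * - t * b + (- t) ^+ 2 * q - m)))).
    by rewrite le_eqVlt; apply/orP; left; apply/eqP; field.
  by rewrite lerNl; apply: le_trans _ h1; rewrite le_eqVlt; apply/orP; left; apply/eqP; field.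
have cX (s : R) : (X (s * t) `^ (r / 2 - 1) * (2 * b + s * t * q)) @[t --> 0^'+] --> m `^ (r / 2 - 1) * (2 * b).
  have ct : (s * t) @[t --> (0:R)^'+] --> s * 0.
    by apply: cvg_at_right_filter; apply: cvgM; [exact: cvg_cst|exact: cvg_id].
  rewrite mulr0 in ct.
  have cXt : X (s * t) @[t --> (0:R)^'+] --> m.
    rewrite (_ : m = m + 2 * 0 * b + 0 * 0 * q); last by ring.
    apply: cvgD; last first.
      by rewrite /X; apply: cvgM; [under eq_cvg do rewrite expr2; exact: cvgM|exact: cvg_cst].
    apply: cvgD; first exact: cvg_cst.
    by apply: cvgM; [apply: cvgM => //; exact: cvg_cst|exact: cvg_cst].
  apply: cvgM.
    exact: cvg_powR.
  rewrite -[X in _ --> X]addr0 -[X in _ --> _ + X](mul0r q).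
  apply: cvgD; first exact: cvg_cst.
  by apply: cvgM => //; exact: cvg_cst.
have P0 : 0 < m `^ (r / 2 - 1) by rewrite powR_gt0.
have jb : 2 * j * m `^ (r / 2 - 1) <= m `^ (r / 2 - 1) * (2 * b).
  apply: (ler_cvg_to (cvg_cst _) (cX 1)); near=> t; rewrite mul1r.
  by have [] := slope t _.
have bj : m `^ (r / 2 - 1) * (2 * b) <= 2 * j * m `^ (r / 2 - 1).
  apply: (ler_cvg_to (cX (-1)) (cvg_cst _)); near=> t; rewrite mulN1r mulNr.
  by have [] := slope t _.
move: jb bj; rewrite mulrC !ler_pM2l// => jb bj; rewrite -/b -/j.
by apply/eqP; rewrite eq_le; apply/andP; split; lra.
Unshelve. all: by end_near. Qed.

End Variation.

(** * Minimizers are critical, and critical points satisfy the Nehari identity *)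

Section Criticality.
Context {R : realType} {n : nat}.
Notation mu := (@lebesgue_measure R).
Notation E := ((R -> R) * (R -> R))%type.
Notation hl := (@halfline R).
Implicit Types (u w h k : E) (v : graph_function R n).
Variables (gamma omega p : R) (V : potential R n) (c1 c2 d m : R).
Hypotheses (hsym : symmetric_potential V) (hW : potential_bounds (V ord0) c1 c2).
Hypotheses (hp : 1 < p) (om0 : 0 < omega) (d0 : 0 < d) (m0 : 0 < m).
Local Notation r := (p + 1).
Local Notation N := (@NN R n).
Let al : R := @alpha R n gamma.
Let c := fun x => V ord0 x + omega.
Hypothesis hd : forall u, H1 u -> d * n0 u <= bil al c u u.
Hypothesis hm : forall u, H1 u -> m `^ (r / 2 - 1) * bb r u <= bil al c u u `^ (r / 2).
Let r2 : 2 < r. Proof. by move: hp; lra. Qed.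
Let r0 : 0 < r. Proof. by move: hp; lra. Qed.
Let pc : potential_bounds c c1 (c2 + omega). Proof. exact: pot_shift. Qed.
Let N0 : 0 < N. Proof. exact: NN_gt0. Qed.
Local Notation A := (AA gamma V omega).

Definition sqn u w : R := n0 u + n0 w + (n1 u + n1 w).

Lemma sqn_ge0 u w : 0 <= sqn u w.
Proof. by rewrite !addr_ge0 ?n0_ge0 ?n1_ge0. Qed.

Lemma rep_add v (h : graph_function R n) u w h1 h2 : rep v u w -> rep h h1 h2 ->
  rep (fun e x => v e x + h e x) (addE u h1) (addE w h2).
Proof.
move=> [hu hw vE] [hh1 hh2 hE]; split; [exact: H1_add|exact: H1_add|].
by move=> e x x0; rewrite vE// hE// /pair_of !add1.
Qed.

Lemma A_add u w h k : H1 u -> H1 w -> H1 h -> H1 k ->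
  A (addE u h) (addE w k) = A u w + 2 * (bil al c u h + bil al c w k) + A h k.
Proof.
move=> hu hw hh hk; rewrite /AA /addE.
by rewrite (bil_sq_lc _ pc)// (bil_sq_lc _ pc)//; ring.
Qed.

Lemma split_diff (Y X : R) : X = Y + (X - Y).
Proof. by ring. Qed.

Lemma quadratic_arith (K b B X Y Z G s C r' : R) : 0 < r' -> K <= B -> B <= K + r' * G * s ->
  `|Z| <= C * s ->
  `|(2^-1 * (X + 2 * b + Z) - r'^-1 * (Y + r' * b + (B - K))) - (2^-1 * X - r'^-1 * Y)| <=
   (C + G) * s.
Proof.
move=> r'0 h1 h2; rewrite ler_norml => /andP[z1 z2].
have -> : 2^-1 * (X + 2 * b + Z) - r'^-1 * (Y + r' * b + (B - K)) - (2^-1 * X - r'^-1 * Y) =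
  2^-1 * Z - r'^-1 * (B - K) by field; rewrite gt_eqF.
have q0 : 0 <= r'^-1 * (B - K) by rewrite mulr_ge0 ?invr_ge0 ?(ltW r'0)// subr_ge0.
have q1 : r'^-1 * (B - K) <= G * s.
  rewrite -(ler_pM2l r'0) mulrA mulfV ?gt_eqF// mul1r; lra.
by rewrite ler_norml; apply/andP; split; lra.
Qed.

Local Notation minimizer := (minimizer r omega al (V ord0) m).

(** The linear terms cancel by [euler], applied to each component. What remains is quadratic: the
    form of the increment, by [bil_up], and the nonlinear remainder, nonnegative by [BB_tangent] and
    bounded above by [BB_taylor]. *)
Lemma frechet_of_minimizer v u w : rep v u w -> minimizer u w ->
  frechet_derivative_H1_eq (S_action p gamma omega V) v (fun=> 0).
Proof.
move=> rv min; have [hu hw Am Bm] := min; split.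
- by move=> *; rewrite mulr0 addr0.
- by exists 0 => ? _; rewrite normr0 mul0r.
move=> eps eps0.
have [M0 M00 hM0] := pair_bounded hu hw.
(* An increment of norm below 1 has squared modulus at most 2 by [H1_bound], so [M] bounds the
   modulus both before and after the increment. *)
pose M := Num.sqrt (2 * M0 ^+ 2 + 4).
have M2 : M ^+ 2 = 2 * M0 ^+ 2 + 4 by rewrite sqr_sqrtr// addr_ge0// mulr_ge0// sqr_ge0.
have M_0 : 0 <= M by exact: sqrtr_ge0.
have [Cu Cu0 hCu] := bil_up al pc.
pose K := Cu + r * M `^ (r - 2).
have K0 : 0 <= K by rewrite addr_ge0// mulr_ge0 ?powR_ge0// ltW.
have K1 : 0 < K + 1 by rewrite ltr_wpDl.
exists (Num.min 1 (eps / (K + 1))); split; first by rewrite lt_min ltr01 divr_gt0.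
move=> h hh; rewrite lt_min => /andP[n1' n2'].
have [h1 [h2 rh]] := H1_eq_rep hh; have [hh1 hh2 _] := rh.
have s0 := sqn_ge0 h1 h2; set s := sqn h1 h2 in s0.
have nE : H1_norm h = Num.sqrt (N * s) by rewrite (H1_norm_rep rh).
have Ns0 : 0 <= N * s by rewrite mulr_ge0// ltW.
have norm0 : 0 <= H1_norm h by rewrite nE sqrtr_ge0.
have nn : H1_norm h ^+ 2 = N * s by rewrite nE sqr_sqrtr.
have Ns1 : N * s <= 1 by rewrite -nn exprn_ile1// ltW.
have N1 : 1 <= N by rewrite ler1n.
have s1 : s <= 1 by apply: le_trans Ns1; rewrite ler_peMl.
have b2 x : (u.1 x + h1.1 x) ^+ 2 + (w.1 x + h2.1 x) ^+ 2 <= M ^+ 2.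
  have k1 := H1_bound x hh1; have k2 := H1_bound x hh2; have k3 := hM0 x.
  have ks : 2 * (n0 h1 + n1 h1) + 2 * (n0 h2 + n1 h2) <= 2 by move: s1; rewrite /s /sqn; lra.
  have e1 := sqr_ge0 (u.1 x - h1.1 x); have e2 := sqr_ge0 (w.1 x - h2.1 x).
  by rewrite M2; move: k1 k2 k3 ks e1 e2; rewrite !expr2; lra.
have b1 x : u.1 x ^+ 2 + w.1 x ^+ 2 <= M ^+ 2.
  by apply: le_trans (hM0 x) _; rewrite M2; have := sqr_ge0 M0; lra.
have lo := BB_tangent r2 hu hw hh1 hh2.
have up := BB_taylor r2 hu hw hh1 hh2 M_0 b1 b2.
have [_ kE] := KK2E r2 hu hw hh1 hh2.
have eu := euler r2 om0 hW d0 hd m0 hm min hh1.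
have ew := euler r2 om0 hW d0 hd m0 hm (minimizer_sym min) hh2.
have kb : bil al c h1 h1 + bil al c h2 h2 = A h1 h2 by [].
have Zs : `|A h1 h2| <= Cu * s.
  rewrite -kb; apply: le_trans (ler_normD _ _) _; apply: le_trans (lerD (hCu _ hh1) (hCu _ hh2)) _.
  by rewrite -mulrDr /s /sqn le_eqVlt; apply/orP; left; apply/eqP; congr (_ * _); ring.
have G0 : 0 <= r * r * M `^ (r - 2) by rewrite !mulr_ge0 ?powR_ge0// ltW.
have ns : n0 h1 + n0 h2 <= s by rewrite /s /sqn lerDl addr_ge0 ?n1_ge0.
have up' := le_trans up (lerD (lexx _) (ler_wpM2l G0 ns)).
rewrite subr0 (S_rep gamma hsym hW omega hp (rep_add rv rh)) (S_rep gamma hsym hW omega hp rv).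
rewrite A_add// eu ew -kE -mulrBr normrM (gtr0_norm N0).
rewrite [BB r (addE u h1) (addE w h2)](split_diff (BB r u w + r * KK2 r u w h1 h2)).
have up'' : BB r (addE u h1) (addE w h2) <= BB r u w + r * KK2 r u w h1 h2 + r * (r * M `^ (r - 2)) * s.
  by rewrite !mulrA.
have Q := @quadratic_arith _ (KK2 r u w h1 h2) _ (A u w) (BB r u w) _ _ _ _ _ r0 lo up'' Zs.
apply: le_trans (ler_wpM2l (ltW N0) Q) _.
rewrite -/K mulrCA -nn expr2 mulrA ler_wpM2r//.
apply: (@le_trans _ _ ((K + 1) * H1_norm h)); first by rewrite ler_wpM2r// lerDl.
by rewrite -ler_pdivlMl// mulrC ltW.
Qed.

Lemma first_order_arith (r' t a b B X : R) : 0 < r' -> b + r' * (t * b) <= B ->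
  X <= 2^-1 * (a + 2 * (t * a) + t ^+ 2 * a) - r'^-1 * B - (2^-1 * a - r'^-1 * b) ->
  X <= t * (a - b) + t ^+ 2 * (2^-1 * a).
Proof.
move=> r'0 h1 h2; apply: le_trans h2 _.
have : r'^-1 * (b + r' * (t * b)) <= r'^-1 * B by rewrite ler_wpM2l// invr_ge0 ltW.
have -> : r'^-1 * (b + r' * (t * b)) = r'^-1 * b + t * b by field; rewrite gt_eqF.
by move: (r'^-1 * b) (r'^-1 * B) => P Q; lra.
Qed.

Lemma nehari_arith (D B C : R) : 0 <= B -> 0 <= C ->
  (forall eps : R, 0 < eps -> exists delta : R, 0 < delta /\ forall t : R, `|t| * C < delta ->
     - (eps * (`|t| * C)) <= t * D + t ^+ 2 * B) -> D = 0.
Proof.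
move=> B0 C0 h; apply/eqP; rewrite -normr_eq0 eq_le normr_ge0 andbT.
apply/ler_addgt0Pr => e e0; rewrite add0r.
have C1 : 0 < C + 1 by rewrite ltr_wpDl.
have B1 : 0 < B + 1 by rewrite ltr_wpDl.
have ep : 0 < e / (2 * (C + 1)) by rewrite divr_gt0// mulr_gt0.
have [de [de0 hde]] := h _ ep.
pose t := Num.min (de / (C + 1)) (e / (2 * (B + 1))).
have t0 : 0 < t by rewrite lt_min !divr_gt0// mulr_gt0.
have tC : t * C < de.
  apply: (@lt_le_trans _ _ (t * (C + 1))); first by rewrite ltr_pM2l// ltrDl.
  by rewrite -ler_pdivlMr// ge_min lexx.
have tB : t * B <= e / 2.
  apply: (@le_trans _ _ (t * (B + 1))); first by rewrite ler_pM2l// lerDl.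
  rewrite -ler_pdivlMr//; apply: (@le_trans _ _ (e / (2 * (B + 1)))).
    by rewrite ge_min lexx orbT.
  by rewrite le_eqVlt; apply/orP; left; apply/eqP; field; rewrite gt_eqF.
have eC : e / (2 * (C + 1)) * C <= e / 2.
  apply: (@le_trans _ _ (e / (2 * (C + 1)) * (C + 1))); first by rewrite ler_wpM2l ?(ltW ep)// lerDl.
  by rewrite le_eqVlt; apply/orP; left; apply/eqP; field; rewrite gt_eqF.
have := hde t; have := hde (- t); rewrite normrN (gtr0_norm t0) tC => /(_ isT) q1 /(_ isT) q2.
have q1' : - (e / (2 * (C + 1)) * C) <= - D + t * B.
  by rewrite -(ler_pM2l t0); apply: le_trans (le_trans _ q1) _; rewrite le_eqVlt; apply/orP; left; apply/eqP; ring.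
have q2' : - (e / (2 * (C + 1)) * C) <= D + t * B.
  by rewrite -(ler_pM2l t0); apply: le_trans (le_trans _ q2) _; rewrite le_eqVlt; apply/orP; left; apply/eqP; ring.
by rewrite ler_norml; apply/andP; split; lra.
Qed.

(** The derivative is tested in the direction of [v] itself. Up to the factor [NN], [BB_tangent]
    bounds [S ((1 + t) v) - S v] above by [t * (A - BB) + t ^ 2 * A / 2], and the two signs of [t]
    force [A = BB]. *)
Lemma nehari_of_critical v u w : rep v u w ->
  frechet_derivative_H1_eq (S_action p gamma omega V) v (fun=> 0) -> A u w = BB r u w.
Proof.
move=> rv [_ _ fr]; have [hu hw vE] := rv.
have A0 : 0 <= A u w by rewrite addr_ge0// (aa_ge0 d0 hd).
pose C := Num.sqrt (N * sqn u w).
have C0 : 0 <= C by exact: sqrtr_ge0.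
apply/eqP; rewrite -subr_eq0; apply/eqP.
have A2 : 0 <= 2^-1 * A u w by rewrite mulr_ge0.
apply: (nehari_arith A2 C0) => eps eps0.
have [de [de0 hde]] := fr (N * eps) (mulr_gt0 N0 eps0).
exists de; split => // t tC.
pose tu := lc t u 0 u; pose tw := lc t w 0 w.
have htu : H1 tu by exact: H1_lc. have htw : H1 tw by exact: H1_lc.
pose h : graph_function R n := fun e x => pair_of tu tw x.
have rh : rep h tu tw by split.
have nE : H1_norm h = `|t| * C.
  rewrite (H1_norm_rep rh) !n0_scale// !n1_scale//.
  have -> : N * (t ^+ 2 * n0 u + t ^+ 2 * n0 w + (t ^+ 2 * n1 u + t ^+ 2 * n1 w)) =
    t ^+ 2 * (N * sqn u w) by rewrite /sqn; ring.
  by rewrite sqrtrM ?sqr_ge0// sqrtr_sqr.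
have := hde h (rep_H1_eq rh); rewrite nE => /(_ tC); rewrite subr0.
rewrite (S_rep gamma hsym hW omega hp (rep_add rv rh)) (S_rep gamma hsym hW omega hp rv).
rewrite A_add// -mulrBr ler_norml -mulrA -mulrN => /andP[]; rewrite ler_pM2l// => lo _.
have b1 : bil al c u tu = t * bil al c u u by rewrite (bil_lcr al pc)//; ring.
have b2 : bil al c w tw = t * bil al c w w by rewrite (bil_lcr al pc)//; ring.
have At : A tu tw = t ^+ 2 * A u w.
  by rewrite /AA /tu /tw (bil_sq_lc _ pc)// (bil_sq_lc _ pc)//; ring.
have kt : KK2 r u w tu tw = t * BB r u w.
  have iB := integ_BB r2 hu hw.
  transitivity (\int[mu]_(x in hl) (t * (u.1 x ^+ 2 + w.1 x ^+ 2) `^ (r / 2) + 0 * (u.1 x ^+ 2 + w.1 x ^+ 2) `^ (r / 2))).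
    apply: int_eq => x _; rewrite /rho /=.
    have s0 : 0 <= u.1 x ^+ 2 + w.1 x ^+ 2 by rewrite addr_ge0 ?sqr_ge0.
    have e0 : 0 < r / 2 by rewrite divr_gt0.
    by rewrite -(mulr_powRB1 s0 e0); ring.
  by rewrite int_lin ?mul0r ?addr0//; exact: mhl.
have tan := BB_tangent r2 hu hw htu htw; rewrite kt in tan.
move: lo; rewrite b1 b2 At -mulrDr.
have -> : bil al c u u + bil al c w w = A u w by [].
exact: (first_order_arith r0 tan).
Qed.

End Criticality.

(** * The phase of a minimizer *)

Section LinearEquation.
Context {R : realType}.
Notation mu := (@lebesgue_measure R).
Notation E := ((R -> R) * (R -> R))%type.
Notation hl := (@halfline R).
Implicit Types (u w h k : E).
Variables (al : R) (c s : R -> R) (c1 c2 : R) (k : E).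
Hypotheses (hc : potential_bounds c c1 c2) (hk : H1 k).
Hypothesis (is_ : forall h, H1 h -> integ hl (fun x => s x * (k.1 x * h.1 x))).
Hypothesis (ls : forall T, integ `]0, T] s).
Hypothesis (eqk : forall h, H1 h -> bil al c k h = \int[mu]_(x in hl) (s x * (k.1 x * h.1 x))).

(** With this coefficient [eqk] is the weak form of [- k'' + q * k = 0] together with the vertex
    condition. *)
Let q x := c x - s x.

Lemma q_loc T : integ `]0, T] q.
Proof. by apply: integB => //; exact: pot_loc hc T. Qed.

Lemma q_mul h : H1 h -> integ hl (fun x => q x * (k.1 x * h.1 x)).
Proof.
move=> hh; apply: integ_eq (integB mhl (pot_mul hc hk hh) (is_ hh)) => [|x _]; first exact: mhl.
by rewrite /q mulrBl.
Qed.

Lemma weak_form h : H1 h -> k.1 0 * h.1 0 = 0 ->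
  \int[mu]_(x in hl) (k.2 x * h.2 x) = - \int[mu]_(x in hl) (q x * (k.1 x * h.1 x)).
Proof.
move=> hh z; have i1 := pot_mul hc hk hh; have i2 := is_ hh.
have -> : \int[mu]_(x in hl) (q x * (k.1 x * h.1 x)) =
  1 * \int[mu]_(x in hl) (c x * (k.1 x * h.1 x)) + (-1) * \int[mu]_(x in hl) (s x * (k.1 x * h.1 x)).
  by rewrite -int_lin//; [apply: int_eq => x _; rewrite /q; ring|exact: mhl].
by have := eqk hh; rewrite /bil z => <-; ring.
Qed.

Definition Qint (T : R) : R := \int[mu]_(x in `]0, T]) `|q x|.

Lemma Qint_ge0 T : 0 <= Qint T.
Proof. by apply: Rintegral_ge0 => x _; exact: normr_ge0. Qed.

Lemma Qint_mono (T T' : R) : 0 <= T -> T <= T' -> Qint T <= Qint T'.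
Proof.
move=> T0 TT; apply: int_sub_le => //.
- by move=> x; rewrite /= !in_itv/= => /andP[-> xT]; exact: le_trans TT.
- exact: integ_abs (q_loc T').
Qed.

Lemma q_bound h (T S : R) : H1 h -> 0 <= T -> (forall x, 0 < x -> x <= T -> `|k.1 x * h.1 x| <= S) ->
  (forall x, T < x -> k.1 x * h.1 x = 0) ->
  `|\int[mu]_(x in hl) (q x * (k.1 x * h.1 x))| <= S * Qint T.
Proof.
move=> hh T0 b1 b2; have iq := q_mul hh.
rewrite (int_split T0 iq) [X in _ + X]int_zero ?addr0; last first.
  by move=> x; rewrite /= in_itv/= andbT => /b2 ->; rewrite mulr0.
have ia := integ_abs (q_loc T).
have -> : S * Qint T = \int[mu]_(x in `]0, T]) (S * `|q x| + 0 * `|q x|).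
  by rewrite int_lin// mul0r addr0.
apply: int_abs_le => //.
- apply: integ_meas; apply: integ_sub iq => //; first exact: mhl.
  by move=> x; rewrite /= in_itv/= halflineE => /andP[].
- exact: integ_lin.
- move=> x; rewrite /= in_itv/= => /andP[x0 xT]; rewrite mul0r addr0 normrM mulrC.
  by rewrite ler_wpM2r// b1.
Qed.

Lemma absorb_arith (D L Q S : R) : 0 <= D -> L * Q < 1 -> S = L * D -> D <= S * Q -> D = 0.
Proof.
move=> D0 LQ -> h; apply/eqP; rewrite eq_le D0 andbT leNgt; apply/negP => Dp.
have e : D * (L * Q) < D * 1 by rewrite ltr_pM2l.
by move: e; rewrite mulr1 mulrCA mulrA ltNge h.
Qed.

(* Test with [k - k T], stopped at [T]: the energy on the short interval
   [T0, T] is absorbed by the potential term. *)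
Lemma forward_step (T0 T : R) : 0 <= T0 -> T0 <= T -> (forall x, 0 <= x <= T0 -> k.1 x = 0) ->
  (T - T0) * Qint T < 1 -> forall x, 0 <= x <= T -> k.1 x = 0.
Proof.
move=> T00 TT k0 sm; have T_0 := le_trans T00 TT; have [ack mk _ ik1] := hk.
pose z : E := ((fun=> 0), (fun=> 0)).
pose f : E := (fun x => 1 * k.1 x + (- k.1 T) * 1, fun x => 1 * k.2 x + (- k.1 T) * 0).
have acf : AC f.1 f.2 by apply: AC_lin => //; exact: AC_cst.
have f2 x : f.2 x = k.2 x by rewrite /f /=; ring.
have f1 x : f.1 x = k.1 x - k.1 T by rewrite /f /=; ring.
pose h := glue T f z.
have hh : H1 h.
  apply: H1_glue => //; last by rewrite f1 subrr.
  - by apply: measurable_funD; apply: measurable_funM.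
  - have := integ_halfline_oc T (lexx 0) ik1; apply: integ_eq => // x _; by rewrite f2.
  - exact: H1_zero.
have k00 : k.1 0 = 0 by apply: k0; rewrite lexx.
have wf := weak_form hh; rewrite k00 mul0r in wf; have {}wf := wf erefl.
pose D := n1 h; have D0 : 0 <= D by exact: n1_ge0.
have h1 x : x <= T -> h.1 x = k.1 x - k.1 T by move=> xT; rewrite /h /glue /= xT; ring.
have h1z x : T < x -> h.1 x = 0 by move=> Tx; rewrite /h /glue /= leNgt Tx.
have DE : D = \int[mu]_(x in hl) (k.2 x * h.2 x).
  apply: int_eq => x _; rewrite /h /glue /=; case: ifP => _; ring.
have diff x y : 0 <= x -> x <= y -> y <= T -> (k.1 y - k.1 x) ^+ 2 <= (y - x) * D.
  move=> x0 xy yT; have := H1_holder hh x0 xy.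
  by rewrite !h1 ?(le_trans xy)// (_ : k.1 y - k.1 T - (k.1 x - k.1 T) = k.1 y - k.1 x)//; ring.
pose S := (T - T0) * D.
have ksq x : T0 <= x -> x <= T -> k.1 x ^+ 2 <= S /\ (k.1 x - k.1 T) ^+ 2 <= S.
  move=> Tx xT; split.
    have := diff _ _ T00 Tx xT; rewrite (k0 T0) ?lexx ?T00// subr0 => e.
    by apply: le_trans e _; rewrite ler_wpM2r// lerD2r.
  have := diff _ _ (le_trans T00 Tx) xT (lexx T); rewrite -sqrrN opprB => e.
  by apply: le_trans e _; rewrite ler_wpM2r// lerD2l lerN2.
have S0 : 0 <= S by rewrite mulr_ge0// subr_ge0.
have b1 x : 0 < x -> x <= T -> `|k.1 x * h.1 x| <= S.
  move=> x0 xT; have [xT0|/ltW T0x] := leP x T0.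
    by rewrite k0 ?mul0r ?normr0// (ltW x0).
  have [e1 e2] := ksq x T0x xT; rewrite h1//.
  rewrite ler_norml; move: e1 e2; move: (k.1 x) (k.1 T) => a b e1 e2.
  have := sqr_ge0 (a + (a - b)); have := sqr_ge0 (a - (a - b)).
  by rewrite !expr2 in e1 e2 *; move=> g1 g2; apply/andP; split; lra.
have b2 x : T < x -> k.1 x * h.1 x = 0 by move=> /h1z ->; rewrite mulr0.
have Dle : D <= S * Qint T.
  apply: le_trans (q_bound hh T_0 b1 b2); rewrite DE wf; by rewrite -normrN; exact: ler_norm.
have D00 : D = 0 by apply: (absorb_arith D0 sm (erefl S)).
move=> x /andP[x0 xT]; have [xT0|/ltW T0x] := leP x T0; first by rewrite k0// x0.
have [e1 _] := ksq x T0x xT; apply/eqP; rewrite -sqrf_eq0 eq_le sqr_ge0 andbT.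
by apply: le_trans e1 _; rewrite /S D00 mulr0.
Qed.

Lemma step_size (X : R) : exists2 de : R, 0 < de & de * Qint X < 1.
Proof.
have Q0 := Qint_ge0 X; have Q1 : 0 < Qint X + 1 by rewrite ltr_wpDl.
exists (Qint X + 1)^-1; first by rewrite invr_gt0.
by rewrite mulrC ltr_pdivrMr// mul1r ltrDl.
Qed.

(** The step [de] is adapted to the integral of [|q|] over the whole range [[0, X]], so it serves
    every step and finitely many steps reach [x]. *)
Lemma forward (x0 : R) : 0 <= x0 -> (forall x, 0 <= x <= x0 -> k.1 x = 0) ->
  forall x, 0 <= x -> k.1 x = 0.
Proof.
move=> x00 k0 x x_0; have [de de0 hde] := step_size (Num.max x x0).
set X := Num.max x x0 in hde.
have xX : x <= X by rewrite le_max lexx.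
have x0X : x0 <= X by rewrite le_max lexx orbT.
suff H (j : nat) : forall y, 0 <= y <= Num.min (x0 + j%:R * de) X -> k.1 y = 0.
  have lt : X < (Num.bound (X / de))%:R * de.
    by rewrite -ltr_pdivrMr//; apply: archi_boundP; rewrite divr_ge0 ?(ltW de0)// (le_trans x00).
  apply: (H (Num.bound (X / de))); rewrite x_0 le_min xX andbT (le_trans xX)//.
  by apply: le_trans (ltW lt) _; rewrite lerDr.
elim: j => [|j IH] y; first by rewrite mul0r addr0 min_l//; exact: k0.
have jd : 0 <= j%:R * de by rewrite mulr_ge0// ltW.
have mono : Num.min (x0 + j%:R * de) X <= Num.min (x0 + j.+1%:R * de) X.
  rewrite le_min [X in _ && X]ge_min lexx orbT andbT ge_min.
  by rewrite -natr1 mulrDl mul1r addrA lerDl ltW.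
apply: (forward_step (T0 := Num.min (x0 + j%:R * de) X)) => //.
- by rewrite le_min addr_ge0// (le_trans x00).
apply: le_lt_trans hde; apply: ler_pM; [|exact: Qint_ge0| |].
- by rewrite subr_ge0.
- rewrite lerBlDr -natr1 mulrDl mul1r addrA.
  have [h|h] := leP (x0 + j%:R * de) X; first by rewrite ge_min addrC lexx.
  by rewrite ge_min lerDr (ltW de0) orbT.
- apply: Qint_mono; last by rewrite ge_min lexx orbT.
  by rewrite le_min (le_trans x00 x0X) andbT addr_ge0// mulr_ge0// ltW.
Qed.

(** The mirror image of [forward_step]. The test function is 0 up to [T], then [k - k T], and
    [clamp] brings it back to 0 on [[x1, x1 + 1]], where [k.1] and [k.2] vanish, so this last piece
    contributes nothing. Being 0 at the vertex, it removes the boundary term. *)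
Lemma backward_step (T T0 x1 : R) : 0 <= T -> T <= T0 -> T0 <= x1 ->
  (forall x, T0 <= x -> k.1 x = 0) -> (forall x, x1 < x -> k.2 x = 0) ->
  (T0 - T) * Qint x1 < 1 -> forall x, T <= x -> k.1 x = 0.
Proof.
move=> T_0 TT Tx1 k0 k20 sm; have [ack mk _ ik1] := hk.
have x10 : 0 <= x1 := le_trans (le_trans T_0 TT) Tx1.
pose z : E := ((fun=> 0), (fun=> 0)).
pose cl := clamp x1 1; have accl : AC cl.1 cl.2 by exact: AC_clamp.
pose f : E := (fun x => 1 * (1 * k.1 x + (- k.1 T) * 1) + k.1 T * cl.1 x,
               fun x => 1 * (1 * k.2 x + (- k.1 T) * 0) + k.1 T * cl.2 x).
have acf : AC f.1 f.2 by apply: AC_lin => //; apply: AC_lin => //; exact: AC_cst.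
have f2 x : f.2 x = k.2 x + k.1 T * cl.2 x by rewrite /f /=; ring.
have f1 x : f.1 x = k.1 x - k.1 T + k.1 T * cl.1 x by rewrite /f /=; ring.
have mf2 : measurable_fun setT f.2.
  apply: measurable_funD; apply: measurable_funM => //; last exact: clamp_meas.
  by apply: measurable_funD; apply: measurable_funM.
pose g := glue T z f.
have Tx1' := le_trans TT Tx1.
have acg : AC g.1 g.2.
  apply: AC_glue => //; first exact: AC_cst.
  by rewrite f1 clamp_low// mulr0 addr0 subrr.
have mg2 : measurable_fun setT g.2.
  by apply: glue_meas; [exact: measurableT|exact: measurable_cst|exact: mf2].
have gR x : T < x -> g.1 x = f.1 x by move=> Tx; rewrite /g /glue /= leNgt Tx.
pose h := glue (x1 + 1) g z.
have x11 : 0 <= x1 + 1 by rewrite addr_ge0.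
have cl2 x : 0 <= cl.2 x <= 1 by exact: clamp_deriv.
have hh : H1 h.
  apply: H1_glue => //; last first.
  - have -> : z.1 (x1 + 1) = 0 by [].
    rewrite gR ?(le_lt_trans Tx1') ?ltrDl// f1 clamp_high//.
    by rewrite k0 ?(le_trans Tx1) ?lerDl//; ring.
  - exact: H1_zero.
  have ik := integ_halfline_oc (x1 + 1) (lexx 0) ik1.
  apply: integ_le (integ_lin 2 (2 * k.1 T ^+ 2) _ ik (integ_cst_oc 0 (x1 + 1) 1)) => //.
    by apply: measurable_funTS; apply: measurable_funX.
  move=> x _; rewrite ger0_norm ?sqr_ge0// mulr1.
  have -> : g.2 x = if x <= T then 0 else f.2 x by [].
  have /andP[q0 q1] := cl2 x.
  case: ifP => _.
    by rewrite expr0n /= addr_ge0// mulr_ge0 ?sqr_ge0// mulr_ge0// sqr_ge0.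
  rewrite f2; have e1 := sqr_ge0 (k.2 x - k.1 T * cl.2 x).
  have e2 : (k.1 T * cl.2 x) ^+ 2 <= k.1 T ^+ 2.
    by rewrite exprMn ler_piMr ?sqr_ge0// exprn_ile1.
  by move: (k.2 x) (k.1 T) (k.1 T * cl.2 x) e1 e2 => a b t; rewrite !expr2; lra.
have hlow x : x <= T -> h.1 x = 0.
  by move=> xT; rewrite /h /g /glue /= xT (le_trans xT (le_trans Tx1' _))// lerDl.
have hmid x : T < x -> x <= x1 -> h.1 x = k.1 x - k.1 T.
  move=> Tx xx1; have -> : h.1 x = g.1 x.
    by rewrite /h {1}/glue /= (le_trans xx1)// lerDl.
  by rewrite gR// f1 clamp_low// mulr0 addr0.
have kh0 : k.1 0 * h.1 0 = 0 by rewrite hlow// mulr0.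
have wf := weak_form hh kh0.
(* [k] is frozen at its value [k T] to the left of [T]: the [n1] of this function is the energy of
   [k] on [[T, +oo[], and [H1_holder] applies to it. *)
pose g0 : E := glue T ((fun=> k.1 T), (fun=> 0)) k.
have hg0 : H1 g0.
  apply: H1_glue => //; first exact: AC_cst.
    exact: measurable_cst.
  by apply: integ_eq (integ_cst_oc 0 T 0) => // x _; rewrite /= expr0n.
pose D := n1 g0; have D0 : 0 <= D by exact: n1_ge0.
have DE : D = \int[mu]_(x in hl) (k.2 x * h.2 x).
  apply: int_eq => x _; rewrite /g0 /h /g /glue /=.
  have [xT|Tx] := leP x T.
    by rewrite (le_trans xT (le_trans Tx1' _)) ?lerDl//; ring.
  have [xx1|xx1] := leP x (x1 + 1).
    have [xx|xx] := leP x x1; last by rewrite k20//; ring.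
    by ring.
  by rewrite k20 ?(lt_trans _ xx1) ?ltrDl//; ring.
have diff x y : T <= x -> x <= y -> (k.1 y - k.1 x) ^+ 2 <= (y - x) * D.
  move=> Tx xy; have := H1_holder hg0 (le_trans T_0 Tx) xy.
  have g0E t : T <= t -> g0.1 t = k.1 t.
    move=> Tt; rewrite /g0 /glue /=; case: ifP => // tT.
    by congr (k.1 _); apply/eqP; rewrite eq_le Tt tT.
  by rewrite !g0E// (le_trans Tx).
pose S := (T0 - T) * D.
have ksq x : T <= x -> x <= T0 -> k.1 x ^+ 2 <= S /\ (k.1 x - k.1 T) ^+ 2 <= S.
  move=> Tx xT; split.
    have := diff _ _ Tx xT; rewrite (k0 T0) ?lexx// sub0r sqrrN => e.
    by apply: le_trans e _; rewrite ler_wpM2r// lerD2l lerN2.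
  have := diff _ _ (lexx T) Tx => e.
  by apply: le_trans e _; rewrite ler_wpM2r// lerD2r.
have S0 : 0 <= S by rewrite mulr_ge0// subr_ge0.
have b1 x : 0 < x -> x <= x1 -> `|k.1 x * h.1 x| <= S.
  move=> x0 xx1; have [xT|Tx] := leP x T; first by rewrite hlow// mulr0 normr0.
  have [T0x|/ltW xT0] := leP T0 x; first by rewrite k0// mul0r normr0.
  have [e1 e2] := ksq x (ltW Tx) xT0; rewrite hmid//.
  rewrite ler_norml; move: e1 e2; move: (k.1 x) (k.1 T) => a b e1 e2.
  have := sqr_ge0 (a + (a - b)); have := sqr_ge0 (a - (a - b)).
  by rewrite !expr2 in e1 e2 *; move=> g1 g2; apply/andP; split; lra.
have b2 x : x1 < x -> k.1 x * h.1 x = 0.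
  by move=> xx1; rewrite k0 ?mul0r// (le_trans Tx1)// ltW.
have Dle : D <= S * Qint x1.
  apply: le_trans (q_bound hh x10 b1 b2); rewrite DE wf; by rewrite -normrN; exact: ler_norm.
have D00 : D = 0 by apply: (absorb_arith D0 sm (erefl S)).
move=> x Tx; have [T0x|/ltW xT0] := leP T0 x; first exact: k0.
have [e1 _] := ksq x Tx xT0; apply/eqP; rewrite -sqrf_eq0 eq_le sqr_ge0 andbT.
by apply: le_trans e1 _; rewrite /S D00 mulr0.
Qed.

Lemma backward (x0 : R) : 0 <= x0 -> (forall x, x0 <= x -> k.1 x = 0) ->
  (forall x, x0 < x -> k.2 x = 0) -> forall x, 0 <= x -> k.1 x = 0.
Proof.
move=> x00 k0 k20 x x_0; have [de de0 hde] := step_size x0.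
suff H (j : nat) : forall y, Num.max (x0 - j%:R * de) 0 <= y -> k.1 y = 0.
  have lt : x0 < (Num.bound (x0 / de))%:R * de.
    by rewrite -ltr_pdivrMr//; apply: archi_boundP; rewrite divr_ge0 ?(ltW de0).
  by apply: (H (Num.bound (x0 / de))); rewrite ge_max x_0 andbT (le_trans _ x_0)// subr_le0 ltW.
elim: j => [|j IH] y; first by rewrite mul0r subr0 max_l//; exact: k0.
have jd : 0 <= j%:R * de by rewrite mulr_ge0// ltW.
have mono : Num.max (x0 - j.+1%:R * de) 0 <= Num.max (x0 - j%:R * de) 0.
  rewrite ge_max [X in _ && X]le_max lexx orbT andbT le_max -natr1 mulrDl mul1r opprD addrA.
  by rewrite gerBl ltW.
apply: (backward_step (T0 := Num.max (x0 - j%:R * de) 0) (x1 := x0)) => //.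
- by rewrite le_max lexx orbT.
- by rewrite ge_max x00 andbT gerBl.
apply: le_lt_trans hde; apply: ler_wpM2r; first exact: Qint_ge0.
rewrite lerBlDr ge_max; apply/andP; split.
  by rewrite -lerBlDl le_max -natr1 mulrDl mul1r opprD addrA lexx.
by rewrite addr_ge0 ?(ltW de0)// le_max lexx orbT.
Qed.

End LinearEquation.

(** * Reflection, rotation and positivity *)

Section Phase.
Context {R : realType}.
Notation mu := (@lebesgue_measure R).
Notation E := ((R -> R) * (R -> R))%type.
Notation hl := (@halfline R).
Implicit Types (u w h k : E).
Variables (r om al : R) (W : R -> R) (c1 c2 d m : R).
Hypotheses (r2 : 2 < r) (om0 : 0 < om) (hW : potential_bounds W c1 c2).
Hypotheses (d0 : 0 < d) (m0 : 0 < m).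
Let c := fun x => W x + om.
Hypothesis (hd : forall u, H1 u -> d * n0 u <= bil al c u u).
Hypothesis (hm : forall u, H1 u -> m `^ (r / 2 - 1) * bb r u <= bil al c u u `^ (r / 2)).
Let pc : potential_bounds c c1 (c2 + om). Proof. exact: pot_shift. Qed.
Local Notation min := (minimizer r om al W m).

Definition flip (x0 : R) u : E := glue x0 u (lc (-1) u 0 u).

Lemma flip1 x0 u x : (flip x0 u).1 x = if x <= x0 then u.1 x else - u.1 x.
Proof. by rewrite /flip /glue /=; case: ifP => _ //; ring. Qed.

Lemma flip2 x0 u x : (flip x0 u).2 x = if x <= x0 then u.2 x else - u.2 x.
Proof. by rewrite /flip /glue /=; case: ifP => _ //; ring. Qed.

Lemma lc1 (a b : R) u w x : (lc a u b w).1 x = a * u.1 x + b * w.1 x.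
Proof. by []. Qed.

Lemma lc2 (a b : R) u w x : (lc a u b w).2 x = a * u.2 x + b * w.2 x.
Proof. by []. Qed.

Lemma sq_if (b : bool) (x : R) : (if b then x else - x) ^+ 2 = x ^+ 2.
Proof. by case: b; rewrite ?sqrrN. Qed.

Lemma minimizer_flip (x0 : R) u w : 0 <= x0 -> u.1 x0 = 0 -> min u w -> min (flip x0 u) w.
Proof.
move=> x00 u0 [hu hw hA hB]; have [acu mu2 _ iu1] := hu.
have s1 x : (flip x0 u).1 x * (flip x0 u).1 x = u.1 x * u.1 x by rewrite -!expr2 flip1 sq_if.
have s2 x : (flip x0 u).2 x * (flip x0 u).2 x = u.2 x * u.2 x by rewrite -!expr2 flip2 sq_if.
split.
- apply: H1_glue x00 acu mu2 _ _ _; [exact: integ_halfline_oc|exact: H1_lc|].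
  by rewrite /lc /= u0; ring.
- exact: hw.
- rewrite -hA; congr (_ + _); rewrite /bil s1; congr (_ - _ + _).
    by apply: int_eq => x _; exact: s2.
  by apply: int_eq => x _; rewrite s1.
- by rewrite -hB; apply: int_eq => x _; rewrite flip1 sq_if.
Qed.

Lemma minimizer_comb u g w (a b : R) : min u w -> min g w ->
  (forall x, (g.1 x) ^+ 2 = (u.1 x) ^+ 2) ->
  forall h, H1 h -> bil al c (lc a u b g) h =
    \int[mu]_(x in hl) (rho r u w x * ((lc a u b g).1 x * h.1 x)).
Proof.
move=> mu_ mg gu h hh; have [hu hw _ _] := mu_; have [hg _ _ _] := mg.
rewrite (bil_lc _ pc)//.
rewrite (euler r2 om0 hW d0 hd m0 hm mu_ hh) (euler r2 om0 hW d0 hd m0 hm mg hh) /JJ.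
rewrite -int_lin; [|exact: mhl|exact: integ_rho|exact: integ_rho].
by apply: int_eq => x _; rewrite /rho gu /=; ring.
Qed.

Lemma rho_loc u w (T : R) : H1 u -> H1 w -> integ `]0, T] (rho r u w).
Proof.
move=> hu hw; have [M M0 hM] := rho_bounded r2 hu hw.
apply: integ_le (integ_cst_oc 0 T M) => //; first exact: rho_meas.
by move=> x _; rewrite ger0_norm ?rho_ge0.
Qed.

(* Reflecting [u] beyond one of its zeros gives another minimizer, and the sum and
   difference of the two solve the same linear equation. *)
Lemma minimizer_vanish (x0 : R) u w : min u w -> 0 <= x0 -> u.1 x0 = 0 ->
  forall x, 0 <= x -> u.1 x = 0.
Proof.
move=> mu_ x00 u0; have mg := minimizer_flip x00 u0 mu_.
pose g := flip x0 u.
have [hu hw _ _] := mu_; have [hg _ _ _] := mg.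
have gu x : g.1 x ^+ 2 = u.1 x ^+ 2 by rewrite flip1 sq_if.
have is_ k : H1 k -> forall h, H1 h -> integ hl (fun x => rho r u w x * (k.1 x * h.1 x)).
  by move=> hk h hh; exact: integ_rho.
have ls T : integ `]0, T] (rho r u w) by exact: rho_loc.
have hk1 : H1 (lc 1 u (-1) g) by exact: H1_lc.
have hk2 : H1 (lc 1 u 1 g) by exact: H1_lc.
have F : forall x, 0 <= x -> (lc 1 u (-1) g).1 x = 0.
  apply: (forward pc hk1 (is_ _ hk1) ls (minimizer_comb 1 (-1) mu_ mg gu) x00) => x /andP[_ xx].
  by rewrite lc1 flip1 xx; ring.
have right x : x0 <= x -> u.1 x = 0.
  rewrite le_eqVlt => /orP[/eqP <- //|xx].
  have := F x (le_trans x00 (ltW xx)); rewrite lc1 flip1 leNgt xx /=.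
  by move: (u.1 x) => t; rewrite /=; lra.
have B : forall x, 0 <= x -> (lc 1 u 1 g).1 x = 0.
  apply: (backward pc hk2 (is_ _ hk2) ls (minimizer_comb 1 1 mu_ mg gu) x00) => x xx.
    by rewrite lc1 flip1 (right x xx); case: ifP => _; ring.
  by rewrite lc2 flip2 leNgt xx /=; ring.
move=> x x_0; have [xx|/ltW xx] := leP x x0; last exact: right.
have := B x x_0; rewrite lc1 flip1 xx /=.
by move: (u.1 x) => t; lra.
Qed.

Lemma rotate_sq (a b s t : R) : a ^+ 2 + b ^+ 2 = 1 ->
  (a * s + b * t) ^+ 2 + (b * s + - a * t) ^+ 2 = s ^+ 2 + t ^+ 2.
Proof.
move=> e; rewrite -[RHS]mul1r -e; ring.
Qed.

Lemma minimizer_rotate (a b : R) u w : a ^+ 2 + b ^+ 2 = 1 -> min u w ->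
  min (lc a u b w) (lc b u (- a) w).
Proof.
move=> e [hu hw hA hB]; split; [exact: H1_lc|exact: H1_lc| |].
- rewrite (bil_sq_lc _ pc)// (bil_sq_lc _ pc)// -hA -[RHS]mul1r -e /c; ring.
- by rewrite -hB; apply: int_eq => x _; rewrite /= rotate_sq.
Qed.

Lemma minimizer_neq0 u w : min u w -> ~ forall x, 0 < x -> u.1 x = 0 /\ w.1 x = 0.
Proof.
move=> [_ _ _ hB] z; have : BB r u w = 0.
  apply: int_zero => x; rewrite halflineE => x0.
  have [-> ->] := z x x0; rewrite expr0n /= addr0 powR0// gt_eqF//.
  by move: r2; lra.
by rewrite hB; move/eqP; rewrite gt_eqF.
Qed.

Lemma polar_angle (a b : R) : a ^+ 2 + b ^+ 2 = 1 -> exists th : R, cos th = a /\ sin th = b.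
Proof.
move=> e; have ab : -1 <= a <= 1.
  have := sqr_ge0 b => hb; rewrite -ler_norml -(@ler_pXn2r _ 2)// ?nnegrE// expr1n.
  rewrite real_normK ?num_real//; lra.
have cb : cos (acos a) = a by rewrite acosK// in_itv.
have sb : sin (acos a) = `|b|.
  by rewrite sin_acos// -sqrtr_sqr; congr Num.sqrt; rewrite -e; ring.
have [b0|/ltW b0] := leP 0 b; first by exists (acos a); rewrite cb sb ger0_norm.
by exists (- acos a); rewrite cosN sinN cb sb ler0_norm// opprK.
Qed.

Lemma minimizer_pos u w : min u w -> 0 < u.1 1 -> forall x, 0 < x -> 0 < u.1 x.
Proof.
move=> mu_ u1 x x0; rewrite ltNge; apply/negP => ux.
have [hu _ _ _] := mu_; have [acu _ _ _] := hu.
have cu := AC_continuous acu.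
suff [y y0 uy] : exists2 y, 0 <= y & u.1 y = 0.
  by have := minimizer_vanish mu_ y0 uy ler01; apply/eqP; rewrite gt_eqF.
have cw a b : {within `[a, b], continuous u.1} by exact: continuous_subspaceT.
have [x1|/ltW x1] := leP x 1.
  have [|y yI uy] := @IVT R u.1 x 1 0 x1 (cw _ _).
    by rewrite ge_min ux /= le_max (ltW u1) orbT.
  by exists y => //; move: yI; rewrite in_itv /= => /andP[xy _]; rewrite (le_trans (ltW x0)).
have [|y yI uy] := @IVT R u.1 1 x 0 x1 (cw _ _).
  by rewrite ge_min ux orbT /= le_max (ltW u1).
by exists y => //; move: yI; rewrite in_itv /= => /andP[xy _]; rewrite (le_trans ler01).
Qed.

Lemma minimizer_phase u w : min u w -> exists (th : R) (f : E),
  [/\ H1 f, forall x, 0 < x -> 0 < f.1 x &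
  forall x, 0 < x -> u.1 x = cos th * f.1 x /\ w.1 x = sin th * f.1 x].
Proof.
move=> mu_; pose a := u.1 1; pose b := w.1 1; pose s := Num.sqrt (a ^+ 2 + b ^+ 2).
have ab0 : 0 <= a ^+ 2 + b ^+ 2 by rewrite addr_ge0 ?sqr_ge0.
(* If both components vanished at 1, both would vanish identically by [minimizer_vanish]. *)
have s0 : 0 < s.
  rewrite sqrtr_gt0 lt_neqAle ab0 andbT; apply/negP => /eqP/esym/eqP.
  rewrite paddr_eq0 ?sqr_ge0// !sqrf_eq0 => /andP[/eqP za /eqP zb].
  apply: (minimizer_neq0 mu_) => x x0; split.
    exact: (minimizer_vanish mu_ ler01 za (ltW x0)).
  exact: (minimizer_vanish (minimizer_sym mu_) ler01 zb (ltW x0)).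
have sn : s != 0 by rewrite gt_eqF.
have ss : s ^+ 2 = a ^+ 2 + b ^+ 2 by rewrite sqr_sqrtr.
have e : (a / s) ^+ 2 + (b / s) ^+ 2 = 1.
  by rewrite !expr_div_n -mulrDl -ss mulfV// expf_neq0.
have mf := minimizer_rotate e mu_.
set f := lc (a / s) u (b / s) w in mf; set g := lc _ _ _ _ in mf.
have f1 : f.1 1 = s.
  by rewrite /f /lc /= -/a -/b -[RHS](mulfK sn) -expr2 ss; field.
have g1 : g.1 1 = 0 by rewrite /g /lc /= -/a -/b; field.
have gz := minimizer_vanish (minimizer_sym mf) ler01 g1.
have [hf _ _ _] := mf.
have [th [ct st]] := polar_angle e; exists th, f; split => //.
  by apply: (minimizer_pos mf); rewrite f1.
move=> x x0; rewrite ct st.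
have := gz x (ltW x0); rewrite /g /f /lc /= => gx; split.
  rewrite -[LHS]mul1r -e -[RHS]addr0 -(mulr0 (b / s)) -gx; ring.
rewrite -[LHS]mul1r -e -[LHS]addr0 -(mulr0 (a / s)) -gx; ring.
Qed.

End Phase.

(** * Ground states *)

Section GroundStates.
Context {R : realType} {n : nat}.
Notation mu := (@lebesgue_measure R).
Notation E := ((R -> R) * (R -> R))%type.
Notation hl := (@halfline R).
Implicit Types (u w h k : E) (v : graph_function R n).
Variables (gamma omega p : R) (V : potential R n) (c1 c2 d m : R).
Hypotheses (hsym : symmetric_potential V) (hW : potential_bounds (V ord0) c1 c2).
Hypotheses (hp : 1 < p) (om0 : 0 < omega) (d0 : 0 < d) (m0 : 0 < m).
Local Notation r := (p + 1).
Local Notation N := (@NN R n).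
Let al : R := @alpha R n gamma.
Let c := fun x => V ord0 x + omega.
Hypothesis hd : forall u, H1 u -> d * n0 u <= bil al c u u.
Hypothesis hm : forall u, H1 u -> m `^ (r / 2 - 1) * bb r u <= bil al c u u `^ (r / 2).
Let r2 : 2 < r. Proof. by move: hp; lra. Qed.
Let r0 : 0 < r. Proof. by move: hp; lra. Qed.
Local Notation A := (AA gamma V omega).
Local Notation min := (minimizer r omega al (V ord0) m).
Local Notation S := (S_action p gamma omega V).
Let K : R := N * (2^-1 - r^-1).

Let K0 : 0 < K.
Proof. by apply: mulr_gt0; [exact: NN_gt0|rewrite subr_gt0 ltf_pV2 ?posrE]. Qed.

(** For [A = BB] the inequality [BB_le] reads [m ^ (r / 2 - 1) * A <= A ^ (r / 2)], and one factor
    [A] cancels. *)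
Lemma nehari_form_ge u w : H1 u -> H1 w -> A u w = BB r u w -> 0 < A u w -> m <= A u w.
Proof.
move=> hu hw e A0; have := BB_le r2 d0 hd hm hu hw.
rewrite -[BB r u w]e -[X in _ <= X `^ _]/(A u w) -(mulr_powRB1 (ltW A0)); last by move: r2; lra.
rewrite mulrC ler_pM2l// => h; rewrite leNgt; apply/negP => Am.
have e0 : 0 < r / 2 - 1 by move: r2; lra.
have := gt0_ltr_powR e0 (ltW A0) (ltW m0) Am.
by rewrite ltNge h.
Qed.

Lemma nonzero_form v u w : rep v u w -> nonzero v -> 0 < A u w.
Proof.
move=> [hu hw vE] [e [x [x0 vx]]].
have a1 := aa_ge0 d0 hd hu; have a2 := aa_ge0 d0 hd hw.
rewrite lt_neqAle addr_ge0// andbT eq_sym; apply/negP.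
rewrite paddr_eq0// => /andP[/eqP z1 /eqP z2]; apply: vx; rewrite vE//.
by rewrite /pair_of (aa_eq0 d0 hd hu z1) (aa_eq0 d0 hd hw z2).
Qed.

Lemma S_nehari v u w : rep v u w -> A u w = BB r u w -> S v = K * A u w.
Proof. by move=> vr e; rewrite (S_rep gamma hsym hW omega hp vr) -e /K; ring. Qed.

Lemma nehari_rep v : H1_eq v -> nonzero v -> I_nehari p gamma omega V v = 0 ->
  exists u w, [/\ rep v u w, A u w = BB r u w, m <= A u w & S v = K * A u w].
Proof.
move=> hv nv; have [u [w vr]] := H1_eq_rep hv.
rewrite (I_rep gamma hsym hW omega hp vr) => /eqP; rewrite mulf_eq0 gt_eqF ?NN_gt0//= subr_eq0.
move=> /eqP e; exists u, w; split=> //; last exact: S_nehari.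
by have [hu hw _] := vr; apply: nehari_form_ge => //; exact: nonzero_form vr nv.
Qed.

Lemma minimizer_rep v u w : rep v u w -> min u w ->
  [/\ H1_eq v, nonzero v, I_nehari p gamma omega V v = 0 & S v = K * m].
Proof.
move=> vr mw; have [hu hw hA hB] := mw.
have e : A u w = BB r u w by rewrite hB -hA.
split; [exact: rep_H1_eq vr| | |].
- apply: contrapT => nz; apply: (minimizer_neq0 r2 m0 mw) => x x0.
  have [_ _ vE] := vr.
  have vx : v ord0 x = 0 by apply: contrapT => vx; apply: nz; exists ord0, x.
  by have := vE ord0 x x0; rewrite vx /pair_of => -[<- <-].
- by rewrite (I_rep gamma hsym hW omega hp vr) e subrr mulr0.
- by rewrite (S_nehari vr e) -hA.
Qed.

Lemma nehari_of_bound v : bound_states_eq p gamma omega V v -> I_nehari p gamma omega V v = 0.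
Proof.
move=> [hv nv fv]; have [u [w vr]] := H1_eq_rep hv.
rewrite (I_rep gamma hsym hW omega hp vr).
by rewrite (nehari_of_critical hsym hW hp om0 d0 hd vr fv) subrr mulr0.
Qed.

Lemma bound_of_minimizer v u w : rep v u w -> min u w -> bound_states_eq p gamma omega V v.
Proof.
move=> vr mw; have [hv nv _ _] := minimizer_rep vr mw; split => //.
exact: (frechet_of_minimizer hsym hW hp om0 d0 m0 hd hm vr mw).
Qed.

Variables (v0 : graph_function R n) (u0 w0 : E).
Hypotheses (vr0 : rep v0 u0 w0) (mw0 : min u0 w0).

Lemma d_eqE : d_eq p gamma omega V = (K * m)%:E.
Proof.
apply/eqP; rewrite eq_le; apply/andP; split.
  apply: ereal_inf_lbound; have [hv nv iv sv] := minimizer_rep vr0 mw0.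
  by exists v0 => //; rewrite sv.
apply: le_ereal_inf_tmp => _ [v [hv nv iv] <-].
have [u [w [_ _ mA ->]]] := nehari_rep hv nv iv.
by rewrite lee_fin ler_pM2l.
Qed.

Lemma form_minimal v u w : rep v u w -> A u w = BB r u w -> A u w = m -> min u w.
Proof. by move=> [hu hw _] e Am; split; [exact: hu|exact: hw|exact: Am|rewrite -e]. Qed.

Lemma minimizers_eqP v :
  minimizers_eq p gamma omega V v <-> exists u w, rep v u w /\ min u w.
Proof.
split=> [[hv nv sv iv]|[u [w [vr mw]]]].
  have [u [w [vr e mA sA]]] := nehari_rep hv nv iv; exists u, w; split; first exact: vr.
  apply: form_minimal vr e _; move: sv; rewrite d_eqE sA => -[] /(mulfI _); apply.
  by rewrite gt_eqF.
have [hv nv iv sv] := minimizer_rep vr mw; split => //.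
by rewrite d_eqE sv.
Qed.

(** Bound states lie on the Nehari manifold, where the action is [K * A] with [A >= m]. The given
    minimizer [v0] is a bound state of action [K * m], so a ground state must have [A = m]. *)
Lemma ground_states_eqP v :
  ground_states_eq p gamma omega V v <-> exists u w, rep v u w /\ min u w.
Proof.
split=> [[bv le]|[u [w [vr mw]]]].
  have [hv nv _] := bv.
  have [u [w [vr e mA sA]]] := nehari_rep hv nv (nehari_of_bound bv).
  exists u, w; split; first exact: vr.
  apply: form_minimal vr e _.
  have := le _ (bound_of_minimizer vr0 mw0).
  have [_ _ _ ->] := minimizer_rep vr0 mw0; rewrite sA ler_pM2l// => Am.
  by apply/eqP; rewrite eq_le Am mA.
split=> [|v' bv]; first exact: bound_of_minimizer vr mw.
have [_ _ _ ->] := minimizer_rep vr mw; have [hv nv _] := bv.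
have [u' [w' [_ _ mA ->]]] := nehari_rep hv nv (nehari_of_bound bv).
by rewrite ler_pM2l.
Qed.

Lemma ground_state_phase v : ground_states_eq p gamma omega V v ->
  exists (theta : R) (phi : graph_function R n),
    [/\ H1_eq phi, positive_function phi &
        forall e x, 0 < x -> v e x = (cos theta +i* sin theta) * phi e x].
Proof.
move=> /ground_states_eqP[u [w [vr mw]]].
have [th [f [hf fp fE]]] := minimizer_phase r2 om0 hW d0 m0 hd hm mw.
pose z : E := ((fun=> 0), (fun=> 0)).
pose phi : graph_function R n := fun=> pair_of f z.
exists th, phi; split.
- by apply: (@rep_H1_eq _ _ phi f z); split => //; exact: H1_zero.
- by move=> e x x0; rewrite /phi /pair_of ltcE /= eqxx fp.
- move=> e x x0; have [_ _ ->] := vr => //; have [a b] := fE x x0.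
  by apply: complex_eq; rewrite /phi /pair_of /= ?a ?b; ring.
Qed.

End GroundStates.

Lemma minimizer_real {R : realType} (r om al m c1 c2 : R) (W : R -> R) (w : (R -> R) * (R -> R)) :
  2 < r -> potential_bounds W c1 c2 -> H1 w -> bil al (fun x => W x + om) w w = m ->
  bb r w = m -> minimizer r om al W m w ((fun=> 0), (fun=> 0)).
Proof.
move=> r2 hW hw hA hB; split; [exact: hw|exact: H1_zero| |].
- rewrite hA /bil /= !mulr0 subr0 -[RHS]addr0; congr (_ + _).
  by rewrite !int_zero ?addr0// => x _; rewrite ?mulr0.
- by rewrite BBC BB_eq_bb.
Qed.

Unset Implicit Arguments.
Set Strict Implicit.
Set Printing Implicit Defensive.

Theorem proposition4p6 (R : realType) (n : nat) (p gamma omega : R)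
    (V : potential R n)
    (hp : 1 < p)
    (hsym : symmetric_potential V)
    (hV1 : potential_L1_Loo V)
    (hV2 : potential_vanishing V)
    (hV3 : potential_negative V)
    (homega0 : (0 < omega0_eq gamma V)%E)
    (homega : (omega0_eq gamma V < omega%:E)%E) :
  [/\ ground_states_eq p gamma omega V !=set0,
      ground_states_eq p gamma omega V = minimizers_eq p gamma omega V &
      forall phi_omega : graph_function R n,
        ground_states_eq p gamma omega V phi_omega ->
        exists (theta : R) (phi : graph_function R n),
          [/\ H1_eq phi, positive_function phi &
              forall e x, 0 < x ->
                phi_omega e x = (cos theta +i* sin theta) * phi e x]].
Proof.
have [c1 [c2 hW]] := potential_bounds_of_L1_Loo hV1.
have om0 := omega_gt0 homega0 homega.
have r2 : 2 < p + 1 by move: hp; lra.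
have [d d0 hd] := form_lower_bound hsym hW homega0 homega.
have hneg := potential_le0 hV3 hW.
have hex := exists_negative_form hsym hW homega0.
have comp := competitor r2 om0 hW d0 hd hneg hex.
have [w [m [hw m0 wA wB hm]]] := exists_minimizer hW (vanishing_eps hV2) d0 hd comp.
have mw := minimizer_real r2 hW hw wA wB.
pose z : (R -> R) * (R -> R) := ((fun=> 0), (fun=> 0)).
pose v0 : graph_function R n := fun=> pair_of w z.
have vr0 : rep v0 w z by split => //; exact: H1_zero.
have G v := ground_states_eqP hsym hW hp om0 d0 m0 hd hm vr0 mw v.
split.
- by exists v0; apply/G; exists w, z.
- apply/funext => v; apply/propext.
  exact: iff_trans (G v) (iff_sym (minimizers_eqP hsym hW hp d0 m0 hd hm vr0 mw v)).
- exact: (ground_state_phase hsym hW hp om0 d0 m0 hd hm vr0 mw).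
Qed.
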